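(* Let $q>2$. Let $\phi\in C_0^\infty(\mathbb R^n)$ be a non-negative radial function supported in $\{|x|\le1/4\}$ with $\int\phi=1$, and put $\phi_k(x)=2^{-kn}\phi(2^{-k}x)$ for $k\in\mathbb Z$. Let $T$ be an $\omega$-Dini Calderón–Zygmund operator of convolution type whose kernel $K$ satisfies $\int_{\varepsilon<|x|<R}K(x)\,dx=0$ for all $0<\varepsilon<R<\infty$. Then for $f\in L^1(\mathbb R^n)$, $$\|V_q(\{\phi_k\ast Tf\}_{k\in\mathbb Z})\|_{L^{1,\infty}}\le c_{q,n}\Big(\|\omega\|_{Dini}+\|\omega\|_{Dini}^{1/q}\|\omega^{1/q'}\|_{Dini}+\|\omega\|_{Dini}^{1/q'}\|\omega^{1/2}\|_{Dini}^{2/q}+C_K+\|T\|_{L^2\to L^2}\Big)\|f\|_{L^1} .$$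
   Context: The function $\phi$ is fixed; the constant $c_{q,n}$ depends only on $q,n$ (and on the fixed $\phi$). $q'=q/(q-1)$. $\|g\|_{L^{1,\infty}}=\sup_{\alpha>0}\alpha|\{x:|g(x)|>\alpha\}|$. Moduli: a modulus of continuity is a function $\omega:[0,\infty)\to[0,\infty)$ with $\omega(0)=0$ such that $u\le t+s$ implies $\omega(u)\le\omega(t)+\omega(s)$. Its Dini norm is $\|\omega\|_{Dini}=\int_0^1\omega(t)\frac{dt}{t}$; likewise $\|\omega^{a}\|_{Dini}=\int_0^1\omega(t)^a\frac{dt}t$. Operators: an $\omega$-Dini Calderón–Zygmund operator of convolution type (with $\|\omega\|_{Dini}<\infty$) is a bounded linear operator $T$ on $L^2(\mathbb R^n)$ with $Tf(x)=\int K(x-y)f(y)\,dy$ for all $x\notin\operatorname{supp}f$, where $|K(x)|\le C_K|x|^{-n}$ for $x\ne0$ and $|K(x-y)-K(x)|\le\omega(|y|/|x|)\,|x|^{-n}$ whenever $2|y|\le|x|$, $x\neq 0$. For $f\in L^1\cap L^2$ the functions $\phi_k\ast Tf$ are defined directly; for general $f\in L^1$ they are understood through the extension by density. Variation: for a family $\mathcal F=\{F_t\}_{t\in\mathcal I}$, $\mathcal I\subset\mathbb R$, of measurable functions on $\mathbb R^n$, $$V_q(\mathcal F)(x)=\sup\Big(\sum_{k\ge1}|F_{t_k}(x)-F_{t_{k-1}}(x)|^q\Big)^{1/q},$$ the supremum running over all increasing sequences $\{t_k\}_{k\ge0}\subset\mathcal I$. *)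

(* Defs.v *)
From HB Require Import structures.
From mathcomp Require Import all_boot all_order all_algebra.
From mathcomp Require Import all_classical all_reals all_analysis.
From mathcomp Require Import complex.

Set Implicit Arguments.
Unset Strict Implicit.
Unset Printing Implicit Defensive.

Import Order.TTheory GRing.Theory Num.Theory.
Import numFieldNormedType.Exports.
Local Open Scope classical_set_scope.
Local Open Scope ring_scope.

(* R^n is 'rV[R]_n with the sigma-algebra generated by the coordinates, that
   is, its Borel sigma-algebra.  The norm and the topology that the library
   puts on 'rV[R]_n are those of the sup norm. *)
Section measurable_rV.
Context {R : realType} (n : nat).

Let coord (i : 'I_n) (x : 'rV[R]_n) : R := x ord0 i.

Let rV_set0 : g_sigma_preimage coord set0.
Proof. exact: sigma_algebra0. Qed.

Let rV_setC A : g_sigma_preimage coord A -> g_sigma_preimage coord (~` A).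
Proof. exact: sigma_algebraC. Qed.

Let rV_bigcup (F : _^nat) : (forall i, g_sigma_preimage coord (F i)) ->
  g_sigma_preimage coord (\bigcup_i (F i)).
Proof. exact: sigma_algebra_bigcup. Qed.

HB.instance Definition _ :=
  @isMeasurable.Build (measure_tuple_display default_measure_display)
    'rV[R]_n (g_sigma_preimage coord) rV_set0 rV_setC rV_bigcup.

Lemma measurable_coord (i : 'I_n) :
  measurable_fun [set: 'rV[R]_n] (fun x : 'rV[R]_n => x ord0 i).
Proof.
move=> _ Y mY; rewrite setTI; apply: sub_sigma_algebra => /=.
rewrite -bigcup_seq/=; exists i => /=; first by rewrite mem_index_enum.
by exists Y => //; rewrite setTI.
Qed.

Lemma measurable_fun_coordP d (T : measurableType d) (f : T -> 'rV[R]_n) :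
  measurable_fun [set: T] f <->
  forall i, measurable_fun [set: T] (fun t => f t ord0 i).
Proof.
split=> [mf i|mf].
  exact: (measurableT_comp (measurable_coord i) mf).
suff : g_sigma_preimage (fun i t => f t ord0 i) `<=` @measurable _ T.
  rewrite (_ : (fun i t => f t ord0 i) = (fun i => coord i \o f))//.
  rewrite g_sigma_preimage_comp => sub _ A mA; apply: sub.
  by exists A.
apply: smallest_sub; first exact: sigma_algebra_measurable.
rewrite -bigcup_seq; apply: bigcup_sub => i _.
by move=> A [B mB <-]; exact: mf.
Qed.

End measurable_rV.

Section lebesgue_measure_rV.
Context {R : realType}.

Definition cons_rV n (p : R * 'rV[R]_n) : 'rV[R]_n.+1 :=
  \row_i (if unlift ord0 i is Some j then p.2 ord0 j else p.1).

Lemma cons_rV0 n (p : R * 'rV[R]_n) : cons_rV p ord0 ord0 = p.1.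
Proof. by rewrite mxE unlift_none. Qed.

Lemma cons_rVS n (p : R * 'rV[R]_n) i :
  cons_rV p ord0 (lift ord0 i) = p.2 ord0 i.
Proof. by rewrite mxE liftK. Qed.

Definition uncons_rV n (x : 'rV[R]_n.+1) : R * 'rV[R]_n :=
  (x ord0 ord0, \row_i x ord0 (lift ord0 i)).

Lemma cons_rVK n : cancel (@cons_rV n) (@uncons_rV n).
Proof.
case=> x v; rewrite /uncons_rV cons_rV0; congr pair.
by apply/rowP => i; rewrite mxE cons_rVS.
Qed.

Lemma uncons_rVK n : cancel (@uncons_rV n) (@cons_rV n).
Proof.
move=> x; apply/rowP => i; case: (unliftP ord0 i) => [j|] ->.
  by rewrite cons_rVS mxE.
by rewrite cons_rV0.
Qed.

Lemma measurable_cons_rV n : measurable_fun setT (@cons_rV n).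
Proof.
apply/measurable_fun_coordP => i; case: (unliftP ord0 i) => [j|] ->.
  under eq_fun do rewrite cons_rVS.
  by apply: (measurableT_comp (measurable_coord j)); exact: measurable_snd.
under eq_fun do rewrite cons_rV0.
exact: measurable_fst.
Qed.

Lemma measurable_uncons_rV n : measurable_fun setT (@uncons_rV n).
Proof.
apply: measurable_fun_pair; first exact: measurable_coord.
apply/measurable_fun_coordP => i.
by under eq_fun do rewrite mxE; exact: measurable_coord.
Qed.

Section step.
Variables (n : nat) (m : {sigma_finite_measure set 'rV[R]_n -> \bar R}).

Definition lebesgue_rV_step : set 'rV[R]_n.+1 -> \bar R :=
  pushforward (@lebesgue_measure R \x m)%E (@cons_rV n).

Let mcons (A : set 'rV[R]_n.+1) : measurable A ->
  measurable (@cons_rV n @^-1` A).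
Proof.
by move=> mA; rewrite -[X in measurable X]setTI; exact: measurable_cons_rV.
Qed.

Let step0 : lebesgue_rV_step set0 = 0%E.
Proof. by rewrite /lebesgue_rV_step /pushforward preimage_set0 measure0. Qed.

Let step_ge0 A : (0 <= lebesgue_rV_step A)%E.
Proof. by rewrite /lebesgue_rV_step /pushforward measure_ge0. Qed.

Let step_sigma_additive : semi_sigma_additive lebesgue_rV_step.
Proof.
move=> F mF tF mUF; rewrite /lebesgue_rV_step /pushforward preimage_bigcup.
apply: measure_semi_sigma_additive.
- by move=> k; exact: mcons.
- apply/trivIsetP => /= i j _ _ ij; rewrite -preimage_setI.
  by move/trivIsetP : tF => /(_ _ _ _ _ ij) ->//; rewrite preimage_set0.
- by rewrite -preimage_bigcup; exact: mcons.
Qed.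

HB.instance Definition _ := isMeasure.Build _ _ _ lebesgue_rV_step
  step0 step_ge0 step_sigma_additive.

Let step_sigma_finite : sigma_finite setT lebesgue_rV_step.
Proof.
have /sigma_finiteP[F [TF ndF Foo]] := sigma_finiteT (@lebesgue_measure R).
have /sigma_finiteP[G [TG ndG Goo]] := sigma_finiteT m.
exists (fun k => @uncons_rV n @^-1` (F k `*` G k)).
  rewrite -preimage_bigcup -(preimage_setT (@uncons_rV n)) -setXTT TF TG.
  congr preimage; rewrite predeqE => -[x y]; split.
    move=> [/= [i _ Fix] [j _ Gjy]]; exists (maxn i j) => //; split.
    - by move: x Fix; exact/subsetPset/ndF/leq_maxl.
    - by move: y Gjy; exact/subsetPset/ndG/leq_maxr.
  by move=> [i _ []/= ? ?]; split; exists i.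
move=> k; have [? ?] := Foo k; have [? ?] := Goo k; split.
  rewrite -[X in measurable X]setTI; apply: measurable_uncons_rV => //.
  exact: measurableX.
rewrite /lebesgue_rV_step /pushforward -comp_preimage.
rewrite (_ : _ \o _ = id); last by apply/funext => p; exact: cons_rVK.
by rewrite preimage_id product_measure1E// lte_mul_pinfty// ge0_fin_numE.
Qed.

HB.instance Definition _ := Measure_isSigmaFinite.Build _ _ _ lebesgue_rV_step
  step_sigma_finite.

End step.

Fixpoint lebesgue_rV n : {sigma_finite_measure set 'rV[R]_n -> \bar R} :=
  if n is n'.+1 then lebesgue_rV_step (lebesgue_rV n')
  else \d_ (0 : 'rV[R]_0).

Lemma lebesgue_rV_box n (A : 'I_n -> set R) : (forall i, measurable (A i)) ->
  lebesgue_rV n [set x | forall i, A i (x ord0 i)] =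
  (\prod_(i < n) lebesgue_measure (A i))%E.
Proof.
elim: n A => [|n IH] A mA.
  rewrite (_ : [set _ | _] = setT); first by rewrite big_ord0 /= diracT.
  by apply/seteqP; split=> // x _ [].
have mB : measurable [set x : 'rV[R]_n | forall i, A (lift ord0 i) (x ord0 i)].
  rewrite (_ : [set _ | _] =
      \bigcap_(i in [set: 'I_n])
        ((fun x : 'rV[R]_n => x ord0 i) @^-1` A (lift ord0 i))).
    apply: fin_bigcap_measurable => // i _.
    by rewrite -[X in measurable X]setTI; exact: measurable_coord.
  by apply/seteqP; split=> x /= xA i => [_|]; exact: xA.
have consE : @cons_rV n @^-1` [set x | forall i, A i (x ord0 i)] =
    A ord0 `*` [set x : 'rV[R]_n | forall i, A (lift ord0 i) (x ord0 i)].
  apply/seteqP; split=> -[t x] /= tx.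
    split=> [|i]; first by have := tx ord0; rewrite cons_rV0.
    by have := tx (lift ord0 i); rewrite cons_rVS.
  move=> i; case: (unliftP ord0 i) => [j|] ->; rewrite ?cons_rVS ?cons_rV0 /=.
    exact: tx.2.
  exact: tx.1.
rewrite big_ord_recl -IH//.
transitivity ((@lebesgue_measure R \x lebesgue_rV n)
  (@cons_rV n @^-1` [set x | forall i, A i (x ord0 i)]))%E => //.
rewrite consE (product_measure1E (@lebesgue_measure R) (lebesgue_rV n))//.
exact: (mA ord0).
Qed.

End lebesgue_measure_rV.

Section functions_on_Rn.
Context {R : realType} {n : nat}.
Implicit Types (x y : 'rV[R]_n) (f g : 'rV[R]_n -> R[i]).

Definition enorm x : R := Num.sqrt (\sum_(i < n) x ord0 i ^+ 2).

(* The norm of the library on R[i] takes its values in R[i]. *)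
Definition cabs (z : R[i]) : R := complex.Re `|z|.

Definition cmeasurable f :=
  measurable_fun setT (fun x => complex.Re (f x)) /\
  measurable_fun setT (fun x => complex.Im (f x)).

Definition cintegral (D : set 'rV[R]_n) f : R[i] :=
  Complex (\int[lebesgue_rV n]_(x in D) complex.Re (f x))
          (\int[lebesgue_rV n]_(x in D) complex.Im (f x)).

Definition Lpnorm (p : R) f : \bar R :=
  ('N[lebesgue_rV n]_(p%:E)[EFin \o cabs \o f])%E.

Definition Lp (p : R) f := cmeasurable f /\ (Lpnorm p f < +oo)%E.

Definition weak_L1norm (g : 'rV[R]_n -> \bar R) : \bar R :=
  ereal_sup [set (a%:E * lebesgue_rV n [set x | a%:E < `|g x|])%E
            | a in [set a : R | 0 < a]].

Fixpoint partial (s : seq 'I_n) (h : 'rV[R]_n -> R) : 'rV[R]_n -> R :=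
  if s is i :: s' then 'D_(delta_mx ord0 i) (partial s' h) else h.

Definition smooth (h : 'rV[R]_n -> R) := forall s : seq 'I_n,
  continuous (partial s h) /\
  forall (i : 'I_n) x, derivable (partial s h) x (delta_mx ord0 i).

Definition radial (h : 'rV[R]_n -> R) :=
  forall x y, enorm x = enorm y -> h x = h y.

Definition dilate (h : 'rV[R]_n -> R) (k : int) x : R :=
  (2 : R) ^ (- (k * n%:Z)) * h ((2 : R) ^ (- k) *: x).

Definition convol (h : 'rV[R]_n -> R) f x : R[i] :=
  cintegral setT (fun y => Complex (h (x - y)) 0 * f y).

(* The support of a class of functions modulo a.e. equality. *)
Definition ess_support f : set 'rV[R]_n :=
  [set x | forall r : R, 0 < r ->
    ~ {ae lebesgue_rV n, forall y, enorm (y - x) < r -> f y = 0}].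

(* Increasing sequences need not be strictly increasing: repeating an index
   only adds zero terms to the sum. *)
Definition q_variation {d} {I : porderType d} (q : R)
    (F : I -> 'rV[R]_n -> R[i]) x : \bar R :=
  ereal_sup
    [set ((\sum_(1 <= k <oo)
            ((cabs (F (t k) x - F (t k.-1) x)) `^ q)%:E) `^ q^-1)%E
    | t in [set t : nat -> I | {homo t : j k / (j <= k)%N >-> (j <= k)%O}]].

End functions_on_Rn.

Section calderon_zygmund.
Context {R : realType} {n : nat}.
Implicit Types (w : R -> R) (K : 'rV[R]_n -> R[i])
  (T : ('rV[R]_n -> R[i]) -> 'rV[R]_n -> R[i]).

Definition modulus_of_continuity w :=
  [/\ forall t, 0 <= t -> 0 <= w t, w 0 = 0 &
      forall t s u, 0 <= t -> 0 <= s -> 0 <= u -> u <= t + s ->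
        w u <= w t + w s].

Definition dini w : \bar R :=
  (\int[lebesgue_measure]_(t in `]0%R, 1%R]) (w t / t)%:E)%E.

Definition L2_opnorm T : \bar R :=
  ereal_sup [set Lpnorm 2 (T f) | f in [set f | Lp 2 f /\ (Lpnorm 2 f <= 1)%E]].

(* T acts on representatives of classes of functions modulo a.e. equality.
   That T f depends only on the class of f follows from the first three
   fields. *)
Record L2_bounded_linear T : Prop := {
  L2_stable : forall f, Lp 2 f -> Lp 2 (T f);
  L2_linear : forall (a : R[i]) f g, Lp 2 f -> Lp 2 g ->
    {ae lebesgue_rV n, forall x,
      T (fun y => a * f y + g y) x = a * T f x + T g x};
  L2_bounded : (L2_opnorm T < +oo)%E }.

Record dini_CZ_operator w K (CK : R) T : Prop := {
  CZ_L2 : L2_bounded_linear T;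
  CZ_repr : forall f, Lp 2 f ->
    {ae lebesgue_rV n, forall x, ~ ess_support f x ->
      T f x = cintegral setT (fun y => K (x - y) * f y)};
  CZ_size : forall x : 'rV[R]_n, x != 0 -> cabs (K x) <= CK * enorm x ^- n;
  CZ_regular : forall x y : 'rV[R]_n, x != 0 -> 2 * enorm y <= enorm x ->
    cabs (K (x - y) - K x) <= w (enorm y / enorm x) * enorm x ^- n }.

Definition kernel_cancellation K := forall e r : R, 0 < e -> e < r ->
  cintegral [set x | e < enorm x < r] K = 0.

(* g is a value at f of the extension by density, from L^1 `&` L^2 with the
   L^1 norm to weak L^1, of the operator S. *)
Definition density_extension
    (S : ('rV[R]_n -> R[i]) -> 'rV[R]_n -> R[i]) (f g : 'rV[R]_n -> R[i]) :=
  cmeasurable g /\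
  exists u : nat -> 'rV[R]_n -> R[i],
    [/\ forall j, Lp 1 (u j) /\ Lp 2 (u j),
        (fun j => Lpnorm 1 (fun x => u j x - f x)) @ \oo --> 0%E &
        (fun j => weak_L1norm (fun x => (cabs (S (u j) x - g x))%:E)) @ \oo
          --> 0%E].

End calderon_zygmund.

(* Main.v *)
(* Dyadic cells of side [r] play the role of dyadic cubes.  The variation of
   [k |-> phi_k * g] is that of the conditional expectations of [g] on cells,
   which is controlled in weak L^2 by counting jumps of a martingale, up to the
   square function of the differences.  A Calderon-Zygmund decomposition turns a
   weak (2,2) bound, together with a Hormander condition on the l^q-variation of
   the kernels, into a weak (1,1) bound.  It is applied first to the kernels
   [phi_k] and then to [phi_k * K^rho], where [K^rho] is [K] cut off at distance
   [rho].  In the Hormander condition for the latter, consecutive scales differ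
   by terms controlled by [w], and bounding [w^q] by [w^(q-1) w] gives the
   product [dini(w)^(1/q) dini(w^(1/q'))].  On functions constant on the cells
   of side [rho], [T] differs from the convolution with [K^rho] by an operator
   that is bounded on L^1, so that the two weak (1,1) bounds add up.  Such
   functions are dense, and the constants depend neither on [rho] nor on the
   finite window of scales under consideration. *)
Require Import Defs.
From mathcomp Require Import all_boot all_order all_algebra.
From mathcomp Require Import all_classical all_reals all_analysis.
From mathcomp Require Import measurable_realfun complex.
From mathcomp Require Import ring lra zify.

Set Implicit Arguments.
Unset Strict Implicit.
Unset Printing Implicit Defensive.

Import Order.TTheory GRing.Theory Num.Theory.
Import numFieldNormedType.Exports.
Local Open Scope classical_set_scope.
Local Open Scope ring_scope.

(** * Lebesgue measure and integrals on row vectors *)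

(** [T] is known through its kernel only off supports, so no Hormander condition can be tested on
    [T] itself. Truncating [K] at the side [rho] of the cells repairs this: on the indicator of a
    cell, [T] and the truncated convolution agree away from the neighbouring cells, and the local
    error is controlled by the L^2 bound of [T] and the size of [K]. The same comparison yields the
    L^2 bound of the truncated convolution. In the Hormander condition, for a translation by [y],
    the differences at scales below [y] do not decay with the scale and cannot be summed. They are
    compared with [K] instead: this leaves a single jump [K z - K (z + y)], and an l^q sum of
    approximation errors from which the second Dini term arises. The passage to L^1 handles finitely
    many scales at a time, because each [F k] comes with its own approximating sequence and a common
    one has to be chosen for a whole window. *)

Section affine1.
Context {R : realType}.
Local Notation leb := (@lebesgue_measure R).

Lemma measurable_affine1 (a b : R) :
  measurable_fun setT (fun t : R => a * t + b).
Proof. by apply: measurable_funD => //; apply: measurable_funM. Qed.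

(** The image measure multiplied by [a] agrees with Lebesgue measure on half-open intervals, and
    uniqueness of Lebesgue measure does the rest. *)
Lemma lebesgue_measure_affine (a b : R) (A : set R) : 0 < a -> measurable A ->
  leb ((fun t => a * t + b) @^-1` A) = (a^-1%:E * leb A)%E.
Proof.
move=> a0 mA.
have mf : measurable_fun setT (fun t : measurableTypeR R => (a * t + b : measurableTypeR R)).
  exact: measurable_affine1.
pose f := (fun t : measurableTypeR R => (a * t + b : measurableTypeR R)).
have an0 : 0 <= a by exact: ltW.
pose m0 := mscale (NngNum an0) (pushforward leb f) : {measure set (measurableTypeR R) -> \bar R}.
pose m := m0 mf.
have E X : m X = (a%:E * leb ((fun t => (a * t + b)%R) @^-1` X))%E by [].
have H : forall X, ocitv X -> leb X = m X.
  move=> _ [[u v]] _ <-; rewrite E.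
  have -> : (fun t => a * t + b) @^-1` `]u, v] = `](u - b) / a, (v - b) / a]%classic.
    apply/seteqP; split => t /=; rewrite !in_itv/= => /andP[h1 h2].
      by rewrite ltr_pdivrMr// ler_pdivlMr// ltrBlDr lerBrDr mulrC h1.
    by move: h1 h2; rewrite ltr_pdivrMr// ler_pdivlMr// ltrBlDr lerBrDr mulrC => -> ->.
  rewrite !lebesgue_measure_itv/= !lte_fin.
  rewrite ltr_pM2r ?invr_gt0// ltrD2r; case: ifP => // _; last by rewrite mule0.
  rewrite -!EFinB -EFinM; congr EFin.
  by field; rewrite gt_eqF.
have := lebesgue_measure_unique H mA; rewrite E => ->.
by rewrite muleA -EFinM mulVf ?gt_eqF// mul1e.
Qed.
End affine1.

Section measurability_rV.
Context {R : realType}.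

Lemma measurable_rV_sub n d (T : measurableType d) (f g : T -> 'rV[R]_n) :
  measurable_fun setT f -> measurable_fun setT g ->
  measurable_fun setT (fun t => f t - g t).
Proof.
move=> /measurable_fun_coordP mf /measurable_fun_coordP mg.
apply/measurable_fun_coordP => i.
under eq_fun do rewrite !mxE.
exact: measurable_funB.
Qed.

Lemma measurable_rV_affine n d (T : measurableType d) (a : R) (b : 'rV[R]_n)
    (f : T -> 'rV[R]_n) :
  measurable_fun setT f -> measurable_fun setT (fun t => a *: f t + b).
Proof.
move=> /measurable_fun_coordP mf.
apply/measurable_fun_coordP => i.
under eq_fun do rewrite !mxE.
by apply: measurable_funD => //; apply: measurable_funM.
Qed.

Lemma measurable_rV_opp n d (T : measurableType d) (f : T -> 'rV[R]_n) :
  measurable_fun setT f -> measurable_fun setT (fun t => - f t).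
Proof.
move=> /measurable_fun_coordP mf.
apply/measurable_fun_coordP => i.
under eq_fun do rewrite !mxE.
exact: measurableT_comp.
Qed.

Lemma measurable_enorm n : measurable_fun setT (@enorm R n).
Proof.
rewrite /enorm; apply: (@measurableT_comp _ _ _ _ _ _ (@Num.sqrt R)).
  by apply: continuous_measurable_fun; exact: sqrt_continuous.
by apply: measurable_sum => i; apply: measurable_funX; exact: measurable_coord.
Qed.

End measurability_rV.

Section affine_n.
Context {R : realType}.
Local Notation leb := (@lebesgue_measure R).
Local Open Scope ereal_scope.

Lemma ge0_integral_affine1 (a b : R) (f : R -> \bar R) : (0 < a)%R ->
  measurable_fun setT f -> (forall t, 0 <= f t) ->
  \int[leb]_t f (a * t + b)%R = (a^-1)%:E * \int[leb]_t f t.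
Proof.
move=> a0 mf f0.
have mg : measurable_fun setT (fun t : measurableTypeR R => (a * t + b : measurableTypeR R)%R).
  exact: measurable_affine1.
have an0 : (0 <= a^-1)%R by rewrite invr_ge0 ltW.
rewrite -(@ge0_integral_mscale _ _ _ leb setT _ (NngNum an0))//.
rewrite -[LHS]/(\int[leb]_(t in (fun t : measurableTypeR R => (a * t + b : measurableTypeR R)%R) @^-1` setT)
  (f \o (fun t : measurableTypeR R => (a * t + b : measurableTypeR R)%R)) t).
rewrite -ge0_integral_pushforward//.
apply: eq_measure_integral => A mA _.
exact: lebesgue_measure_affine.
Qed.

Lemma ge0_integral_opp1 (f : R -> \bar R) :
  measurable_fun setT f -> (forall t, 0 <= f t) ->
  \int[leb]_t f (- t)%R = \int[leb]_t f t.
Proof.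
move=> mf f0.
rewrite -[LHS]/(\int[leb]_(t in (-%R : measurableTypeR R -> measurableTypeR R) @^-1` setT)
  (f \o (-%R : measurableTypeR R -> measurableTypeR R)) t).
rewrite -ge0_integral_pushforward//.
apply: eq_measure_integral => A mA _.
exact: lebesgue_measureN.
Qed.

(** Tonelli for the recursive construction of [lebesgue_rV]; it drives all inductions on the
    dimension. *)
Lemma ge0_integral_rVS n (f : 'rV[R]_n.+1 -> \bar R) :
  measurable_fun setT f -> (forall x, 0 <= f x) ->
  \int[lebesgue_rV n.+1]_x f x =
  \int[leb]_t \int[lebesgue_rV n]_v f (cons_rV (t, v)).
Proof.
move=> mf f0.
transitivity (\int[pushforward (leb \x lebesgue_rV n) (@cons_rV R n)]_x f x).
  apply: eq_measure_integral => [|A mA _]; last by [].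
  exact: measurable_cons_rV.
rewrite ge0_integral_pushforward//=; last exact: measurable_cons_rV.
rewrite preimage_setT fubini_tonelli1//.
by apply: measurableT_comp => //; exact: measurable_cons_rV.
Qed.

End affine_n.

Section affine_rV.
Context {R : realType}.
Local Notation leb := (@lebesgue_measure R).
Local Open Scope ereal_scope.

Lemma cons_rV_affine n (a : R) (b : 'rV[R]_n.+1) t (v : 'rV[R]_n) :
  (a *: cons_rV (t, v) + b = cons_rV (a * t + b ord0 ord0, a *: v + (uncons_rV b).2))%R.
Proof.
apply/rowP => i; rewrite !mxE; case: (unliftP ord0 i) => [j|] -> /=.
  by rewrite !mxE.
by [].
Qed.

(** Each coordinate contributes one factor [a^-1], by induction on the dimension. *)
Lemma ge0_integral_affine n (a : R) (b : 'rV[R]_n) (f : 'rV[R]_n -> \bar R) :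
  (0 < a)%R -> measurable_fun setT f -> (forall x, 0 <= f x) ->
  \int[lebesgue_rV n]_x f (a *: x + b)%R = (a ^- n)%:E * \int[lebesgue_rV n]_x f x.
Proof.
elim: n b f => [|n IH] b f a0 mf f0.
  rewrite expr0 invr1 mul1e; apply: eq_integral => x _; congr f.
  by apply/rowP => -[].
have mg : measurable_fun setT (fun x : 'rV[R]_n.+1 => f (a *: x + b)%R).
  by apply: (measurableT_comp mf); apply: measurable_rV_affine.
rewrite !ge0_integral_rVS//.
transitivity (\int[leb]_t ((a ^- n)%:E *
    \int[lebesgue_rV n]_v f (cons_rV ((a * t + b ord0 ord0)%R, v)))).
  apply: eq_integral => t _.
  rewrite -(IH (uncons_rV b).2 (fun v => f (cons_rV (a * t + b ord0 ord0, v)%R)) a0)//.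
    by apply: eq_integral => v _; rewrite cons_rV_affine.
  apply: (measurableT_comp mf).
  apply: (measurableT_comp (measurable_cons_rV (n := n))).
  exact: measurable_pair1.
have an0 : (0 <= a^-1)%R by rewrite invr_ge0 ltW.
have mF : measurable_fun setT (fun t : R => \int[lebesgue_rV n]_v f (cons_rV (t, v))).
  apply: (measurable_fun_fubini_tonelli_F (fun p => f (cons_rV p))) => //.
  by apply: (measurableT_comp mf); exact: measurable_cons_rV.
have F0 t : 0 <= \int[lebesgue_rV n]_v f (cons_rV (t, v)).
  by apply: integral_ge0.
have mFa : measurable_fun setT
    (fun t : R => \int[lebesgue_rV n]_v f (cons_rV ((a * t + b ord0 ord0)%R, v))).
  by apply: (measurableT_comp mF); exact: measurable_affine1.
have c0 : 0 <= (a ^- n)%:E by rewrite lee_fin invr_ge0 exprn_ge0// ltW.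
rewrite (ge0_integralZl leb measurableT mFa (fun t _ => F0 _) c0).
rewrite (ge0_integral_affine1 (b ord0 ord0) a0 mF F0).
by rewrite muleA -EFinM exprS invfM [(a^-1 * _)%R]mulrC.
Qed.

Lemma ge0_integral_opp n (f : 'rV[R]_n -> \bar R) :
  measurable_fun setT f -> (forall x, 0 <= f x) ->
  \int[lebesgue_rV n]_x f (- x)%R = \int[lebesgue_rV n]_x f x.
Proof.
elim: n f => [|n IH] f mf f0.
  by apply: eq_integral => x _; congr f; apply/rowP => -[].
have mg : measurable_fun setT (fun x : 'rV[R]_n.+1 => f (- x)%R).
  by apply: (measurableT_comp mf); exact: measurable_rV_opp.
rewrite (ge0_integral_rVS mg (fun x => f0 _)) (ge0_integral_rVS mf f0).
have mF : measurable_fun setT (fun t : R => \int[lebesgue_rV n]_v f (cons_rV (t, v))).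
  apply: (measurable_fun_fubini_tonelli_F (fun p => f (cons_rV p))) => //.
  by apply: (measurableT_comp mf); exact: measurable_cons_rV.
have F0 t : 0 <= \int[lebesgue_rV n]_v f (cons_rV (t, v)).
  by apply: integral_ge0.
rewrite -(ge0_integral_opp1 mF F0); apply: eq_integral => t _.
rewrite -(IH (fun v => f (cons_rV (- t, v)%R)))//.
  apply: eq_integral => v _; congr f.
  by apply/rowP => i; rewrite !mxE; case: unlift => [j|] //=; rewrite mxE.
apply: (measurableT_comp mf).
apply: (measurableT_comp (measurable_cons_rV (n := n))).
exact: measurable_pair1.
Qed.

Lemma ge0_integral_translate n (b : 'rV[R]_n) (f : 'rV[R]_n -> \bar R) :
  measurable_fun setT f -> (forall x, 0 <= f x) ->
  \int[lebesgue_rV n]_x f (x + b)%R = \int[lebesgue_rV n]_x f x.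
Proof.
move=> mf f0; have := @ge0_integral_affine n 1 b f ltr01 mf f0.
rewrite expr1n invr1 mul1e => <-.
by apply: eq_integral => x _; rewrite scale1r.
Qed.

Lemma ge0_integral_reflect n (b : 'rV[R]_n) (f : 'rV[R]_n -> \bar R) :
  measurable_fun setT f -> (forall x, 0 <= f x) ->
  \int[lebesgue_rV n]_x f (b - x)%R = \int[lebesgue_rV n]_x f x.
Proof.
move=> mf f0.
rewrite -(ge0_integral_translate b mf f0).
rewrite -[RHS]ge0_integral_opp//.
  by apply: eq_integral => x _; rewrite addrC.
apply: (measurableT_comp mf); apply/measurable_fun_coordP => i.
under eq_fun do rewrite mxE.
by apply: measurable_funD => //; exact: measurable_coord.
Qed.

End affine_rV.

Ltac meas_step :=
  cbv beta;
  lazymatch goal with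
  | |- measurable_fun _ (fun x => x) => exact: measurable_id
  | |- measurable_fun _ (fun x => EFin (@?f x)) =>
      apply: (proj2 (@measurable_EFinP _ _ _ _ f))
  | |- measurable_fun _ (EFin \o ?f) =>
      apply: (proj2 (@measurable_EFinP _ _ _ _ f))
  | |- measurable_fun _ (fun x => GRing.add (@?f x) (@?g x)) =>
      apply: (@measurable_funD _ _ _ _ f g)
  | |- measurable_fun _ (fun x => GRing.opp (@?f x)) =>
      apply: (@measurable_funN _ _ _ _ f)
  | |- measurable_fun _ (fun x => GRing.mul (@?f x) (@?g x)) =>
      apply: (@measurable_funM _ _ _ _ f g)
  | |- measurable_fun _ (fun x => GRing.exp (@?f x) ?k) =>
      apply: (@measurable_funX _ _ _ _ f k)
  | |- measurable_fun _ (fun x => Num.norm (@?f x)) =>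
      apply: (@measurableT_comp _ _ _ _ _ _ _ _ f (@normr_measurable _ _))
  | |- measurable_fun _ (fun x => Order.max (@?f x) (@?g x)) =>
      apply: (@measurable_maxr _ _ _ _ f g)
  | |- measurable_fun _ (fun x => \sum_(i <- ?s) _) =>
      apply: measurable_sum => ?
  | |- measurable_fun _ (fun x => ?c) => exact: measurable_cst
  end.
Ltac meas := repeat (first [assumption | meas_step]); try assumption.

(** * Integrals and norms of real functions *)

Section real_integrals.
Context d (T : measurableType d) {R : realType}.
Variable m : {measure set T -> \bar R}.
Implicit Types f g : T -> R.
Local Open Scope ereal_scope.

(** Functions are [R]-valued while the norms below are extended reals, so that norm inequalities can
    be stated and chained before integrability is known. *)
Definition intg f := m.-integrable setT (EFin \o f).
Definition nl1 f := \int[m]_x (`|f x|%R)%:E.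
(* The square of the L^2 norm. *)
Definition nl2 f := \int[m]_x (f x ^+ 2)%R%:E.

Lemma nl1_ge0 f : 0 <= nl1 f.
Proof. by apply: integral_ge0 => x _; rewrite lee_fin. Qed.

Lemma nl2_ge0 f : 0 <= nl2 f.
Proof. by apply: integral_ge0 => x _; rewrite lee_fin sqr_ge0. Qed.

Lemma intgP f : measurable_fun setT f -> nl1 f < +oo -> intg f.
Proof.
move=> mf foo; apply/integrableP; split; last exact: foo.
exact/measurable_EFinP.
Qed.

Lemma intg_meas f : intg f -> measurable_fun setT f.
Proof. by move=> /measurable_int/measurable_EFinP. Qed.

Lemma intg_nl1 f : intg f -> nl1 f < +oo.
Proof. by move=> /integrableP[_]. Qed.

Lemma le_nl f g : measurable_fun setT f -> measurable_fun setT g ->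
  (forall x, 0 <= f x <= g x)%R ->
  \int[m]_x (f x)%:E <= \int[m]_x (g x)%:E.
Proof.
move=> mf mg fg; apply: ge0_le_integral => //.
- by move=> x _; rewrite lee_fin; have /andP[] := fg x.
- exact/measurable_EFinP.
- exact/measurable_EFinP.
- by move=> x _; rewrite lee_fin; have /andP[] := fg x.
Qed.

Lemma le_nl1 f g : measurable_fun setT f -> measurable_fun setT g ->
  (forall x, `|f x| <= g x)%R -> nl1 f <= \int[m]_x (g x)%:E.
Proof. by move=> mf mg fg; apply: le_nl => //; [meas|move=> x; rewrite normr_ge0 fg]. Qed.

Lemma le_intg f g : measurable_fun setT f -> intg g ->
  (forall x, `|f x| <= `|g x|)%R -> intg f.
Proof.
move=> mf ig fg; apply: intgP => //; apply: le_lt_trans (intg_nl1 ig).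
by apply: le_nl1 => //; have := intg_meas ig => mg; meas.
Qed.

Lemma abs_Rintegral_le f : measurable_fun setT f ->
  (`|\int[m]_x f x|%R)%:E <= nl1 f.
Proof.
move=> mf; have [foo|] := ltP (nl1 f) +oo.
  rewrite EFin_normr_Rintegral//; last exact: intgP.
  by apply: le_abse_integral => //; exact/measurable_EFinP.
by rewrite leye_eq => /eqP ->; rewrite leey.
Qed.

Lemma EFin_Rintegral f : intg f -> (\int[m]_x f x)%:E = \int[m]_x (f x)%:E.
Proof. by move=> fi; rewrite /Rintegral fineK//; exact: integrable_fin_num. Qed.

Lemma nl2Z (c : R) f : measurable_fun setT f ->
  nl2 (fun x => c * f x)%R = (c ^+ 2)%:E * nl2 f.
Proof.
move=> mf; rewrite /nl2 -ge0_integralZl//.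
- by apply: eq_integral => x _; rewrite exprMn.
- by apply/measurable_EFinP; meas.
- by move=> x _; rewrite lee_fin sqr_ge0.
- by rewrite lee_fin sqr_ge0.
Qed.

Lemma nl1Z (c : R) f : measurable_fun setT f ->
  nl1 (fun x => c * f x)%R = (`|c|)%:E * nl1 f.
Proof.
move=> mf; rewrite /nl1 -ge0_integralZl//.
- by apply: eq_integral => x _; rewrite normrM.
- by apply/measurable_EFinP; meas.
Qed.

Lemma ge0_nlD f g : measurable_fun setT f -> measurable_fun setT g ->
  (forall x, 0 <= f x)%R -> (forall x, 0 <= g x)%R ->
  \int[m]_x (f x + g x)%:E = \int[m]_x (f x)%:E + \int[m]_x (g x)%:E.
Proof.
move=> mf mg f0 g0.
rewrite -ge0_integralD//; [by move=> x _; rewrite lee_fin|exact/measurable_EFinP|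
  by move=> x _; rewrite lee_fin|exact/measurable_EFinP].
Qed.

Lemma ge0_nlZ (c : R) f : measurable_fun setT f -> (0 <= c)%R ->
  (forall x, 0 <= f x)%R ->
  \int[m]_x (c * f x)%:E = c%:E * \int[m]_x (f x)%:E.
Proof.
move=> mf c0 f0; rewrite -ge0_integralZl//; first exact/measurable_EFinP.
by move=> x _; rewrite lee_fin.
Qed.

Lemma ge0_nl_sum I (s : seq I) (f : I -> T -> R) :
  (forall i, measurable_fun setT (f i)) -> (forall i x, 0 <= f i x)%R ->
  \int[m]_x (\sum_(i <- s) f i x)%R%:E = \sum_(i <- s) \int[m]_x (f i x)%:E.
Proof.
move=> mf f0; rewrite -ge0_integral_sum//.
- by apply: eq_integral => x _; rewrite sumEFin.
- by move=> i; exact/measurable_EFinP.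
- by move=> i x _; rewrite lee_fin.
Qed.

Lemma nl1D f g : measurable_fun setT f -> measurable_fun setT g ->
  nl1 (fun x => f x + g x)%R <= nl1 f + nl1 g.
Proof.
move=> mf mg; rewrite /nl1 -ge0_nlD//; [|by meas|by meas].
by apply: le_nl; [meas|meas|move=> x; rewrite normr_ge0 ler_normD].
Qed.

Lemma nl2D f g : measurable_fun setT f -> measurable_fun setT g ->
  nl2 (fun x => f x + g x)%R <= 2%:E * (nl2 f + nl2 g).
Proof.
move=> mf mg; rewrite /nl2 -ge0_nlD; [|by meas|by meas|..];
  try by move=> x; exact: sqr_ge0.
rewrite -ge0_nlZ//; [|by meas|by move=> x; rewrite addr_ge0 ?sqr_ge0].
apply: le_nl; [by meas|by meas|move=> x].
by rewrite sqr_ge0/=; have := sqr_ge0 (f x - g x)%R; nra.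
Qed.

Lemma intgM f g : measurable_fun setT f -> measurable_fun setT g ->
  nl2 f < +oo -> nl2 g < +oo -> intg (fun x => f x * g x)%R.
Proof.
move=> mf mg fo go; apply: intgP; first by meas.
apply: (@le_lt_trans _ _ (nl2 f + nl2 g)); last exact: lte_add_pinfty.
rewrite /nl2 -ge0_nlD; [|by meas|by meas|..]; try by move=> x; exact: sqr_ge0.
apply: le_nl1; [by meas|by meas|move=> x].
rewrite ler_norml; have := sqr_ge0 (f x - g x)%R; have := sqr_ge0 (f x + g x)%R.
by move=> h1 h2; apply/andP; split; nra.
Qed.

Lemma intgD f g : intg f -> intg g -> intg (fun x => f x + g x)%R.
Proof.
move=> fi gi; apply: (eq_integrable measurableT _ _ _ (integrableD measurableT fi gi)).
by move=> x _; rewrite /= EFinD.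
Qed.

Lemma intgB f g : intg f -> intg g -> intg (fun x => f x - g x)%R.
Proof.
move=> fi gi; apply: (eq_integrable measurableT _ _ _ (integrableB measurableT fi gi)).
by move=> x _; rewrite /= EFinB.
Qed.

Lemma intgZ (c : R) f : intg f -> intg (fun x => c * f x)%R.
Proof.
move=> fi; apply: (eq_integrable measurableT _ _ _ (integrableZl measurableT c fi)).
by move=> x _; rewrite /= EFinM.
Qed.

Lemma ae_eq_Rintegral f g : measurable_fun setT f -> measurable_fun setT g ->
  {ae m, forall x, f x = g x} -> (\int[m]_x f x = \int[m]_x g x)%R.
Proof.
move=> mf mg fg; congr fine; apply: ae_eq_integral => //.
- exact/measurable_EFinP.
- exact/measurable_EFinP.
by apply: filterS fg => x /= -> _.
Qed.

End real_integrals.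

Section double_integrals.
Context d1 d2 (T1 : measurableType d1) (T2 : measurableType d2) {R : realType}.
Variable m1 : {sigma_finite_measure set T1 -> \bar R}.
Variable m2 : {sigma_finite_measure set T2 -> \bar R}.
Implicit Types F : T1 * T2 -> R.
Local Open Scope ereal_scope.

Lemma meas_pair1 F x : measurable_fun setT F -> measurable_fun setT (fun y => F (x, y)).
Proof. by move=> mF; apply: (measurableT_comp mF); exact: pair1_measurable. Qed.

Lemma meas_pair2 F y : measurable_fun setT F -> measurable_fun setT (fun x => F (x, y)).
Proof. by move=> mF; apply: (measurableT_comp mF); exact: pair2_measurable. Qed.

Lemma meas_ge0_int2 F : measurable_fun setT F -> (forall p, 0 <= F p)%R ->
  measurable_fun setT (fun x => \int[m2]_y (F (x, y))%:E).
Proof.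
move=> mF F0; apply: (measurable_fun_fubini_tonelli_F (fun p => (F p)%:E)).
  exact/measurable_EFinP.
by move=> p; rewrite lee_fin.
Qed.

(** The Tonelli integrals of the positive and negative parts are measurable, hence so is [fine] of
    their difference, including at the points where the inner integral is infinite or undefined. *)
Lemma meas_Rint2 F : measurable_fun setT F ->
  measurable_fun setT (fun x => \int[m2]_y F (x, y))%R.
Proof.
move=> mF; rewrite /Rintegral; apply: measurableT_comp; first exact: fine_measurable.
have mE : measurable_fun setT (EFin \o F) by exact/measurable_EFinP.
have -> : (fun x => \int[m2]_y (F (x, y))%:E) =
  (fun x => \int[m2]_y (EFin \o F)^\+ (x, y) - \int[m2]_y (EFin \o F)^\- (x, y)).
  by apply/funext => x; rewrite [LHS]integralE; congr (_ - _); apply: eq_integral => y _; rewrite ?funeposE ?funenegE.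
apply: (@emeasurable_funB _ _ _ setT (fubini_F m2 (EFin \o F)^\+) (fubini_F m2 (EFin \o F)^\-)).
- apply: (measurable_fun_fubini_tonelli_F (EFin \o F)^\+) => //.
  exact: measurable_funepos.
- apply: (measurable_fun_fubini_tonelli_F (EFin \o F)^\-) => //.
  exact: measurable_funeneg.
Qed.

Lemma tonelliR F : measurable_fun setT F -> (forall p, 0 <= F p)%R ->
  \int[m1]_x \int[m2]_y (F (x, y))%:E = \int[m2]_y \int[m1]_x (F (x, y))%:E.
Proof.
move=> mF F0; apply: (fubini_tonelli (fun p => (F p)%:E)).
  exact/measurable_EFinP.
by move=> p; rewrite lee_fin.
Qed.

Lemma nl1_Rint2 F : measurable_fun setT F ->
  nl1 m1 (fun x => \int[m2]_y F (x, y))%R <= \int[m1]_x nl1 m2 (fun y => F (x, y)).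
Proof.
move=> mF; apply: ge0_le_integral => //.
- by apply/measurable_EFinP; have := meas_Rint2 mF => h; meas.
- by apply: (@meas_ge0_int2 (fun p => `|F p|%R)) => //; meas.
- by move=> x _; apply: abs_Rintegral_le; exact: meas_pair1.
Qed.

Lemma intg_Rint2 F : measurable_fun setT F ->
  \int[m1]_x nl1 m2 (fun y => F (x, y)) < +oo ->
  intg m1 (fun x => \int[m2]_y F (x, y))%R.
Proof.
move=> mF oo; apply: intgP; first exact: meas_Rint2.
by apply: le_lt_trans oo; exact: nl1_Rint2.
Qed.

End double_integrals.

Lemma meas_swap d1 d2 (T1 : measurableType d1) (T2 : measurableType d2) {R : realType}
  (F : T1 * T2 -> R) : measurable_fun setT F ->
  measurable_fun setT (fun p : T2 * T1 => F (p.2, p.1)).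
Proof.
move=> mF; apply: (measurableT_comp mF).
by apply: measurable_fun_pair; [exact: measurable_snd|exact: measurable_fst].
Qed.

Section fubini_real.
Context d1 d2 (T1 : measurableType d1) (T2 : measurableType d2) {R : realType}.
Variable m1 : {sigma_finite_measure set T1 -> \bar R}.
Variable m2 : {sigma_finite_measure set T2 -> \bar R}.
Local Open Scope ereal_scope.

(** The real iterated integrals agree with the extended ones only where the sections are integrable,
    that is, almost everywhere; this is enough for the outer integral. *)
Lemma fubiniR (F : T1 * T2 -> R) : measurable_fun setT F ->
  \int[m1]_x nl1 m2 (fun y => F (x, y)) < +oo ->
  (\int[m1]_x \int[m2]_y F (x, y) = \int[m2]_y \int[m1]_x F (x, y))%R.
Proof.
move=> mF oo.
have mE : measurable_fun setT (EFin \o F) by exact/measurable_EFinP.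
have iF : (m1 \x m2).-integrable setT (EFin \o F) by apply/integrable12ltyP.
have oo' : \int[m2]_y nl1 m1 (fun x => F (x, y)) < +oo.
  by rewrite /nl1 -(@tonelliR _ _ _ _ _ m1 m2 (fun p => `|F p|)%R)//; meas.
have E1 : (\int[m1]_x \int[m2]_y F (x, y))%R%:E = \int[m1]_x \int[m2]_y (F (x, y))%:E.
  rewrite EFin_Rintegral; last exact: intg_Rint2.
  apply: ae_eq_integral => //.
  - by apply/measurable_EFinP; exact: meas_Rint2.
  - exact: (measurable_fubini_F iF).
  have := ae_integrable1 iF; apply: filterS => x ix _.
  by rewrite EFin_Rintegral.
have E2 : (\int[m2]_y \int[m1]_x F (x, y))%R%:E = \int[m2]_y \int[m1]_x (F (x, y))%:E.
  rewrite EFin_Rintegral; last first.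
    by apply: (intg_Rint2 (m1 := m2) (m2 := m1) (meas_swap mF)).
  apply: ae_eq_integral => //.
  - by apply/measurable_EFinP; exact: (meas_Rint2 m1 (meas_swap mF)).
  - exact: (measurable_fubini_G iF).
  have := ae_integrable2 iF; apply: filterS => x ix _.
  by rewrite EFin_Rintegral.
by apply: EFin_inj; rewrite E1 E2; exact: (Fubini iF).
Qed.

End fubini_real.

Section weighted_CS.
Context d (T : measurableType d) {R : realType}.
Variable m : {measure set T -> \bar R}.
Local Open Scope ereal_scope.

(** The optimal parameter is [t = I / A]. *)
Lemma real_amgm_sq (I A B : R) : (0 < A)%R -> (0 <= B)%R -> (0 <= I)%R ->
  (forall t : R, 0 < t -> 2 * I <= t * A + B / t)%R -> (I ^+ 2 <= A * B)%R.
Proof.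
move=> A0 B0; rewrite le_eqVlt => /predU1P[<-|I0] h.
  by rewrite expr0n/= mulr_ge0// ltW.
have t0 : (0 < I / A)%R by rewrite divr_gt0.
have := h _ t0; rewrite mulfVK ?gt_eqF// invf_div.
rewrite -(ler_pM2l I0) mulrDr.
rewrite (_ : (I * (B * (A / I)) = A * B)%R); last by field; rewrite gt_eqF.
by rewrite expr2; nra.
Qed.

(** Cauchy-Schwarz for the measure with density [|a|], obtained by integrating
    [2 |a b| <= t |a| + |a| b^2 / t] and optimizing over [t]. With a weight of mass one it serves as
    Jensen's inequality for squares. *)
Lemma weighted_CS (a b : T -> R) (A : R) : (0 < A)%R ->
  measurable_fun setT a -> measurable_fun setT b ->
  nl1 m a <= A%:E ->
  ((\int[m]_x (a x * b x)) ^+ 2)%R%:E <= A%:E * \int[m]_x (`|a x| * b x ^+ 2)%:E.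
Proof.
move=> A0 ma mb aA.
have mab : measurable_fun setT (fun x => `|a x| * b x ^+ 2)%R by meas.
have [Boo|] := ltP (\int[m]_x (`|a x| * b x ^+ 2)%:E) +oo; last first.
  by rewrite leye_eq => /eqP ->; rewrite gt0_muley ?lte_fin ?leey.
have B0 : 0 <= \int[m]_x (`|a x| * b x ^+ 2)%:E.
  by apply: integral_ge0 => x _; rewrite lee_fin mulr_ge0 ?sqr_ge0.
move: Boo; rewrite -ge0_fin_numE// => /fineK EB.
rewrite -EB -EFinM lee_fin -real_normK ?num_real//.
apply: real_amgm_sq => // [|t t0]; first exact: fine_ge0.
rewrite -lee_fin.
have h : \int[m]_x (2 * `|a x * b x|)%:E <=
   \int[m]_x (t * `|a x| + t^-1 * (`|a x| * b x ^+ 2))%:E.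
  apply: le_nl; [by meas|by meas|move=> x].
  rewrite mulr_ge0//= normrM.
  rewrite -(ler_pM2l t0) mulrDr (mulrA t (t^-1)%R) mulfV ?gt_eqF// mul1r.
  rewrite -(real_normK (num_real (b x))).
  have := sqr_ge0 (t - `|b x|)%R; have := normr_ge0 (a x); have := normr_ge0 (b x).
  by nra.
have p1 x : (0 <= `|a x| * b x ^+ 2)%R by rewrite mulr_ge0 ?sqr_ge0.
have p2 x : (0 <= t^-1 * (`|a x| * b x ^+ 2))%R by rewrite mulr_ge0 ?invr_ge0 ?(ltW t0) ?p1.
have p3 x : (0 <= t * `|a x|)%R by rewrite mulr_ge0 ?(ltW t0).
rewrite ge0_nlD// in h; [|by meas|by meas].
rewrite !ge0_nlZ// in h; try solve [by meas|by rewrite ?invr_ge0 ltW].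
rewrite -EB -EFinM in h.
rewrite EFinM; apply: le_trans (le_trans _ h) _.
  rewrite lee_pmul2l//; apply: abs_Rintegral_le; meas.
by rewrite EFinD leeD// ?lee_fin ?(mulrC t^-1)%R// EFinM lee_pmul2l.
Qed.

End weighted_CS.

(** * Convolutions on R^n *)

Section convolution.
Context {R : realType} {n : nat}.
Local Notation mu := (@lebesgue_rV R n).
Local Notation rV := 'rV[R]_n.
Implicit Types (f g L M u : rV -> R) (x y : rV).
Local Open Scope ereal_scope.

Definition conv L u x : R := (\int[mu]_y (L (x - y) * u y))%R.

Lemma meas_subrV f : measurable_fun setT f ->
  measurable_fun setT (fun p : rV * rV => f (p.1 - p.2)%R).
Proof.
move=> mf; apply: (measurableT_comp mf); apply: measurable_rV_sub.
  exact: measurable_fst.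
exact: measurable_snd.
Qed.

Lemma meas_comp2 d1 d2 (T1 : measurableType d1) (T2 : measurableType d2) (f : T2 -> R) :
  measurable_fun setT f -> measurable_fun setT (fun p : T1 * T2 => f p.2).
Proof. by move=> mf; apply: (measurableT_comp mf); exact: measurable_snd. Qed.

Lemma meas_comp1 d1 d2 (T1 : measurableType d1) (T2 : measurableType d2) (f : T1 -> R) :
  measurable_fun setT f -> measurable_fun setT (fun p : T1 * T2 => f p.1).
Proof. by move=> mf; apply: (measurableT_comp mf); exact: measurable_fst. Qed.

Lemma meas_refl f x : measurable_fun setT f -> measurable_fun setT (fun y => f (x - y)%R).
Proof. by move=> mf; exact: (meas_pair1 x (meas_subrV mf)). Qed.

Lemma meas_shift f y : measurable_fun setT f -> measurable_fun setT (fun x => f (x - y)%R).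
Proof. by move=> mf; exact: (meas_pair2 y (meas_subrV mf)). Qed.

Lemma meas_shiftD f y : measurable_fun setT f -> measurable_fun setT (fun x => f (x + y)%R).
Proof.
move=> mf; have := meas_shift (- y)%R mf.
by under eq_fun do rewrite opprK.
Qed.

Lemma nl_refl f x : measurable_fun setT f -> (forall y, 0 <= f y)%R ->
  \int[mu]_y (f (x - y)%R)%:E = \int[mu]_y (f y)%:E.
Proof.
move=> mf f0; apply: (ge0_integral_reflect x (f := fun y => (f y)%:E)).
  exact/measurable_EFinP.
by move=> y; rewrite lee_fin.
Qed.

Lemma nl_shift f y : measurable_fun setT f -> (forall y, 0 <= f y)%R ->
  \int[mu]_x (f (x + y)%R)%:E = \int[mu]_x (f x)%:E.
Proof.
move=> mf f0; apply: (ge0_integral_translate y (f := fun y => (f y)%:E)).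
  exact/measurable_EFinP.
by move=> z; rewrite lee_fin.
Qed.

(** Positive and negative parts are translated separately, so the equality also covers functions
    that are not integrable. *)
Lemma Rint_shift f y : measurable_fun setT f ->
  (\int[mu]_x f (x + y) = \int[mu]_x f x)%R.
Proof.
move=> mf; rewrite /Rintegral; congr fine.
have mE : measurable_fun setT (EFin \o f) by exact/measurable_EFinP.
rewrite [LHS]integralE [RHS]integralE; congr (_ - _).
- rewrite -(ge0_integral_translate y (measurable_funepos mE))//.
  by apply: eq_integral => x _; rewrite !funeposE.
- rewrite -(ge0_integral_translate y (measurable_funeneg mE))//.
  by apply: eq_integral => x _; rewrite !funenegE.
Qed.

Lemma meas_convF L u : measurable_fun setT L -> measurable_fun setT u ->
  measurable_fun setT (fun p : rV * rV => L (p.1 - p.2) * u p.2)%R.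
Proof.
move=> mL m_u; apply: measurable_funM; first exact: meas_subrV.
exact: meas_comp2.
Qed.

Lemma meas_conv L u : measurable_fun setT L -> measurable_fun setT u ->
  measurable_fun setT (conv L u).
Proof. by move=> mL m_u; apply: (meas_Rint2 mu (meas_convF mL m_u)). Qed.

Lemma tonelli_conv L u : measurable_fun setT L -> measurable_fun setT u ->
  \int[mu]_x nl1 mu (fun y => L (x - y) * u y)%R = nl1 mu L * nl1 mu u.
Proof.
move=> mL m_u.
have mF := meas_convF mL m_u.
rewrite /nl1 (tonelliR mu mu (F := fun p => `|L (p.1 - p.2) * u p.2|%R))//; last by meas.
rewrite /= -ge0_integralZl//; last 2 first.
- by apply/measurable_EFinP; meas.
- exact: nl1_ge0.
apply: eq_integral => y _.
under eq_integral do rewrite normrM mulrC.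
rewrite ge0_nlZ//; last by have := meas_shift y mL => h; meas.
rewrite muleC; congr (_ * _).
by apply: (nl_shift (f := fun x => `|L x|%R) (- y)%R) => //; meas.
Qed.

Lemma nl1_conv L u : measurable_fun setT L -> measurable_fun setT u ->
  nl1 mu (conv L u) <= nl1 mu L * nl1 mu u.
Proof.
move=> mL m_u; rewrite -tonelli_conv//.
exact: (nl1_Rint2 mu mu (meas_convF mL m_u)).
Qed.

(** Young's inequality for L^1 and L^2: weighted Cauchy-Schwarz at each [x], then Tonelli. *)
Lemma nl2_conv L u (A : R) : (0 < A)%R -> measurable_fun setT L ->
  measurable_fun setT u -> nl1 mu L <= A%:E ->
  nl2 mu (conv L u) <= (A ^+ 2)%:E * nl2 mu u.
Proof.
move=> A0 mL m_u LA.
have mL2 : measurable_fun setT (fun x => `|L x|%R) by meas.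
have mu2 : measurable_fun setT (fun x => u x ^+ 2)%R by meas.
have mF := meas_convF mL2 mu2.
have F0 (p : rV * rV) : (0 <= `|L (p.1 - p.2)| * u p.2 ^+ 2)%R.
  by rewrite mulr_ge0 ?sqr_ge0.
have mG := @meas_ge0_int2 _ _ _ _ _ mu _ mF F0.
apply: (@le_trans _ _ (\int[mu]_x (A%:E * \int[mu]_y (`|L (x - y)| * u y ^+ 2)%R%:E))).
  apply: ge0_le_integral => //.
  - by move=> x _; rewrite lee_fin sqr_ge0.
  - by apply/measurable_EFinP; apply: measurable_funX; exact: meas_conv.
  - exact: emeasurable_funM.
  move=> x _; apply: (weighted_CS A0 (meas_refl x mL) m_u).
  by rewrite /nl1 (nl_refl (f := fun x => `|L x|%R))//.
rewrite ge0_integralZl//; last 2 first.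
- by move=> x _; apply: integral_ge0 => y _; rewrite lee_fin (F0 (x, y)).
- by rewrite lee_fin ltW.
rewrite expr2 EFinM -muleA lee_pmul2l//.
have := tonelli_conv mL mu2.
under [X in X = _ -> _]eq_integral => x _.
  rewrite /nl1; under eq_integral do rewrite normrM (ger0_norm (sqr_ge0 _)).
  over.
move=> ->; apply: lee_pmul => //; [exact: nl1_ge0|exact: nl1_ge0|].
by apply: le_nl1; [by meas|by meas|move=> x; rewrite ger0_norm ?sqr_ge0].
Qed.

(** Boundedness of [M] makes the double integral absolutely convergent, with bound [c |L|_1 |u|_1],
    at every [x] and not only almost everywhere. It is meant for [M] a truncated singular kernel,
    which need not be integrable. *)
Lemma conv_assoc L M u x : measurable_fun setT L -> measurable_fun setT M ->
  measurable_fun setT u ->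
  (exists c : R, forall x, `|M x| <= c)%R -> nl1 mu L < +oo -> nl1 mu u < +oo ->
  conv L (conv M u) x = conv (conv L M) u x.
Proof.
move=> mL mM m_u [c Mc] Loo uoo; rewrite /conv.
have mF : measurable_fun setT (fun p : rV * rV =>
    L (x - p.1) * (M (p.1 - p.2) * u p.2))%R.
  apply: measurable_funM; first by apply: (measurableT_comp (meas_refl x mL)); exact: measurable_fst.
  exact: meas_convF.
have -> : (\int[mu]_z (L (x - z) * \int[mu]_y (M (z - y) * u y)) =
  \int[mu]_z \int[mu]_y (L (x - z) * (M (z - y) * u y)))%R.
  apply: eq_Rintegral => z _; rewrite RintegralZl//.
  apply: (le_intg (g := fun y => c * u y)%R).
  - exact: (meas_pair1 z (meas_convF mM m_u)).
  - by apply: intgZ; exact: intgP.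
  - move=> y; rewrite !normrM ler_wpM2r// (le_trans (Mc _))//.
    exact: ler_norm.
rewrite (fubiniR mF)/=; last first.
  apply: (@le_lt_trans _ _ (\int[mu]_z (`|L (x - z)|%:E * (`|c|%:E * nl1 mu u)))).
    apply: ge0_le_integral => //.
    - by move=> z _; exact: nl1_ge0.
    - apply: (@meas_ge0_int2 _ _ _ _ _ mu (fun p : rV * rV =>
        `|L (x - p.1) * (M (p.1 - p.2) * u p.2)|)%R) => //; meas.
    - apply: emeasurable_funM => //; apply/measurable_EFinP.
      by have := meas_refl x mL => h; meas.
    - move=> z _.
      rewrite -nl1Z// -nl1Z; last by meas.
      apply: le_nl1; [exact: (meas_pair1 z mF)|by meas|move=> y].
      rewrite !normrM; apply: ler_wpM2l => //; apply: ler_wpM2r => //.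
      by apply: le_trans (Mc _) _; exact: ler_norm.
  have -> : `|c|%:E * nl1 mu u = (`|c| * fine (nl1 mu u))%R%:E.
    by rewrite EFinM fineK// ge0_fin_numE// nl1_ge0.
  rewrite ge0_integralZr//; last 2 first.
  - by apply/measurable_EFinP; have := meas_refl x mL => h; meas.
  - by rewrite lee_fin mulr_ge0// fine_ge0// nl1_ge0.
  rewrite (nl_refl (f := fun x => `|L x|%R) x)//; last by meas.
  by apply: lte_mul_pinfty => //; [exact: nl1_ge0|rewrite ge0_fin_numE// nl1_ge0|rewrite ltry].
apply: eq_Rintegral => y _.
have -> : (\int[mu]_z (L (x - z) * (M (z - y) * u y)) =
   \int[mu]_z (L (x - z) * M (z - y) * u y))%R.
  by apply: eq_Rintegral => z _; rewrite mulrA.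
rewrite RintegralZr//; last first.
  apply: (@le_intg _ _ _ mu _ (fun z => c * L (x - z))%R).
  - apply: measurable_funM; [exact: meas_refl|exact: meas_shift].
  - apply: intgZ; apply: intgP; first exact: meas_refl.
    by rewrite /nl1 (nl_refl (f := fun x => `|L x|%R) x)//; meas.
  - move=> z; rewrite !normrM mulrC ler_wpM2r// (le_trans (Mc _))//.
    exact: ler_norm.
congr (_ * _)%R.
rewrite -(Rint_shift y); last first.
  by apply: measurable_funM; [exact: meas_refl|exact: meas_shift].
by apply: eq_Rintegral => z _; rewrite addrK opprD addrCA addrC.
Qed.

End convolution.

(** * Cells and conditional expectations *)

Section cells.
Context {R : realType} {n : nat}.
Local Notation mu := (@lebesgue_rV R n).
Local Notation rV := 'rV[R]_n.
Implicit Types (f g h u : rV -> R) (x y : rV) (r : R).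

Definition cell r x : 'rV[int]_n := \row_i Num.floor (x ord0 i / r).

(** A reference point that depends only on the cell of [x]. *)
Definition corner r x : rV := \row_i (r * (cell r x ord0 i)%:~R).

Definition box r (v : 'rV[int]_n) : set rV :=
  [set x | forall i, `[r * (v ord0 i)%:~R, r * (v ord0 i + 1)%:~R[%classic (x ord0 i)].

(** Measurability with respect to the cells of side [r], in a form that also makes sense for the
    states and sets used below. *)
Definition cellconst r (S : Type) (h : rV -> S) :=
  forall x y, cell r x = cell r y -> h x = h y.

Lemma cellP r x v : 0 < r -> (cell r x = v) <-> box r v x.
Proof.
move=> r0; split=> [<- i|h].
  rewrite /= in_itv/= mxE; apply/andP; split.
    by rewrite mulrC -ler_pdivlMr// floor_le.
  by rewrite mulrC -ltr_pdivrMr// floorD1_gt.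
apply/rowP => i; rewrite mxE; apply: floor_def.
have := h i; rewrite /= in_itv/= => /andP[h1 h2].
by rewrite ler_pdivlMr// ltr_pdivrMr// ![_%:~R * r]mulrC h1 h2.
Qed.

Lemma measurable_box r v : measurable (box r v).
Proof.
rewrite (_ : box r v = \bigcap_(i in [set: 'I_n])
  ((fun x : rV => x ord0 i) @^-1` `[r * (v ord0 i)%:~R, r * (v ord0 i + 1)%:~R[%classic)).
  apply: fin_bigcap_measurable => // i _.
  by rewrite -[X in measurable X]setTI; apply: measurable_coord => //; exact: measurable_itv.
by apply/seteqP; split=> x xA i => [_|]; exact: xA.
Qed.

Lemma measure_box r v : 0 < r -> mu (box r v) = (r ^+ n)%:E.
Proof.
move=> r0; rewrite /box (lebesgue_rV_box
  (A := fun i => `[r * (v ord0 i)%:~R, r * (v ord0 i + 1)%:~R[%classic)); last first.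
  by move=> i; exact: measurable_itv.
rewrite (eq_bigr (fun=> r%:E)).
  by rewrite prodEFin prodr_const card_ord.
move=> i _; rewrite lebesgue_measure_itv/= lte_fin ltr_pM2l// ltr_int.
by rewrite ltrDl ltr01 -EFinB; congr EFin; rewrite intrD; ring.
Qed.

Lemma cell_preimage r v : 0 < r -> [set x | cell r x = v] = box r v.
Proof. by move=> r0; apply/seteqP; split => x /(cellP x v r0). Qed.

Lemma measurable_cell_comp d (T : measurableType d) r (f : T -> rV) (A : set 'rV[int]_n) :
  0 < r -> measurable_fun setT f -> measurable [set t | A (cell r (f t))].
Proof.
move=> r0 mf.
rewrite (_ : [set _ | _] = \bigcup_v [set t | A v /\ cell r (f t) = v]).
  apply: countable_bigcupT_measurable => [|v]; first exact: countableP.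
  have [Av|nAv] := pselect (A v); last first.
    by rewrite (_ : [set _ | _] = set0)//; apply/seteqP; split => t // -[].
  rewrite (_ : [set _ | _] = f @^-1` box r v).
    by rewrite -[X in measurable X]setTI; apply: mf => //; exact: measurable_box.
  by apply/seteqP; split => t /=; [case=> _ /(cellP _ _ r0)|move/(cellP _ _ r0)].
by apply/seteqP; split=> t /=; [move=> h; exists (cell r (f t))|case=> v _ [Av ->]].
Qed.

(** Every preimage is a countable union of cells. *)
Lemma meas_cellconst r h : 0 < r -> cellconst r h -> measurable_fun setT h.
Proof.
move=> r0 hc _ Y mY; rewrite setTI.
rewrite (_ : _ @^-1` _ = [set x | (fun v => exists2 y, cell r y = v & Y (h y)) (cell r x)]).
  exact: (measurable_cell_comp (fun v => exists2 y, cell r y = v & Y (h y)) r0 (@measurable_id _ _ setT)).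
apply/seteqP; split => x /=; first by exists x.
by case=> y /hc ->.
Qed.

Lemma measurable_same_cell r : 0 < r ->
  measurable [set p : rV * rV | cell r p.1 = cell r p.2].
Proof.
move=> r0.
rewrite (_ : [set _ | _] = \bigcup_v
  ([set p : rV * rV | cell r p.1 = v] `&` [set p | cell r p.2 = v])).
  apply: countable_bigcupT_measurable => [|v]; first exact: countableP.
  apply: measurableI.
  - by apply: (@measurable_cell_comp _ (rV * rV)%type r fst [set v] r0); exact: measurable_fst.
  - by apply: (@measurable_cell_comp _ (rV * rV)%type r snd [set v] r0); exact: measurable_snd.
by apply/seteqP; split=> p /=; [move=> h; exists (cell r p.2)|case=> v _ [-> ->]].
Qed.

Lemma cell_corner r x : 0 < r -> cell r (corner r x) = cell r x.
Proof.
move=> r0; apply/rowP => i; rewrite !mxE mulrC mulKf ?gt_eqF//.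
exact: intrKfloor.
Qed.

Lemma cell_near r x y i : 0 < r -> cell r x = cell r y -> `|x ord0 i - y ord0 i| < r.
Proof.
move=> r0 /(cellP _ _ r0)/(_ i) hx; have /(cellP _ _ r0)/(_ i) hy := erefl (cell r y).
move: hx hy; rewrite /= !in_itv/= intrD => /andP[a b] /andP[c d].
by rewrite ltr_norml; apply/andP; split; nra.
Qed.

(** Indices that differ by more than [k] leave at least [k] whole cells between the two points. *)
Lemma cell_far r x y (k : nat) i : 0 < r ->
  (k%:Z < `|cell r x ord0 i - cell r y ord0 i|) -> r * k%:R <= `|x ord0 i - y ord0 i|.
Proof.
move=> r0 hk.
have /(cellP _ _ r0)/(_ i) hx := erefl (cell r x).
have /(cellP _ _ r0)/(_ i) hy := erefl (cell r y).
move: hx hy hk; rewrite /= !in_itv/= !intrD.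
set a := cell r x ord0 i; set b := cell r y ord0 i => /andP[x1 x2] /andP[y1 y2] hk.
have [ab|ab] : (b + k%:Z + 1 <= a) \/ (a + k%:Z + 1 <= b) by lia.
  have : (b + k%:Z + 1)%:~R <= a%:~R :> R by rewrite ler_int.
  rewrite !intrD => h; apply: le_trans (ler_norm _).
  have : r * (b%:~R + k%:Z%:~R + 1%:~R) <= r * a%:~R by rewrite ler_pM2l.
  by rewrite -pmulrn; nra.
have : (a + k%:Z + 1)%:~R <= b%:~R :> R by rewrite ler_int.
rewrite !intrD => h; rewrite distrC; apply: le_trans (ler_norm _).
have : r * (a%:~R + k%:Z%:~R + 1%:~R) <= r * b%:~R by rewrite ler_pM2l.
by rewrite -pmulrn; nra.
Qed.

Lemma cell_shift r x (v : 'rV[int]_n) : 0 < r ->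
  cell r (x - \row_i (r * (v ord0 i)%:~R)) = cell r x - v.
Proof.
move=> r0; apply/rowP => i; rewrite !mxE mulrBl [r * _]mulrC mulfK ?gt_eqF//.
by rewrite -intrN floorDrz ?intrKfloor// ?rpredN ?intr_int.
Qed.

(** Dyadic nesting: the integer part of [t / 2] is determined by that of [t]. *)
Lemma cell_double r x y : 0 < r -> cell r x = cell r y -> cell (r * 2) x = cell (r * 2) y.
Proof.
move=> r0 h; apply/rowP => i; move/rowP : h => /(_ i); rewrite !mxE => h.
apply/esym; apply: floor_def.
have r2 : 0 < r * 2 by rewrite mulr_gt0.
have E (z : R) : z / (r * 2) = z / r / 2 by rewrite invfM mulrA.
rewrite !E; set a := Num.floor (x ord0 i / r / 2).
have /andP[] := floor_itv (x ord0 i / r / 2); rewrite -/a.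
rewrite ler_pdivlMr// ltr_pdivrMr// [_ <= _ / 2]ler_pdivlMr// [_ / 2 < _]ltr_pdivrMr// => h1 h2.
apply/andP; split.
  have : (a * 2)%:~R <= x ord0 i / r by rewrite intrM.
  by rewrite -floor_ge_int h floor_ge_int intrM.
have : x ord0 i / r < ((a + 1) * 2)%:~R by rewrite intrM.
by rewrite -floor_lt_int h floor_lt_int intrM.
Qed.

Lemma cell_scale r x y j : 0 < r -> cell r x = cell r y ->
  cell (r * 2 ^+ j) x = cell (r * 2 ^+ j) y.
Proof.
move=> r0 h; elim: j => [|j IH]; first by rewrite expr0 mulr1.
by rewrite exprSr mulrA; apply: cell_double => //; rewrite mulr_gt0// exprn_gt0.
Qed.

Lemma cellconst_scale r (S : Type) (h : rV -> S) j k : 0 < r -> (j <= k)%N ->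
  cellconst (r * 2 ^+ k) h -> cellconst (r * 2 ^+ j) h.
Proof.
move=> r0 jk hc x y xy; apply: hc; rewrite -(subnKC jk) exprD mulrA.
by apply: cell_scale => //; rewrite mulr_gt0// exprn_gt0.
Qed.

Definition ce r x y : R := r ^- n * (cell r x == cell r y)%:R.

Lemma ce_ge0 r x y : 0 < r -> 0 <= ce r x y.
Proof. by move=> r0; rewrite mulr_ge0// invr_ge0 exprn_ge0// ltW. Qed.

Lemma ceC r x y : ce r x y = ce r y x.
Proof. by rewrite /ce eq_sym. Qed.

Lemma meas_bool d (T : measurableType d) (P : T -> bool) :
  measurable [set t | P t] -> measurable_fun setT (fun t => (P t)%:R : R).
Proof.
move=> mP; rewrite (_ : (fun t => _) = \1_[set t | P t]); first exact: measurable_indic.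
apply/funext => t; rewrite indicE.
by have [h|/negP h] := boolP (P t); [rewrite mem_set|rewrite memNset].
Qed.

Lemma meas_ce r : 0 < r -> measurable_fun setT (fun p : rV * rV => ce r p.1 p.2).
Proof.
move=> r0; apply: measurable_funM => //; apply: meas_bool.
rewrite (_ : [set _ | _] = [set p : rV * rV | cell r p.1 = cell r p.2]).
  exact: measurable_same_cell.
by apply/seteqP; split => p /= /eqP.
Qed.

Lemma meas_ce1 r x : 0 < r -> measurable_fun setT (ce r x).
Proof. by move=> r0; exact: (meas_pair1 x (meas_ce r0)). Qed.

Lemma int_ce r x : 0 < r -> (\int[mu]_y (ce r x y)%:E = 1)%E.
Proof.
move=> r0; rewrite /ce ge0_nlZ//; last first.
- by rewrite invr_ge0 exprn_ge0// ltW.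
- apply: meas_bool; rewrite (_ : [set _ | _] = box r (cell r x)).
    exact: measurable_box.
  by rewrite -cell_preimage//; apply/seteqP; split => y /=; [move/eqP <-|move->].
rewrite (_ : (\int[mu]_y _)%E = (\int[mu]_y (\1_(box r (cell r x)) y)%:E)%E).
  rewrite integral_indic//; last exact: measurable_box.
  rewrite [X in (_ * X)%E](_ : _ = (r ^+ n)%:E); last by rewrite setIT; exact: measure_box.
  by rewrite -EFinM mulVf// expf_neq0// gt_eqF.
apply: eq_integral => y _; rewrite indicE; congr ((nat_of_bool _)%:R%:E).
by apply/eqP/idP => [h|/set_mem/(cellP _ _ r0)->//]; rewrite mem_set//; exact/(cellP _ _ r0).
Qed.

End cells.

Section cond_exp.
Context {R : realType} {n : nat}.
Local Notation mu := (@lebesgue_rV R n).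
Local Notation rV := 'rV[R]_n.
Implicit Types (f g h u v : rV -> R) (x y : rV).
Variable r : R.
Hypothesis r0 : 0 < r.

(** Conditional expectation on the cells of side [r], written as an integral operator. Its kernel
    [ce] is symmetric, nonnegative and of mass one, from which its properties are read off. *)
Definition E u x : R := \int[mu]_y (ce r x y * u y).

Lemma ce_cell x x' y : cell r x = cell r x' -> ce r x y = ce r x' y.
Proof. by rewrite /ce => ->. Qed.

Lemma E_cellconst u : cellconst r (E u).
Proof. by move=> x y xy; apply: eq_Rintegral => z _; rewrite (ce_cell _ xy). Qed.

Lemma meas_E u : measurable_fun setT (E u).
Proof. by apply: (meas_cellconst r0); exact: E_cellconst. Qed.

Lemma meas_ceF u : measurable_fun setT u ->
  measurable_fun setT (fun p : rV * rV => ce r p.1 p.2 * u p.2).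
Proof. by move=> m_u; apply: measurable_funM; [exact: meas_ce|exact: meas_comp2]. Qed.

(** [ce] is supported on pairs of points of one cell, so a function constant on cells passes from
    one variable to the other. *)
Lemma ce_mul_const h x y : cellconst r h -> ce r x y * h y = ce r x y * h x.
Proof.
move=> hc; rewrite /ce; have [e|_] := eqVneq; last by rewrite mulr0 !mul0r.
by rewrite (hc _ _ e).
Qed.

Lemma ce_mul2 h x y (a : R) : cellconst r h ->
  ce r x y * (a * h y) = ce r x y * a * h x.
Proof. by move=> hc; rewrite mulrCA (ce_mul_const _ _ hc); ring. Qed.

Lemma tonelli_ce u h : measurable_fun setT u -> cellconst r h ->
  (\int[mu]_x nl1 mu (fun y => (ce r x y * u y * h x)%R) = nl1 mu (fun y => (u y * h y)%R))%E.
Proof.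
move=> m_u hc; have mh := meas_cellconst r0 hc.
have mF : measurable_fun setT (fun p : rV * rV => (ce r p.1 p.2 * (u p.2 * h p.2))%R).
  by apply: (@meas_ceF (fun y => u y * h y)); meas.
transitivity (\int[mu]_x (\int[mu]_y (`|ce r x y * (u y * h y)|%R)%:E))%E.
  apply: eq_integral => x _; apply: eq_integral => y _.
  by rewrite -[(ce r x y * u y * h x)%R]mulrA mulrCA -(ce_mul_const _ _ hc) mulrCA.
rewrite (tonelliR mu mu (F := fun p => `|ce r p.1 p.2 * (u p.2 * h p.2)|))//=; last by meas.
apply: eq_integral => y _.
under eq_integral do rewrite normrM (ger0_norm (ce_ge0 _ _ r0)) ceC mulrC.
rewrite ge0_nlZ//; [by rewrite int_ce// mule1|exact: meas_ce1|by move=> x; exact: ce_ge0].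
Qed.

Lemma nl1_E u : measurable_fun setT u -> (nl1 mu (E u) <= nl1 mu u)%E.
Proof.
move=> m_u; apply: le_trans (nl1_Rint2 mu mu (meas_ceF m_u)) _.
have := @tonelli_ce u (fun=> 1) m_u (fun _ _ _ => erefl).
rewrite [X in _ = X](_ : _ = nl1 mu u); last first.
  by apply: eq_integral => x _; rewrite mulr1.
move=> <-; rewrite le_eqVlt; apply/orP; left; apply/eqP.
by apply: eq_integral => x _; apply: eq_integral => y _; rewrite mulr1.
Qed.

Lemma nl1_ce x : (nl1 mu (ce r x) <= 1%:E)%E.
Proof.
rewrite -(int_ce x r0); rewrite le_eqVlt; apply/orP; left; apply/eqP.
by apply: eq_integral => y _; rewrite ger0_norm// ce_ge0.
Qed.

(** Jensen for the probability density [ce r x], followed by Tonelli. *)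
Lemma nl2_E u : measurable_fun setT u -> (nl2 mu (E u) <= nl2 mu u)%E.
Proof.
move=> m_u.
have m2 : measurable_fun setT (fun y => u y ^+ 2) by meas.
have h1 (x : rV) : measurable_fun setT (fun y => ce r x y * u y ^+ 2).
  by have := meas_ce1 x r0 => h; meas.
apply: (@le_trans _ _ (\int[mu]_x (\int[mu]_y (ce r x y * u y ^+ 2)%R%:E))%E).
  apply: ge0_le_integral => //.
  - by move=> x _; rewrite lee_fin sqr_ge0.
  - by apply/measurable_EFinP; apply: measurable_funX; exact: meas_E.
  - apply: (@meas_ge0_int2 _ _ _ _ _ mu (fun p : rV * rV => ce r p.1 p.2 * u p.2 ^+ 2)).
      exact: (meas_ceF m2).
    by move=> p; rewrite mulr_ge0 ?sqr_ge0// ce_ge0.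
  move=> x _; have := weighted_CS ltr01 (meas_ce1 x r0) m_u (nl1_ce x).
  rewrite mul1e; congr (_ <= _)%E.
  by apply: eq_integral => y _; rewrite ger0_norm// ce_ge0.
have := @tonelli_ce (fun y => u y ^+ 2) (fun=> 1) m2 (fun _ _ _ => erefl).
rewrite [X in _ = X -> _](_ : _ = nl2 mu u); last first.
  by apply: eq_integral => x _; rewrite mulr1 ger0_norm ?sqr_ge0.
move=> <-; rewrite le_eqVlt; apply/orP; left; apply/eqP.
apply: eq_integral => x _; apply: eq_integral => y _.
by rewrite mulr1 ger0_norm// mulr_ge0 ?sqr_ge0// ce_ge0.
Qed.

Lemma E_id h x : cellconst r h -> E h x = h x.
Proof.
move=> hc; rewrite /E.
rewrite (eq_Rintegral mu (g := fun y => h x * ce r x y)); last first.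
  by move=> y _; rewrite ce_mul_const// mulrC.
rewrite RintegralZl//; last by apply: intgP; [exact: meas_ce1|rewrite (le_lt_trans (nl1_ce x))// ltry].
by rewrite /Rintegral int_ce//= mulr1.
Qed.

Lemma intg_ce x : intg mu (ce r x).
Proof. by apply: intgP; [exact: meas_ce1|rewrite (le_lt_trans (nl1_ce x))// ltry]. Qed.

Lemma ce_le x y : ce r x y <= r ^- n.
Proof.
rewrite /ce; have rn : 0 <= r ^- n by rewrite invr_ge0 exprn_ge0// ltW.
by case: eqP; rewrite ?mulr1 ?mulr0.
Qed.

Lemma nl2_ce x : (nl2 mu (ce r x) < +oo)%E.
Proof.
apply: (@le_lt_trans _ _ ((r ^- n)%:E * 1)%E); last by rewrite mule1 ltry.
rewrite -(int_ce x r0) -ge0_nlZ//; last 3 first.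
- exact: meas_ce1.
- by rewrite invr_ge0 exprn_ge0// ltW.
- by move=> y; exact: ce_ge0.
have := meas_ce1 x r0 => m.
apply: le_nl; [by meas|by meas|move=> y].
by rewrite sqr_ge0 expr2 ler_wpM2r ?ce_ge0// ce_le.
Qed.

(** Integrability on each cell: a common roof for functions in L^1 and in L^2. *)
Definition locint u := forall x, intg mu (fun y => ce r x y * u y).

Lemma locint1 u : intg mu u -> locint u.
Proof.
move=> ui x; have := meas_ce1 x r0 => mc; have := intg_meas ui => m_u.
apply: (@le_intg _ _ _ mu _ (fun y => r ^- n * u y)); [by meas|exact: intgZ|].
move=> y; rewrite !normrM ler_wpM2r//.
by rewrite !ger0_norm ?ce_ge0 ?ce_le// invr_ge0 exprn_ge0// ltW.
Qed.

Lemma locint2 u : measurable_fun setT u -> (nl2 mu u < +oo)%E -> locint u.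
Proof. by move=> m_u oo x; apply: intgM => //; [exact: meas_ce1|exact: nl2_ce]. Qed.

Lemma locintM u h : locint u -> cellconst r h -> locint (fun y => u y * h y).
Proof.
move=> ui hc x; have := intgZ (h x) (ui x).
apply: eq_integrable => // y _ /=; congr EFin.
by rewrite (ce_mul2 _ _ _ hc) mulrC.
Qed.

(** Fubini with the symmetric kernel; only the product [u * h] has to be integrable. Orthogonality
    of martingale differences, the tower property and the cancellation of bad parts all come from
    this identity. *)
Lemma E_adj u h : measurable_fun setT u -> locint u -> cellconst r h ->
  (nl1 mu (fun y => (u y * h y)%R) < +oo)%E ->
  \int[mu]_x (E u x * h x) = \int[mu]_x (u x * h x).
Proof.
move=> m_u lu hc oo; have mh := meas_cellconst r0 hc.
have mF : measurable_fun setT (fun p : rV * rV => (ce r p.1 p.2 * u p.2 * h p.1)%R).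
  by apply: measurable_funM; [exact: meas_ceF|exact: meas_comp1].
have -> : \int[mu]_x (E u x * h x) = \int[mu]_x \int[mu]_y (ce r x y * u y * h x).
  by apply: eq_Rintegral => x _; rewrite RintegralZr//; exact: lu.
rewrite (fubiniR mF)/=; last by rewrite tonelli_ce.
apply: eq_Rintegral => y _.
rewrite (eq_Rintegral mu (g := fun x => (u y * h y) * ce r y x)); last first.
  by move=> x _; rewrite ceC -mulrA (ce_mul2 _ _ _ hc); ring.
by rewrite RintegralZl//; [rewrite /Rintegral int_ce//= mulr1|exact: intg_ce].
Qed.

Lemma E_D u v x : locint u -> locint v -> E (fun y => u y + v y) x = E u x + E v x.
Proof.
move=> lu lv; rewrite /E -RintegralD//; [|exact: lu|exact: lv].
by apply: eq_Rintegral => y _; rewrite mulrDr.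
Qed.

Lemma E_B u v x : locint u -> locint v -> E (fun y => u y - v y) x = E u x - E v x.
Proof.
move=> lu lv; rewrite /E -RintegralB//; [|exact: lu|exact: lv].
by apply: eq_Rintegral => y _; rewrite mulrBr.
Qed.

Lemma E_norm u x : measurable_fun setT u -> locint u -> `|E u x| <= E (fun y => `|u y|) x.
Proof.
move=> m_u lu; apply: le_trans (le_normr_Rintegral measurableT (lu x)) _.
rewrite le_eqVlt; apply/orP; left; apply/eqP; apply: eq_Rintegral => y _.
by rewrite normrM ger0_norm// ce_ge0.
Qed.

Lemma E_norm_ge0 u x : 0 <= E (fun y => `|u y|) x.
Proof. by apply: Rintegral_ge0 => y _; rewrite mulr_ge0// ce_ge0. Qed.

(** Averages of an integrable function are small on large cells, which starts the stopping-time
    argument, and an integrable function constant on cells is bounded. *)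
Lemma E_sup u x : measurable_fun setT u ->
  ((`|E u x|)%:E <= (r ^- n)%:E * nl1 mu u)%E.
Proof.
move=> m_u; have mc := meas_ce1 x r0.
have rn : 0 <= r ^- n by rewrite invr_ge0 exprn_ge0// ltW.
apply: le_trans (abs_Rintegral_le _ _) _; first by meas.
rewrite -ge0_nlZ//; last by meas.
apply: le_nl; [by meas|by meas|move=> y].
by rewrite normr_ge0/= normrM ler_wpM2r// ger0_norm ?ce_ge0 ?ce_le.
Qed.

Lemma locint_E u : measurable_fun setT u -> locint u -> locint (E u).
Proof.
move=> m_u lu x; have := intgZ (E u x) (intg_ce x).
apply: eq_integrable => // y _ /=; congr EFin.
by rewrite (ce_mul_const _ _ (E_cellconst u)) mulrC.
Qed.

Lemma E_diff u x : measurable_fun setT u -> locint u -> E (fun y => u y - E u y) x = 0.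
Proof.
move=> m_u lu; rewrite E_B//; last exact: locint_E.
by rewrite (E_id _ (E_cellconst u)) subrr.
Qed.

End cond_exp.

(** * Variation and jumps of martingales *)

Section variation.
Context {R : realType}.
Implicit Types (a b : nat -> R) (t : nat -> nat) (q lam : R).

(** The [q]-th power of the variation along the first [L] terms of [t]. Working with powers and
    finite sums postpones roots and suprema to the end. *)
Definition pvar q a t L : R :=
  \sum_(1 <= k < L) `|a (t k) - a (t k.-1)| `^ q.

Definition ndecr t := {homo t : j k / (j <= k)%N >-> (j <= k)%N}.

Lemma pvar_ge0 q a t L : 0 <= pvar q a t L.
Proof. by apply: sumr_ge0 => k _; exact: powR_ge0. Qed.

Lemma powRD_le q (x y : R) : 0 <= q ->
  `|x + y| `^ q <= 2 `^ q * (`|x| `^ q + `|y| `^ q).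
Proof.
move=> q0; wlog xy : x y / `|x| <= `|y|.
  move=> h; have [/h//|/ltW/h] := lerP `|x| `|y|.
  by rewrite addrC [X in _ * X]addrC.
apply: (@le_trans _ _ ((2 * `|y|) `^ q)).
  apply: ge0_ler_powR; rewrite ?nnegrE// ?mulr_ge0//.
  by rewrite (le_trans (ler_normD _ _))// mulr_natl mulr2n lerD2r.
by rewrite powRM// ler_wpM2l ?powR_ge0// lerDr powR_ge0.
Qed.

Lemma pvarD q a b t L : 0 <= q ->
  pvar q (fun i => a i + b i) t L <= 2 `^ q * (pvar q a t L + pvar q b t L).
Proof.
move=> q0; rewrite /pvar -big_split/= mulr_sumr; apply: ler_sum => k _.
by rewrite opprD addrACA; exact: powRD_le.
Qed.

(** Once the repetitions of [t] are discarded, each index is reached at most once. *)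
Lemma ndecr_sum_next t (f : nat -> R) L : ndecr t -> (forall i, 0 <= f i) ->
  \sum_(1 <= k < L.+1) (if t k.-1 == t k then 0 else f (t k)) <= \sum_(i < (t L).+1) f i.
Proof.
move=> tm f0; elim: L => [|L IH].
  by rewrite big_geq//; exact: sumr_ge0.
rewrite big_nat_recr//=; have tL : (t L <= t L.+1)%N by exact: tm.
have [e|tne] := eqVneq (t L) (t L.+1); first by rewrite addr0 -e.
have tlt : (t L < t L.+1)%N by rewrite ltn_neqAle tne.
rewrite big_ord_recr/= lerD2r (le_trans IH)//.
rewrite -!(big_mkord predT f) [leRHS](big_cat_nat (n := (t L).+1))//= lerDl.
by apply: sumr_ge0.
Qed.

Lemma ndecr_sum_prev t (f : nat -> R) L : ndecr t -> (forall i, 0 <= f i) ->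
  \sum_(1 <= k < L.+1) (if t k.-1 == t k then 0 else f (t k.-1)) <= \sum_(i < t L) f i.
Proof.
move=> tm f0; elim: L => [|L IH].
  by rewrite big_geq//; exact: sumr_ge0.
rewrite big_nat_recr//=; have tL : (t L <= t L.+1)%N by exact: tm.
have mono k l : (k <= l)%N -> \sum_(i < k) f i <= \sum_(i < l) f i.
  move=> kl; rewrite -!(big_mkord predT f) [leRHS](big_cat_nat (n := k))//= lerDl.
  by apply: sumr_ge0.
have [_|tne] := eqVneq (t L) (t L.+1); first by rewrite addr0 (le_trans IH)// mono.
have tlt : (t L < t L.+1)%N by rewrite ltn_neqAle tne.
by apply: le_trans (mono _ _ tlt); rewrite big_ord_recr/= lerD2r.
Qed.

Lemma sum_ord_zero_tail (f : nat -> R) M k : (forall i, 0 <= f i) ->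
  (forall i, (M < i)%N -> f i = 0) -> \sum_(i < k) f i <= \sum_(i < M.+1) f i.
Proof.
move=> f0 fz; have [kM|kM] := leqP k M.+1.
  rewrite -!(big_mkord predT f) [leRHS](big_cat_nat (n := k))//= lerDl.
  by apply: sumr_ge0.
rewrite -!(big_mkord predT f) (big_cat_nat (n := M.+1))//=; last exact: ltnW.
rewrite [X in _ + X]big_nat_cond [X in _ + X]big1 ?addr0// => i.
by rewrite andbT => /andP[Mi _]; exact: fz.
Qed.

(** Each difference splits into its two end values, and every index occurs at most once as a right
    end and once as a left end, apart from repetitions, whose differences vanish. *)
Lemma pvar_lq q a t L M : 0 < q -> ndecr t -> (forall i, (M < i)%N -> a i = 0) ->
  pvar q a t L <= 2 * 2 `^ q * \sum_(i < M.+1) `|a i| `^ q.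
Proof.
move=> q0 tm az; pose f i := `|a i| `^ q.
have f0 i : 0 <= f i by exact: powR_ge0.
have fz i : (M < i)%N -> f i = 0.
  by move=> /az ai; rewrite /f ai normr0 powR0// gt_eqF.
case: L => [|L].
  by rewrite /pvar big_geq// mulr_ge0 ?mulr_ge0 ?powR_ge0// sumr_ge0.
apply: (@le_trans _ _ (2 `^ q * (
   \sum_(1 <= k < L.+1) (if t k.-1 == t k then 0 else f (t k)) +
   \sum_(1 <= k < L.+1) (if t k.-1 == t k then 0 else f (t k.-1))))).
  rewrite -big_split/= mulr_sumr; apply: ler_sum => k _.
  have [->|_] := eqVneq; first by rewrite subrr normr0 powR0 ?gt_eqF// addr0 mulr0.
  by rewrite /f -(normrN (a (t k.-1))); apply: powRD_le; exact: ltW.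
rewrite [2 * _]mulrC -mulrA ler_wpM2l ?powR_ge0// mulr_natl mulr2n lerD//.
- by apply: le_trans (ndecr_sum_next L tm f0) _; exact: sum_ord_zero_tail.
- by apply: le_trans (ndecr_sum_prev L tm f0) _; exact: sum_ord_zero_tail.
Qed.

(** All entries are at most [s], so [|a|^q <= a^2 s^(q-2)]. *)
Lemma lq_l2 q (a : nat -> R) M (s : R) : 2 <= q -> 0 <= s ->
  \sum_(i < M) a i ^+ 2 <= s ^+ 2 -> \sum_(i < M) `|a i| `^ q <= s `^ q.
Proof.
move=> q2 s0 h.
have q20 : 0 <= q - 2 by rewrite subr_ge0.
have ai i : (i < M)%N -> `|a i| <= s.
  move=> iM; rewrite -(ler_pXn2r (n := 2))// ?nnegrE// (real_normK (num_real _)).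
  apply: le_trans h; rewrite (bigD1 (Ordinal iM))//= lerDl.
  by apply: sumr_ge0 => j _; exact: sqr_ge0.
have qE (x : R) : 0 <= x -> x `^ q = x ^+ 2 * x `^ (q - 2).
  move=> x0; have [->|xn0] := eqVneq x 0.
    by rewrite powR0 ?expr0n ?mul0r// gt_eqF// (lt_le_trans _ q2).
  by rewrite -(powR_mulrn 2 x0) -powRD ?xn0 ?implybT// addrC subrK.
rewrite qE//; apply: (@le_trans _ _ (\sum_(i < M) a i ^+ 2 * s `^ (q - 2))).
  apply: ler_sum => i _; rewrite qE// (real_normK (num_real _)).
  by rewrite ler_wpM2l ?sqr_ge0// ge0_ler_powR ?nnegrE// ai.
by rewrite -mulr_suml ler_wpM2r ?powR_ge0.
Qed.

Lemma lq_l1_sup q (a : nat -> R) M (s S : R) : 1 <= q -> 0 <= s ->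
  (forall i, (i < M)%N -> `|a i| <= s) -> \sum_(i < M) `|a i| <= S ->
  \sum_(i < M) `|a i| `^ q <= s `^ (q - 1) * S.
Proof.
move=> q1 s0 h hS.
have q10 : 0 <= q - 1 by rewrite subr_ge0.
apply: (@le_trans _ _ (\sum_(i < M) s `^ (q - 1) * `|a i|)).
  apply: ler_sum => i _; rewrite mulrC.
  rewrite [leLHS](_ : _ = `|a i| * `|a i| `^ (q - 1)).
    by rewrite ler_wpM2l// ge0_ler_powR ?nnegrE// h.
  have [->|xn0] := eqVneq (a i) 0.
    by rewrite normr0 powR0 ?mul0r// gt_eqF// (lt_le_trans ltr01).
  by rewrite -{2}(powRr1 (normr_ge0 (a i))) -powRD ?normr_eq0 ?xn0 ?implybT// addrC subrK.
by rewrite -mulr_sumr ler_wpM2l ?powR_ge0.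
Qed.

Section jumps.
Variables (a : nat -> R) (M : nat).
Hypothesis az : forall i, (M < i)%N -> a i = 0.

(* Greedy count from the coarse end [M] downwards: the value at the last
   recorded jump of size [lam], and the number of jumps so far. *)
Fixpoint jst lam l : R * nat :=
  if l is l'.+1 then
    let s := jst lam l' in
    if lam <= `|a (M - l') - s.1| then (a (M - l'), s.2.+1) else s
  else (0, 0%N).

(** The state after the indices from [M] down to [i] have been read. *)
Definition jat lam i := jst lam (M.+1 - i).
Definition njump lam := (jat lam 0).2.

(** Either the value at [i] has just been recorded or the test has failed. Above [M] the initial
    record 0 is exact, since [a] vanishes there. *)
Lemma jat_close lam i : 0 < lam -> `|a i - (jat lam i).1| < lam.
Proof.
move=> l0; have [iM|iM] := ltnP M i.
  have : (M.+1 - i = 0)%N by apply/eqP; rewrite subn_eq0.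
  by rewrite /jat => ->; rewrite /= az// subrr normr0.
rewrite /jat subSn//= subKn//.
by case: ifP => [_|/negbT]; rewrite /= ?subrr ?normr0// -ltNge.
Qed.

Lemma jst_mono lam l k : ((jst lam l).2 <= (jst lam (l + k)).2)%N.
Proof.
elim: k => [|k IH]; first by rewrite addn0.
by rewrite addnS/=; case: ifP => _ //=; rewrite (leq_trans IH).
Qed.

Lemma jst_const lam l k : (jst lam l).2 = (jst lam (l + k)).2 ->
  (jst lam l).1 = (jst lam (l + k)).1.
Proof.
elim: k => [|k IH]; first by rewrite addn0.
rewrite addnS/=; case: ifP => _ /=; last exact: IH.
by have := jst_mono lam l k => /[swap] ->; rewrite ltnn.
Qed.

(** If nothing were recorded between [j] and [i], both values would be within [lam] of the same
    record. *)
Lemma jat_jump lam i j : 0 < lam -> (i <= j)%N -> 2 * lam <= `|a j - a i| ->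
  ((jat lam j).2 < (jat lam i).2)%N.
Proof.
move=> l0 ij h.
have e : (M.+1 - i = (M.+1 - j) + ((M.+1 - i) - (M.+1 - j)))%N.
  by rewrite subnKC// leq_sub2l.
have := jst_mono lam (M.+1 - j) ((M.+1 - i) - (M.+1 - j)); rewrite -e.
rewrite -/(jat lam j) -/(jat lam i) leq_eqVlt => /predU1P[/eqP eq|//].
have := @jst_const lam (M.+1 - j) ((M.+1 - i) - (M.+1 - j)); rewrite -e => /(_ (eqP eq)).
rewrite -/(jat lam j) -/(jat lam i) => e1.
have := jat_close i l0; have := jat_close j l0; rewrite e1 => h1 h2.
exfalso; move: h; apply/negP; rewrite -ltNge.
rewrite (_ : a j - a i = (a j - (jat lam i).1) - (a i - (jat lam i).1)); last by ring.
by rewrite (le_lt_trans (ler_normB _ _))// mulr_natl mulr2n ltrD.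
Qed.

Lemma jat_anti lam i j : (i <= j)%N -> ((jat lam j).2 <= (jat lam i).2)%N.
Proof.
move=> ij; have := jst_mono lam (M.+1 - j) ((M.+1 - i) - (M.+1 - j)).
by rewrite subnKC// leq_sub2l.
Qed.

(** The counter decreases along [t] and drops by at least one at each jump of size [2 * lam]; the
    sum telescopes. *)
Lemma count_jumps lam t L : 0 < lam -> ndecr t ->
  (\sum_(1 <= k < L) (2 * lam <= `|a (t k) - a (t k.-1)|)%R <= njump lam)%N.
Proof.
move=> l0 tm; case: L => [|L]; first by rewrite big_geq.
suff : (\sum_(1 <= k < L.+1) (2 * lam <= `|a (t k) - a (t k.-1)|)%R + (jat lam (t L)).2 <=
   (jat lam (t 0%N)).2)%N.
  move=> /(leq_trans (leq_addr _ _))/leq_trans; apply; exact: jat_anti.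
elim: L => [|L IH]; first by rewrite big_geq.
rewrite big_nat_recr//= -addnA; apply: leq_trans IH; rewrite leq_add2l.
have tL : (t L <= t L.+1)%N by exact: tm.
case: (boolP (2 * lam <= _)) => [h|_]; last by rewrite add0n jat_anti.
by rewrite add1n; exact: jat_jump.
Qed.

Lemma njump0 lam i : 0 < lam -> njump lam = 0%N -> `|a i| < lam.
Proof.
move=> l0 h; have := jat_close i l0.
suff -> : (jat lam i).1 = 0 by rewrite subr0.
have [iM|iM] := leqP i M.+1; last by rewrite /jat (_ : M.+1 - i = 0)%N//; apply/eqP; rewrite subn_eq0 ltnW.
apply/esym; rewrite -[LHS]/((jst lam 0).1) /jat.
apply: (@jst_const lam 0 (M.+1 - i)); apply/eqP; rewrite eqn_leq jst_mono/=.
by rewrite add0n -[X in (_ <= X)%N]h; apply: jat_anti.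
Qed.

Local Open Scope ereal_scope.

(** With no jump recorded at height [lam], all values are below [lam] and all differences [d] below
    [2 * lam]. A nonzero [d] is charged to the least level [l] with [lam / 2^l <= d], where
    minimality gives [d <= 4 * (lam / 2^(l+1))]; the jumps of each level are then counted. *)
Lemma pvar_jumps q lam t L : (0 < q)%R -> (0 < lam)%R -> ndecr t -> njump lam = 0%N ->
  (pvar q a t L)%:E <=
  \sum_(l <oo) ((4 * (lam / 2 ^+ l.+1)) `^ q * (njump (lam / 2 ^+ l.+1))%:R)%R%:E.
Proof.
move=> q0 l0 tm h0.
have lp l : (0 < lam / 2 ^+ l.+1)%R by rewrite divr_gt0// exprn_gt0.
have term (d : R) : (0 <= d)%R -> (d < 2 * lam)%R ->
  (d `^ q)%:E <= \sum_(l <oo)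
     ((4 * (lam / 2 ^+ l.+1)) `^ q * (2 * (lam / 2 ^+ l.+1) <= d)%R%:R)%R%:E.
  move=> d0 dl; have t0 l : (0 <= l)%N -> true -> 0 <= ((4 * (lam / 2 ^+ l.+1)) `^ q *
      (2 * (lam / 2 ^+ l.+1) <= d)%R%:R)%R%:E.
    by move=> _ _; rewrite lee_fin mulr_ge0 ?powR_ge0.
  have [->|dn0] := eqVneq d 0%R.
    rewrite powR0 ?gt_eqF//; apply: nneseries_ge0 => l _ _.
    by rewrite lee_fin mulr_ge0 ?powR_ge0.
  have dp : (0 < d)%R by rewrite lt_neqAle eq_sym dn0.
  have ex : exists l, (2 * (lam / 2 ^+ l.+1) <= d)%R.
    have [k hk] : exists k : nat, (lam / d < k%:R)%R.
      by exists (Num.truncn (lam / d)).+1; exact: truncnS_gt.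
    exists k; rewrite (_ : (2 * (lam / 2 ^+ k.+1) = lam / 2 ^+ k)%R); last first.
      by rewrite exprS invfM; field.
    rewrite ler_pdivrMr ?exprn_gt0// -ler_pdivrMl// mulrC. apply: le_trans (ltW hk) _.
    by rewrite -natrX ler_nat ltnW// ltn_expl.
  case: (ex_minnP ex) => l hl lmin.
  apply: le_trans (nneseries_lim_ge l.+1 _); last first.
    by move=> k _; rewrite lee_fin mulr_ge0 ?powR_ge0.
  rewrite big_nat_recr//= hl mulr1.
  apply: (@le_trans _ _ ((4 * (lam / 2 ^+ l.+1)) `^ q)%:E); last first.
    by rewrite leeDr//; apply: sume_ge0 => k _; rewrite lee_fin mulr_ge0 ?powR_ge0.
  rewrite lee_fin; apply: ge0_ler_powR; rewrite ?nnegrE ?(ltW q0)//.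
    by have := lp l; lra.
  case: l lmin {hl} => [|l] lmin.
    by apply: le_trans (ltW dl) _; rewrite expr1; lra.
  have := contraNN (lmin l); rewrite ltnn => /(_ isT); rewrite -ltNge => /ltW/le_trans; apply.
  rewrite [X in (_ <= 4 * (_ / X))%R]exprS invfM; have := lp l; nra.
rewrite /pvar -sumEFin.
apply: (@le_trans _ _ (\sum_(1 <= k < L) \sum_(l <oo)
   ((4 * (lam / 2 ^+ l.+1)) `^ q * (2 * (lam / 2 ^+ l.+1) <= `|a (t k) - a (t k.-1)|)%R%:R)%R%:E)).
  apply: lee_sum => k _; apply: term => //.
  rewrite (le_lt_trans (ler_normB _ _))// mulr_natl mulr2n ltrD//; exact: njump0.
rewrite -nneseries_sum; last by move=> k l _; rewrite lee_fin mulr_ge0 ?powR_ge0.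
apply: lee_nneseries => l _.
  by move=> _; apply: sume_ge0 => k _; rewrite lee_fin mulr_ge0 ?powR_ge0.
rewrite sumEFin lee_fin -mulr_sumr ler_wpM2l ?powR_ge0//.
rewrite -natr_sum ler_nat; exact: count_jumps.
Qed.

End jumps.
End variation.

(** * Bounds on outer measures *)

Section outer_measure_bounds.
Context d (T : measurableType d) {R : realType}.
Variable m : {measure set T -> \bar R}.
Local Open Scope ereal_scope.

(* A bound on the outer measure: level sets of variations are suprema over
   sequences of indices, and need not be shown measurable until the end. *)
Definition omeas (S : set T) (c : \bar R) :=
  exists A, [/\ measurable A, S `<=` A & m A <= c].

Lemma omeas_sub (S S' : set T) c : S `<=` S' -> omeas S' c -> omeas S c.
Proof. by move=> SS' [A [mA SA Ac]]; exists A; split => //; apply: subset_trans SA. Qed.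

Lemma omeas_le (S : set T) c c' : c <= c' -> omeas S c -> omeas S c'.
Proof. by move=> cc' [A [mA SA Ac]]; exists A; split => //; apply: le_trans cc'. Qed.

Lemma omeasU (S S' : set T) c c' : omeas S c -> omeas S' c' -> omeas (S `|` S') (c + c').
Proof.
move=> [A [mA SA Ac]] [B [mB SB Bc]]; exists (A `|` B); split.
- exact: measurableU.
- exact: setUSS.
- by rewrite (le_trans (measureU2 _ mA mB))// leeD.
Qed.

Lemma omeas_measurable (S : set T) c : measurable S -> omeas S c -> m S <= c.
Proof. by move=> mS [A [mA SA]]; apply: le_trans; rewrite le_measure ?inE. Qed.

Lemma emarkov (G : T -> \bar R) (a : R) : (0 < a)%R ->
  measurable_fun setT G -> (forall x, 0 <= G x) ->
  omeas [set x | a%:E <= G x] ((a^-1)%:E * \int[m]_x G x).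
Proof.
move=> a0 mG G0.
have mA : measurable [set x | a%:E <= G x].
  by rewrite -(setTI [set _ | _]); exact: emeasurable_fun_c_infty.
exists [set x | a%:E <= G x]; split => //.
rewrite -(@lee_pmul2l _ a%:E)// muleA -EFinM mulfV ?gt_eqF// mul1e.
rewrite -(setIT [set x | _]) -integral_indic// -ge0_integralZl//; last 2 first.
- by apply/measurable_EFinP; exact: measurable_indic.
- by rewrite lee_fin ltW.
apply: ge0_le_integral => //.
- by move=> x _; rewrite mule_ge0// lee_fin ltW.
- by apply: emeasurable_funM => //; apply/measurable_EFinP; exact: measurable_indic.
move=> x _; rewrite indicE.
by have [/set_mem /= h|_] := boolP (x \in _); rewrite ?mule1 ?mule0.
Qed.

End outer_measure_bounds.

Section nl2_orthogonal.
Context d (T : measurableType d) {R : realType}.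
Variable m : {measure set T -> \bar R}.
Implicit Types f g : T -> R.

Lemma nl2_orth f g : measurable_fun setT f -> measurable_fun setT g ->
  (nl2 m f < +oo)%E -> (nl2 m g < +oo)%E -> \int[m]_x (f x * g x) = 0 ->
  nl2 m (fun x => f x + g x) = (nl2 m f + nl2 m g)%E.
Proof.
move=> mf mg fo go fg0.
have i1 : intg m (fun x => f x ^+ 2) by apply: (intgM mf mf).
have i2 : intg m (fun x => g x ^+ 2) by apply: (intgM mg mg).
have i3 := intgM mf mg fo go.
have i4 : intg m (fun x => f x ^+ 2 + g x ^+ 2) by exact: intgD.
have i5 : intg m (fun x => 2 * (f x * g x)) by exact: intgZ.
have -> : nl2 m (fun x => f x + g x) =
    (\int[m]_x ((f x ^+ 2 + g x ^+ 2) + 2 * (f x * g x))%:E)%E.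
  by apply: eq_integral => x _; congr EFin; ring.
have i6 := intgD i4 i5.
rewrite -(EFin_Rintegral i6) RintegralD// RintegralD// RintegralZl// fg0 mulr0 addr0.
by rewrite EFinD (EFin_Rintegral i1) (EFin_Rintegral i2).
Qed.

Lemma nl2N f : nl2 m (fun x => - f x) = nl2 m f.
Proof. by apply: eq_integral => x _; rewrite sqrrN. Qed.

Lemma nl2B_fin f g : measurable_fun setT f -> measurable_fun setT g ->
  (nl2 m f < +oo)%E -> (nl2 m g < +oo)%E -> (nl2 m (fun x => (f x - g x)%R) < +oo)%E.
Proof.
move=> mf mg fo go; apply: (@le_lt_trans _ _ (2%:E * (nl2 m f + nl2 m g))%E).
  by rewrite -(nl2N g); apply: nl2D => //; meas.
by rewrite lte_mul_pinfty// ?lee_fin//; exact: lte_add_pinfty.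
Qed.

(** A potential argument for a martingale [c], last record [p] and count [k]. When [c] moves on,
    both the potential and the energy [nl2 (c l)] grow by the squared norm of the increment;
    recording a jump exchanges a squared distance of at least [b] for one unit of the count. *)
Lemma energy_induction (c p k : nat -> T -> R) (b : R) N :
  (forall l, measurable_fun setT (c l)) -> (forall l, measurable_fun setT (p l)) ->
  (forall l, measurable_fun setT (k l)) -> (forall l x, 0 <= k l x) ->
  0 <= b -> (forall x, k 0%N x = 0) -> (forall x, p 0%N x = 0) -> (forall x, c 0%N x = 0) ->
  (forall l x, (l < N)%N -> b * k l.+1 x + (c l.+1 x - p l.+1 x) ^+ 2 <=
    b * k l x + (c l.+1 x - p l x) ^+ 2) ->
  (forall l, (l < N)%N -> nl2 m (fun x => c l.+1 x - p l x) =
    (nl2 m (fun x => (c l.+1 x - c l x)%R) + nl2 m (fun x => (c l x - p l x)%R))%E) ->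
  (forall l, (l < N)%N -> nl2 m (c l.+1) =
    (nl2 m (fun x => (c l.+1 x - c l x)%R) + nl2 m (c l))%E) ->
  (\int[m]_x (b * k N x + (c N x - p N x) ^+ 2)%:E <= nl2 m (c N))%E.
Proof.
move=> mc mp mk k0 b0 k00 p00 c00 step s1 s2.
suff : forall l, (l <= N)%N ->
    (\int[m]_x (b * k l x + (c l x - p l x) ^+ 2)%:E <= nl2 m (c l))%E by apply.
elim=> [_|l IH lN].
  rewrite [X in (X <= _)%E](_ : _ = 0%E); first exact: nl2_ge0.
  rewrite -[RHS](integral0 m setT); apply: eq_integral => x _.
  by rewrite k00 p00 c00 mulr0 subr0 expr0n/= addr0.
have h1 := mc l.+1; have h2 := mc l; have h3 := mp l; have h4 := mp l.+1.
have h5 := mk l; have h6 := mk l.+1.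
have bk i x : 0 <= b * k i x by exact: mulr_ge0.
have D (f : T -> R) : measurable_fun setT f ->
   (\int[m]_x (b * k l x + f x ^+ 2)%:E = \int[m]_x (b * k l x)%:E + nl2 m f)%E.
  by move=> mf; apply: ge0_nlD => //; [meas|meas|move=> x; exact: sqr_ge0].
apply: (@le_trans _ _ (\int[m]_x (b * k l x + (c l.+1 x - p l x) ^+ 2)%:E)%E).
  apply: le_nl; [by meas|by meas|move=> x].
  by rewrite addr_ge0 ?sqr_ge0//=; exact: step.
have {}IH := IH (ltnW lN).
rewrite D in IH; last by meas.
rewrite D; last by meas.
by rewrite s1// s2// addeCA leeD2l.
Qed.

End nl2_orthogonal.

(** * Jumps of dyadic averages *)

Section martingale.
Context {R : realType} {n : nat}.
Local Notation mu := (@lebesgue_rV R n).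
Local Notation rV := 'rV[R]_n.
Implicit Types (f g h : rV -> R) (x y : rV).
Variable r : R.
Hypothesis r0 : 0 < r.
Variable u : rV -> R.
Hypothesis m_u : measurable_fun setT u.
Hypothesis uoo : (nl2 mu u < +oo)%E.

Let rk k : 0 < r * 2 ^+ k.
Proof. by rewrite mulr_gt0// exprn_gt0. Qed.

Definition Ek k := E (r * 2 ^+ k) u.

Lemma nl2_Ek k : (nl2 mu (Ek k) < +oo)%E.
Proof. by apply: le_lt_trans uoo; apply: nl2_E. Qed.

Lemma meas_Ek k : measurable_fun setT (Ek k).
Proof. exact: meas_E. Qed.

(** Against a function constant on the coarser cells, both averages integrate to the same value as
    [u]. *)
Lemma E_orth j k h : (j <= k)%N -> cellconst (r * 2 ^+ k) h ->
  (nl2 mu h < +oo)%E -> \int[mu]_x ((Ek j x - Ek k x) * h x) = 0.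
Proof.
move=> jk hc ho.
have mh := meas_cellconst (rk k) hc.
have hj := cellconst_scale r0 jk hc.
have uh := intg_nl1 (intgM m_u mh uoo ho).
under eq_Rintegral do rewrite mulrBl.
rewrite RintegralB//.
- rewrite (E_adj (rk j) m_u (locint2 (rk j) m_u uoo) hj uh).
  by rewrite (E_adj (rk k) m_u (locint2 (rk k) m_u uoo) hc uh) subrr.
- by apply: intgM; [exact: meas_Ek|by []|exact: nl2_Ek|by []].
- by apply: intgM; [exact: meas_Ek|by []|exact: nl2_Ek|by []].
Qed.

Variable M : nat.

(** The averages, cut to 0 beyond the scale [M] so that the count of jumps has a starting value. *)
Definition Atr i x : R := if (i <= M)%N then Ek i x else 0.

Lemma Atr0 x i : (M < i)%N -> Atr i x = 0.
Proof. by rewrite /Atr ltnNge => /negbTE ->. Qed.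

Variable lam : R.
Hypothesis lam0 : 0 < lam.

Let st l x := jst (Atr ^~ x) M lam l.

(** The state has only looked at averages on cells of at least this size, so the last record is
    orthogonal to the next, finer martingale difference. *)
Lemma st_cellconst l : cellconst (r * 2 ^+ (M.+1 - l)) (st l).
Proof.
elim: l => [|l IH]; first by move=> x y _; reflexivity.
have IH' : cellconst (r * 2 ^+ (M.+1 - l.+1)) (st l).
  by apply: (cellconst_scale r0 _ IH); exact: leq_sub2l.
rewrite subSS in IH' *.
move=> x y xy.
have e1 : Atr (M - l) x = Atr (M - l) y.
  by rewrite /Atr; case: ifP => // _; exact: E_cellconst.
have e2 : st l x = st l y by exact: IH'.
have step z : st l.+1 z = if lam <= `|Atr (M - l) z - (st l z).1|
   then (Atr (M - l) z, (st l z).2.+1) else st l z by reflexivity.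
by rewrite !step e1 e2.
Qed.

Let pt l x := (st l x).1.
Let ct l x : R := (st l x).2%:R.
Let c l x := Atr (M.+1 - l) x.

Let rM l : 0 < r * 2 ^+ (M.+1 - l). Proof. exact: rk. Qed.

Let pt_cc l : cellconst (r * 2 ^+ (M.+1 - l)) (pt l).
Proof. by move=> x y xy; rewrite /pt (st_cellconst xy). Qed.

Let m_pt l : measurable_fun setT (pt l).
Proof. exact: (meas_cellconst (rM l) (@pt_cc l)). Qed.

Let m_ct l : measurable_fun setT (ct l).
Proof. by apply: (meas_cellconst (rM l)) => x y xy; rewrite /ct (st_cellconst xy). Qed.

Let c_cc l : cellconst (r * 2 ^+ (M.+1 - l)) (c l).
Proof. by move=> x y xy; rewrite /c /Atr; case: ifP => // _; exact: E_cellconst. Qed.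

Let m_c l : measurable_fun setT (c l).
Proof. exact: (meas_cellconst (rM l) (@c_cc l)). Qed.

Let c_oo l : (nl2 mu (c l) < +oo)%E.
Proof.
have [h|h] := leqP (M.+1 - l) M.
  rewrite (_ : c l = Ek (M.+1 - l)); first exact: nl2_Ek.
  by apply/funext => x; rewrite /c /Atr h.
rewrite (_ : c l = fun=> 0); last by apply/funext => x; rewrite /c Atr0.
by rewrite /nl2; under eq_integral do rewrite expr0n/=; rewrite integral0 ltry.
Qed.

Let pt_oo l : (nl2 mu (pt l) < +oo)%E.
Proof.
elim: l => [|l IH].
  by rewrite /nl2 /pt/=; under eq_integral do rewrite expr0n/=; rewrite integral0 ltry.
apply: (@le_lt_trans _ _ (nl2 mu (c l.+1) + nl2 mu (pt l))%E); last first.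
  by apply: lte_add_pinfty => //; exact: c_oo.
rewrite /nl2 -ge0_nlD; [|by have := m_c l.+1 => h; meas|by have := m_pt l => h; meas|
  by move=> x; exact: sqr_ge0|by move=> x; exact: sqr_ge0].
have h1 := m_c l.+1; have h2 := m_pt l; have h3 := m_pt l.+1.
apply: le_nl; [by meas|by meas|move=> x].
rewrite sqr_ge0/= /pt /st/= -/(st l x); case: ifP => _ /=.
  by rewrite /c subSS lerDl sqr_ge0.
by rewrite lerDr sqr_ge0.
Qed.

Let orth l h : cellconst (r * 2 ^+ (M.+1 - l)) h -> (nl2 mu h < +oo)%E -> (l <= M)%N ->
  (l != 0%N) ->
  \int[mu]_x ((c l.+1 x - c l x) * h x) = 0.
Proof.
move=> hc ho lM l1.
have := @E_orth (M.+1 - l.+1) (M.+1 - l) h; rewrite leq_sub2l// => /(_ isT hc ho) <-.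
apply: eq_Rintegral => x _; rewrite /c /Atr subSS leq_subr.
by case: l l1 {hc} lM => // l _ lM; rewrite subSS leq_subr.
Qed.

Let l0c x : c 0%N x = 0.
Proof. by rewrite /c Atr0. Qed.

Let nl2_split l h : (l <= M)%N -> cellconst (r * 2 ^+ (M.+1 - l)) h -> (nl2 mu h < +oo)%E ->
  (l = 0%N -> forall x, h x = 0) ->
  nl2 mu (fun x => (c l.+1 x - c l x) + h x)%R =
  (nl2 mu (fun x => c l.+1 x - c l x)%R + nl2 mu h)%E.
Proof.
move=> lM hc ho h0; have mh := meas_cellconst (rM l) hc.
have h1 := m_c l.+1; have h2 := m_c l.
have o1 := c_oo l.+1; have o2 := c_oo l.
apply: nl2_orth; [by meas|exact: mh|exact: nl2B_fin|exact: ho|].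
(* At [l = 0] the previous value is the artificial 0 and not an average, so orthogonality fails in
   general; it holds here because [h] is then zero. *)
case: (eqVneq l 0%N) => [l0|l0]; last exact: orth.
under eq_Rintegral do rewrite (h0 l0) mulr0.
by rewrite Rintegral_cst// mul0r.
Qed.

Lemma jump_energy :
  (\int[mu]_x (lam ^+ 2 * ct M.+1 x + (c M.+1 x - pt M.+1 x) ^+ 2)%:E <= nl2 mu (c M.+1))%E.
Proof.
have ct0 l x : 0 <= ct l x by exact: ler0n.
have ctE l z : st l.+1 z = if lam <= `|c l.+1 z - pt l z|
   then (c l.+1 z, (st l z).2.+1) else st l z.
  by rewrite /c subSS; reflexivity.
have stepE l x : lam ^+ 2 * ct l.+1 x + (c l.+1 x - pt l.+1 x) ^+ 2 <=
    lam ^+ 2 * ct l x + (c l.+1 x - pt l x) ^+ 2.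
  rewrite /ct {1}/pt ctE; case: ifP => h /=; last exact: lexx.
  rewrite subrr expr0n/= addr0 -natr1 mulrDr mulr1 lerD2l.
  by rewrite -[leRHS](real_normK (num_real _)) ler_pXn2r ?nnegrE// ltW.
apply: energy_induction => //; first exact: sqr_ge0.
- move=> l lM.
  have h1 := m_c l; have h2 := m_pt l; have o1 := c_oo l; have o2 := pt_oo l.
  have cc : cellconst (r * 2 ^+ (M.+1 - l)) (fun x => c l x - pt l x).
    by move=> x y xy; rewrite (c_cc xy) (pt_cc xy).
  have z : l = 0%N -> forall x, c l x - pt l x = 0.
    by move=> -> x; rewrite l0c sub0r; exact: oppr0.
  rewrite -(nl2_split lM cc (nl2B_fin h1 h2 o1 o2) z).
  by apply: eq_integral => x _; rewrite addrA subrK.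
- move=> l lM; have z : l = 0%N -> forall x, c l x = 0 by move=> -> x; exact: l0c.
  rewrite -(nl2_split lM (@c_cc l) (c_oo l) z).
  by apply: eq_integral => x _; rewrite subrK.
Qed.

Lemma meas_njump : measurable_fun setT (fun x => (njump (Atr ^~ x) M lam)%:R : R).
Proof. by have := m_ct M.+1; rewrite /ct /st /njump /jat subn0. Qed.

(** The energy inequality without its final distance term: jumps of size [lam] are integrable with
    the constant of Chebyshev's inequality. *)
Lemma njump_energy :
  ((lam ^+ 2)%:E * \int[mu]_x ((njump (Atr ^~ x) M lam)%:R)%:E <= nl2 mu u)%E.
Proof.
have h1 := m_c M.+1; have h3 := m_pt M.+1.
have h5 := m_ct M.+1.
rewrite -ge0_nlZ ?sqr_ge0//.
apply: (@le_trans _ _ (nl2 mu (c M.+1))); last first.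
  by rewrite /c subnn /Atr leq0n; apply: nl2_E.
apply: le_trans jump_energy.
apply: le_nl; [|by meas|].
  by have := meas_njump => h; meas.
move=> x; rewrite mulr_ge0 ?sqr_ge0//=.
by rewrite /ct /st /njump /jat subn0 lerDl sqr_ge0.
Qed.

End martingale.

(** * Averages against a bump *)

Section series_bounds.
Context {R : realType}.
Local Open Scope ereal_scope.

Lemma nneseries_le_bound (f : nat -> \bar R) (B : \bar R) :
  (forall i, 0 <= f i) -> (forall N, \sum_(i < N) f i <= B) ->
  \sum_(i <oo) f i <= B.
Proof.
move=> f0 h; apply: lime_le; first by apply: is_cvg_nneseries => i _ _; exact: f0.
by apply: nearW => N; rewrite big_mkord; exact: h.
Qed.

Lemma geo_sum_le (rho : R) N : (0 <= rho)%R -> (rho < 1)%R ->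
  (\sum_(i < N) rho ^+ i <= (1 - rho)^-1)%R.
Proof.
move=> r0 r1; have d0 : (0 < 1 - rho)%R by rewrite subr_gt0.
rewrite -(ler_pM2l d0) mulfV ?gt_eqF//.
rewrite -opprB mulNr -subrX1 opprB lerBlDr lerDl.
by rewrite exprn_ge0.
Qed.

End series_bounds.

Section martingale_variation.
Context {R : realType} {n : nat}.
Local Notation mu := (@lebesgue_rV R n).
Local Notation rV := 'rV[R]_n.

(** The level set [{variation > al}], expressed through finite sums of [q]-th powers. *)
Definition Vset q (F : nat -> rV -> R) al : set rV :=
  [set x | exists t L, ndecr t /\ al `^ q < pvar q (F ^~ x) t L].

(** The set with a jump of size [al] has measure at most [al^-2 |u|_2^2]. Off it, the layered sum of
    [pvar_jumps] is integrated with [njump_energy]: level [l] costs a multiple of [rho^(l+1)] with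
    [rho = 2^(2-q)], which is below one because [q > 2], and Markov's inequality is applied at
    height [al^q]. *)
Lemma mart_weak (q : R) : 2 < q -> exists2 C : R, 0 <= C &
  forall (r : R) (u : rV -> R) M al, 0 < r -> measurable_fun setT u ->
    (nl2 mu u < +oo)%E -> 0 < al ->
    omeas mu (Vset q (Atr r u M) al) ((C / al ^+ 2)%:E * nl2 mu u).
Proof.
move=> q2; pose rho : R := 2^-1 `^ (q - 2).
have q0 : 0 < q by rewrite (lt_trans _ q2).
have rho0 : 0 <= rho by exact: powR_ge0.
have rho1 : rho < 1.
  have : 2^-1 `^ (q - 2) < 1 `^ (q - 2).
    by apply: gt0_ltr_powR; rewrite ?subr_gt0 ?nnegrE// invf_lt1// ltr1n.
  by rewrite powR1.
exists (1 + 4 `^ q * (1 - rho)^-1).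
  by rewrite addr_ge0// mulr_ge0 ?powR_ge0// invr_ge0 subr_ge0 ltW.
move=> r u M al r0 m_u uoo al0.
have lp l : 0 < al / 2 ^+ l.+1 by rewrite divr_gt0// exprn_gt0.
pose N lam x : R := (njump (Atr r u M ^~ x) M lam)%:R.
have mN lam : measurable_fun setT (N lam) by exact: meas_njump.
have eN lam : 0 < lam -> (\int[mu]_x (N lam x)%:E <= (lam ^- 2)%:E * nl2 mu u)%E.
  move=> l0; have l2 : 0 < lam ^+ 2 by rewrite exprn_gt0.
  rewrite -(@lee_pmul2l _ (lam ^+ 2)%:E)// muleA -EFinM mulfV ?gt_eqF// mul1e.
  exact: (@njump_energy _ _ r r0 u m_u uoo M lam l0).
pose g l x := (4 * (al / 2 ^+ l.+1)) `^ q * N (al / 2 ^+ l.+1) x.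
have g0 l x : 0 <= g l x by rewrite mulr_ge0 ?powR_ge0 ?ler0n.
have mg l : measurable_fun setT (fun x => (g l x)%:E).
  by apply/measurable_EFinP; have := mN (al / 2 ^+ l.+1) => h; rewrite /g; meas.
pose G x := (\sum_(l <oo) (g l x)%:E)%E.
have mG : measurable_fun setT G.
  by apply: ge0_emeasurable_sum => // l x _ _; rewrite lee_fin.
have G0 x : (0 <= G x)%E by apply: nneseries_ge0 => l _ _; rewrite lee_fin.
have aq0 : 0 < al `^ q by exact: powR_gt0.
have h1 := @emarkov _ _ _ mu (fun x => (N al x)%:E) 1 ltr01.
have {}h1 := h1 (proj2 (@measurable_EFinP _ _ _ _ (N al)) (mN al)).
have {}h1 : omeas mu [set x | (1%:E <= (N al x)%:E)%E] ((al ^- 2)%:E * nl2 mu u).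
  apply: omeas_le (h1 _) => [|x]; last by rewrite lee_fin ler0n.
  by rewrite invr1 mul1e; exact: eN.
have h2 := emarkov mu aq0 mG G0.
have iG : (\int[mu]_x G x <= (4 `^ q * al `^ q * al ^- 2 * (1 - rho)^-1)%:E * nl2 mu u)%E.
  rewrite integral_nneseries//; last by move=> l x _; rewrite lee_fin.
  have cE l : (4 * (al / 2 ^+ l.+1)) `^ q * (al / 2 ^+ l.+1) ^- 2 =
      4 `^ q * al `^ q * al ^- 2 * rho ^+ l.+1.
    rewrite powRM// ?(ltW (lp l))// -!mulrA; congr (_ * _).
    have e (x : R) : 0 < x -> x `^ q * x ^- 2 = x `^ (q - 2).
      by move=> x0; rewrite powRB ?(gt_eqF x0) ?implybT// powR_mulrn// ltW.
    rewrite e// mulrA e// powRM ?invr_ge0 ?exprn_ge0// ?(ltW al0)//; congr (_ * _).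
    have -> : 2 ^- l.+1 = 2^-1 `^ (l.+1)%:R :> R by rewrite powR_mulrn// exprVn.
    have -> : rho ^+ l.+1 = rho `^ (l.+1)%:R by rewrite powR_mulrn.
    by rewrite /rho -!powRrM mulrC.
  apply: (@le_trans _ _ (\sum_(l <oo) ((4 `^ q * al `^ q * al ^- 2 * rho ^+ l.+1)%:E * nl2 mu u))%E).
    apply: lee_nneseries => l _; first by move=> _; apply: integral_ge0 => x _; rewrite lee_fin.
    rewrite /g ge0_nlZ ?powR_ge0//.
    rewrite -cE EFinM -muleA lee_wpmul2l ?lee_fin ?powR_ge0//; exact: eN.
  have c0 : 0 <= 4 `^ q * al `^ q * al ^- 2.
    by rewrite !mulr_ge0 ?powR_ge0// invr_ge0 exprn_ge0// ltW.
  apply: nneseries_le_bound => [l|K].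
    by rewrite mule_ge0 ?nl2_ge0// lee_fin mulr_ge0// exprn_ge0.
  rewrite -ge0_sume_distrl; last by move=> l _; rewrite lee_fin mulr_ge0// exprn_ge0.
  rewrite lee_wpmul2r ?nl2_ge0// sumEFin lee_fin -mulr_sumr ler_wpM2l//.
  apply: le_trans (geo_sum_le K.+1 rho0 rho1).
  by rewrite big_ord_recl/= lerDr.
have {}h2 : omeas mu [set x | ((al `^ q)%:E <= G x)%E]
    ((4 `^ q * (1 - rho)^-1 / al ^+ 2)%:E * nl2 mu u).
  apply: omeas_le h2; apply: le_trans (lee_wpmul2l _ iG) _.
    by rewrite lee_fin invr_ge0 ltW.
  rewrite muleA -EFinM le_eqVlt; apply/orP; left; apply/eqP; congr (_%:E * _)%E.
  by field; rewrite (gt_eqF aq0) (gt_eqF al0) subr_eq0 eq_sym lt_eqF.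
have := omeasU h1 h2; rewrite -ge0_muleDl; last 2 first.
- by rewrite lee_fin invr_ge0 sqr_ge0.
- by rewrite lee_fin !mulr_ge0 ?powR_ge0 ?invr_ge0 ?sqr_ge0// subr_ge0 ltW.
rewrite -EFinD (_ : al ^- 2 + _ = (1 + 4 `^ q * (1 - rho)^-1) / al ^+ 2); last by rewrite mulrDl mul1r.
apply: omeas_sub => x [t [L [tm hx]]] /=.
have [N0|N1] := posnP (njump (Atr r u M ^~ x) M al); last first.
  by left; rewrite /= /N lee_fin ler1n.
right => /=; rewrite (le_trans _ (pvar_jumps (@Atr0 _ _ r u M x) L q0 al0 tm N0))//.
by rewrite lee_fin ltW.
Qed.

End martingale_variation.

Section dilation.
Context {R : realType} {n : nat}.
Local Notation mu := (@lebesgue_rV R n).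
Local Notation rV := 'rV[R]_n.
Implicit Types (x y z : rV).

(** The norm suited to bounds obtained from partial derivatives, one coordinate at a time. *)
Definition l1 x : R := \sum_i `|x ord0 i|.

Lemma l1_ge0 x : 0 <= l1 x.
Proof. exact: sumr_ge0. Qed.

Lemma l1Z (a : R) x : l1 (a *: x) = `|a| * l1 x.
Proof. by rewrite /l1 mulr_sumr; apply: eq_bigr => i _; rewrite mxE normrM. Qed.

Lemma l1N x : l1 (- x) = l1 x.
Proof. by apply: eq_bigr => i _; rewrite mxE normrN. Qed.

Lemma l1_le (a : R) x : (forall i, `|x ord0 i| <= a) -> l1 x <= n%:R * a.
Proof.
move=> h; apply: le_trans (ler_sum _ (fun i _ => h i)) _.
by rewrite sumr_const card_ord mulr_natl.
Qed.

(* The second differences make the cancellation of the kernel gain a factor two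
   per scale. *)
Record bump (phi : rV -> R) (Lam : R) : Prop := {
  bump_meas : measurable_fun setT phi;
  bump_ge0 : forall x, 0 <= phi x;
  bump_le : forall x, phi x <= Lam;
  bump_supp : forall x, phi x != 0 -> enorm x <= 4^-1;
  bump_int : (\int[mu]_x (phi x)%:E = 1)%E;
  bump_lip : forall x y, `|phi x - phi y| <= Lam * l1 (x - y);
  bump_lip2 : forall x y z,
    `|phi x - phi (x + y) - (phi (x - z) - phi (x + y - z))| <= Lam * (l1 y * l1 z) }.

Lemma coord_le_enorm x i : `|x ord0 i| <= enorm x.
Proof.
rewrite -sqrtr_sqr ler_wsqrtr// (bigD1 i)//= lerDl.
by apply: sumr_ge0 => j _; exact: sqr_ge0.
Qed.

Lemma enormZ (a : R) x : enorm (a *: x) = `|a| * enorm x.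
Proof.
rewrite /enorm -sqrtr_sqr -sqrtrM ?sqr_ge0//; congr Num.sqrt.
by rewrite mulr_sumr; apply: eq_bigr => i _; rewrite mxE exprMn.
Qed.

Variables (phi : rV -> R) (Lam : R).
Hypothesis bphi : bump phi Lam.

Lemma bump_Lam : 0 <= Lam.
Proof. exact: le_trans (bump_ge0 bphi 0) (bump_le bphi 0). Qed.

Definition dil s x : R := s ^- n * phi (s^-1 *: x).

Variable s : R.
Hypothesis s0 : 0 < s.

Let sn0 : 0 <= s ^- n.
Proof. by rewrite invr_ge0 exprn_ge0// ltW. Qed.

Let m_phi_dil : measurable_fun setT (fun x => phi (s^-1 *: x)).
Proof.
apply: (measurableT_comp (bump_meas bphi)).
have := @measurable_rV_affine R n _ rV s^-1 0 id (@measurable_id _ _ setT).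
by under eq_fun do rewrite addr0.
Qed.

Lemma meas_dil : measurable_fun setT (dil s).
Proof. by apply: measurable_funM. Qed.

Lemma dil_ge0 x : 0 <= dil s x.
Proof. by rewrite mulr_ge0// (bump_ge0 bphi). Qed.

Lemma dil_le x : dil s x <= Lam * s ^- n.
Proof. by rewrite /dil mulrC ler_wpM2r// (bump_le bphi). Qed.

Lemma int_dil : (\int[mu]_x (dil s x)%:E = 1)%E.
Proof.
rewrite /dil ge0_nlZ//; last by move=> x; exact: (bump_ge0 bphi).
have si : 0 < s^-1 by rewrite invr_gt0.
have := @ge0_integral_affine R n s^-1 0 (fun x => (phi x)%:E) si.
move=> /(_ (proj2 (@measurable_EFinP _ _ _ _ _) (bump_meas bphi))) h.
have -> : (\int[mu]_x (phi (s^-1 *: x))%:E = \int[mu]_x (phi (s^-1 *: x + 0))%:E)%E.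
  by apply: eq_integral => x _; rewrite addr0.
rewrite h; last by move=> x; rewrite lee_fin (bump_ge0 bphi).
by rewrite (bump_int bphi) mule1 -EFinM exprVn invrK mulVf// expf_neq0// gt_eqF.
Qed.

Lemma nl1_dil : nl1 mu (dil s) = 1%E.
Proof. by rewrite -int_dil; apply: eq_integral => x _; rewrite ger0_norm// dil_ge0. Qed.

Lemma intg_dil : intg mu (dil s).
Proof. by apply: intgP; [exact: meas_dil|rewrite nl1_dil ltry]. Qed.

Lemma dil_supp x : dil s x != 0 -> enorm x <= s / 4.
Proof.
rewrite mulf_eq0 negb_or => /andP[_ /(bump_supp bphi)].
by rewrite enormZ ger0_norm ?invr_ge0 ?(ltW s0)// ler_pdivrMl.
Qed.

Lemma dil_supp_coord x i : dil s x != 0 -> `|x ord0 i| <= s / 4.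
Proof. by move=> /dil_supp; apply: le_trans; exact: coord_le_enorm. Qed.

Lemma dil_lip x y : `|dil s x - dil s y| <= Lam * s ^- n.+1 * l1 (x - y).
Proof.
rewrite -mulrBr normrM (ger0_norm sn0).
apply: le_trans (ler_wpM2l sn0 (bump_lip bphi _ _)) _.
rewrite -scalerBr l1Z ger0_norm ?invr_ge0 ?(ltW s0)// exprSr invfM le_eqVlt.
by apply/orP; left; apply/eqP; ring.
Qed.

Lemma dil_lip2 x y z :
  `|dil s x - dil s (x + y) - (dil s (x - z) - dil s (x + y - z))| <=
  Lam * s ^- n.+2 * (l1 y * l1 z).
Proof.
rewrite -!mulrBr normrM (ger0_norm sn0) !scalerDr !scalerN.
apply: le_trans (ler_wpM2l sn0 (bump_lip2 bphi _ _ _)) _.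
rewrite !l1Z ger0_norm ?invr_ge0 ?(ltW s0)// 2!exprSr !invfM le_eqVlt.
by apply/orP; left; apply/eqP; ring.
Qed.

(** A majorant for differences of translated bumps: the normalized indicator of a cube of half-side
    [2 * s], with L^1 norm independent of [s]. *)
Definition chi z : R := Lam * n%:R * s ^- n * [forall i, `|z ord0 i| <= 2 * s]%:R.

Lemma chi_ge0 z : 0 <= chi z.
Proof. by rewrite !mulr_ge0// bump_Lam. Qed.

Lemma cube_measurable (a : R) : measurable [set z : rV | [forall i, `|z ord0 i| <= a]].
Proof.
rewrite (_ : [set _ | _] = \bigcap_(i in [set: 'I_n])
  ((fun x : rV => x ord0 i) @^-1` `[- a, a]%classic)).
  apply: fin_bigcap_measurable => // i _.
  by rewrite -[X in measurable X]setTI; apply: measurable_coord => //; exact: measurable_itv.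
apply/seteqP; split=> x /=.
  by move=> /forallP h i _ /=; rewrite in_itv/= -ler_norml.
by move=> h; apply/forallP => i; have := h i Logic.I; rewrite /= in_itv/= -ler_norml.
Qed.

Lemma cube_measure (a : R) : 0 <= a ->
  mu [set z : rV | [forall i, `|z ord0 i| <= a]] = ((2 * a) ^+ n)%:E.
Proof.
move=> a0; rewrite (_ : [set _ | _] = [set x : rV | forall i, `[- a, a]%classic (x ord0 i)]).
  rewrite (lebesgue_rV_box (A := fun=> `[- a, a]%classic)); last by move=> i; exact: measurable_itv.
  rewrite (eq_bigr (fun=> (2 * a)%:E)); first by rewrite prodEFin prodr_const card_ord.
  move=> i _; rewrite lebesgue_measure_itv/= lte_fin opprK -EFinD.
  case: ifPn => [_|]; first by congr EFin; ring.
  rewrite -leNgt => h; have -> : a = 0 by apply/eqP; rewrite eq_le a0 andbT; lra.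
  by rewrite mulr0.
apply/seteqP; split=> x /=.
  by move=> /forallP h i /=; rewrite in_itv/= -ler_norml.
by move=> h; apply/forallP => i; have := h i; rewrite /= in_itv/= -ler_norml.
Qed.

Lemma meas_chi : measurable_fun setT chi.
Proof. by apply: measurable_funM => //; apply: meas_bool; exact: cube_measurable. Qed.

Lemma nl1_chi : nl1 mu chi = (Lam * n%:R * 4 ^+ n)%:E.
Proof.
transitivity (\int[mu]_z (Lam * n%:R * s ^- n * [forall i, `|z ord0 i| <= 2 * s]%:R)%:E)%E.
  by apply: eq_integral => x _; rewrite ger0_norm// chi_ge0.
rewrite ge0_nlZ//; last 2 first.
- by apply: meas_bool; exact: cube_measurable.
- by rewrite !mulr_ge0// bump_Lam.
rewrite [X in (_ * X)%E](_ : _ = mu [set z : rV | [forall i, `|z ord0 i| <= 2 * s]]).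
  rewrite cube_measure ?mulr_ge0 ?(ltW s0)// -EFinM; congr EFin.
  rewrite (_ : 2 * (2 * s) = 4 * s); last by ring.
  by rewrite exprMn; field; rewrite expf_neq0 ?gt_eqF.
rewrite -(setIT [set _ | _]) -integral_indic//; last exact: cube_measurable.
apply: eq_integral => x _; rewrite indicE.
by have [h|/negP h] := boolP [forall i, `|x ord0 i| <= 2 * s]; [rewrite mem_set|rewrite memNset].
Qed.

(** Inside the cube this is the Lipschitz bound, with [l1 y <= n * rho] giving the factor [n] in
    [chi]; outside it both values vanish, since the bump lives within [s / 4] and the shift is at
    most [s]. *)
Lemma dil_chi (rho : R) x y : 0 <= rho -> rho <= s -> (forall i, `|y ord0 i| <= rho) ->
  `|dil s x - dil s (x + y)| <= rho / s * chi x.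
Proof.
move=> rho0 rhos hy.
have [h|/negP h] := boolP [forall i, `|x ord0 i| <= 2 * s].
  rewrite /chi h mulr1; apply: le_trans (dil_lip _ _) _.
  rewrite opprD addrA subrr sub0r l1N.
  apply: le_trans (ler_wpM2l _ (l1_le hy)) _.
    by rewrite mulr_ge0 ?bump_Lam// invr_ge0 exprn_ge0// ltW.
  by rewrite exprSr invfM le_eqVlt; apply/orP; left; apply/eqP; ring.
have [z1|z1] := eqVneq (dil s x) 0; last first.
  exfalso; apply: h; apply/forallP => i; apply: le_trans (dil_supp_coord i z1) _.
  by have := s0; lra.
have [z2|z2] := eqVneq (dil s (x + y)) 0.
  by rewrite z1 z2 subrr normr0 mulr_ge0 ?chi_ge0// divr_ge0// ltW.
exfalso; apply: h; apply/forallP => i.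
have := dil_supp_coord i z2; have := hy i; rewrite mxE => h1 h2.
rewrite (_ : x ord0 i = (x ord0 i + y ord0 i) - y ord0 i); last by ring.
by apply: le_trans (ler_normB _ _) _; have := s0; lra.
Qed.

End dilation.

Section bump_averages.
Context {R : realType} {n : nat}.
Local Notation mu := (@lebesgue_rV R n).
Local Notation rV := 'rV[R]_n.
Implicit Types (x y z : rV) (u h : rV -> R).

(** Martingale differences and images under [T] lie in L^2, the error of the truncation in L^1;
    convolution with a bump is defined in either case. *)
Definition L12 u := (nl1 mu u < +oo)%E \/ (nl2 mu u < +oo)%E.

Lemma intg_mul_L12 (k u : rV -> R) (c : R) : measurable_fun setT k -> measurable_fun setT u ->
  (forall x, `|k x| <= c) -> (nl2 mu k < +oo)%E -> L12 u -> intg mu (fun x => k x * u x).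
Proof.
move=> mk m_u kc k2 [u1|u2]; last exact: intgM.
apply: (@le_intg _ _ _ mu _ (fun x => c * u x)); [by meas|by apply: intgZ; exact: intgP|].
move=> x; rewrite !normrM ler_wpM2r// (le_trans (kc x))//; exact: ler_norm.
Qed.

Lemma locint12 (r : R) u : 0 < r -> measurable_fun setT u -> L12 u -> locint r u.
Proof.
by move=> r0 m_u [u1|u2]; [apply: locint1 => //; exact: intgP|exact: locint2].
Qed.

Variables (phi : rV -> R) (Lam : R).
Hypothesis bphi : bump phi Lam.

Let Lam0 := bump_Lam bphi.

Lemma cellconst_corner (r : R) (f : rV -> R) : cellconst r (fun y => f (corner r y)).
Proof. by move=> x y xy; rewrite /corner xy. Qed.

Lemma corner_near (r : R) y i : 0 < r -> `|(y - corner r y) ord0 i| <= r.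
Proof.
move=> r0; have := cell_near i r0 (esym (cell_corner y r0)).
by move=> h; rewrite mxE [X in _ + X]mxE ltW.
Qed.

(** A function of mean zero on the cells of side [r] sees only the oscillation of the wider bump on
    those cells, hence the gain [r / s]. *)
Lemma fine_bound (r s : R) u x : 0 < r -> r <= s -> measurable_fun setT u -> L12 u ->
  (forall x, E r u x = 0) ->
  `|conv (dil phi s) u x| <= r / s * \int[mu]_y (chi Lam s (x - y) * `|u y|).
Proof.
move=> r0 rs m_u u12 Eu0.
have s0 : 0 < s by exact: lt_le_trans rs.
have mdil := meas_dil bphi s.
have mk := meas_refl x mdil.
have dilc z : `|dil phi s z| <= Lam * s ^- n.
  by rewrite ger0_norm; [exact: (dil_le bphi s0)|exact: (dil_ge0 bphi s0)].
have mchi := @meas_chi R n Lam s.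
have chi_c z : `|chi Lam s z| <= Lam * n%:R * s ^- n.
  rewrite ger0_norm; last exact: (chi_ge0 bphi s0 z).
  have c0 : 0 <= Lam * n%:R * s ^- n.
    by rewrite mulr_ge0 ?mulr_ge0// invr_ge0 exprn_ge0// ltW.
  by rewrite /chi; case: ([forall _, _]); rewrite ?mulr1 ?mulr0.
have nl2k (k : rV -> R) (c : R) : measurable_fun setT k -> (forall z, `|k z| <= c) ->
    (nl1 mu k < +oo)%E -> (nl2 mu k < +oo)%E.
  move=> mk' kc k1; apply: (@le_lt_trans _ _ (`|c|%:E * nl1 mu k)%E); last first.
    by rewrite lte_mul_pinfty// ?nl1_ge0// ge0_fin_numE ?nl1_ge0.
  rewrite -ge0_nlZ//; last by meas.
  apply: le_nl; [by meas|by meas|move=> z].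
  rewrite sqr_ge0/= -(real_normK (num_real _)) expr2 ler_wpM2r//.
  by rewrite (le_trans (kc z))// ler_norm.
have refl1 (k : rV -> R) : measurable_fun setT k -> (nl1 mu k < +oo)%E ->
    (nl1 mu (fun y => k (x - y)%R) < +oo)%E.
  by move=> mk' k1; rewrite /nl1 (nl_refl (f := fun z => `|k z|) x)//; meas.
have d1 : (nl1 mu (fun y => dil phi s (x - y)%R) < +oo)%E.
  by apply: refl1 => //; rewrite (nl1_dil bphi s0) ltry.
have i1 : intg mu (fun y => dil phi s (x - y) * u y).
  by apply: intg_mul_L12 => //; exact: nl2k.
have c1 : (nl1 mu (fun y => chi Lam s (x - y)%R) < +oo)%E.
  by apply: refl1 => //; rewrite (nl1_chi bphi s0) ltry.
have mc1 := meas_refl x mchi.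
have m_au : measurable_fun setT (fun y => `|u y|) by meas.
have au12 : L12 (fun y => `|u y|).
  case: u12 => [u1|u2]; [left|right].
    by rewrite (_ : nl1 _ _ = nl1 mu u)//; apply: eq_integral => y _; rewrite normr_id.
  by rewrite (_ : nl2 _ _ = nl2 mu u)//; apply: eq_integral => y _; rewrite real_normK ?num_real.
have i3 : intg mu (fun y => chi Lam s (x - y) * `|u y|).
  by apply: intg_mul_L12 => //; exact: nl2k.
(* The bump frozen at the corner of each cell is constant on cells and integrates to zero against
   [u]. *)
pose h y := dil phi s (x - corner r y).
have hc : cellconst r h by move=> y y' yy'; rewrite /h /corner yy'.
have mh : measurable_fun setT h by exact: meas_cellconst hc.
have key y : `|dil phi s (x - y) - h y| <= r / s * chi Lam s (x - y).
  rewrite /h (_ : x - corner r y = (x - y) + (y - corner r y)); last first.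
    by rewrite addrA subrK.
  apply: (dil_chi bphi s0) => //; first exact: ltW.
  by move=> i; exact: corner_near.
have i2 : intg mu (fun y => (dil phi s (x - y) - h y) * u y).
  apply: (@le_intg _ _ _ mu _ (fun y => r / s * (chi Lam s (x - y) * `|u y|))).
  - by meas.
  - exact: intgZ.
  move=> y; rewrite normrM mulrA [leRHS]normrM normr_id ler_wpM2r//.
  by rewrite (le_trans (key y))// ler_norm.
have i4 : intg mu (fun y => u y * h y).
  have := intgB i1 i2; apply: eq_integrable => // y _ /=; congr EFin; ring.
have z : \int[mu]_y (u y * h y) = 0.
  rewrite -(E_adj r0 m_u (locint12 r0 m_u u12) hc (intg_nl1 i4)).
  by under eq_Rintegral do rewrite Eu0 mul0r; rewrite Rintegral_cst// mul0r.
have -> : conv (dil phi s) u x = \int[mu]_y ((dil phi s (x - y) - h y) * u y).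
  rewrite -[RHS]addr0 -z -RintegralD//.
  by apply: eq_Rintegral => y _; ring.
apply: le_trans (le_normr_Rintegral measurableT i2) _.
rewrite -RintegralZl//; apply: le_Rintegral => //.
- have := intgZ 1 i2 => i2'; apply: (@le_intg _ _ _ mu _ (fun y => (dil phi s (x - y) - h y) * u y)) => //.
    by meas.
  by move=> y; rewrite normr_id.
- exact: intgZ.
by move=> y _; rewrite normrM mulrA ler_wpM2r.
Qed.

Lemma fine_nl2 (r s : R) u : 0 < r -> r <= s -> measurable_fun setT u -> L12 u ->
  (forall x, E r u x = 0) -> 0 < Lam -> (0 < n)%N ->
  (nl2 mu (conv (dil phi s) u) <= ((r / s * (Lam * n%:R * 4 ^+ n)) ^+ 2)%:E * nl2 mu u)%E.
Proof.
move=> r0 rs m_u u12 Eu0 L0 n0.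
have s0 : 0 < s by exact: lt_le_trans rs.
have mdil := meas_dil bphi s; have mchi := @meas_chi R n Lam s.
have m_au : measurable_fun setT (fun y => `|u y|) by meas.
have A0 : 0 < Lam * n%:R * 4 ^+ n by rewrite !mulr_gt0 ?exprn_gt0 ?ltr0n.
have mc := meas_conv mdil m_u; have mc2 := meas_conv mchi m_au.
apply: (@le_trans _ _ (nl2 mu (fun x => r / s * conv (chi Lam s) (fun y => `|u y|) x)%R)).
  apply: le_nl; [by meas|by meas|move=> x].
  rewrite sqr_ge0/= -(real_normK (num_real (conv _ _ _))) ler_pXn2r ?nnegrE//.
    by have := fine_bound x r0 rs m_u u12 Eu0.
  rewrite mulr_ge0 ?divr_ge0 ?(ltW r0) ?(ltW s0)//.
  by apply: Rintegral_ge0 => y _; rewrite mulr_ge0// (chi_ge0 bphi s0).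
rewrite nl2Z// [((r / s * _) ^+ 2)%R]exprMn [in leRHS]EFinM -muleA lee_wpmul2l// ?lee_fin ?sqr_ge0//.
apply: le_trans (nl2_conv A0 mchi m_au _) _.
  by rewrite (nl1_chi bphi s0).
rewrite lee_wpmul2l// ?lee_fin ?sqr_ge0// le_eqVlt; apply/orP; left; apply/eqP.
by apply: eq_integral => y _; rewrite real_normK ?num_real.
Qed.

Lemma fine_nl1 (r s : R) u : 0 < r -> r <= s -> measurable_fun setT u -> L12 u ->
  (forall x, E r u x = 0) ->
  (nl1 mu (conv (dil phi s) u) <= (r / s * (Lam * n%:R * 4 ^+ n))%:E * nl1 mu u)%E.
Proof.
move=> r0 rs m_u u12 Eu0.
have s0 : 0 < s by exact: lt_le_trans rs.
have mdil := meas_dil bphi s; have mchi := @meas_chi R n Lam s.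
have m_au : measurable_fun setT (fun y => `|u y|) by meas.
have mc := meas_conv mdil m_u; have mc2 := meas_conv mchi m_au.
apply: (@le_trans _ _ (nl1 mu (fun x => r / s * conv (chi Lam s) (fun y => `|u y|) x)%R)).
  apply: le_nl; [by meas|by meas|move=> x].
  rewrite normr_ge0/=; apply: le_trans (ler_norm _).
  by have := fine_bound x r0 rs m_u u12 Eu0.
have rs0 : 0 <= r / s by rewrite divr_ge0// ltW.
rewrite nl1Z// (ger0_norm rs0) [in leRHS]EFinM -muleA lee_wpmul2l// ?lee_fin//.
apply: le_trans (nl1_conv mchi m_au) _.
rewrite (nl1_chi bphi s0) le_eqVlt; apply/orP; left; apply/eqP; congr (_ * _)%E.
by apply: eq_integral => y _; rewrite normr_id.
Qed.

(** Indicator of the points whose cell changes under translation by [z]: a neighbourhood of the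
    faces. *)
Definition strip (r : R) z x : R := (cell r x != cell r (x - z))%:R.

Lemma strip_le (r : R) z x : strip r z x <= \sum_i
  (Num.floor (x ord0 i / r) != Num.floor ((x ord0 i - z ord0 i) / r))%:R.
Proof.
rewrite /strip; have [h|_] := boolP (cell r x != cell r (x - z)); last exact: sumr_ge0.
have [i hi] : exists i, cell r x ord0 i != cell r (x - z) ord0 i.
  apply/existsP; rewrite -negb_forall; apply: contra h => /forallP h.
  by apply/eqP/rowP => i; exact/eqP.
rewrite (bigD1 i)//= -[leLHS]addr0; apply: lerD; last exact: sumr_ge0.
by move: hi; rewrite !mxE => ->.
Qed.

(** In one coordinate the cell can change only within [|b|] of the left end if [b >= 0], of the
    right end otherwise. *)
Lemma floor_shift_itv (r a b v : R) : 0 < r -> `|b| <= r ->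
  v = (Num.floor (a / r))%:~R ->
  Num.floor (a / r) != Num.floor ((a - b) / r) ->
  if 0 <= b then (r * v <= a < r * v + `|b|) else (r * (v + 1) - `|b| <= a < r * (v + 1)).
Proof.
move=> r0 br vE h.
have /andP[v1 v2] := floor_itv (a / r).
rewrite intrD -vE in v2; rewrite -vE in v1.
move: (v1) (v2); rewrite ler_pdivlMr// ltr_pdivrMr// => w1 w2.
have [b0|b0] := lerP 0 b.
  rewrite ger0_norm// in br.
  rewrite mulrC w1/= ltNge; apply/negP => h'; move/eqP: h; apply.
  apply/esym/floor_def; rewrite intrD -vE ler_pdivlMr// ltr_pdivrMr//.
  move: h'; rewrite ger0_norm// => h'; apply/andP; split; lra.
rewrite ltr0_norm// in br.
rewrite mulrC w2 andbT leNgt; apply/negP => h'; move/eqP: h; apply.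
apply/esym/floor_def; rewrite intrD -vE ler_pdivlMr// ltr_pdivrMr//.
move: h'; rewrite ltr0_norm// => h'; apply/andP; split; lra.
Qed.

(** The part of the cell [v] within [|z_i|] of the relevant face in direction [i]; by
    [floor_shift_itv], the slabs over all [i] cover the strip inside the cell. *)
Definition slab (r : R) (v : 'rV[int]_n) z i : set rV :=
  [set y | forall j, (if j == i then
      (if 0 <= z ord0 i then `[r * (v ord0 i)%:~R, r * (v ord0 i)%:~R + `|z ord0 i| [%classic
       else `[r * ((v ord0 i)%:~R + 1) - `|z ord0 i|, r * ((v ord0 i)%:~R + 1)[%classic)
    else `[r * (v ord0 j)%:~R, r * (v ord0 j + 1)%:~R[%classic) (y ord0 j)].

Lemma measurable_slab r v z i : measurable (slab r v z i).
Proof.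
pose A j : set R := (if j == i then
      (if 0 <= z ord0 i then `[r * (v ord0 i)%:~R, r * (v ord0 i)%:~R + `|z ord0 i| [%classic
       else `[r * ((v ord0 i)%:~R + 1) - `|z ord0 i|, r * ((v ord0 i)%:~R + 1)[%classic)
    else `[r * (v ord0 j)%:~R, r * (v ord0 j + 1)%:~R[%classic).
rewrite (_ : slab r v z i = \bigcap_(j in [set: 'I_n]) ((fun x : rV => x ord0 j) @^-1` A j)).
  apply: fin_bigcap_measurable => // j _.
  rewrite -[X in measurable X]setTI; apply: measurable_coord => //.
  by rewrite /A; case: ifP => _; [case: ifP => _|]; exact: measurable_itv.
by apply/seteqP; split=> x xA j => [_|]; exact: xA.
Qed.

Lemma measure_slab (r : R) v z i : 0 < r ->
  mu (slab r v z i) = (`|z ord0 i| * r ^+ n.-1)%:E.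
Proof.
move=> r0; pose A j : set R := (if j == i then
      (if 0 <= z ord0 i then `[r * (v ord0 i)%:~R, r * (v ord0 i)%:~R + `|z ord0 i| [%classic
       else `[r * ((v ord0 i)%:~R + 1) - `|z ord0 i|, r * ((v ord0 i)%:~R + 1)[%classic)
    else `[r * (v ord0 j)%:~R, r * (v ord0 j + 1)%:~R[%classic).
rewrite /slab (lebesgue_rV_box (A := A)); last first.
  by move=> j; rewrite /A; case: ifP => _; [case: ifP => _|]; exact: measurable_itv.
have itv (a b c : R) : 0 <= c -> b - a = c -> lebesgue_measure `[a, b[%classic = c%:E :> \bar R.
  move=> c0 bac; rewrite lebesgue_measure_itv/= lte_fin; case: ifPn => [_|]; first by rewrite -EFinB bac.
  by rewrite -leNgt => h; congr EFin; lra.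
rewrite (bigD1 i)//= (eq_bigr (fun=> r%:E)); last first.
  move=> j /negbTE ji; rewrite /A ji; apply: itv; first exact: ltW.
  by rewrite intrD; ring.
rewrite /A eqxx (_ : lebesgue_measure _ = (`|z ord0 i|)%:E); last first.
  by case: ifP => _; apply: itv => //; ring.
rewrite prodEFin prodr_const -EFinM; congr (_ * _ ^+ _)%:E.
by rewrite cardC1 card_ord.
Qed.

Lemma ce_strip_le (r : R) z x y : 0 < r -> (forall i, `|z ord0 i| <= r) ->
  ce r x y * strip r z y <= r ^- n * \sum_i \1_(slab r (cell r x) z i) y.
Proof.
move=> r0 zr; have rn : 0 <= r ^- n by rewrite invr_ge0 exprn_ge0// ltW.
rewrite /ce -mulrA ler_wpM2l//; have [xy|_] := eqVneq; last first.
  by rewrite mul0r; apply: sumr_ge0.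
rewrite mul1r; apply: le_trans (strip_le _ _ _) _; apply: ler_sum => i _.
have [h|_] := boolP (_ != _); last by [].
rewrite indicE mem_set//= => j; have [->|ji] := eqVneq j i.
  have := @floor_shift_itv r (y ord0 i) (z ord0 i) (cell r x ord0 i)%:~R r0 (zr i).
  rewrite xy mxE => /(_ erefl h); case: ifP => _ /=; by rewrite in_itv.
have /(cellP _ _ r0)/(_ j) := erefl (cell r y); by rewrite -xy.
Qed.

Lemma measurable_strip (r : R) z : 0 < r -> measurable_fun setT (strip r z).
Proof.
move=> r0; apply: meas_bool.
have mD : measurable [set x : rV | cell r x = cell r (x - z)].
  rewrite (_ : [set _ | _] = \bigcup_v ([set x : rV | cell r x = v] `&` [set x | cell r (x - z) = v])).
    apply: countable_bigcupT_measurable => [|v]; first exact: countableP.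
    apply: measurableI; first by rewrite cell_preimage//; exact: measurable_box.
    apply: (measurable_cell_comp [set v] r0).
    by apply: measurable_rV_sub => //; exact: measurable_cst.
  by apply/seteqP; split=> p /=; [move=> h; exists (cell r p)|case=> v _ [-> ->]].
rewrite (_ : [set _ | _] = ~` [set x : rV | cell r x = cell r (x - z)]); first exact: measurableC.
by apply/seteqP; split => x /= /eqP.
Qed.

Lemma strip_ge0 r z x : 0 <= strip r z x.
Proof. exact: ler0n. Qed.

Lemma strip_le1 r z x : strip r z x <= 1.
Proof. by rewrite /strip; case: (_ != _). Qed.

Lemma locint_strip (r : R) z : 0 < r -> locint r (strip r z).
Proof.
move=> r0 x; have mc := meas_ce1 x r0; have ms := measurable_strip z r0.
apply: le_intg (intg_ce r0 x) _; first by meas.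
move=> y; rewrite normrM ler_piMr// ger0_norm ?strip_ge0 ?strip_le1//.
Qed.

(** The strip occupies at most the fraction [|z_i| / r] of a cell in each direction. *)
Lemma E_strip (r : R) z x : 0 < r -> (forall i, `|z ord0 i| <= r) ->
  E r (strip r z) x <= l1 z / r.
Proof.
move=> r0 zr; have mc := meas_ce1 x r0; have ms := measurable_strip z r0.
rewrite -lee_fin; apply: (@le_trans _ _ (`|E r (strip r z) x|)%:E).
  by rewrite lee_fin ler_norm.
apply: le_trans (abs_Rintegral_le _ _) _; first by meas.
have rn : 0 <= r ^- n by rewrite invr_ge0 exprn_ge0// ltW.
have mS i : measurable_fun setT (\1_(slab r (cell r x) z i) : rV -> R).
  by apply: measurable_indic; exact: measurable_slab.
apply: (@le_trans _ _ (\int[mu]_y (r ^- n * \sum_i \1_(slab r (cell r x) z i) y)%:E)%E).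
  apply: le_nl; [by meas| |move=> y].
    by apply: measurable_funM => //; apply: measurable_sum => i; exact: mS.
  rewrite normr_ge0/= ger0_norm; first exact: ce_strip_le.
  by rewrite mulr_ge0 ?ce_ge0 ?strip_ge0.
rewrite ge0_nlZ//; last 2 first.
- by apply: measurable_sum => i; exact: mS.
- by move=> y; apply: sumr_ge0.
rewrite ge0_nl_sum//.
rewrite (eq_bigr (fun i => (`|z ord0 i| * r ^+ n.-1)%:E)); last first.
  move=> i _; rewrite integral_indic//; last exact: measurable_slab.
  by rewrite setIT; exact: measure_slab.
rewrite sumEFin -EFinM lee_fin /l1 mulr_suml mulr_sumr.
apply: ler_sum => i _; rewrite le_eqVlt; apply/orP; left; apply/eqP.
case: (n) i {mS ms rn x zr mc} z => [[]//|k] i z /=.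
by rewrite exprS; field; rewrite gt_eqF// expf_neq0// gt_eqF.
Qed.

End bump_averages.

(** * Bumps acting on functions constant on large cells *)

Section coarse.
Context {R : realType} {n : nat}.
Local Notation mu := (@lebesgue_rV R n).
Local Notation rV := 'rV[R]_n.
Implicit Types (x y z : rV) (u h : rV -> R).
Variables (phi : rV -> R) (Lam : R).
Hypothesis bphi : bump phi Lam.

(** As [h^2] is constant on cells, the strip may be replaced by its average over the cell. *)
Lemma strip_energy (r : R) z h : 0 < r -> (forall i, `|z ord0 i| <= r) ->
  cellconst r h -> (nl2 mu h < +oo)%E ->
  (\int[mu]_x (strip r z x * h x ^+ 2)%:E <= (l1 z / r)%:E * nl2 mu h)%E.
Proof.
move=> r0 zr hc ho.
have mh := meas_cellconst r0 hc; have ms := measurable_strip z r0.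
have h2c : cellconst r (fun x => h x ^+ 2) by move=> x y xy; rewrite (hc _ _ xy).
have i1 : intg mu (fun x => strip r z x * h x ^+ 2).
  apply: (@le_intg _ _ _ mu _ (fun x => h x * h x)); [by meas|exact: intgM|].
  move=> x; rewrite normrM -expr2 ler_piMl// ger0_norm ?strip_ge0 ?strip_le1//.
rewrite -(EFin_Rintegral i1) -(E_adj r0 ms (locint_strip z r0) h2c (intg_nl1 i1)).
have mE := meas_E r0 (strip r z).
have E0 x : 0 <= E r (strip r z) x.
  by apply: Rintegral_ge0 => y _; rewrite mulr_ge0 ?strip_ge0// ce_ge0.
have i2 : intg mu (fun x => E r (strip r z) x * h x ^+ 2).
  apply: (@le_intg _ _ _ mu _ (fun x => l1 z / r * (h x * h x))); [by meas|by apply: intgZ; exact: intgM|].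
  move=> x; rewrite -expr2 normrM [leRHS]normrM ler_wpM2r//.
  by rewrite (ger0_norm (E0 x)) (le_trans (E_strip x r0 zr))// ler_norm.
rewrite (EFin_Rintegral i2) -ge0_nlZ//; last 3 first.
- by meas.
- by rewrite divr_ge0 ?l1_ge0// ltW.
- by move=> x; exact: sqr_ge0.
apply: le_nl; [by meas|by meas|move=> x].
by rewrite mulr_ge0 ?sqr_ge0//= ler_wpM2r ?sqr_ge0// E_strip.
Qed.

(** The difference vanishes off the strip, and there [(a - b)^2 <= 2 a^2 + 2 b^2]. The translated
    term is brought back by a change of variable, which turns the strip of [z] into that of
    [- z]. *)
Lemma translation_energy (r : R) z h : 0 < r -> (forall i, `|z ord0 i| <= r) ->
  cellconst r h -> (nl2 mu h < +oo)%E ->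
  (nl2 mu (fun x => (h (x - z) - h x)%R) <= (4 * (l1 z / r))%:E * nl2 mu h)%E.
Proof.
move=> r0 zr hc ho.
have mh := meas_cellconst r0 hc; have ms := measurable_strip z r0.
have msN := measurable_strip (- z) r0.
have mhz := meas_shift z mh.
have sz x : strip r z x = strip r (- z) (x - z).
  by rewrite /strip opprK subrK eq_sym.
apply: (@le_trans _ _ (2%:E * (\int[mu]_x (strip r (- z) (x - z) * h (x - z) ^+ 2)%:E +
   \int[mu]_x (strip r z x * h x ^+ 2)%:E))%E).
  have msz := meas_shift z msN.
  have p1 (v w : rV) (f : rV -> R) x : 0 <= strip r v w * f x ^+ 2.
    by apply: mulr_ge0; [exact: strip_ge0|exact: sqr_ge0].
  rewrite -ge0_nlD; [|by meas|by meas|by move=> x; exact: p1|by move=> x; exact: p1].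
  rewrite -ge0_nlZ//; [|by meas|by move=> x; apply: addr_ge0; exact: p1].
  apply: le_nl; [by meas|by meas|move=> x].
  rewrite sqr_ge0/= -sz /strip; have [e|_] := eqVneq (cell r x) (cell r (x - z)).
    by rewrite (hc _ _ e) subrr expr0n/= !mul0r addr0 mulr0.
  by rewrite !mul1r; have := sqr_ge0 (h (x - z) + h x); lra.
have -> : (\int[mu]_x (strip r (- z) (x - z) * h (x - z) ^+ 2)%:E =
   \int[mu]_x (strip r (- z) x * h x ^+ 2)%:E)%E.
  apply: (nl_shift (f := fun x => strip r (- z) x * h x ^+ 2) (- z)); first by meas.
  by move=> x; rewrite mulr_ge0 ?sqr_ge0 ?strip_ge0.
have zrN i : `|(- z) ord0 i| <= r by rewrite mxE normrN.
apply: le_trans (lee_wpmul2l _ (leeD (strip_energy r0 zrN hc ho) (strip_energy r0 zr hc ho))) _.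
  by rewrite lee_fin.
rewrite l1N -ge0_muleDl; last 2 first.
- by rewrite lee_fin divr_ge0 ?l1_ge0// ltW.
- by rewrite lee_fin divr_ge0 ?l1_ge0// ltW.
rewrite muleA -EFinD -EFinM le_eqVlt; apply/orP; left; apply/eqP.
by congr (_%:E * _)%E; ring.
Qed.

(** Jensen against the bump, then [translation_energy] for each shift in its support. The gain is
    [s / r] and not its square, because [h] jumps across the faces of its cells. *)
Lemma coarse_nl2 (r s : R) h : 0 < s -> s <= r -> cellconst r h -> (nl2 mu h < +oo)%E ->
  (nl2 mu (fun x => (conv (dil phi s) h x - h x)%R) <= (4 * n%:R * (s / r))%:E * nl2 mu h)%E.
Proof.
move=> s0 sr hc ho; have r0 : 0 < r by exact: lt_le_trans sr.
have mh := meas_cellconst r0 hc.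
have mdil := meas_dil bphi s.
have mc := meas_conv mdil mh.
have idil := intg_dil bphi s0.
have d2 : (nl2 mu (dil phi s) < +oo)%E.
  apply: (@le_lt_trans _ _ ((Lam * s ^- n)%:E * nl1 mu (dil phi s))%E).
    rewrite -ge0_nlZ//; [|by meas|].
      apply: le_nl; [by meas|by meas|move=> z].
      rewrite sqr_ge0/= (ger0_norm (dil_ge0 bphi s0 z)) expr2 ler_wpM2r ?(dil_ge0 bphi s0)//.
      exact: (dil_le bphi s0).
    by rewrite mulr_ge0 ?(bump_Lam bphi)// invr_ge0 exprn_ge0// ltW.
  by rewrite (nl1_dil bphi s0) mule1 ltry.
have mF : measurable_fun setT (fun p : rV * rV => dil phi s p.2 * (h (p.1 - p.2) - h p.1) ^+ 2).
  apply: measurable_funM; first exact: meas_comp2.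
  apply: measurable_funX; apply: measurable_funB; first exact: meas_subrV.
  exact: meas_comp1.
have F0 (p : rV * rV) : 0 <= dil phi s p.2 * (h (p.1 - p.2) - h p.1) ^+ 2.
  by rewrite mulr_ge0 ?sqr_ge0// (dil_ge0 bphi s0).
have convE x : conv (dil phi s) h x = \int[mu]_z (dil phi s z * h (x - z)).
  rewrite /conv /Rintegral.
  have mG : measurable_fun setT (fun y => dil phi s (x - y) * h y).
    by have := meas_refl x mdil => m; meas.
  congr fine; rewrite [LHS]integralE [RHS]integralE.
  have mE := proj2 (@measurable_EFinP _ _ _ _ _) mG.
  congr (_ - _)%E.
    rewrite -(ge0_integral_reflect x (measurable_funepos mE))//.
    by apply: eq_integral => z _; rewrite !funeposE /= subKr.
  rewrite -(ge0_integral_reflect x (measurable_funeneg mE))//.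
  by apply: eq_integral => z _; rewrite !funenegE /= subKr.
apply: (@le_trans _ _ (\int[mu]_x \int[mu]_z (dil phi s z * (h (x - z) - h x) ^+ 2)%:E)%E).
  apply: ge0_le_integral => //.
  - by move=> x _; rewrite lee_fin sqr_ge0.
  - by apply/measurable_EFinP; meas.
  - exact: (@meas_ge0_int2 _ _ _ _ _ mu _ mF F0).
  move=> x _.
  have m1 : measurable_fun setT (fun z => h (x - z) - h x).
    by have := meas_refl x mh => m; meas.
  have := @weighted_CS _ _ _ mu (dil phi s) (fun z => h (x - z) - h x) 1 ltr01 mdil m1.
  rewrite (nl1_dil bphi s0) lexx mul1e => /(_ isT).
  have -> : \int[mu]_z (dil phi s z * (h (x - z) - h x)) = conv (dil phi s) h x - h x.
    have hx2 : (nl2 mu (fun z => h (x - z)%R) < +oo)%E.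
      rewrite /nl2 (nl_refl (f := fun z => h z ^+ 2) x)//; first by meas.
      by move=> z; exact: sqr_ge0.
    have e : \int[mu]_z (dil phi s z * h x) = h x.
      by rewrite RintegralZr// /Rintegral (int_dil bphi s0)/= mul1r.
    rewrite convE -[X in _ = _ - X]e -RintegralB//.
    - by apply: eq_Rintegral => z _; rewrite mulrBr.
    - by apply: intgM => //; exact: meas_refl.
    - have := intgZ (h x) idil; apply: eq_integrable => // z _ /=; congr EFin; ring.
  move=> H; apply: le_trans H _; rewrite le_eqVlt; apply/orP; left; apply/eqP.
  by apply: eq_integral => z' _; rewrite (ger0_norm (dil_ge0 bphi s0 z')).
rewrite (tonelliR mu mu (F := fun p => dil phi s p.2 * (h (p.1 - p.2) - h p.1) ^+ 2))//=.
apply: (@le_trans _ _ (\int[mu]_z ((dil phi s z)%:E * ((4 * n%:R * (s / r))%:E * nl2 mu h)))%E).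
  apply: ge0_le_integral => //.
  - by move=> z _; apply: integral_ge0 => x _; rewrite lee_fin (F0 (x, z)).
  - exact: (@meas_ge0_int2 _ _ _ _ _ mu _ (meas_swap mF) (fun p => F0 (p.2, p.1))).
  - by apply: emeasurable_funM => //; apply/measurable_EFinP.
  move=> z _; rewrite ge0_nlZ ?(dil_ge0 bphi s0)//; last 2 first.
  - by have := meas_shift z mh => m; meas.
  - by move=> x; exact: sqr_ge0.
  have [->|z0] := eqVneq (dil phi s z) 0; first by rewrite !mul0e.
  rewrite lee_wpmul2l ?lee_fin ?(dil_ge0 bphi s0)//.
  have zs i : `|z ord0 i| <= s.
    by apply: le_trans (dil_supp_coord bphi s0 i z0) _; lra.
  have zr i : `|z ord0 i| <= r by exact: le_trans (zs i) sr.
  apply: le_trans (translation_energy r0 zr hc ho) _.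
  rewrite lee_wpmul2r ?nl2_ge0// lee_fin -mulrA ler_wpM2l//.
  by rewrite mulrA ler_wpM2r ?invr_ge0 ?(ltW r0)// l1_le.
rewrite ge0_integralZr//; last 3 first.
- by apply/measurable_EFinP.
- by move=> z _; rewrite lee_fin (dil_ge0 bphi s0).
- apply: mule_ge0; last exact: nl2_ge0.
  by rewrite lee_fin; apply: mulr_ge0; [exact: mulr_ge0|rewrite divr_ge0// ltW].
by rewrite (int_dil bphi s0) mul1e.
Qed.

End coarse.

Section weighted_sums.
Context {R : realType}.

(** Expansion of the nonnegative sum of [c i * (x i / c i - X / S)^2]. *)
Lemma sum_CS (I : finType) (c x : I -> R) (S : R) : 0 < S -> (forall i, 0 < c i) ->
  \sum_i c i <= S -> (\sum_i x i) ^+ 2 <= S * \sum_i x i ^+ 2 / c i.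
Proof.
move=> S0 c0 cS; set X := \sum_i x i.
have h : 0 <= \sum_i c i * (x i / c i - X / S) ^+ 2.
  by apply: sumr_ge0 => i _; rewrite mulr_ge0 ?sqr_ge0// ltW.
have e : \sum_i c i * (x i / c i - X / S) ^+ 2 =
    \sum_i x i ^+ 2 / c i - 2 * (X / S) * (\sum_i x i) + (X / S) ^+ 2 * \sum_i c i.
  rewrite !mulr_sumr -sumrB -big_split/=; apply: eq_bigr => i _.
  by field; rewrite !gt_eqF.
rewrite e -/X in h.
have h2 : (X / S) ^+ 2 * \sum_i c i <= (X / S) ^+ 2 * S by rewrite ler_wpM2l ?sqr_ge0.
have e2 : (X / S) ^+ 2 * S = X ^+ 2 / S by field; rewrite gt_eqF.
have e3 : 2 * (X / S) * X = 2 * (X ^+ 2 / S) by field; rewrite gt_eqF.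
rewrite e2 in h2; rewrite e3 in h.
by rewrite mulrC -ler_pdivrMr//; lra.
Qed.

Definition dst (i j : nat) := ((i - j) + (j - i))%N.

Lemma dstC i j : dst i j = dst j i.
Proof. by rewrite /dst addnC. Qed.

Lemma dst_sum (rho : R) i K : 0 <= rho -> rho < 1 ->
  \sum_(j < K) rho ^+ dst i j <= 2 / (1 - rho).
Proof.
move=> r0 r1; have d0 : 0 < 1 - rho by rewrite subr_gt0.
have A : forall k, \sum_(0 <= j < k.+1) rho ^+ (k - j) <= (1 - rho)^-1.
  elim=> [|k IH].
    rewrite big_nat1 subnn expr0 -[leLHS]invr1 lef_pV2 ?posrE// lerBlDr lerDl//.
  rewrite big_nat_recr//= subnn expr0.
  rewrite (eq_big_nat _ _ (F2 := fun j => rho * rho ^+ (k - j))); last first.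
    by move=> j /andP[_ jk]; rewrite subSn// exprS.
  rewrite -mulr_sumr; apply: (@le_trans _ _ (rho * (1 - rho)^-1 + 1)).
    by rewrite lerD2r ler_wpM2l.
  rewrite le_eqVlt; apply/orP; left; apply/eqP; field.
  by rewrite subr_eq0 eq_sym lt_eqF.
apply: (@le_trans _ _ (\sum_(0 <= j < i.+1 + K) rho ^+ dst i j)).
  rewrite -(big_mkord predT (fun j => rho ^+ dst i j)) [leRHS](big_cat_nat (n := K))//=; last exact: leq_addl.
  by rewrite lerDl; apply: sumr_ge0 => j _; rewrite exprn_ge0.
rewrite (big_cat_nat (n := i.+1))//=; last exact: leq_addr.
rewrite mulr_natl mulr2n; apply: lerD.
  rewrite (eq_big_nat _ _ (F2 := fun j => rho ^+ (i - j))); first exact: A.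
  move=> j /andP[_ ji]; rewrite /dst; congr (_ ^+ _).
  by rewrite (_ : (j - i = 0)%N) ?addn0//; apply/eqP; rewrite subn_eq0.
rewrite -{1}[i.+1]add0n big_addn addKn big_mkord.
apply: le_trans (geo_sum_le K.+1 r0 r1).
rewrite big_ord_recl/= expr0 -[leLHS]add0r; apply: lerD; first by [].
apply: ler_sum => j _; rewrite /fintype.bump leq0n add1n le_eqVlt; apply/orP; left; apply/eqP.
by congr (_ ^+ _); rewrite /dst; lia.
Qed.

End weighted_sums.

Section square_function.
Context {R : realType} {n : nat}.
Local Notation mu := (@lebesgue_rV R n).
Local Notation rV := 'rV[R]_n.
Implicit Types (x y z : rV) (u h : rV -> R).

(** [E_adj] tested on the coarse kernel [ce], which is constant on the finer cells. *)
Lemma E_tower (r : R) i j u x : 0 < r -> (i <= j)%N -> measurable_fun setT u ->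
  locint (r * 2 ^+ i) u -> locint (r * 2 ^+ j) u ->
  E (r * 2 ^+ j) (E (r * 2 ^+ i) u) x = E (r * 2 ^+ j) u x.
Proof.
move=> r0 ij m_u li lj.
have rk k : 0 < r * 2 ^+ k by rewrite mulr_gt0// exprn_gt0.
have cc : cellconst (r * 2 ^+ i) (ce (r * 2 ^+ j) x).
  apply: (cellconst_scale r0 ij) => y y' yy'.
  by rewrite /ce yy'.
have oo : (nl1 mu (fun y => (u y * ce (r * 2 ^+ j) x y)%R) < +oo)%E.
  rewrite (_ : nl1 _ _ = nl1 mu (fun y => ce (r * 2 ^+ j) x y * u y)%R).
    exact: (intg_nl1 (lj x)).
  by apply: eq_integral => y _; rewrite mulrC.
have := E_adj (rk i) m_u li cc oo.
rewrite /E => h; rewrite -[RHS](eq_Rintegral _ (f := fun y => u y * ce (r * 2 ^+ j) x y)).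
  by rewrite -h; apply: eq_Rintegral => y _; rewrite mulrC.
by move=> y _; rewrite mulrC.
Qed.

Variables (phi : rV -> R) (Lam : R).
Hypothesis bphi : bump phi Lam.

Lemma nl2_dil s : 0 < s -> (nl2 mu (dil phi s) < +oo)%E.
Proof.
move=> s0; have mdil := meas_dil bphi s.
apply: (@le_lt_trans _ _ ((Lam * s ^- n)%:E * nl1 mu (dil phi s))%E); last first.
  by rewrite (nl1_dil bphi s0) mule1 ltry.
rewrite -ge0_nlZ//; [|by meas|].
  apply: le_nl; [by meas|by meas|move=> z].
  rewrite sqr_ge0/= (ger0_norm (dil_ge0 bphi s0 z)) expr2 ler_wpM2r ?(dil_ge0 bphi s0)//.
  exact: (dil_le bphi s0).
by rewrite mulr_ge0 ?(bump_Lam bphi)// invr_ge0 exprn_ge0// ltW.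
Qed.

Lemma intg_dil_mul s x u : 0 < s -> measurable_fun setT u -> L12 u ->
  intg mu (fun y => dil phi s (x - y) * u y).
Proof.
move=> s0 m_u u12; have mdil := meas_dil bphi s; have mk := meas_refl x mdil.
apply: (intg_mul_L12 mk m_u (c := Lam * s ^- n)) => //.
  move=> y; rewrite ger0_norm; [exact: (dil_le bphi s0)|exact: (dil_ge0 bphi s0)].
rewrite /nl2 (nl_refl (f := fun z => dil phi s z ^+ 2) x)//.
- exact: nl2_dil.
- by meas.
- by move=> y; exact: sqr_ge0.
Qed.

Lemma conv_dilB s u h x : 0 < s -> measurable_fun setT u -> measurable_fun setT h ->
  L12 u -> L12 h ->
  conv (dil phi s) (fun y => u y - h y) x = conv (dil phi s) u x - conv (dil phi s) h x.
Proof.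
move=> s0 m_u mh u12 h12; rewrite /conv -RintegralB//; try exact: intg_dil_mul.
by apply: eq_Rintegral => y _; rewrite mulrBr.
Qed.

(** * Almost orthogonality of bumps and martingale differences *)

Hypothesis n0 : (0 < n)%N.
Hypothesis Lam_gt0 : 0 < Lam.
Variables (r : R) (g : rV -> R) (M : nat).
Hypothesis r0 : 0 < r.
Hypothesis mg : measurable_fun setT g.
Hypothesis goo : (nl2 mu g < +oo)%E.

Let rk k : 0 < r * 2 ^+ k.
Proof. by rewrite mulr_gt0// exprn_gt0. Qed.

(** The index of [P] is shifted by one so that [g] itself comes first. The [D j] with [j <= M] are
    the successive differences and [D (M+1)] is the remaining coarse average, so that
    [D 0, ..., D (M+1)] decompose [g] orthogonally. *)
Let P j : rV -> R := if j is j'.+1 then Ek r g j' else g.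
Let D j x : R := if (j <= M)%N then P j x - P j.+1 x else P j x.

Let mP j : measurable_fun setT (P j).
Proof. by case: j => [|j] //=; exact: meas_Ek. Qed.

Let Poo j : (nl2 mu (P j) < +oo)%E.
Proof. by case: j => [|j] //=; exact: nl2_Ek. Qed.

Let mD j : measurable_fun setT (D j).
Proof. by rewrite /D; case: leqP => _; [have h1 := mP j; have h2 := mP j.+1; meas|exact: mP]. Qed.

Let Doo j : (nl2 mu (D j) < +oo)%E.
Proof. by rewrite /D; case: leqP => _; [exact: nl2B_fin|exact: Poo]. Qed.

Let loc k u : measurable_fun setT u -> (nl2 mu u < +oo)%E -> locint (r * 2 ^+ k) u.
Proof. by move=> m_u uoo; exact: locint2. Qed.

Let EP i j x : (j <= i.+1)%N -> E (r * 2 ^+ i) (P j) x = Ek r g i x.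
Proof.
case: j => [//|j] ji; rewrite /P /Ek E_tower//; exact: loc.
Qed.

Let ED i j x : (j <= i)%N -> (j <= M)%N -> E (r * 2 ^+ i) (D j) x = 0.
Proof.
move=> ji jM; rewrite /D jM E_B//; [|exact: loc|exact: loc].
by rewrite !EP ?subrr// (leq_trans ji).
Qed.

Let nl2P j : (j <= M)%N -> nl2 mu (P j) = (nl2 mu (D j) + nl2 mu (P j.+1))%E.
Proof.
move=> jM; rewrite /D jM -nl2_orth//.
- by apply: eq_integral => x _; rewrite subrK.
- by have h1 := mP j; have h2 := mP j.+1; meas.
- exact: nl2B_fin.
case: j jM => [|j] jM /=; last first.
  apply: (E_orth r0 mg goo (leqnSn j)); last exact: nl2_Ek.
  exact: E_cellconst.
under eq_Rintegral do rewrite mulrBl.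
have iE : intg mu (fun x => g x * Ek r g 0 x).
  by apply: intgM => //; [exact: meas_Ek|exact: nl2_Ek].
rewrite RintegralB//; last first.
  by apply: intgM; [exact: meas_Ek|exact: meas_Ek|exact: nl2_Ek|exact: nl2_Ek].
rewrite -(E_adj (rk 0) mg (loc 0 mg goo) (E_cellconst g) (intg_nl1 iE)).
by rewrite subrr.
Qed.

Let sumD : (\sum_(j < M.+2) nl2 mu (D j) = nl2 mu g)%E.
Proof.
suff : forall k, (k <= M.+1)%N ->
    nl2 mu g = (\sum_(j < k) nl2 mu (D j) + nl2 mu (P k))%E.
  by move=> /(_ M.+1 (leqnn _)) ->; rewrite big_ord_recr/= {2}/D ltnn.
elim=> [_|k IH kM]; first by rewrite big_ord0 add0e.
by rewrite big_ord_recr/= -addeA -nl2P// -IH// ltnW.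
Qed.

Let sumDE x : \sum_(j < M.+2) D j x = g x.
Proof.
suff : forall k, (k <= M.+1)%N -> g x = \sum_(j < k) D j x + P k x.
  by move=> /(_ M.+1 (leqnn _)) ->; rewrite big_ord_recr/= {2}/D ltnn.
elim=> [_|k IH kM]; first by rewrite big_ord0 add0r.
have DE : D k x = P k x - P k.+1 x by rewrite /D -ltnS kM.
by rewrite big_ord_recr/= -addrA DE subrK -IH// ltnW.
Qed.

Let c1 := Lam * n%:R * 4 ^+ n.
Let C0 := c1 ^+ 2 + 8 * n%:R.

Let Tt i j x := conv (dil phi (r * 2 ^+ i)) (D j) x - E (r * 2 ^+ i) (D j) x.

Let mTt i j : measurable_fun setT (Tt i j).
Proof.
have h1 := meas_conv (meas_dil bphi (r * 2 ^+ i)) (mD j).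
have h2 := meas_E (rk i) (D j); rewrite /Tt; meas.
Qed.

(** If [j <= i], then [D j] has mean zero on cells of scale [j] and the bump gains by [fine_nl2]. If
    [j > i], then [D j] is constant on cells of scale [j - 1 >= i], its average at scale [i] is
    itself, and [coarse_nl2] applies. The first gain is squared; only one power is kept. *)
Let nl2T i j : (i <= M)%N -> (j <= M.+1)%N ->
  (nl2 mu (Tt i j) <= (C0 * 2^-1 ^+ dst i j)%:E * nl2 mu (D j))%E.
Proof.
move=> iM jM; have [ji|ij] := leqP j i.
  have jM' : (j <= M)%N by exact: leq_trans iM.
  have z x : E (r * 2 ^+ j) (D j) x = 0 by apply: ED.
  rewrite (_ : nl2 mu (Tt i j) = nl2 mu (conv (dil phi (r * 2 ^+ i)) (D j))); last first.
    by apply: eq_integral => x _; rewrite /Tt ED// subr0.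
  have rji : r * 2 ^+ j <= r * 2 ^+ i by rewrite ler_pM2l// ler_eXn2l// ltr1n.
  apply: le_trans (fine_nl2 bphi (rk j) rji (mD j) (or_intror (Doo j)) z Lam_gt0 n0) _.
  rewrite lee_wpmul2r ?nl2_ge0// lee_fin -/c1.
  rewrite (_ : r * 2 ^+ j / (r * 2 ^+ i) = 2^-1 ^+ dst i j); last first.
    rewrite /dst (_ : (j - i = 0)%N) ?addn0; last by apply/eqP; rewrite subn_eq0.
    rewrite -{1}(subnK ji) exprD exprVn; field.
    by rewrite !expf_neq0 ?gt_eqF.
  have h0 : 0 <= (2^-1 : R) ^+ dst i j by rewrite exprn_ge0.
  have h1 : (2^-1 : R) ^+ dst i j <= 1 by rewrite exprn_ile1// invf_le1// ler1n.
  rewrite exprMn /C0 mulrDl; apply: (@le_trans _ _ (c1 ^+ 2 * 2^-1 ^+ dst i j)).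
    by rewrite mulrC ler_wpM2l ?sqr_ge0// expr2 ler_piMr.
  by rewrite lerDl !mulr_ge0.
case: j ij jM => [//|j] ij jM; rewrite ltnS in ij.
have dc : cellconst (r * 2 ^+ j) (D j.+1).
  have c1' : cellconst (r * 2 ^+ j) (P j.+1) by exact: E_cellconst.
  have c2' : cellconst (r * 2 ^+ j) (P j.+2).
    by apply: (cellconst_scale r0 (leqnSn j)); exact: E_cellconst.
  by move=> x y xy; rewrite /D; case: leqP => _; rewrite (c1' _ _ xy) ?(c2' _ _ xy).
rewrite (_ : nl2 mu (Tt i j.+1) =
    nl2 mu (fun x => conv (dil phi (r * 2 ^+ i)) (D j.+1) x - D j.+1 x)); last first.
  apply: eq_integral => x _; rewrite /Tt (E_id (rk i) x (cellconst_scale r0 ij dc))//.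
have rij : r * 2 ^+ i <= r * 2 ^+ j by rewrite ler_pM2l// ler_eXn2l// ltr1n.
apply: le_trans (coarse_nl2 bphi (rk i) rij dc (Doo j.+1)) _.
rewrite lee_wpmul2r ?nl2_ge0// lee_fin.
rewrite (_ : r * 2 ^+ i / (r * 2 ^+ j) = 2 * 2^-1 ^+ dst i j.+1); last first.
  rewrite /dst (_ : (i - j.+1 = 0)%N) ?add0n; last by apply/eqP; rewrite subn_eq0 (leq_trans ij).
  rewrite subSn// exprS -{1}(subnKC ij) exprD exprVn; field.
  by rewrite !expf_neq0 ?gt_eqF.
apply: (@le_trans _ _ (8 * n%:R * 2^-1 ^+ dst i j.+1)).
  by rewrite le_eqVlt; apply/orP; left; apply/eqP; ring.
by rewrite /C0 [leRHS]mulrDl lerDr mulr_ge0 ?sqr_ge0// exprn_ge0.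
Qed.

Let conv_sum i x k : conv (dil phi (r * 2 ^+ i)) (fun y => \sum_(j < k) D j y) x =
  \sum_(j < k) conv (dil phi (r * 2 ^+ i)) (D j) x.
Proof.
elim: k => [|k IH].
  rewrite big_ord0 /conv; under eq_Rintegral do rewrite big_ord0 mulr0.
  by rewrite Rintegral_cst// mul0r.
rewrite big_ord_recr/= -IH /conv -RintegralD//.
- by apply: eq_Rintegral => y _; rewrite big_ord_recr/= mulrDr.
- have -> : (fun y => dil phi (r * 2 ^+ i) (x - y) * (\sum_(j < k) D j y)) =
    (fun y => \sum_(j < k) (dil phi (r * 2 ^+ i) (x - y) * D j y)).
    by apply/funext => y; rewrite mulr_sumr.
  elim: k {IH} => [|k IH].
    have := @integrable0 _ _ _ mu setT; apply: eq_integrable => // y _.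
    by rewrite /= big_ord0.
  have := intgD IH (intg_dil_mul x (rk i) (mD k) (or_intror (Doo k))).
  by apply: eq_integrable => // y _; rewrite /= big_ord_recr.
- exact: (intg_dil_mul x (rk i) (mD k) (or_intror (Doo k))).
Qed.

Let E_sum i x k : E (r * 2 ^+ i) (fun y => \sum_(j < k) D j y) x =
  \sum_(j < k) E (r * 2 ^+ i) (D j) x.
Proof.
have L : locint (r * 2 ^+ i) (fun y => \sum_(j < k) D j y).
  elim: k => [|k IH] y.
    have := @integrable0 _ _ _ mu setT; apply: eq_integrable => // z _.
    by rewrite /= big_ord0 mulr0.
  have := intgD (IH y) (loc i (mD k) (Doo k) y).
  by apply: eq_integrable => // z _; rewrite /= big_ord_recr/= mulrDr.
elim: k L => [|k IH] L.
  rewrite big_ord0 /E; under eq_Rintegral do rewrite big_ord0 mulr0.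
  by rewrite Rintegral_cst// mul0r.
have Lk : locint (r * 2 ^+ i) (fun y => \sum_(j < k) D j y).
  move=> y; have := intgB (L y) (loc i (mD k) (Doo k) y).
  by apply: eq_integrable => // z _; rewrite /= big_ord_recr/= mulrDr addrK.
rewrite big_ord_recr/= -(IH Lk) -E_D//; last exact: loc.
by congr E; apply/funext => y; rewrite big_ord_recr.
Qed.

Definition sqd i x := conv (dil phi (r * 2 ^+ i)) g x - E (r * 2 ^+ i) g x.

Lemma meas_sqd i : measurable_fun setT (sqd i).
Proof.
have h1 := meas_conv (meas_dil bphi (r * 2 ^+ i)) mg.
have h2 := meas_E (rk i) g; rewrite /sqd; meas.
Qed.

(** The geometric decay off the diagonal is shared out between a weighted Cauchy-Schwarz inequality
    in [j] and a sum over [i]. *)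
Lemma square_function : (\sum_(i < M.+1) nl2 mu (sqd i) <= (48 * C0)%:E * nl2 mu g)%E.
Proof.
have gE : g = (fun y => \sum_(j < M.+2) D j y) by apply/funext => y; rewrite sumDE.
have dE i x : sqd i x = \sum_(j < M.+2) Tt i j x.
  by rewrite /sqd {1 2}gE conv_sum E_sum -sumrB.
(* Any ratio strictly between 1/2 and 1 works. These weights sum to at most 8; the decay left is
   [(1/2) / (3/4) = 2/3], summing to at most 6, whence the constant 48. *)
pose c i j : R := (3 / 4) ^+ dst i j.
have c0 i j : 0 < c i j by rewrite exprn_gt0.
have cS i : \sum_(j < M.+2) c i j <= 8.
  apply: le_trans (@dst_sum R (3 / 4) i M.+2 ltac:(lra) ltac:(lra)) _.
  by rewrite (_ : 1 - 3 / 4 = 4^-1) ?invrK; [lra|by field].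
have h i : (i <= M)%N -> (nl2 mu (sqd i) <= 8%:E * \sum_(j < M.+2) ((C0 * (2 / 3) ^+ dst i j)%:E * nl2 mu (D j)))%E.
  move=> iM; apply: (@le_trans _ _ (\int[mu]_x (8 * \sum_(j < M.+2) (c i j)^-1 * Tt i j x ^+ 2)%:E)%E).
    apply: le_nl.
    - by have := meas_sqd i => m; meas.
    - by apply: measurable_funM => //; apply: measurable_sum => j; have := mTt i j => m; meas.
    move=> x; rewrite sqr_ge0/= dE.
    have := @sum_CS _ 'I_M.+2 (c i) (fun j => Tt i j x) 8 ltac:(lra) (c0 i) (cS i).
    move/le_trans; apply; rewrite ler_wpM2l//; apply: ler_sum => j _.
    by rewrite mulrC.
  rewrite ge0_nlZ//; last 2 first.
  - by apply: measurable_sum => j; have := mTt i j => m; meas.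
  - by move=> x; apply: sumr_ge0 => j _; rewrite mulr_ge0 ?sqr_ge0// invr_ge0 ltW.
  rewrite lee_wpmul2l// ge0_nl_sum//; last 2 first.
  - by move=> j; have := mTt i j => m; meas.
  - by move=> j x; rewrite mulr_ge0 ?sqr_ge0// invr_ge0 ltW.
  apply: lee_sum => j _; rewrite ge0_nlZ//; last 3 first.
  - by have := mTt i j => m; meas.
  - by rewrite invr_ge0 ltW.
  - by move=> x; exact: sqr_ge0.
  apply: le_trans (lee_wpmul2l _ (nl2T iM _)) _.
  - by rewrite lee_fin invr_ge0 ltW.
  - by rewrite -ltnS.
  rewrite muleA -EFinM le_eqVlt; apply/orP; left; apply/eqP; congr (_%:E * _)%E.
  rewrite mulrCA /c -exprVn -exprMn; congr (_ * _ ^+ _).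
  by field.
apply: (@le_trans _ _ (\sum_(i < M.+1) (8%:E * \sum_(j < M.+2) ((C0 * (2 / 3) ^+ dst i j)%:E * nl2 mu (D j))))%E).
  by apply: lee_sum => i _; apply: h; rewrite -ltnS.
have C00 : 0 <= C0 by rewrite addr_ge0 ?sqr_ge0// mulr_ge0.
have t0 i j : (0 <= (C0 * (2 / 3) ^+ dst i j)%:E * nl2 mu (D j))%E.
  by rewrite mule_ge0 ?nl2_ge0// lee_fin mulr_ge0// exprn_ge0.
rewrite -ge0_sume_distrr; last by move=> i _; apply: sume_ge0.
rewrite exchange_big/=.
apply: (@le_trans _ _ (8%:E * \sum_(j < M.+2) ((6 * C0)%:E * nl2 mu (D j)))%E).
  rewrite lee_wpmul2l//; apply: lee_sum => j _.
  rewrite -ge0_sume_distrl; last by move=> i _; rewrite lee_fin mulr_ge0// exprn_ge0.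
  rewrite lee_wpmul2r ?nl2_ge0// sumEFin lee_fin -mulr_sumr mulrC ler_wpM2r//.
  rewrite (eq_bigr (fun i : 'I_M.+1 => (2 / 3) ^+ dst j i)); last by move=> i _; rewrite dstC.
  apply: le_trans (@dst_sum R (2 / 3) j M.+1 ltac:(lra) ltac:(lra)) _.
  by rewrite (_ : 1 - 2 / 3 = 3^-1) ?invrK; [lra|by field].
rewrite -ge0_sume_distrr; last by move=> j _; exact: nl2_ge0.
rewrite sumD muleA -EFinM le_eqVlt; apply/orP; left; apply/eqP.
by congr (_%:E * _)%E; ring.
Qed.

End square_function.

Section lq_minkowski.
Context {R : realType}.

(** Holder's inequality against the extremal vector [sg a * |a|^(q-1)], from Young's inequality
    applied to normalized entries. The case [h = 0], where normalizing is impossible, forces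
    [e = 0]. *)
Lemma lq_dual (q h s : R) (L : nat) (a e : nat -> R) : 1 < q -> 0 <= h -> 0 < s ->
  \sum_(1 <= k < L) `|a k| `^ q = s `^ q -> \sum_(1 <= k < L) `|e k| `^ q <= h `^ q ->
  \sum_(1 <= k < L) e k * (Num.sg (a k) * `|a k| `^ (q - 1)) <= h * s `^ (q - 1).
Proof.
move=> q1 h0 s0 aS eh; have q0 : 0 < q by rewrite (lt_trans _ q1).
have q10 : 0 < q - 1 by rewrite subr_gt0.
apply: (@le_trans _ _ (\sum_(1 <= k < L) `|e k| * `|a k| `^ (q - 1))).
  apply: ler_sum => k _; apply: le_trans (ler_norm _) _.
  rewrite !normrM mulrA [`|_ `^ _|]ger0_norm ?powR_ge0// ler_wpM2r ?powR_ge0//.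
  by rewrite ler_piMr// normr_sg; case: (_ != _).
move: h0; rewrite le_eqVlt => /predU1P[h0|h0].
  rewrite -h0 powR0 ?gt_eqF// in eh; rewrite -h0 mul0r.
  have z k : (1 <= k < L)%N -> e k = 0.
    move=> kL; have : `|e k| `^ q <= 0.
      apply: le_trans eh; rewrite (big_rem k)/=; last by rewrite mem_index_iota.
      by rewrite lerDl; apply: sumr_ge0 => i _; exact: powR_ge0.
    rewrite le_eqVlt ltNge powR_ge0 orbF => /eqP/powR_eq0_eq0 /eqP.
    by rewrite normr_eq0 => /eqP.
  rewrite big_nat_cond big1// => k /andP[kL _].
  by rewrite z// normr0 mul0r.
have sq : 0 < s `^ q by exact: powR_gt0.
have hq : 0 < h `^ q by exact: powR_gt0.
have sq1 : 0 < s `^ (q - 1) by exact: powR_gt0.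
have p0 : 0 < q / (q - 1) by exact: divr_gt0.
have pq : q^-1 + (q / (q - 1))^-1 = 1.
  by field; rewrite !gt_eqF.
have young k : `|e k| * `|a k| `^ (q - 1) <=
   h * s `^ (q - 1) * (`|e k| `^ q / h `^ q / q + `|a k| `^ q / s `^ q / (q / (q - 1))).
  have := @conjugate_powR _ (`|e k| / h) ((`|a k| / s) `^ (q - 1)) _ _
    (divr_ge0 (normr_ge0 _) (ltW h0)) (powR_ge0 _ _) q0 p0 pq.
  rewrite -powRrM (_ : (q - 1) * (q / (q - 1)) = q); last by field; rewrite gt_eqF.
  rewrite !powRM ?invr_ge0 ?(ltW h0) ?(ltW s0)//.
  have iv (x y : R) : 0 <= x -> x^-1 `^ y = (x `^ y)^-1.
    by move=> x0; rewrite -powR_inv1// -powRrM mulN1r powRN.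
  rewrite !iv ?(ltW h0) ?(ltW s0)// => H.
  rewrite -ler_pdivrMl ?mulr_gt0//; apply: le_trans H.
  by rewrite le_eqVlt; apply/orP; left; apply/eqP; field; rewrite !gt_eqF.
apply: le_trans (ler_sum _ (fun k _ => young k)) _.
rewrite -mulr_sumr big_split/= -!mulr_suml aS ler_piMr//.
  by rewrite mulr_ge0 ?powR_ge0// ltW.
rewrite (divff (lt0r_neq0 sq)) mul1r -[leRHS]pq lerD2r.
rewrite -[leRHS]mul1r ler_wpM2r ?invr_ge0 ?(ltW q0)//.
by rewrite ler_pdivrMr// mul1r.
Qed.

(** Minkowski's integral inequality for l^q by duality: the variation of the integral is paired with
    its own extremal vector, the pairing is moved under the integral sign, and [lq_dual] is applied
    pointwise. *)
Lemma pvar_minkowski d (Y : measurableType d) (m : {measure set Y -> \bar R})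
    (q : R) t L (D : nat -> Y -> R) (H : Y -> R) : 1 < q ->
  (forall i, intg m (D i)) -> intg m H -> (forall y, 0 <= H y) ->
  (forall y, pvar q (D ^~ y) t L <= H y `^ q) ->
  pvar q (fun i => \int[m]_y D i y) t L <= (\int[m]_y H y) `^ q.
Proof.
move=> q1 iD iH H0 hD; have q0 : 0 < q by rewrite (lt_trans _ q1).
set a := fun k => \int[m]_y D (t k) y - \int[m]_y D (t k.-1) y.
set S := pvar _ _ _ _; have I0 : 0 <= \int[m]_y H y by exact: Rintegral_ge0.
have SE : S = \sum_(1 <= k < L) `|a k| `^ q by [].
have : 0 <= S by exact: pvar_ge0.
rewrite le_eqVlt => /predU1P[<-|S0]; first exact: powR_ge0.
pose s := S `^ q^-1; have s0 : 0 < s by exact: powR_gt0.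
have sS : s `^ q = S by rewrite /s -powRrM mulVf ?gt_eqF// powRr1// ltW.
pose l k := Num.sg (a k) * `|a k| `^ (q - 1).
have iB k : intg m (fun y => D (t k) y - D (t k.-1) y) by exact: intgB.
have aE k : a k = \int[m]_y (D (t k) y - D (t k.-1) y) by rewrite RintegralB//; exact: iD.
have lin : forall s' : seq nat, intg m (fun y => \sum_(k <- s') (D (t k) y - D (t k.-1) y) * l k) /\
    \sum_(k <- s') a k * l k = \int[m]_y \sum_(k <- s') (D (t k) y - D (t k.-1) y) * l k.
  elim=> [|k s' [IH1 IH2]].
    split.
      have := @integrable0 _ _ _ m setT; apply: eq_integrable => // y _.
      by rewrite /= big_nil.
    rewrite big_nil; under eq_Rintegral do rewrite big_nil.
    by rewrite Rintegral_cst// mul0r.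
  have ik : intg m (fun y => (D (t k) y - D (t k.-1) y) * l k).
    by have := intgZ (l k) (iB k); apply: eq_integrable => // y _; rewrite /= mulrC.
  split.
    have := intgD ik IH1; apply: eq_integrable => // y _.
    by rewrite /= big_cons.
  rewrite big_cons IH2 aE -RintegralZr//; last exact: iB.
  by rewrite -RintegralD//; apply: eq_Rintegral => y _; rewrite big_cons.
have SI : S <= \int[m]_y H y * s `^ (q - 1).
  have -> : S = \sum_(1 <= k < L) a k * l k.
    rewrite SE; apply: eq_bigr => k _; rewrite /l mulrA [a k * _]mulrC -normrEsg.
    by rewrite mulr_powRB1.
  have [i1 ->] := lin (index_iota 1 L).
  rewrite -RintegralZr//; apply: le_Rintegral => //.
    by have := intgZ (s `^ (q - 1)) iH; apply: eq_integrable => // y _; rewrite /= mulrC.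
  move=> y _; apply: (lq_dual q1 (H0 y) s0 (a := a)); last exact: hD.
  by rewrite -SE sS.
rewrite -sS in SI *; have q10 : 0 <= q - 1 by rewrite subr_ge0 ltW.
rewrite -(mulr_powRB1 (ltW s0) q0) ler_pM2r ?powR_gt0// in SI.
by rewrite ge0_ler_powR ?nnegrE// ltW.
Qed.

End lq_minkowski.

Section bump_weak22.
Context {R : realType} {n : nat}.
Local Notation mu := (@lebesgue_rV R n).
Local Notation rV := 'rV[R]_n.

(* The cutoff makes sums over scales finite; the jump to 0 that it adds only
   enlarges the variation. *)
Definition upto (M : nat) (F : nat -> rV -> R) i x : R := if (i <= M)%N then F i x else 0.

(** [pvarD] replaces the triangle inequality: with both terms at most [(al/4)^q], the sum is at most
    [2 * 2^q * (al/4)^q <= al^q]. *)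
Lemma VsetD (q : R) (F G : nat -> rV -> R) (al : R) : 1 <= q -> 0 < al ->
  Vset q (fun i x => F i x + G i x) al `<=` Vset q F (al / 4) `|` Vset q G (al / 4).
Proof.
move=> q1 al0 x [t [L [tm h]]]; have q0 : 0 <= q by exact: le_trans q1.
have [h1|h1] := ltP ((al / 4) `^ q) (pvar q (F ^~ x) t L); first by left; exists t, L.
have [h2|h2] := ltP ((al / 4) `^ q) (pvar q (G ^~ x) t L); first by right; exists t, L.
exfalso; move: h; apply/negP; rewrite -leNgt.
apply: le_trans (pvarD _ _ _ _ q0) _.
apply: le_trans (ler_wpM2l _ (lerD h1 h2)) _; first exact: powR_ge0.
have h4 : 4 `^ q * (al / 4) `^ q = al `^ q.
  by rewrite -powRM ?divr_ge0 ?(ltW al0)// mulrC divfK.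
have h22 : (4 : R) `^ q = 2 `^ q * 2 `^ q by rewrite -powRM// -natrM.
rewrite (_ : _ + _ = 2 * (al / 4) `^ q); last by ring.
rewrite -h4 mulrA ler_wpM2r ?powR_ge0// h22 ler_wpM2l ?powR_ge0//.
by rewrite le1r_powR// ler1n.
Qed.

(** The averages are handled by [mart_weak]. The differences between bumps and averages have their
    l^q variation below their l^2 norm over the scales, which the square function controls. *)
Lemma bump_weak22 (q Lam : R) : 2 < q -> (0 < n)%N -> 0 < Lam -> exists2 C : R, 0 <= C &
  forall (phi : rV -> R) (r : R) (g : rV -> R) M al, bump phi Lam -> 0 < r ->
    measurable_fun setT g -> (nl2 mu g < +oo)%E -> 0 < al ->
    omeas mu (Vset q (upto M (fun i => conv (dil phi (r * 2 ^+ i)) g)) al)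
      ((C / al ^+ 2)%:E * nl2 mu g).
Proof.
move=> q2 n0 L0; have [C C0 hC] := @mart_weak R n q q2.
have q0 : 0 < q by rewrite (lt_trans _ q2).
pose C1 : R := 48 * ((Lam * n%:R * 4 ^+ n) ^+ 2 + 8 * n%:R).
have C10 : 0 <= C1 by rewrite mulr_ge0// addr_ge0 ?sqr_ge0// mulr_ge0.
have C20 : 0 <= 16 * (16 * C1) by apply: mulr_ge0; [exact: ler0n|apply: mulr_ge0; [exact: ler0n|]].
have C30 : 0 <= 16 * C by apply: mulr_ge0; [exact: ler0n|].
exists (16 * C + 16 * (16 * C1)); first exact: addr_ge0.
move=> phi r g M al bphi r0 mg goo al0.
have al4 : 0 < al / 4 by rewrite divr_gt0.
have h1 := hC r g M _ r0 mg goo al4.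
pose sd := sqd phi r g.
have msd i : measurable_fun setT (sd i) by exact: (meas_sqd bphi).
pose G x : \bar R := (\sum_(i < M.+1) sd i x ^+ 2)%:E.
have mG : measurable_fun setT G.
  by apply/measurable_EFinP; apply: measurable_sum => i; have := msd i => m; meas.
have G0 x : (0 <= G x)%E by rewrite lee_fin; apply: sumr_ge0 => i _; exact: sqr_ge0.
(* [pvar_lq] loses [2 * 2^q <= 4^q], so an l^2 norm below [al / 16] keeps the variation below
   [al / 4]. *)
have a0 : 0 < (al / 16) ^+ 2 by rewrite exprn_gt0// divr_gt0.
have h2 := emarkov mu a0 mG G0.
have iG : (\int[mu]_x G x <= C1%:E * nl2 mu g)%E.
  have := square_function bphi n0 L0 M r0 mg goo; apply: le_trans.
  rewrite /G ge0_nl_sum//.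
  - by move=> i; have := msd i => m; meas.
  - by move=> i x; exact: sqr_ge0.
have {}h2 : omeas mu [set x | (((al / 16) ^+ 2)%:E <= G x)%E]
    ((16 * (16 * C1) / al ^+ 2)%:E * nl2 mu g).
  apply: omeas_le h2; apply: le_trans (lee_wpmul2l _ iG) _.
    by rewrite lee_fin invr_ge0 ltW.
  rewrite muleA -EFinM le_eqVlt; apply/orP; left; apply/eqP; congr (_%:E * _)%E.
  by field; rewrite gt_eqF.
have := omeasU h1 h2; rewrite -ge0_muleDl; last 2 first.
- by rewrite lee_fin divr_ge0 ?sqr_ge0.
- by rewrite lee_fin divr_ge0 ?sqr_ge0.
rewrite -EFinD (_ : C / (al / 4) ^+ 2 + _ = (16 * C + 16 * (16 * C1)) / al ^+ 2); last first.
  by field; rewrite gt_eqF.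
apply: omeas_sub.
have -> : upto M (fun i => conv (dil phi (r * 2 ^+ i)) g) =
    (fun i x => Atr r g M i x + upto M sd i x).
  apply/funext => i; apply/funext => x; rewrite /upto /Atr /sd /sqd /Ek.
  by case: ifP => _; rewrite ?addr0// addrC subrK.
have q1 : 1 <= q by rewrite (le_trans _ (ltW q2))// ler1n.
apply: subset_trans (VsetD q1 al0) _; apply: setUS => x [t [L [tm h]]] /=.
rewrite lee_fin leNgt; apply/negP => hs; move: h; apply/negP; rewrite -leNgt.
have uz i : (M < i)%N -> upto M sd i x = 0 by rewrite /upto ltnNge => /negbTE ->.
apply: le_trans (pvar_lq _ q0 tm uz) _.
have s0 : 0 <= al / 16 by rewrite divr_ge0// ltW.
have := @lq_l2 _ q (upto M sd ^~ x) M.+1 _ (ltW q2) s0.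
have -> : \sum_(i < M.+1) upto M sd i x ^+ 2 = \sum_(i < M.+1) sd i x ^+ 2.
  by apply: eq_bigr => i _; rewrite /upto -ltnS ltn_ord.
move=> /(_ (ltW hs)) h3.
apply: le_trans (ler_wpM2l _ h3) _; first by rewrite mulr_ge0// powR_ge0.
have -> : al / 4 = 4 * (al / 16) by field.
rewrite [leRHS]powRM// ler_wpM2r ?powR_ge0//.
have -> : (4 : R) `^ q = 2 `^ q * 2 `^ q by rewrite -powRM// -natrM.
by rewrite ler_wpM2r ?powR_ge0// le1r_powR// ler1n.
Qed.

End bump_weak22.

(** * Calderon-Zygmund decomposition *)

Section cz_decomposition.
Context {R : realType} {n : nat}.
Local Notation mu := (@lebesgue_rV R n).
Local Notation rV := 'rV[R]_n.
Implicit Types (x y z : rV).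

Lemma omeas_big d (T : measurableType d) (m : {measure set T -> \bar R}) (I : Type)
    (s : seq I) (S : I -> set T) (c : I -> \bar R) :
  (forall i, omeas m (S i) (c i)) ->
  omeas m (\big[setU/set0]_(i <- s) S i) (\sum_(i <- s) c i)%E.
Proof.
move=> h; elim: s => [|i s IH]; last by rewrite !big_cons; exact: omeasU.
by rewrite !big_nil; exists set0; split; rewrite ?measure0.
Qed.

Lemma Rint_sum d (T : measurableType d) (m : {measure set T -> \bar R}) (K : nat)
    (f : nat -> T -> R) : (forall j, intg m (f j)) ->
  intg m (fun w => \sum_(j < K) f j w) /\
  \int[m]_w (\sum_(j < K) f j w) = \sum_(j < K) \int[m]_w f j w.
Proof.
move=> h; elim: K => [|K [IH1 IH2]].
  split.
    have := @integrable0 _ _ _ m setT; apply: eq_integrable => // y _.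
    by rewrite /= big_ord0.
  rewrite big_ord0; under eq_Rintegral do rewrite big_ord0.
  by rewrite Rintegral_cst// mul0r.
split.
  by have := intgD IH1 (h K); apply: eq_integrable => // y _; rewrite /= big_ord_recr.
rewrite big_ord_recr/= -IH2 -RintegralD//; last exact: h.
by apply: eq_Rintegral => y _; rewrite big_ord_recr.
Qed.

Variables (q rho : R) (L : nat -> rV -> R) (c : nat).
Hypothesis q1 : 1 < q.
Hypothesis rho0 : 0 < rho.
Hypothesis mL : forall i, measurable_fun setT (L i).
Hypothesis Lb : forall i, exists b : R, forall x, `|L i x| <= b.

Let rk j := rho * 2 ^+ j.

Let rk0 j : 0 < rk j.
Proof. by rewrite mulr_gt0// exprn_gt0. Qed.

Variables (u : rV -> R) (s : R) (J0 : nat).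
Hypothesis cu : cellconst rho u.
Hypothesis u1 : (nl1 mu u < +oo)%E.
Hypothesis s0 : 0 < s.

Let m_u : measurable_fun setT u := meas_cellconst rho0 cu.
Let au x : R := `|u x|.
Let au0 x : 0 <= au x. Proof. exact: normr_ge0. Qed.
Let m_au : measurable_fun setT au.
Proof. by rewrite /au; meas. Qed.
Let iu : intg mu u := intgP m_u u1.
Let iau : intg mu au.
Proof. by apply: (le_intg m_au iu) => x; rewrite /au normr_id. Qed.
Let A j : rV -> R := E (rk j) au.
Let e j : rV -> R := E (rk j) u.

Hypothesis AJ0 : forall x, A J0 x <= s.

(* The stopping cells: [j] is the largest scale at which the average of [|u|]
   exceeds [s]. *)
Let sg j x : R := ((s < A j x) && [forall i : 'I_J0, (j < i)%N ==> (A i x <= s)])%:R.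

Let cell_le j k (S : Type) (h : rV -> S) : (j <= k)%N -> cellconst (rk k) h -> cellconst (rk j) h.
Proof. exact: cellconst_scale. Qed.

Let A_cell j : cellconst (rk j) (A j).
Proof. exact: E_cellconst. Qed.

(** The stopping rule at scale [j] only looks at averages on cells of scale at least [j]. *)
Let sg_cell j : cellconst (rk j) (sg j).
Proof.
move=> x y xy; have e1 : A j x = A j y by exact: A_cell.
have e2 : [forall i : 'I_J0, (j < i)%N ==> (A i x <= s)] =
          [forall i : 'I_J0, (j < i)%N ==> (A i y <= s)].
  apply: eq_forallb => i; case: ltnP => // ji.
  by have -> : A i x = A i y by exact: (cell_le (ltnW ji) (@A_cell i) xy).
by rewrite /sg e1 e2.
Qed.

Let msg j : measurable_fun setT (sg j).
Proof. exact: (meas_cellconst (rk0 j) (@sg_cell j)). Qed.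

Let sg_ge0 j x : 0 <= sg j x. Proof. exact: ler0n. Qed.
Let sg_le1 j x : sg j x <= 1. Proof. by rewrite /sg; case: (_ && _). Qed.

Let sg_uniq j k x : (j < J0)%N -> (k < J0)%N -> j != k -> sg j x != 0 -> sg k x = 0.
Proof.
wlog jk : j k / (j < k)%N.
  move=> h jJ kJ jk; case: (ltnP j k) => [jk'|kj]; first exact: h.
  move=> sj; apply/eqP; apply: contraNT sj => sk; apply/eqP; apply: (h k j) => //.
    by rewrite ltn_neqAle eq_sym jk.
  by rewrite eq_sym.
move=> _ kJ _; rewrite /sg; case: andP => [[_ /forallP h]|_]; last by rewrite eqxx.
have := h (Ordinal kJ); rewrite jk/= => Ak _.
by rewrite ltNge Ak.
Qed.

(** At most one stopping scale is active at each point, so sums weighted by [sg] collapse. *)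
Let sg_case x : (exists2 j, (j < J0)%N & sg j x = 1 /\
   forall f : nat -> R, \sum_(k < J0) sg k x * f k = f j) \/
  ((forall j, (j < J0)%N -> sg j x = 0) /\
   forall f : nat -> R, \sum_(k < J0) sg k x * f k = 0).
Proof.
have [/existsP[[j jJ] /= sj]|h] := boolP [exists j : 'I_J0, sg j x != 0]; [left|right].
  have sj1 : sg j x = 1 by move: sj; rewrite /sg; case: (_ && _); rewrite ?eqxx.
  exists j => //; split => // f; rewrite (bigD1 (Ordinal jJ))//= sj1 mul1r big1 ?addr0// => k kj.
  by rewrite (@sg_uniq j k) ?mul0r// eq_sym.
have z j : (j < J0)%N -> sg j x = 0.
  move=> jJ; apply/eqP; apply: contraNT h => sj; apply/existsP; by exists (Ordinal jJ).
by split=> // f; rewrite big1// => k _; rewrite z// mul0r.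
Qed.

(** On the stopping cells of scale [j] the bad part is [u] minus its average; the good part keeps
    that average. *)
Let b j x : R := sg j x * (u x - e j x).
Let g x : R := u x - \sum_(j < J0) b j x.

Let me j : measurable_fun setT (e j).
Proof. exact: meas_E. Qed.

Let mb j : measurable_fun setT (b j).
Proof. by have h1 := msg j; have h2 := me j; rewrite /b; meas. Qed.

Let b_cell j : cellconst rho (b j).
Proof.
move=> x y xy; have xy0 : cell (rk 0) x = cell (rk 0) y by rewrite /rk expr0 mulr1.
rewrite /b (cell_le (leq0n j) (@sg_cell j) xy0) (cu xy).
have -> : e j x = e j y by exact: (cell_le (leq0n j) (@E_cellconst _ _ (rk j) u) xy0).
by [].
Qed.

Let g_cell : cellconst rho g.
Proof.
by move=> x y xy; rewrite /g (cu xy); congr (_ - _); apply: eq_bigr => j _; exact: b_cell.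
Qed.

Let mg : measurable_fun setT g := meas_cellconst rho0 g_cell.

Let locu j : locint (rk j) u := locint1 (rk0 j) iu.
Let locau j : locint (rk j) au := locint1 (rk0 j) iau.

Let eA j x : `|e j x| <= A j x.
Proof. exact: E_norm. Qed.

(** A cell has [2^n] times less volume than its parent. *)
Let AS j x : A j x <= 2 ^+ n * A j.+1 x.
Proof.
rewrite /A /E -RintegralZl//; last exact: locau.
apply: le_Rintegral => //; first exact: locau.
  by apply: intgZ; exact: locau.
move=> y _; rewrite mulrA ler_wpM2r ?normr_ge0// /ce.
have [xy|_] := eqVneq (cell (rk j) x) (cell (rk j) y); last first.
  by rewrite mulr0; apply: mulr_ge0; rewrite ?exprn_ge0// ce_ge0.
have -> : rk j.+1 = rk j * 2 by rewrite /rk exprSr mulrA.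
have e2 : (rk j * 2) ^- n = rk j ^- n * 2 ^- n by rewrite exprMn invfM.
rewrite (cell_double (rk0 j) xy) eqxx e2 le_eqVlt; apply/orP; left; apply/eqP.
by field; rewrite !expf_neq0// gt_eqF.
Qed.

Let A0 x : A 0 x = au x.
Proof.
have -> : A 0 = E rho au by rewrite /A /rk expr0 mulr1.
by apply: E_id => //; move=> y y' yy'; rewrite /au (cu yy').
Qed.

(** On a stopping cell, [g] is an average, compared with the average on the parent; the parent
    satisfies the bound by maximality, or by [AJ0] when it has the top scale. Elsewhere [g = u], and
    [|u|] is its own average at scale 0 because [u] is constant on the smallest cells. *)
Let g_le x : `|g x| <= 2 ^+ n * s.
Proof.
have n1 : 1 <= 2 ^+ n :> R by rewrite exprn_ege1// ler1n.
rewrite /g; have [[j jJ [sj sE]]|[z sE]] := sg_case x.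
  rewrite (sE (fun j => u x - e j x)) opprB addrC subrK.
  apply: le_trans (eA _ _) _; apply: le_trans (AS _ _) _.
  rewrite ler_wpM2l ?exprn_ge0//.
  move: sj; rewrite /sg; case: andP => [[_ /forallP h] _|_ /eqP]; last by rewrite eq_sym oner_eq0.
  have [j1|j1] := ltnP j.+1 J0; first by have := h (Ordinal j1); rewrite /= ltnSn.
  by rewrite (_ : j.+1 = J0); [exact: AJ0|apply/eqP; rewrite eqn_leq jJ].
rewrite (sE (fun j => u x - e j x)) subr0.
apply: (@le_trans _ _ s); last by rewrite -[leLHS]mul1r ler_wpM2r// ltW.
rewrite -/(au x) -A0; have [J00|Jp] := posnP J0; first by rewrite -{1}J00.
rewrite leNgt; apply/negP => h.
have [k [kJ Ak kmax]] : exists k, [/\ (k < J0)%N, s < A k x & forall i, (k < i < J0)%N -> A i x <= s].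
  have hex : exists k, (k < J0)%N && (s < A k x) by exists 0%N; rewrite Jp.
  have hub k : (k < J0)%N && (s < A k x) -> (k <= J0)%N by move=> /andP[/ltnW].
  case: (ex_maxnP hex hub) => k /andP[kJ Ak] kmax; exists k; split => // i /andP[ki iJ].
  rewrite leNgt; apply/negP => Ai; have := kmax i; rewrite iJ Ai => /(_ isT).
  by rewrite leqNgt ki.
have := z k kJ; rewrite /sg Ak/=; case: forallP => [_ /eqP|[]]; first by rewrite oner_eq0.
by move=> i; apply/implyP => ki; apply: kmax; rewrite ki ltn_ord.
Qed.

Let U j : \bar R := (\int[mu]_x (sg j x * au x)%:E)%E.

Let msau j : measurable_fun setT (fun x => sg j x * au x).
Proof. by have := msg j => h; meas. Qed.

Let isau j : intg mu (fun x => sg j x * au x).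
Proof.
apply: (le_intg (msau j) iau) => x; rewrite normrM ler_piMl//.
by rewrite ger0_norm.
Qed.

(** The stopping set is a union of cells, so [|u|] and its average have the same mass on it. Since
    the average exceeds [s] there, Markov's inequality bounds its measure. *)
Let UE j : (U j = \int[mu]_x (sg j x * A j x)%:E)%E.
Proof.
have i2 : intg mu (fun x => au x * sg j x).
  by have := isau j; apply: eq_integrable => // x _; rewrite /= mulrC.
have i3 : intg mu (fun x => sg j x * A j x).
  have iA : intg mu (A j).
    by apply: (intgP (meas_E (rk0 j) au)); apply: le_lt_trans (nl1_E (rk0 j) m_au) (intg_nl1 iau).
  apply: (le_intg _ iA); first by have h1 := msg j; have h2 := intg_meas iA; meas.
  by move=> x; rewrite normrM ler_piMl// ger0_norm.
rewrite /U -(EFin_Rintegral (isau j)) -(EFin_Rintegral i3); congr EFin.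
have := E_adj (rk0 j) m_au (locau j) (@sg_cell j) (intg_nl1 i2) => h.
rewrite (_ : \int[mu]_x (sg j x * au x) = \int[mu]_x (au x * sg j x)); last first.
  by apply: eq_Rintegral => x _; rewrite mulrC.
by rewrite -h; apply: eq_Rintegral => x _; rewrite mulrC.
Qed.

Let U_ge0 j : (0 <= U j)%E.
Proof. by apply: integral_ge0 => x _; rewrite lee_fin mulr_ge0. Qed.

Let U_sum : (\sum_(j < J0) U j <= nl1 mu u)%E.
Proof.
rewrite /U -ge0_nl_sum//; last by move=> j x; rewrite mulr_ge0.
apply: le_nl => //; first by apply: measurable_sum => j; exact: msau.
move=> x; rewrite sumr_ge0/=; last by move=> j _; rewrite mulr_ge0.
by have [[j _ [_ /(_ (fun=> au x)) ->]]|[_ /(_ (fun=> au x)) ->]] := sg_case x.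
Qed.

Let nl1b j : (nl1 mu (b j) <= 2%:E * U j)%E.
Proof.
have -> : (2%:E * U j = U j + \int[mu]_x (sg j x * A j x)%:E)%E.
  by rewrite -UE -[2]/(1 + 1) EFinD ge0_muleDl ?lee_fin// mul1e.
have mA : measurable_fun setT (fun x => sg j x * A j x).
  by have h1 := msg j; have h2 := meas_E (rk0 j) au; rewrite /A; meas.
have A_ge0 x : 0 <= A j x by exact: E_norm_ge0.
rewrite /U -ge0_nlD//; [|by move=> x; rewrite mulr_ge0|by move=> x; rewrite mulr_ge0].
apply: le_nl; [by have := mb j => h; meas|by apply: measurable_funD|move=> x].
rewrite normr_ge0/= /b normrM ger0_norm// -mulrDr ler_wpM2l//.
by apply: le_trans (ler_normB _ _) _; rewrite lerD2l.
Qed.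

Let nl1b_sum : (\sum_(j < J0) nl1 mu (b j) <= 2%:E * nl1 mu u)%E.
Proof.
apply: le_trans (lee_sum _ (fun (j : 'I_J0) _ => nl1b j)) _.
by rewrite -ge0_sume_distrr//; apply: lee_wpmul2l => //; rewrite lee_fin.
Qed.

Let ib j : intg mu (b j).
Proof.
apply: intgP => //; apply: le_lt_trans (nl1b j) _.
by rewrite lte_mul_pinfty// /U; rewrite -(EFin_Rintegral (isau j)) ltry.
Qed.

Let nl1g : (nl1 mu g <= 3%:E * nl1 mu u)%E.
Proof.
apply: (@le_trans _ _ (nl1 mu u + \sum_(j < J0) nl1 mu (b j))%E); last first.
  rewrite (_ : 3 = 1 + 2 :> R); last by ring.
  have -> : ((1 + 2)%:E * nl1 mu u = nl1 mu u + 2%:E * nl1 mu u)%E.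
    by rewrite EFinD ge0_muleDl ?lee_fin// mul1e.
  exact: leeD2l.
have mn j : measurable_fun setT (fun x => `|b j x|) by have := mb j => h; meas.
rewrite /nl1 -ge0_nl_sum// -ge0_nlD//; last 2 first.
- by apply: measurable_sum.
- by move=> x; apply: sumr_ge0.
apply: le_nl; [by meas|by apply: measurable_funD => //; apply: measurable_sum|move=> x].
by rewrite normr_ge0/= /g; apply: le_trans (ler_normB _ _) _; rewrite lerD2l ler_norm_sum.
Qed.

Let nl2g : (nl2 mu g <= (3 * 2 ^+ n * s)%:E * nl1 mu u)%E.
Proof.
apply: (@le_trans _ _ ((2 ^+ n * s)%:E * nl1 mu g)%E).
  rewrite -ge0_nlZ//; [|by meas|by rewrite mulr_ge0 ?exprn_ge0// ltW].
  apply: le_nl; [by meas|by meas|move=> x].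
  by rewrite sqr_ge0/= -(real_normK (num_real _)) expr2 ler_wpM2r.
apply: le_trans (lee_wpmul2l _ nl1g) _; first by rewrite lee_fin mulr_ge0 ?exprn_ge0// ltW.
rewrite muleA -EFinM le_eqVlt; apply/orP; left; apply/eqP; congr (_%:E * _)%E.
by ring.
Qed.

(** Offsets by at most [c] cells in each coordinate, encoded in a finite type. [Om j] enlarges the
    stopping cells by these [(2c+1)^n] translations and takes the place of concentric dilates. *)
Let wv (w : {ffun 'I_n -> 'I_c.*2.+1}) : 'rV[int]_n := \row_i ((w i)%:Z - c%:Z).
Let Om j := \big[setU/set0]_w [set x | sg j (x - \row_i (rk j * (wv w ord0 i)%:~R)) != 0].

(** Were all index differences at most [c], one of the offsets would carry [x] into the stopping
    cell of [y]. *)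
Let far j x y : ~ Om j x -> sg j y != 0 -> exists i, rk j * c%:R <= `|(x - y) ord0 i|.
Proof.
move=> xO sy; have [/existsP[i hi]|] := boolP [exists i, (c%:Z < `|cell (rk j) x ord0 i - cell (rk j) y ord0 i|)%R].
  by exists i; rewrite !mxE; exact: (cell_far (rk0 j) hi).
rewrite negb_exists => /forallP h; exfalso; apply: xO.
rewrite /Om -bigcup_seq.
have h' i : (absz (cell (rk j) x ord0 i - cell (rk j) y ord0 i + c%:Z)%R < c.*2.+1)%N.
  have := h i; rewrite -leNgt; move: (_ - _) => d; lia.
set w := [ffun i => Ordinal (h' i)]; exists w; first by rewrite /= mem_index_enum.
rewrite /=; set x' := x - _; suff e1 : sg j x' = sg j y by rewrite e1.
apply: sg_cell; rewrite cell_shift//.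
apply/rowP => i; rewrite mxE [in X in _ + X]mxE [in X in _ + X]mxE ffunE/=.
have := h i; rewrite -leNgt; move: (cell _ x _ _) (cell _ y _ _) => d1 d2; lia.
Qed.

Let omS j : omeas mu [set x | sg j x != 0] ((s^-1)%:E * U j).
Proof.
have mG : measurable_fun setT (fun x => (sg j x * A j x)%:E).
  by apply/measurable_EFinP; have h1 := msg j; have h2 := meas_E (rk0 j) au; rewrite /A; meas.
have := emarkov mu s0 mG; rewrite -UE => h.
apply: omeas_sub (h _) => x /=; last first.
  by rewrite lee_fin mulr_ge0// E_norm_ge0.
by rewrite /sg lee_fin; case: andP => [[/ltW h1 _] _|_]; rewrite ?mul1r ?eqxx.
Qed.

Let omeas_shift S a v : omeas mu S a -> omeas mu [set x | S (x - v)] a.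
Proof.
move=> [B [mB SB Ba]].
have mshift : measurable ((fun x => x - v) @^-1` B).
  rewrite -[X in measurable X]setTI.
  have mv : measurable_fun setT (fun x : rV => x - v).
    by apply: measurable_rV_sub; [exact: measurable_id|exact: measurable_cst].
  exact: mv.
exists ((fun x => x - v) @^-1` B); split => //; first by move=> x /= /SB.
apply: le_trans Ba; rewrite le_eqVlt; apply/orP; left; apply/eqP.
have muE (D : set rV) : measurable D -> (mu D = \int[mu]_x (\1_D x)%:E)%E.
  by move=> mD; rewrite integral_indic// setIT.
apply: etrans (muE _ mshift) _; apply: etrans _ (esym (muE _ mB)).
have mI : measurable_fun setT (\1_B : rV -> R) by exact: measurable_indic.
by rewrite -(nl_shift (- v) mI)//; apply: eq_integral => x _; rewrite !indicE.
Qed.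

Let omOm : omeas mu (\big[setU/set0]_(j < J0) Om j)
  (((c.*2.+1 ^ n)%:R / s)%:E * nl1 mu u).
Proof.
have h : omeas mu (\big[setU/set0]_(j < J0) Om j)
    (\sum_(j < J0) \sum_(w : {ffun 'I_n -> 'I_c.*2.+1}) ((s^-1)%:E * U j))%E.
  apply: omeas_big => j; apply: omeas_big => w.
  exact: omeas_shift (omS j).
apply: omeas_le h.
have -> : (\sum_(j < J0) \sum_(w : {ffun 'I_n -> 'I_c.*2.+1}) ((s^-1)%:E * U j) =
    (((c.*2.+1 ^ n)%:R / s)%:E * \sum_(j < J0) U j))%E.
  rewrite [RHS]ge0_sume_distrr//; apply: eq_bigr => j _.
  rewrite -ge0_sume_distrl; last by move=> _ _; rewrite lee_fin invr_ge0 ltW.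
  by rewrite sumEFin sumr_const card_ffun !card_ord mulr_natl.
by rewrite lee_wpmul2l// lee_fin divr_ge0// ltW.
Qed.

(** The Hormander condition on the l^q variation of the kernels: for shifts within a cell of scale
    [j] and points at least [c] cells away, it is dominated by [Th j], with integral bounded
    uniformly in [j]. *)
Variables (Th : nat -> rV -> R) (B : R).
Hypothesis mTh : forall j, measurable_fun setT (Th j).
Hypothesis Th0 : forall j x, 0 <= Th j x.
Hypothesis ThB : forall j, (\int[mu]_x (Th j x)%:E <= B%:E)%E.
Hypothesis hoer : forall j z y, (forall i, `|y ord0 i| <= rk j) ->
  (exists i, rk j * c%:R <= `|z ord0 i|) -> forall t K, ndecr t ->
  pvar q (fun i => L i z - L i (z + y)) t K <= Th j z `^ q.

Let B0 : 0 <= B.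
Proof.
by rewrite -lee_fin; apply: le_trans (ThB 0); apply: integral_ge0 => x _; rewrite lee_fin.
Qed.

Let bad x : R := \sum_(j < J0) b j x.

Let intgLb i x f : intg mu f -> intg mu (fun y => L i (x - y) * f y).
Proof.
move=> fi; have [a ha] := Lb i; have mf := intg_meas fi; have := meas_refl x (mL i) => mr.
apply: (@le_intg _ _ _ mu _ (fun y => a * f y)); [by meas|exact: intgZ|move=> y].
by rewrite !normrM ler_wpM2r// (le_trans (ha _))// ler_norm.
Qed.

(** The kernel minus its value at the corner of the stopping cell, a subtraction that costs nothing
    since [b j] has mean zero on that cell. *)
Let Dk i x y : R := \sum_(j < J0) (L i (x - y) - L i (x - corner (rk j) y)) * b j y.

Let iD i x j : intg mu (fun y => (L i (x - y) - L i (x - corner (rk j) y)) * b j y).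
Proof.
have [a ha] := Lb i; have h1 := meas_refl x (mL i).
have h2 : measurable_fun setT (fun y => L i (x - corner (rk j) y)).
  exact: (meas_cellconst (rk0 j) (@cellconst_corner _ _ (rk j) (fun z => L i (x - z)))).
apply: (@le_intg _ _ _ mu _ (fun y => (a + a) * b j y)); [by have := mb j => h3; meas|exact: intgZ|move=> y].
rewrite !normrM ler_wpM2r//; apply: le_trans (ler_normB _ _) _.
by apply: le_trans (lerD (ha _) (ha _)) (ler_norm _).
Qed.

(** The kernel frozen at the corner is constant on cells of scale [j], so [E_adj] gives [u] and its
    average the same integral. *)
Let b_mean0 i x j : \int[mu]_y (L i (x - corner (rk j) y) * b j y) = 0.
Proof.
pose h y : R := sg j y * L i (x - corner (rk j) y).
have hc : cellconst (rk j) h.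
  move=> y y' yy'; rewrite /h (sg_cell yy'); congr (_ * _).
  exact: (@cellconst_corner _ _ (rk j) (fun z => L i (x - z)) y y' yy').
have mh := meas_cellconst (rk0 j) hc.
have [a ha] := Lb i.
have ih f : intg mu f -> intg mu (fun y => f y * h y).
  move=> fi; have mf := intg_meas fi; apply: (@le_intg _ _ _ mu _ (fun y => a * f y)); [by meas|exact: intgZ|move=> y].
  rewrite mulrC !normrM ler_wpM2r// (le_trans _ (ler_norm a))//.
  by apply: le_trans (ha (x - corner (rk j) y)); rewrite ler_piMl// ger0_norm.
have ie : intg mu (e j).
  by apply: (intgP (me j)); apply: le_lt_trans (nl1_E (rk0 j) m_u) u1.
have -> : \int[mu]_y (L i (x - corner (rk j) y) * b j y) =
    \int[mu]_y (u y * h y - e j y * h y).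
  by apply: eq_Rintegral => y _; rewrite /b /h; ring.
rewrite RintegralB//; [|exact: ih|exact: ih].
by rewrite (E_adj (rk0 j) m_u (locu j) hc (intg_nl1 (ih _ iu))) subrr.
Qed.

Let convbad i x : conv (L i) bad x = \int[mu]_y Dk i x y.
Proof.
have ibL j := intgLb i x (ib j).
rewrite /conv (eq_Rintegral mu (g := fun y => \sum_(j < J0) L i (x - y) * b j y)); last first.
  by move=> y _; rewrite /bad mulr_sumr.
rewrite (Rint_sum J0 ibL).2 (Rint_sum J0 (iD i x)).2.
apply: eq_bigr => j _.
have i2 : intg mu (fun y => L i (x - corner (rk j) y) * b j y).
  by have := intgB (ibL j) (iD i x j); apply: eq_integrable => // y _ /=; congr EFin; ring.
rewrite -[LHS]subr0 -(b_mean0 i x j) -RintegralB//; last exact: ibL.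
by apply: eq_Rintegral => y _; rewrite mulrBl.
Qed.

Let G x : \bar R := (\sum_(j < J0) nl1 mu (fun y => (Th j (x - y) * b j y)%R))%E.

Let mThb j : measurable_fun setT (fun p : rV * rV => Th j (p.1 - p.2) * b j p.2).
Proof. exact: meas_convF. Qed.

Let mG : measurable_fun setT G.
Proof.
apply: emeasurable_sum => j.
apply: (meas_ge0_int2 mu (F := fun p : rV * rV => `|Th j (p.1 - p.2) * b j p.2|)) => //.
by have := mThb j => h; meas.
Qed.

Let intG : (\int[mu]_x G x <= (2 * B)%:E * nl1 mu u)%E.
Proof.
rewrite ge0_integral_sum//; last 2 first.
- move=> j; apply: (meas_ge0_int2 mu (F := fun p : rV * rV => `|Th j (p.1 - p.2) * b j p.2|)) => //.
  by have := mThb j => h; meas.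
- by move=> j x _; exact: nl1_ge0.
apply: (@le_trans _ _ (\sum_(j < J0) (B%:E * nl1 mu (b j)))%E).
  apply: lee_sum => j _; rewrite tonelli_conv// lee_wpmul2r ?nl1_ge0//.
  apply: le_trans (ThB j); rewrite le_eqVlt; apply/orP; left; apply/eqP.
  by apply: eq_integral => x _; rewrite ger0_norm.
rewrite -ge0_sume_distrr; last by move=> j _; exact: nl1_ge0.
apply: le_trans (lee_wpmul2l _ nl1b_sum) _; first by rewrite lee_fin.
by rewrite muleA -EFinM [B * 2]mulrC.
Qed.

(** Minkowski's inequality moves the variation under the integral. At each [y] at most one stopping
    scale is active, and the distance of [x] from its cell lets the Hormander condition apply. *)
Let bad_pvar x (al : R) : 0 < al -> ~ (\big[setU/set0]_(j < J0) Om j) x ->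
  Vset q (fun i => conv (L i) bad) al x -> (al%:E <= G x)%E.
Proof.
move=> al0 xO [t [K [tm h]]]; rewrite leNgt; apply/negP => Gal.
have fin j : (j < J0)%N -> (nl1 mu (fun y => (Th j (x - y) * b j y)%R) < +oo)%E.
  move=> jJ; apply: le_lt_trans (lt_trans Gal (ltry _)).
  rewrite /G (bigD1 (Ordinal jJ))//= leeDl//; apply: sume_ge0 => i _; exact: nl1_ge0.
pose f j y : R := if (j < J0)%N then `|Th j (x - y) * b j y| else 0.
have mf j : measurable_fun setT (fun y => Th j (x - y) * b j y).
  by have h1 := meas_refl x (mTh j); have h2 := mb j; meas.
have fi j : intg mu (f j).
  have [jJ|jJ] := ltnP j J0; last first.
    have := @integrable0 _ _ _ mu setT; apply: eq_integrable => // y _.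
    by rewrite /f /= ltnNge jJ.
  rewrite (_ : f j = fun y => `|Th j (x - y) * b j y|); last by rewrite /f jJ.
  apply: intgP; first by have := mf j => h1; meas.
  apply: le_lt_trans (fin j jJ); rewrite le_eqVlt; apply/orP; left; apply/eqP.
  by apply: eq_integral => y _; rewrite normr_id.
have [iH HE] := Rint_sum J0 fi.
pose H y : R := \sum_(j < J0) f j y.
have H0 y : 0 <= H y by apply: sumr_ge0 => j _; rewrite /f ltn_ord.
have Gfin : G x = (\int[mu]_y H y)%:E.
  rewrite HE -sumEFin; apply: eq_bigr => j _.
  by rewrite (EFin_Rintegral (fi j)); apply: eq_integral => y _; rewrite /f ltn_ord.
have iDk i : intg mu (Dk i x) by exact: (Rint_sum J0 (iD i x)).1.
have pw y : pvar q (fun i => Dk i x y) t K <= H y `^ q.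
  have q0 : 0 < q by rewrite (lt_trans _ q1).
  have DE i : Dk i x y = \sum_(j < J0) sg j y * ((L i (x - y) - L i (x - corner (rk j) y)) * (u y - e j y)).
    by apply: eq_bigr => j _; rewrite /b mulrCA.
  have HE' : H y = \sum_(j < J0) sg j y * (Th j (x - y) * `|u y - e j y|).
    apply: eq_bigr => j _; rewrite /f ltn_ord /b !normrM (ger0_norm (Th0 _ _)) (ger0_norm (sg_ge0 _ _)).
    by rewrite mulrCA.
  have [[j jJ [sj sE]]|[_ sE]] := sg_case y; last first.
    rewrite HE' (sE (fun j => Th j (x - y) * `|u y - e j y|)) /pvar big1 ?powR_ge0// => k _.
    rewrite !DE (sE (fun j => (L (t k) (x - y) - L (t k) (x - corner (rk j) y)) * (u y - e j y))).
    rewrite (sE (fun j => (L (t k.-1) (x - y) - L (t k.-1) (x - corner (rk j) y)) * (u y - e j y))).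
    by rewrite subrr normr0 powR0// gt_eqF.
  rewrite HE' (sE (fun j => Th j (x - y) * `|u y - e j y|)).
  have xOj : ~ Om j x.
    by move=> xj; apply: xO; rewrite -bigcup_seq; exists (Ordinal jJ) => //=; rewrite mem_index_enum.
  have yn i : `|(y - corner (rk j) y) ord0 i| <= rk j by exact: corner_near.
  have xy := far xOj (y := y); rewrite sj oner_neq0 in xy.
  have := hoer yn (xy isT) K tm; rewrite powRM// => /(ler_wpM2r (powR_ge0 `|u y - e j y| q)).
  apply: le_trans; rewrite /pvar mulr_suml; apply: ler_sum => k _.
  rewrite !DE (sE (fun j => (L (t k) (x - y) - L (t k) (x - corner (rk j) y)) * (u y - e j y))).
  rewrite (sE (fun j => (L (t k.-1) (x - y) - L (t k.-1) (x - corner (rk j) y)) * (u y - e j y))).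
  rewrite (_ : x - corner (rk j) y = x - y + (y - corner (rk j) y)); last by rewrite addrA subrK.
  by rewrite -mulrBl normrM powRM.
have := pvar_minkowski (D := fun i y => Dk i x y) q1 iDk iH H0 pw.
rewrite (_ : (fun i => _) = (fun i => conv (L i) bad x)); last by apply/funext => i; rewrite convbad.
apply/negP; rewrite -ltNge; apply: le_lt_trans h.
rewrite ge0_ler_powR ?nnegrE ?(ltW al0)//.
- by rewrite ltW// (lt_trans _ q1).
- by apply: Rintegral_ge0 => y _; exact: H0.
by rewrite ltW// -lte_fin -Gfin.
Qed.

Variable A1 : R.
Hypothesis weak22 : forall h al, cellconst rho h -> (nl1 mu h < +oo)%E -> 0 < al ->
  omeas mu (Vset q (fun i => conv (L i) h) al) ((A1 ^+ 2 / al ^+ 2)%:E * nl2 mu h).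

(** The good part by the weak (2,2) bound, the enlarged stopping cells by their measure, the bad
    part off them by Markov's inequality for [G]. *)
Lemma cz_split (al : R) : 0 < al -> omeas mu (Vset q (fun i => conv (L i) u) al)
  ((A1 ^+ 2 / (al / 4) ^+ 2 * (3 * 2 ^+ n * s) + (c.*2.+1 ^ n)%:R / s +
    (al / 4)^-1 * (2 * B))%:E * nl1 mu u).
Proof.
move=> al0; have al4 : 0 < al / 4 by rewrite divr_gt0.
have g1 : (nl1 mu g < +oo)%E by apply: le_lt_trans nl1g _; rewrite lte_mul_pinfty.
have h1 := weak22 g_cell g1 al4.
have G0 x : (0 <= G x)%E by apply: sume_ge0 => j _; exact: nl1_ge0.
have h3 := emarkov mu al4 mG G0.
have c1 : 0 <= A1 ^+ 2 / (al / 4) ^+ 2 by rewrite divr_ge0 ?sqr_ge0.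
have h1' : omeas mu (Vset q (fun i => conv (L i) g) (al / 4))
    ((A1 ^+ 2 / (al / 4) ^+ 2 * (3 * 2 ^+ n * s))%:E * nl1 mu u).
  apply: omeas_le h1; apply: le_trans (lee_wpmul2l _ nl2g) _; first by rewrite lee_fin.
  by rewrite muleA -EFinM.
have h3' : omeas mu [set x | ((al / 4)%:E <= G x)%E] (((al / 4)^-1 * (2 * B))%:E * nl1 mu u).
  apply: omeas_le h3; apply: le_trans (lee_wpmul2l _ intG) _.
    by rewrite lee_fin invr_ge0 ltW.
  by rewrite muleA -EFinM.
have := omeasU (omeasU h1' omOm) h3'.
have c2 : 0 <= A1 ^+ 2 / (al / 4) ^+ 2 * (3 * 2 ^+ n * s).
  by rewrite mulr_ge0// mulr_ge0 ?(ltW s0)// mulr_ge0// exprn_ge0.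
have c3 : 0 <= (c.*2.+1 ^ n)%:R / s by rewrite divr_ge0// ltW.
have c4 : 0 <= (al / 4)^-1 * (2 * B) by rewrite mulr_ge0 ?mulr_ge0// invr_ge0 ltW.
rewrite -!ge0_muleDl ?lee_fin ?addr_ge0// -!EFinD.
apply: omeas_sub.
have -> : (fun i => conv (L i) u) = (fun i x => conv (L i) g x + conv (L i) bad x).
  apply/funext => i; apply/funext => x; rewrite /conv -RintegralD//.
  - by apply: eq_Rintegral => y _; rewrite -mulrDr /g subrK.
  - by apply: intgLb; exact: intgP.
  - by apply: intgLb; exact: (Rint_sum J0 ib).1.
apply: subset_trans (VsetD (ltW q1) al0) _ => x [?|hx]; first by left; left.
have [xO|xO] := pselect ((\big[setU/set0]_(j < J0) Om j) x); first by left; right.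
by right; exact: (bad_pvar al4 xO hx).
Qed.

End cz_decomposition.

Section cz_theorem.
Context {R : realType} {n : nat}.
Local Notation mu := (@lebesgue_rV R n).
Local Notation rV := 'rV[R]_n.

Lemma exists_scale (rho X : R) : 0 < rho -> exists J, X <= rho * 2 ^+ J.
Proof.
move=> rho0; exists (Num.truncn (X / rho)).+1.
rewrite mulrC -ler_pdivrMr//; have h := truncnS_gt (X / rho).
apply: le_trans (ltW h) _; apply: le_trans (_ : (2 ^ (Num.truncn (X / rho)).+1)%:R <= _).
  by rewrite ler_nat ltnW// ltn_expl.
by rewrite natrX.
Qed.

(** The factors are those of [cz_split] with the height optimized: [48 = 16 * 3] comes from the good
    part, [8 = 4 * 2] from the bad part. *)
Lemma cz_weak11 (q rho A B : R) (L : nat -> rV -> R) (c : nat) (Th : nat -> rV -> R) :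
  (0 < n)%N -> 1 < q -> 0 < rho -> 0 < A ->
  (forall i, measurable_fun setT (L i)) ->
  (forall i, exists b : R, forall x, `|L i x| <= b) ->
  (forall j, measurable_fun setT (Th j)) -> (forall j x, 0 <= Th j x) ->
  (forall j, (\int[mu]_x (Th j x)%:E <= B%:E)%E) ->
  (forall j (z y : rV), (forall i, `|y ord0 i| <= rho * 2 ^+ j) ->
    (exists i, rho * 2 ^+ j * c%:R <= `|z ord0 i|) -> forall t K, ndecr t ->
    pvar q (fun i => L i z - L i (z + y)) t K <= Th j z `^ q) ->
  (forall h al, cellconst rho h -> (nl1 mu h < +oo)%E -> 0 < al ->
    omeas mu (Vset q (fun i => conv (L i) h) al) ((A ^+ 2 / al ^+ 2)%:E * nl2 mu h)) ->
  forall u al, cellconst rho u -> (nl1 mu u < +oo)%E -> 0 < al ->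
    omeas mu (Vset q (fun i => conv (L i) u) al)
      (((48 * 2 ^+ n + (c.*2.+1 ^ n)%:R + 8) * (A + B) / al)%:E * nl1 mu u).
Proof.
move=> n0 q1 rho0 A0 mL Lb mTh Th0 ThB hoer w22 u al cu u1 al0.
(* This height balances [A^2 s / al^2] and [1 / s], both becoming [A / al]; the constant is thus
   linear in the weak (2,2) constant. *)
pose s := al / A; have s0 : 0 < s by exact: divr_gt0.
have m_u := meas_cellconst rho0 cu.
have B0 : 0 <= B.
  by rewrite -lee_fin; apply: le_trans (ThB 0); apply: integral_ge0 => x _; rewrite lee_fin.
(* A side of at least 1 is below its own [n]-th power, so a side above [|u|_1 / s] already makes the
   averages at most [s]. *)
have [J J1] := exists_scale (Num.max 1 (fine (nl1 mu u) / s)) rho0.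
have m_au : measurable_fun setT (fun x => `|u x|) by meas.
have uf : nl1 mu u = (fine (nl1 mu u))%:E by rewrite fineK// ge0_fin_numE// nl1_ge0.
have AJ0 x : E (rho * 2 ^+ J) (fun y => `|u y|) x <= s.
  have rJ : 0 < rho * 2 ^+ J by rewrite mulr_gt0// exprn_gt0.
  have := E_sup rJ x m_au.
  rewrite (_ : nl1 mu (fun y => `|u y|) = nl1 mu u); last first.
    by apply: eq_integral => y _; rewrite normr_id.
  rewrite uf -EFinM lee_fin => /(le_trans (ler_norm _))/le_trans; apply.
  rewrite ler_pdivrMl ?exprn_gt0// mulrC -ler_pdivrMl// mulrC.
  move: J1; rewrite ge_max => /andP[J1 J2]; apply: le_trans J2 _.
  case: (n) n0 => // k _; rewrite exprS ler_peMr ?(ltW rJ)//.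
  exact: exprn_ege1.
have := cz_split q1 rho0 mL Lb cu u1 s0 AJ0 mTh Th0 ThB hoer w22 al0.
apply: omeas_le; rewrite lee_wpmul2r ?nl1_ge0// lee_fin.
have -> : A ^+ 2 / (al / 4) ^+ 2 * (3 * 2 ^+ n * s) + (c.*2.+1 ^ n)%:R / s +
    (al / 4)^-1 * (2 * B) = (48 * 2 ^+ n * A + (c.*2.+1 ^ n)%:R * A + 8 * B) / al.
  by rewrite /s; field; rewrite !gt_eqF.
rewrite ler_wpM2r ?invr_ge0 ?(ltW al0)//.
have n2 : 0 <= 48 * 2 ^+ n :> R by apply: mulr_ge0; [exact: ler0n|exact: exprn_ge0].
have n3 : 0 <= (c.*2.+1 ^ n)%:R :> R by exact: ler0n.
have h1 := mulr_ge0 n2 B0; have h2 := mulr_ge0 n3 B0; have := ltW A0.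
move: n2 n3 h1 h2; move: (48 * 2 ^+ n) ((c.*2.+1 ^ n)%:R) => X Y; nra.
Qed.

End cz_theorem.

(** * Euclidean norm and radial majorants *)

Section annuli.
Context {R : realType} {n : nat}.
Local Notation mu := (@lebesgue_rV R n).
Local Notation rV := 'rV[R]_n.
Implicit Types (x y z : rV).

Lemma enorm_ge0 x : 0 <= enorm x.
Proof. exact: sqrtr_ge0. Qed.

Lemma enorm_sqr x : enorm x ^+ 2 = \sum_i x ord0 i ^+ 2.
Proof. by rewrite sqr_sqrtr//; apply: sumr_ge0 => i _; exact: sqr_ge0. Qed.

Lemma enormN x : enorm (- x) = enorm x.
Proof. by congr Num.sqrt; apply: eq_bigr => i _; rewrite mxE sqrrN. Qed.

Lemma enorm_eq0 x : enorm x = 0 -> x = 0.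
Proof.
move=> h; apply/rowP => i; rewrite mxE; apply/eqP; rewrite -normr_le0 -h.
exact: coord_le_enorm.
Qed.

Lemma enorm0 : enorm (0 : rV) = 0.
Proof. by rewrite /enorm big1 ?sqrtr0// => i _; rewrite mxE expr0n. Qed.

Lemma enormD x y : enorm (x + y) <= enorm x + enorm y.
Proof.
have [/enorm_eq0 ->|x0] := eqVneq (enorm x) 0; first by rewrite add0r lerDr enorm_ge0.
have [/enorm_eq0 ->|y0] := eqVneq (enorm y) 0; first by rewrite addr0 lerDl enorm_ge0.
have X0 : 0 < enorm x by rewrite lt_neqAle eq_sym x0 enorm_ge0.
have Y0 : 0 < enorm y by rewrite lt_neqAle eq_sym y0 enorm_ge0.
rewrite -(ler_pXn2r (n := 2))// ?nnegrE ?enorm_ge0 ?addr_ge0 ?enorm_ge0//.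
have h : 0 <= \sum_i (x ord0 i / enorm x - y ord0 i / enorm y) ^+ 2.
  by apply: sumr_ge0 => i _; exact: sqr_ge0.
pose P := \sum_i x ord0 i * y ord0 i.
have e : \sum_i (x ord0 i / enorm x - y ord0 i / enorm y) ^+ 2 =
    (enorm x) ^- 2 * (\sum_i x ord0 i ^+ 2) - 2 / (enorm x * enorm y) * P +
    (enorm y) ^- 2 * (\sum_i y ord0 i ^+ 2).
  rewrite !mulr_sumr -sumrB -big_split/=; apply: eq_bigr => i _.
  by field; rewrite x0 y0.
rewrite e -!enorm_sqr !mulVf ?sqrf_eq0// in h.
have hP : P <= enorm x * enorm y.
  have h2 : 2 / (enorm x * enorm y) * P <= 2 by lra.
  rewrite -(ler_pM2l (x := 2 / (enorm x * enorm y))) ?divr_gt0 ?mulr_gt0//.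
  by apply: le_trans h2 _; rewrite le_eqVlt; apply/orP; left; apply/eqP; field; rewrite x0 y0.
rewrite enorm_sqr (eq_bigr (fun i => x ord0 i ^+ 2 + 2 * (x ord0 i * y ord0 i) + y ord0 i ^+ 2)).
  by rewrite !big_split/= -!enorm_sqr -mulr_sumr -/P; nra.
by move=> i _; rewrite mxE; ring.
Qed.

Lemma enorm_le_l1 x : enorm x <= l1 x.
Proof.
have l0 := l1_ge0 x.
rewrite -(ler_pXn2r (n := 2))// ?nnegrE ?enorm_ge0// enorm_sqr expr2.
rewrite {1}/l1 mulr_suml; apply: ler_sum => i _.
rewrite -(real_normK (num_real _)) expr2 ler_wpM2l//.
by rewrite /l1 (bigD1 i)//= lerDl; apply: sumr_ge0.
Qed.

Definition annulus (a b : R) : set rV := [set z | a <= enorm z < b].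

Lemma measurable_annulus a b : measurable (annulus a b).
Proof.
rewrite (_ : annulus a b = (@enorm R n) @^-1` `[a, b[%classic); last first.
  by apply/seteqP; split => x /=; rewrite in_itv.
by rewrite -[X in measurable X]setTI; apply: measurable_enorm.
Qed.

Lemma measure_annulus a b : 0 <= b -> (mu (annulus a b) <= ((2 * b) ^+ n)%:E)%E.
Proof.
move=> b0; rewrite -cube_measure//; apply: le_measure; rewrite ?inE.
- exact: measurable_annulus.
- exact: cube_measurable.
by move=> z /andP[_ /ltW zb]; apply/forallP => i; exact: le_trans (coord_le_enorm _ _) zb.
Qed.

Variables (tau : R) (th : nat -> R).
Hypothesis tau0 : 0 < tau.
Hypothesis th0 : forall i, 0 <= th i.

Let rad i := 2 ^+ i * tau.

Let rad0 i : 0 < rad i.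
Proof. by rewrite mulr_gt0// exprn_gt0. Qed.

Let rad_le i j : (i <= j)%N -> rad i <= rad j.
Proof. by move=> ij; rewrite ler_pM2r// ler_weXn2l// ler1n. Qed.

Let tm i z : R := th i * rad i ^- n * \1_(annulus (rad i) (rad i.+1)) z.

Let tm0 i z : 0 <= tm i z.
Proof. by rewrite mulr_ge0// mulr_ge0// invr_ge0 exprn_ge0// ltW. Qed.

Let mtm i : measurable_fun setT (tm i).
Proof. by apply: measurable_funM => //; apply: measurable_indic; exact: measurable_annulus. Qed.

Let ser z : \bar R := (\sum_(i <oo) (tm i z)%:E)%E.

(** The radial step function with value [th i * rad i ^- n] on the [i]-th annulus; at each point at
    most one term of the series is nonzero. *)
Definition ann z : R := fine (ser z).

Let mser : measurable_fun setT ser.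
Proof.
have m i : measurable_fun setT (fun z => (tm i z)%:E) by apply/measurable_EFinP.
by apply: ge0_emeasurable_sum => // i x _ _; rewrite lee_fin.
Qed.

Lemma meas_ann : measurable_fun setT ann.
Proof. by apply: measurableT_comp mser; exact: fine_measurable. Qed.

Lemma ann_ge0 z : 0 <= ann z.
Proof. by apply: fine_ge0; apply: nneseries_ge0 => i _ _; rewrite lee_fin. Qed.

Lemma annE i z : rad i <= enorm z < rad i.+1 -> ann z = th i * rad i ^- n.
Proof.
move=> zi; rewrite /ann.
have ti : tm i z = th i * rad i ^- n by rewrite /tm indicE mem_set ?mulr1.
suff -> : ser z = (tm i z)%:E by rewrite ti.
apply/eqP; rewrite eq_le; apply/andP; split; last first.
  apply: le_trans (@nneseries_lim_ge R (fun k => (tm k z)%:E) xpredT 0 i.+1 _); last by move=> k _; rewrite lee_fin.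
  by rewrite big_mkord big_ord_recr/= leeDr// sume_ge0// => k _; rewrite lee_fin.
apply: nneseries_le_bound => [k|N]; first by rewrite lee_fin.
have z0 k : k != i -> tm k z = 0.
  move=> ki; rewrite /tm indicE memNset ?mulr0// => /= zk; move/eqP: ki; apply.
  move: zi zk => /andP[a b] /andP[c d].
  case: (ltngtP k i) => // h.
    by have := le_lt_trans (le_trans (rad_le h) a) d; rewrite ltxx.
  by have := le_lt_trans (le_trans (rad_le h) c) b; rewrite ltxx.
have [iN|Ni] := ltnP i N.
  rewrite (bigD1 (Ordinal iN))//= big1 ?adde0// => k ki; rewrite z0//.
rewrite big1 ?lee_fin// => k _; rewrite z0//.
by rewrite neq_ltn (leq_trans (ltn_ord k) Ni).
Qed.

(** The [i]-th annulus lies in a cube of side [4 * rad i], which cancels [rad i ^- n]. *)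
Lemma int_ann (S : R) : (forall N, \sum_(i < N) th i <= S) ->
  (\int[mu]_z (ann z)%:E <= (4 ^+ n * S)%:E)%E.
Proof.
move=> hS; apply: (@le_trans _ _ (\int[mu]_z ser z)%E).
  apply: ge0_le_integral => //.
  - by move=> z _; rewrite lee_fin ann_ge0.
  - by apply/measurable_EFinP; exact: meas_ann.
  move=> z _; rewrite /ann.
  have : (0 <= ser z)%E by apply: nneseries_ge0 => i _ _; rewrite lee_fin.
  by case: (ser z) => [r| |]//= _; rewrite leey.
rewrite integral_nneseries//; last 2 first.
- by move=> i; apply/measurable_EFinP.
- by move=> i z _; rewrite lee_fin.
apply: nneseries_le_bound => [i|N].
  by apply: integral_ge0 => z _; rewrite lee_fin.
apply: (@le_trans _ _ (\sum_(i < N) (4 ^+ n * th i)%:E)%E).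
  apply: lee_sum => i _; have ri : 0 < rad i ^+ n by exact: exprn_gt0.
  rewrite ge0_nlZ//; last 2 first.
  - by apply: measurable_indic; exact: measurable_annulus.
  - by rewrite mulr_ge0// invr_ge0 ltW.
  rewrite integral_indic//; last exact: measurable_annulus.
  rewrite setIT; apply: le_trans (lee_wpmul2l _ (measure_annulus _ (ltW (rad0 _)))) _.
    by rewrite lee_fin mulr_ge0// invr_ge0 ltW.
  rewrite -EFinM lee_fin (_ : 2 * rad i.+1 = 4 * rad i); last by rewrite /rad exprS; ring.
  rewrite [(4 * _) ^+ n]exprMn le_eqVlt; apply/orP; left; apply/eqP.
  by field; rewrite gt_eqF.
by rewrite sumEFin lee_fin -mulr_sumr ler_wpM2l// exprn_ge0.
Qed.

End annuli.

Section radial_hormander.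
Context {R : realType} {n : nat}.
Local Notation mu := (@lebesgue_rV R n).
Local Notation rV := 'rV[R]_n.
Implicit Types (x y z : rV).

Lemma find_annulus (tau : R) z (k : nat) : 0 < tau -> 2 ^+ k * tau <= enorm z ->
  exists2 i, (k <= i)%N & 2 ^+ i * tau <= enorm z < 2 ^+ i.+1 * tau.
Proof.
move=> tau0 hk; have [J hJ] := exists_scale (enorm z) tau0.
pose P i := (k <= i)%N && (2 ^+ i * tau <= enorm z).
have ex : exists i, P i by exists k; rewrite /P leqnn.
have ub i : P i -> (i <= J)%N.
  move=> /andP[_ h]; rewrite leqNgt; apply/negP => Ji.
  have := le_trans h hJ; rewrite mulrC ler_pM2l// leNgt.
  by rewrite ltr_eXn2l ?ltr1n// Ji.
case: (ex_maxnP ex ub) => i /andP[ki hi] imax; exists i => //.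
rewrite hi/= ltNge; apply/negP => h.
by have := imax i.+1; rewrite /P h leqW// => /(_ isT); rewrite ltnn.
Qed.

(** From cubes to Euclidean annuli: a shift within a cell of scale [j] has [l1] norm at most [n]
    times the side, and [n <= 2^n], so the reference scale is [P = j + n]. With [c = 2^(n+4)], the
    points concerned are at distance at least 16 times that scale. *)
Lemma hormander_ann (q rho : R) (L : nat -> rV -> R) (th : nat -> R) (S : R) :
  0 < rho -> (forall i, 0 <= th i) -> (forall N, \sum_(i < N) th i <= S) ->
  (forall P i z y, (4 <= i)%N -> l1 y <= rho * 2 ^+ P ->
    2 ^+ i * (rho * 2 ^+ P) <= enorm z < 2 ^+ i.+1 * (rho * 2 ^+ P) ->
    forall t K, ndecr t -> pvar q (fun i => L i z - L i (z + y)) t K <=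
      (th i * (2 ^+ i * (rho * 2 ^+ P)) ^- n) `^ q) ->
  exists Th : nat -> rV -> R, [/\ forall j, measurable_fun setT (Th j),
    forall j x, 0 <= Th j x,
    forall j, (\int[mu]_x (Th j x)%:E <= (4 ^+ n * S)%:E)%E &
    forall j z y, (forall i, `|y ord0 i| <= rho * 2 ^+ j) ->
    (exists i, rho * 2 ^+ j * (2 ^ (n + 4))%:R <= `|z ord0 i|) -> forall t K, ndecr t ->
    pvar q (fun i => L i z - L i (z + y)) t K <= Th j z `^ q].
Proof.
move=> rho0 th0 thS h; pose tau j := rho * 2 ^+ (j + n).
have tau0 j : 0 < tau j by rewrite mulr_gt0// exprn_gt0.
exists (fun j => ann (tau j) th); split => [j|j x|j|j z y hy [k hz] t K tm].
- exact: meas_ann.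
- exact: ann_ge0.
- exact: int_ann.
have yl : l1 y <= tau j.
  apply: le_trans (l1_le hy) _; rewrite (_ : tau j = 2 ^+ n * (rho * 2 ^+ j)); last by rewrite /tau exprD; ring.
  apply: ler_wpM2r.
    by rewrite mulr_ge0 ?exprn_ge0// ltW.
  by rewrite -natrX ler_nat ltnW// ltn_expl.
have zl : 2 ^+ 4 * tau j <= enorm z.
  apply: le_trans (coord_le_enorm z k); apply: le_trans hz.
  rewrite natrX /tau !exprD le_eqVlt; apply/orP; left; apply/eqP; ring.
have [i i4 zi] := find_annulus (tau0 j) zl.
rewrite (annE (tau0 j) th0 zi); exact: h.
Qed.

End radial_hormander.

(** * Weak (1,1) bound for averages against a bump *)

Section bump_weak11.
Context {R : realType} {n : nat}.
Local Notation mu := (@lebesgue_rV R n).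
Local Notation rV := 'rV[R]_n.
Implicit Types (x y z : rV).

Lemma pvar_l1 (q : R) a t L M : 1 <= q -> ndecr t -> (forall i, (M < i)%N -> a i = 0) ->
  pvar q a t L <= (4 * \sum_(i < M.+1) `|a i|) `^ q.
Proof.
move=> q1 tm az; have q0 : 0 < q by rewrite (lt_le_trans _ q1).
apply: le_trans (pvar_lq _ q0 tm az) _; set S : R := \sum_(i < M.+1) `|a i|.
have S0 : 0 <= S by apply: sumr_ge0.
have h : \sum_(i < M.+1) `|a i| `^ q <= S `^ (q - 1) * S.
  apply: lq_l1_sup => // i iM.
  by rewrite /S (bigD1 (Ordinal iM))//= lerDl; apply: sumr_ge0.
apply: le_trans (ler_wpM2l _ h) _; first by rewrite mulr_ge0// powR_ge0.
have -> : S `^ (q - 1) * S = S `^ q by rewrite mulrC mulr_powRB1.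
rewrite powRM// ler_wpM2r ?powR_ge0//.
have -> : (4 : R) `^ q = 2 `^ q * 2 `^ q by rewrite -powRM// -natrM.
by rewrite ler_wpM2r ?powR_ge0// le1r_powR// ler1n.
Qed.

Lemma conv_upto M (L : nat -> rV -> R) u i : conv (upto M L i) u = upto M (fun i => conv (L i) u) i.
Proof.
apply/funext => x; rewrite /upto /conv; case: ifP => // _.
by under eq_Rintegral do rewrite mul0r; rewrite Rintegral_cst// mul0r.
Qed.

Variables (phi : rV -> R) (Lam : R).
Hypothesis bphi : bump phi Lam.

Let Lam0 := bump_Lam bphi.

Lemma dil_diff0 s z y (d tau : R) : 0 < s -> 16 * tau <= d -> enorm y <= tau -> d <= enorm z ->
  s < 3 * d -> dil phi s z - dil phi s (z + y) = 0.
Proof.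
move=> s0 td yt dz sd; have z0 : 0 <= enorm y by exact: enorm_ge0.
have [->|/(dil_supp bphi s0) h] := eqVneq (dil phi s z) 0; last by exfalso; lra.
have [->|/(dil_supp bphi s0) h] := eqVneq (dil phi s (z + y)) 0; first by rewrite subrr.
have := enormD (z + y) (- y); rewrite addrK enormN => h2; exfalso; lra.
Qed.

Lemma geo_tail (P k M : nat) (f : nat -> R) (c : R) : 0 <= c ->
  (forall p, (p < M)%N -> (p < k + P)%N -> f p = 0) ->
  (forall p, (p < M)%N -> (k + P <= p)%N -> `|f p| <= c * 2^-1 ^+ (p - P)) ->
  \sum_(p < M) `|f p| <= 2 * c * 2^-1 ^+ k.
Proof.
move=> c0 h1 h2.
apply: (@le_trans _ _ (\sum_(p < M) (c * 2^-1 ^+ k) * ((k + P <= p)%N%:R * 2^-1 ^+ (p - (k + P))))).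
  apply: ler_sum => p _; have [kp|pk] := leqP (k + P) p; last first.
    by rewrite h1// normr0 mul0r mulr0.
  apply: le_trans (h2 p (ltn_ord p) kp) _; rewrite mul1r -mulrA -exprD.
  by rewrite (_ : (p - P = k + (p - (k + P)))%N)//; lia.
rewrite -mulr_sumr mulrC -[2 * c * _]mulrA ler_wpM2r ?mulr_ge0 ?exprn_ge0 ?invr_ge0//.
have [Mk|kM] := leqP M (k + P).
  rewrite big1 ?ler0n// => p _; rewrite leqNgt (leq_trans (ltn_ord p) Mk).
  by rewrite mul0r.
rewrite -(big_mkord predT (fun p => (k + P <= p)%N%:R * 2^-1 ^+ (p - (k + P)))).
rewrite (big_cat_nat (n := (k + P)%N))//=; last exact: ltnW.
rewrite big_nat_cond big1 ?add0r; last first.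
  by move=> p /andP[/andP[_ pk] _]; rewrite leqNgt pk mul0r.
rewrite -{1}[(k + P)%N]add0n big_addn big_mkord.
apply: (@le_trans _ _ (\sum_(i < M - (k + P)) 2^-1 ^+ i)).
  by apply: ler_sum => i _; rewrite leq_addl mul1r addnK.
have := @geo_sum_le R 2^-1 (M - (k + P)); rewrite (_ : 1 - 2^-1 = 2^-1); last by field.
by rewrite invrK => h; apply: h; [rewrite invr_ge0|rewrite invf_lt1// ltr1n].
Qed.

(** Bumps of scale below [|z|] do not reach [z] or [z + y], and at larger scales the Lipschitz bound
    decays geometrically: the sum over scales is dominated by its first term. *)
Lemma bump_hormander (q rho : R) M P i z y t K : 1 <= q -> 0 < rho -> (4 <= i)%N ->
  l1 y <= rho * 2 ^+ P ->
  2 ^+ i * (rho * 2 ^+ P) <= enorm z < 2 ^+ i.+1 * (rho * 2 ^+ P) -> ndecr t ->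
  pvar q (fun p => upto M (fun p => dil phi (rho * 2 ^+ p)) p z -
    upto M (fun p => dil phi (rho * 2 ^+ p)) p (z + y)) t K <=
  (8 * Lam * 2^-1 ^+ i * (2 ^+ i * (rho * 2 ^+ P)) ^- n) `^ q.
Proof.
move=> q1 rho0 i4 yl /andP[zi _] tm.
have tau0 : 0 < rho * 2 ^+ P by rewrite mulr_gt0// exprn_gt0.
set d := 2 ^+ i * (rho * 2 ^+ P) in zi *.
have d0 : 0 < d by rewrite mulr_gt0// exprn_gt0.
have td : 16 * (rho * 2 ^+ P) <= d.
  by rewrite ler_pM2r// (_ : 16 = 2 ^+ 4) ?ler_weXn2l ?ler1n// -natrX.
have ye : enorm y <= rho * 2 ^+ P by exact: le_trans (enorm_le_l1 y) yl.
apply: le_trans (@pvar_l1 q _ t K M q1 tm _) _.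
  by move=> p pM; rewrite /upto leqNgt pM subrr.
have dn0 : 0 <= Lam * d ^- n by rewrite mulr_ge0// invr_ge0 exprn_ge0// ltW.
rewrite ge0_ler_powR ?nnegrE ?(le_trans _ q1)//.
- by rewrite mulr_ge0// sumr_ge0.
- rewrite mulrAC -!mulrA mulr_ge0// mulrA mulr_ge0// exprn_ge0// invr_ge0//.
rewrite (_ : 8 * Lam * 2^-1 ^+ i * d ^- n = 4 * (2 * (Lam * d ^- n) * 2^-1 ^+ i)); last by ring.
rewrite ler_wpM2l//.
apply: (@geo_tail P i M.+1 (fun p => upto M (fun p => dil phi (rho * 2 ^+ p)) p z -
    upto M (fun p => dil phi (rho * 2 ^+ p)) p (z + y))).
- by [].
- move=> p pM pi; rewrite /upto -ltnS pM; apply: (dil_diff0 _ td ye zi).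
    by rewrite mulr_gt0// exprn_gt0.
  apply: (@le_lt_trans _ _ d); last by lra.
  by rewrite /d mulrCA ler_pM2l// -exprD ler_weXn2l ?ler1n// ltnW.
move=> p pM pi; rewrite /upto -ltnS pM.
have s0 : 0 < rho * 2 ^+ p by rewrite mulr_gt0// exprn_gt0.
apply: le_trans (dil_lip bphi s0 _ _) _.
rewrite opprD addrA subrr sub0r l1N.
apply: le_trans (ler_wpM2l _ yl) _; first by rewrite mulr_ge0// invr_ge0 exprn_ge0// ltW.
have -> : Lam * (rho * 2 ^+ p) ^- n.+1 * (rho * 2 ^+ P) = Lam * (rho * 2 ^+ p) ^- n * 2^-1 ^+ (p - P).
  have -> : 2 ^+ P = 2 ^+ p * 2^-1 ^+ (p - P) :> R.
    rewrite exprVn -{1}(subnK (_ : P <= p)%N) ?(leq_trans _ pi) ?leq_addl// exprD.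
    by field; rewrite expf_neq0.
  rewrite exprSr invfM; field.
  by rewrite !expf_neq0// ?gt_eqF// mulf_neq0 ?expf_neq0 ?gt_eqF.
rewrite ler_wpM2r ?exprn_ge0 ?invr_ge0// ler_wpM2l//.
rewrite lef_pV2 ?posrE ?exprn_gt0//; apply: lerXn2r; rewrite ?nnegrE ?(ltW d0) ?(ltW s0)//.
by rewrite /d mulrCA ler_pM2l// -exprD ler_weXn2l ?ler1n.
Qed.

Lemma cellconst_bounded (r : R) h : 0 < r -> cellconst r h -> (nl1 mu h < +oo)%E ->
  exists2 b : R, 0 <= b & forall x, `|h x| <= b.
Proof.
move=> r0 hc h1; have mh := meas_cellconst r0 hc.
exists (r ^- n * fine (nl1 mu h)).
  by rewrite mulr_ge0 ?fine_ge0 ?nl1_ge0// invr_ge0 exprn_ge0// ltW.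
move=> x; have := E_sup r0 x mh; rewrite E_id//.
by rewrite -[nl1 mu h]fineK ?ge0_fin_numE ?nl1_ge0// -EFinM lee_fin.
Qed.

Lemma bounded_nl2 (b : R) (h : rV -> R) : measurable_fun setT h -> 0 <= b -> (forall x, `|h x| <= b) ->
  (nl2 mu h <= b%:E * nl1 mu h)%E.
Proof.
move=> mh b0 hb; rewrite -ge0_nlZ//; last by meas.
apply: le_nl; [by meas|by meas|move=> x].
by rewrite sqr_ge0/= -(real_normK (num_real _)) expr2 ler_wpM2r.
Qed.

Lemma cellconst_nl2 (r : R) h : 0 < r -> cellconst r h -> (nl1 mu h < +oo)%E ->
  (nl2 mu h < +oo)%E.
Proof.
move=> r0 hc h1; have [b b0 hb] := cellconst_bounded r0 hc h1.
apply: le_lt_trans (bounded_nl2 (meas_cellconst r0 hc) b0 hb) _.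
by rewrite lte_mul_pinfty// ge0_fin_numE ?nl1_ge0.
Qed.

Lemma meas_upto M (F : nat -> rV -> R) i : (forall i, measurable_fun setT (F i)) ->
  measurable_fun setT (upto M F i).
Proof.
move=> h; have [iM|iM] := leqP i M.
  by rewrite (_ : upto M F i = F i)//; apply/funext => x; rewrite /upto iM.
by rewrite (_ : upto M F i = fun=> 0)//; apply/funext => x; rewrite /upto leqNgt iM.
Qed.

(** It will be applied to the error of the truncation, which is not constant on cells. Its average
    on the cells of side [r] goes through the Calderon-Zygmund argument; the rest has mean zero on
    these cells, and its convolutions are summable in L^1 over the scales. *)
Lemma bump_weak11 (q : R) : 2 < q -> (0 < n)%N -> 0 < Lam -> exists2 C : R, 0 <= C &
  forall (r : R) e M al, 0 < r -> measurable_fun setT e -> (nl1 mu e < +oo)%E -> 0 < al ->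
    omeas mu (Vset q (upto M (fun i => conv (dil phi (r * 2 ^+ i)) e)) al)
      ((C / al)%:E * nl1 mu e).
Proof.
move=> q2 n0 L0; have q1 : 1 < q by rewrite (lt_trans _ q2)// ltr1n.
have [C C0 w22] := bump_weak22 q2 n0 L0.
pose A := Num.sqrt (C + 1); have A0 : 0 < A by rewrite sqrtr_gt0 ltr_wpDl.
have AE : A ^+ 2 = C + 1 by rewrite sqr_sqrtr// addr_ge0.
pose th i : R := 8 * Lam * 2^-1 ^+ i.
have th0 i : 0 <= th i by rewrite mulr_ge0 ?mulr_ge0// exprn_ge0// invr_ge0.
have thS N : \sum_(i < N) th i <= 16 * Lam.
  rewrite -mulr_sumr (_ : 16 * Lam = 8 * Lam * 2); last by ring.
  rewrite ler_wpM2l ?mulr_ge0//; have := @geo_sum_le R 2^-1 N.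
  rewrite (_ : 1 - 2^-1 = 2^-1); last by field.
  by rewrite invrK => h; apply: h; [rewrite invr_ge0|rewrite invf_lt1// ltr1n].
pose c := (2 ^ (n + 4))%N; pose B := 4 ^+ n * (16 * Lam).
pose K : R := (48 * 2 ^+ n + (c.*2.+1 ^ n)%:R + 8) * (A + B).
have B0 : 0 <= B by rewrite mulr_ge0 ?exprn_ge0// mulr_ge0.
have K0 : 0 <= K.
  apply: mulr_ge0; last by rewrite addr_ge0// ltW.
  by rewrite !addr_ge0.
pose c1 := Lam * n%:R * 4 ^+ n.
have c10 : 0 <= c1 by rewrite !mulr_ge0// exprn_ge0.
have C1 : 0 <= 64 * c1 by apply: mulr_ge0; [exact: ler0n|].
exists (4 * K + 64 * c1); first by rewrite addr_ge0// mulr_ge0.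
move=> r e M al r0 me e1 al0; have al4 : 0 < al / 4 by rewrite divr_gt0.
pose L := upto M (fun i => dil phi (r * 2 ^+ i)).
have rk i : 0 < r * 2 ^+ i by rewrite mulr_gt0// exprn_gt0.
have mL i : measurable_fun setT (L i) by apply: meas_upto => k; exact: (meas_dil bphi).
have Lb i : exists b : R, forall x, `|L i x| <= b.
  exists (Lam * (r * 2 ^+ i) ^- n) => x; rewrite /L /upto; case: ifP => _.
    rewrite ger0_norm; [exact: (dil_le bphi)|exact: (dil_ge0 bphi)].
  by rewrite normr0 mulr_ge0// invr_ge0 exprn_ge0// ltW.
have [|Th [mTh Th0 ThB hoer]] := @hormander_ann R n q r L th (16 * Lam) r0 th0 thS.
  move=> P i z y i4 yl zi t N tm.
  exact: (@bump_hormander q r M P i z y t N (ltW q1)).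
have w22' h al' : cellconst r h -> (nl1 mu h < +oo)%E -> 0 < al' ->
    omeas mu (Vset q (fun i => conv (L i) h) al') ((A ^+ 2 / al' ^+ 2)%:E * nl2 mu h).
  move=> hc h1 al'0.
  have := w22 phi r h M al' bphi r0 (meas_cellconst r0 hc) (cellconst_nl2 r0 hc h1) al'0.
  rewrite (_ : (fun i => conv (L i) h) = upto M (fun i => conv (dil phi (r * 2 ^+ i)) h)); last first.
    by apply/funext => i; rewrite conv_upto.
  apply: omeas_le; rewrite lee_wpmul2r ?nl2_ge0// lee_fin AE ler_wpM2r ?invr_ge0 ?sqr_ge0//.
  by rewrite lerDl.
have mE := meas_E r0 e; have E1 := nl1_E r0 me.
have Eoo : (nl1 mu (E r e) < +oo)%E by exact: le_lt_trans e1.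
have h1 := cz_weak11 n0 q1 r0 A0 mL Lb mTh Th0 ThB hoer w22' (E_cellconst e) Eoo al4.
rewrite (_ : (fun i => conv (L i) (E r e)) = upto M (fun i => conv (dil phi (r * 2 ^+ i)) (E r e))) in h1; last first.
  by apply/funext => i; rewrite conv_upto.
pose e2 x := e x - E r e x.
have me2 : measurable_fun setT e2 by rewrite /e2; meas.
have e21 : (nl1 mu e2 <= 2%:E * nl1 mu e)%E.
  apply: (@le_trans _ _ (nl1 mu e + nl1 mu (fun x => - E r e x)%R)%E).
    by apply: nl1D => //; meas.
  rewrite (_ : nl1 mu (fun x => - E r e x)%R = nl1 mu (E r e)); last first.
    by apply: eq_integral => x _; rewrite normrN.
  rewrite -[2]/(1 + 1) EFinD ge0_muleDl ?lee_fin// mul1e; exact: leeD2l.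
have e2oo : (nl1 mu e2 < +oo)%E.
  by apply: le_lt_trans e21 _; rewrite lte_mul_pinfty.
have ie := intgP me e1; have loce := locint1 r0 ie.
have E2 x : E r e2 x = 0 by exact: E_diff.
pose G x : \bar R := (\sum_(i < M.+1) `|conv (dil phi (r * 2 ^+ i)) e2 x|)%:E.
have mc i : measurable_fun setT (conv (dil phi (r * 2 ^+ i)) e2).
  by apply: meas_conv => //; exact: (meas_dil bphi).
have mac i : measurable_fun setT (fun x => `|conv (dil phi (r * 2 ^+ i)) e2 x|).
  by have := mc i => m; meas.
have mG : measurable_fun setT G by apply/measurable_EFinP; apply: measurable_sum.
have G0 x : (0 <= G x)%E by rewrite lee_fin sumr_ge0.
have iG : (\int[mu]_x G x <= (4 * c1)%:E * nl1 mu e)%E.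
  rewrite /G ge0_nl_sum//.
  apply: (@le_trans _ _ (\sum_(i < M.+1) ((c1 * 2^-1 ^+ i)%:E * nl1 mu e2))%E).
    apply: lee_sum => i _; have rs : r <= r * 2 ^+ i by rewrite ler_peMr ?(ltW r0)// exprn_ege1// ler1n.
    have := fine_nl1 bphi r0 rs me2 (or_introl e2oo) E2.
    rewrite -/c1 (_ : r / (r * 2 ^+ i) * c1 = c1 * 2^-1 ^+ i)//.
    by rewrite exprVn; field; rewrite expf_neq0// gt_eqF.
  rewrite -ge0_sume_distrl; last by move=> i _; rewrite lee_fin mulr_ge0// exprn_ge0// invr_ge0.
  rewrite sumEFin -mulr_sumr.
  apply: (@le_trans _ _ ((c1 * 2)%:E * nl1 mu e2)%E).
    rewrite lee_wpmul2r ?nl1_ge0// lee_fin ler_wpM2l//; have := @geo_sum_le R 2^-1 M.+1.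
    rewrite (_ : 1 - 2^-1 = 2^-1); last by field.
    by rewrite invrK => h; apply: h; [rewrite invr_ge0|rewrite invf_lt1// ltr1n].
  apply: le_trans (lee_wpmul2l _ e21) _; first by rewrite lee_fin mulr_ge0.
  rewrite muleA -EFinM le_eqVlt; apply/orP; left; apply/eqP; congr (_%:E * _)%E; ring.
(* [pvar_l1] loses a factor 4 and the level available is [al / 4]. *)
have a16 : 0 < al / 16 by rewrite divr_gt0.
have h2 := emarkov mu a16 mG G0.
have {}h1 : omeas mu (Vset q (upto M (fun i => conv (dil phi (r * 2 ^+ i)) (E r e))) (al / 4))
    ((4 * K / al)%:E * nl1 mu e).
  apply: omeas_le h1; apply: le_trans (lee_wpmul2l _ E1) _.
    by rewrite lee_fin divr_ge0// ltW.
  rewrite le_eqVlt; apply/orP; left; apply/eqP; congr (_%:E * _)%E.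
  by rewrite -/K invf_div; ring.
have {}h2 : omeas mu [set x | ((al / 16)%:E <= G x)%E] ((64 * c1 / al)%:E * nl1 mu e).
  apply: omeas_le h2; apply: le_trans (lee_wpmul2l _ iG) _.
    by rewrite lee_fin invr_ge0 ltW.
  rewrite muleA -EFinM le_eqVlt; apply/orP; left; apply/eqP; congr (_%:E * _)%E.
  by rewrite invf_div; field; rewrite gt_eqF.
have := omeasU h1 h2.
rewrite -ge0_muleDl ?lee_fin; last 2 first.
- by rewrite divr_ge0 ?(ltW al0)// mulr_ge0.
- by rewrite divr_ge0 ?(ltW al0).
rewrite -EFinD -mulrDl; apply: omeas_sub.
have -> : upto M (fun i => conv (dil phi (r * 2 ^+ i)) e) =
    (fun i x => upto M (fun i => conv (dil phi (r * 2 ^+ i)) (E r e)) i x +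
      upto M (fun i => conv (dil phi (r * 2 ^+ i)) e2) i x).
  apply/funext => i; apply/funext => x; rewrite /upto; case: ifP => _; last by rewrite addr0.
  rewrite (conv_dilB bphi) //; first by rewrite addrC subrK.
  - by left.
  - by left.
apply: subset_trans (VsetD (ltW q1) al0) _; apply: setUS => x [t [N [tm hx]]] /=.
rewrite /G lee_fin leNgt; apply/negP => hs; move: hx; apply/negP; rewrite -leNgt.
apply: le_trans (@pvar_l1 q _ t N M (ltW q1) tm _) _.
  by move=> p pM; rewrite /upto leqNgt pM.
rewrite ge0_ler_powR ?nnegrE ?(ltW al4)//.
- by rewrite (le_trans _ (ltW q1)).
- by rewrite mulr_ge0// sumr_ge0.
rewrite (eq_bigr (fun i : 'I_M.+1 => `|conv (dil phi (r * 2 ^+ i)) e2 x|)); last first.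
  by move=> i _; rewrite /upto -ltnS ltn_ord.
by move: hs; lra.
Qed.

End bump_weak11.

(** * Truncated singular kernels *)

Section variation_sums.
Context {R : realType}.

(** A sequence that drops from [c] to 0 moves once along any nondecreasing [t]. *)
Lemma pvar_step (q c : R) m t K : 0 < q -> ndecr t ->
  pvar q (fun i => if (i < m)%N then c else 0) t K <= `|c| `^ q.
Proof.
move=> q0 tm; case: K => [|K]; first by rewrite /pvar big_geq// powR_ge0.
suff : pvar q (fun i => if (i < m)%N then c else 0) t K.+1 <=
    `|c| `^ q * ((t 0 < m)%N%:R - (t K < m)%N%:R).
  move/le_trans; apply; rewrite ler_piMr ?powR_ge0//.
  by case: (t 0 < m)%N; case: (t K < m)%N => /=; lra.
elim: K => [|K IH]; first by rewrite /pvar big_geq// subrr mulr0.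
rewrite /pvar big_nat_recr//=; apply: le_trans (lerD IH (lexx _)) _.
have tK : (t K <= t K.+1)%N by exact: tm.
case: (ltnP (t K.+1) m) => h1; case: (ltnP (t K) m) => h2.
- by rewrite subrr normr0 powR0 ?gt_eqF// addr0.
- by have := leq_trans h1 (leq_trans h2 tK); rewrite ltnn.
- by rewrite sub0r normrN /=; move: ((t 0 < m)%N%:R) (`|c| `^ q) => T X; lra.
- by rewrite subrr normr0 powR0 ?gt_eqF// addr0.
Qed.

Lemma powR_superadd (q x y : R) : 1 <= q -> 0 <= x -> 0 <= y ->
  x `^ q + y `^ q <= (x + y) `^ q.
Proof.
move=> q1 x0 y0; have q0 : 0 < q by exact: lt_le_trans q1.
have q10 : 0 <= q - 1 by rewrite subr_ge0.
have e u : 0 <= u -> u `^ q = u * u `^ (q - 1) by move=> u0; rewrite mulr_powRB1.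
rewrite (e _ x0) (e _ y0) (e _ (addr_ge0 x0 y0)) mulrDl.
apply: lerD; apply: ler_wpM2l => //.
  by apply: ge0_ler_powR => //; rewrite ?nnegrE ?addr_ge0// lerDl.
by apply: ge0_ler_powR => //; rewrite ?nnegrE ?addr_ge0// lerDr.
Qed.

Lemma sum_ord_shift (f : nat -> R) a m : (forall i, 0 <= f i) ->
  \sum_(i < m) f (a + i)%N <= \sum_(p < a + m) f p.
Proof. by move=> f0; rewrite big_split_ord/= lerDr sumr_ge0. Qed.

Lemma sum_window (g : nat -> R) P m N : (forall i, 0 <= g i) ->
  \sum_(p < N) (if (P <= p < P + m)%N then g (p - P)%N else 0) <= \sum_(l < m) g l.
Proof.
move=> g0; set f := fun p => if (P <= p < P + m)%N then g (p - P)%N else 0.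
have f0 p : 0 <= f p by rewrite /f; case: ifP.
apply: (@le_trans _ _ (\sum_(p < N + (P + m)) f p)).
  by rewrite big_split_ord/= lerDl; apply: sumr_ge0 => i _; exact: f0.
rewrite addnC big_split_ord/= [X in _ + X]big1 ?addr0; last first.
  by move=> i _; rewrite /f ltnNge leq_addr andbF.
rewrite big_split_ord/= big1 ?add0r; last first.
  by move=> i _; rewrite /f leqNgt ltn_ord.
by apply: ler_sum => i _; rewrite /f leq_addr ltn_add2l ltn_ord/= addKn.
Qed.

End variation_sums.

Section kernel.
Context {R : realType} {n : nat}.
Local Notation mu := (@lebesgue_rV R n).
Local Notation rV := 'rV[R]_n.
Implicit Types (x y z v : rV).

Lemma conv_swap (f g : rV -> R) x : measurable_fun setT f -> measurable_fun setT g ->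
  conv f g x = \int[mu]_v (f v * g (x - v)).
Proof.
move=> mf mg; rewrite /conv /Rintegral.
have mG : measurable_fun setT (fun y => f (x - y) * g y).
  by have := meas_refl x mf => m; meas.
congr fine; rewrite [LHS]integralE [RHS]integralE.
have mE := proj2 (@measurable_EFinP _ _ _ _ _) mG.
congr (_ - _)%E.
  rewrite -(ge0_integral_reflect x (measurable_funepos mE))//.
  by apply: eq_integral => z _; rewrite !funeposE /= subKr.
rewrite -(ge0_integral_reflect x (measurable_funeneg mE))//.
by apply: eq_integral => z _; rewrite !funenegE /= subKr.
Qed.

Variables (k : rV -> R) (w : R -> R) (CK : R).
Hypothesis w_ge0 : forall t, 0 <= t -> 0 <= w t.
Hypothesis w_mono : forall s t, 0 <= s -> s <= t -> w s <= w t.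
Hypothesis w_cvg : forall e : R, 0 < e -> exists i : nat, w (2^-1 ^+ i) < e.
Hypothesis CK0 : 0 <= CK.
Hypothesis ksize : forall x, x != 0 -> `|k x| <= CK * enorm x ^- n.
Hypothesis kreg : forall x y, x != 0 -> 2 * enorm y <= enorm x ->
  `|k (x - y) - k x| <= w (enorm y / enorm x) * enorm x ^- n.
Hypothesis kcanc : forall e r : R, 0 < e -> e < r ->
  \int[mu]_(x in [set x | e < enorm x < r]) k x = 0.

Lemma enorm_gt0 x : 0 < enorm x -> x != 0.
Proof. by move=> h; apply/eqP => x0; move: h; rewrite x0 enorm0 ltxx. Qed.

Variable rho : R.
Hypothesis rho0 : 0 < rho.

Definition ktr x : R := if rho < enorm x then k x else 0.

Lemma ktr_le x : `|ktr x| <= CK * rho ^- n.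
Proof.
rewrite /ktr; case: ltP => h; last first.
  by rewrite normr0 mulr_ge0// invr_ge0 exprn_ge0// ltW.
have x0 := lt_trans rho0 h.
apply: le_trans (ksize (enorm_gt0 x0)) _; rewrite ler_wpM2l// lef_pV2 ?posrE ?exprn_gt0//.
by apply: lerXn2r; rewrite ?nnegrE ltW.
Qed.

Lemma meas_enorm_lt (a : R) : measurable [set x : rV | a < enorm x].
Proof.
rewrite (_ : [set _ | _] = (@enorm R n) @^-1` `]a, +oo[%classic); last first.
  by apply/seteqP; split => x /=; rewrite in_itv/= andbT.
by rewrite -[X in measurable X]setTI; apply: measurable_enorm.
Qed.

(** Away from the origin, regularity makes [k] continuous, so it is the pointwise limit of its
    values at the corners of shrinking cells, which are measurable. *)
Lemma meas_ktr : measurable_fun setT ktr.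
Proof.
pose f (m : nat) x : R := k (corner (2^-1 ^+ m) x) * (rho < enorm x)%R%:R.
have p0 (m : nat) : 0 < (2^-1 : R) ^+ m by rewrite exprn_gt0// invr_gt0.
have mf m : measurable_fun setT (f m).
  apply: measurable_funM.
    exact: (meas_cellconst (p0 m) (@cellconst_corner _ _ _ k)).
  by apply: meas_bool; exact: meas_enorm_lt.
apply: (measurable_fun_cvg (h := f)) => // x _.
apply/cvgrPdist_lt => e e0; rewrite /f /ktr; case: ltP => h; last first.
  by near=> m; rewrite mulr0 subrr normr0.
have x0 : 0 < enorm x := lt_trans rho0 h.
have xn0 : 0 < enorm x ^+ n by exact: exprn_gt0.
have [i wi] := w_cvg (mulr_gt0 e0 xn0).
have [J HJ] := exists_scale (n%:R * (2 ^+ i.+1 / enorm x)) (ltr01 : 0 < (1 : R)).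
near=> m; rewrite mulr1 distrC.
rewrite (_ : corner (2^-1 ^+ m) x = x - (x - corner (2^-1 ^+ m) x)); last by rewrite subKr.
set y := x - corner _ x.
have ye : enorm y <= n%:R * 2^-1 ^+ m.
  apply: le_trans (enorm_le_l1 _) _; apply: l1_le => j; exact: corner_near.
have yx : enorm y / enorm x <= 2^-1 ^+ i.+1.
  rewrite ler_pdivrMr//; apply: le_trans ye _.
  rewrite exprVn ler_pdivrMr ?exprn_gt0// exprVn -mulrA mulrC ler_pdivlMr ?exprn_gt0//.
  rewrite -ler_pdivrMl//; apply: (@le_trans _ _ (1 * 2 ^+ J)).
    apply: le_trans HJ; rewrite le_eqVlt; apply/orP; left; apply/eqP; ring.
  rewrite mul1r ler_weXn2l ?ler1n//.
  by near: m; exact: nbhs_infty_ge.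
have h2 : (2^-1 : R) ^+ i <= 1 by rewrite exprn_ile1 ?invr_ge0// invf_le1// ler1n.
have y2 : 2 * enorm y <= enorm x.
  have : enorm y / enorm x <= 2^-1.
    by apply: le_trans yx _; rewrite exprS ler_piMr// invr_ge0.
  by rewrite ler_pdivrMr//; lra.
apply: le_lt_trans (kreg (enorm_gt0 x0) y2) _.
rewrite ltr_pdivrMr//; apply: le_lt_trans wi; apply: w_mono.
  by rewrite divr_ge0 ?enorm_ge0// ltW.
apply: le_trans yx _; rewrite exprS ler_piMl ?exprn_ge0 ?invr_ge0// invf_le1// ler1n.
Unshelve. all: by end_near. Qed.

Variables (phi : rV -> R) (Lam : R).
Hypothesis bphi : bump phi Lam.

Let Lam0 := bump_Lam bphi.

Definition kF s := conv (dil phi s) ktr.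

Let intg_dk (f : rV -> R) z : intg mu f -> intg mu (fun v => f v * ktr (z - v)).
Proof.
move=> fi; have mf := intg_meas fi; have := meas_refl z meas_ktr => mr.
apply: (@le_intg _ _ _ mu _ (fun y => (CK * rho ^- n) * f y)); [by meas|exact: intgZ|move=> y].
rewrite mulrC !normrM ler_wpM2r// (le_trans (ktr_le _))//.
by rewrite -normrM ler_norm.
Qed.

Let intg_dilD s y : 0 < s -> intg mu (fun v => dil phi s (v + y)).
Proof.
move=> s0; have md := meas_dil bphi s; have mdy := meas_shiftD y md.
apply: intgP => //; rewrite /nl1 (nl_shift (f := fun v => `|dil phi s v|) y)//; last by meas.
by have := nl1_dil bphi s0; rewrite /nl1 => ->; rewrite ltry.
Qed.

Let Rint_dil s : 0 < s -> \int[mu]_v dil phi s v = 1.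
Proof. by move=> s0; rewrite /Rintegral (int_dil bphi s0). Qed.

(** The bump averages [k] over points within [s / 4] of [z]; the second condition keeps these points
    outside the truncation. *)
Lemma kF_near s z : 0 < s -> s <= enorm z -> 4 * rho < 3 * enorm z ->
  `|kF s z - k z| <= w (s / (4 * enorm z)) * enorm z ^- n.
Proof.
move=> s0 sz rz; have md := meas_dil bphi s; have z0 : 0 < enorm z := lt_le_trans s0 sz.
have id := intg_dil bphi s0.
have -> : kF s z - k z = \int[mu]_v (dil phi s v * (ktr (z - v) - k z)).
  rewrite /kF conv_swap//; last exact: meas_ktr.
  rewrite -[X in _ - X]mul1r -(Rint_dil s0) -RintegralZr// -RintegralB//.
  - by apply: eq_Rintegral => v _; rewrite mulrBr.
  - exact: intg_dk.
  - by have := intgZ (k z) id; apply: eq_integrable => // v _; rewrite /= mulrC.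
set W := w _ * _.
have W0 : 0 <= W.
  rewrite mulr_ge0//; first by apply: w_ge0; rewrite divr_ge0 ?mulr_ge0 ?(ltW s0) ?(ltW z0).
  by rewrite invr_ge0 exprn_ge0// ltW.
have pw v : `|dil phi s v * (ktr (z - v) - k z)| <= dil phi s v * W.
  have d0 := dil_ge0 bphi s0 v; rewrite normrM ger0_norm//.
  have [->|/(dil_supp bphi s0) vs] := eqVneq (dil phi s v) 0; first by rewrite !mul0r.
  rewrite ler_wpM2l//.
  have h1 : rho < enorm (z - v).
    by have := enormD (z - v) v; rewrite subrK; lra.
  rewrite /ktr h1; apply: le_trans (kreg (enorm_gt0 z0) _) _.
    by have := enorm_ge0 v; lra.
  rewrite ler_wpM2r ?invr_ge0 ?exprn_ge0 ?(ltW z0)//; apply: w_mono.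
    by rewrite divr_ge0 ?enorm_ge0.
  rewrite invfM mulrA ler_wpM2r ?invr_ge0 ?(ltW z0)//.
have iW : intg mu (fun v => dil phi s v * W).
  by have := intgZ W id; apply: eq_integrable => // v _; rewrite /= mulrC.
have mk := meas_refl z meas_ktr.
have iD : intg mu (fun v => dil phi s v * (ktr (z - v) - k z)).
  apply: (le_intg _ iW); first by meas.
  by move=> v; apply: le_trans (pw v) _; rewrite ler_norm.
apply: le_trans (le_normr_Rintegral measurableT iD) _.
rewrite -[leRHS]mul1r -(Rint_dil s0) -RintegralZr//; apply: le_Rintegral => //.
have mm := intg_meas iD; apply: (le_intg _ iW); first by meas.
by move=> v; rewrite normr_id; apply: le_trans (pw v) _; rewrite ler_norm.
Qed.

Let kF_shift s z y : 0 < s -> kF s (z + y) = \int[mu]_v (dil phi s (v + y) * ktr (z - v)).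
Proof.
move=> s0; rewrite /kF conv_swap//; [|exact: (meas_dil bphi)|exact: meas_ktr].
have md := meas_dil bphi s; have mk := meas_refl (z + y) meas_ktr.
rewrite -(Rint_shift (f := fun v => dil phi s v * ktr (z + y - v)) y); last by meas.
by apply: eq_Rintegral => v _; rewrite opprD addrACA subrr addr0.
Qed.

(** The difference of two translated bumps has integral zero, so [k z] may be subtracted: smoothness
    of the bump gives [tau / s], regularity of the kernel gives [w]. *)
Lemma kF_mid s z y (tau d : R) : 0 < s -> l1 y <= tau -> tau <= s -> d <= enorm z ->
  4 * s <= d -> 16 * rho <= d ->
  `|kF s z - kF s (z + y)| <= Lam * n%:R * 4 ^+ n * (tau / s) * w (2 * s / d) * d ^- n.
Proof.
move=> s0 yt ts dz sd rd; have md := meas_dil bphi s.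
have d0 : 0 < d by lra.
have z0 : 0 < enorm z := lt_le_trans d0 dz.
have tau0 : 0 <= tau by exact: le_trans (l1_ge0 y) yt.
have id := intg_dil bphi s0; have idy := intg_dilD y s0.
have mdy := intg_meas idy; have mk := meas_refl z meas_ktr.
have yc i : `|y ord0 i| <= tau.
  by apply: le_trans yt; rewrite /l1 (bigD1 i)//= lerDl; apply: sumr_ge0.
have ye : enorm y <= tau by exact: le_trans (enorm_le_l1 y) yt.
have iB : intg mu (fun v => dil phi s v - dil phi s (v + y)) by exact: intgB.
have -> : kF s z - kF s (z + y) =
    \int[mu]_v ((dil phi s v - dil phi s (v + y)) * (ktr (z - v) - k z)).
  rewrite kF_shift// {1}/kF conv_swap//; last exact: meas_ktr.
  rewrite -RintegralB//; [|exact: intg_dk|exact: intg_dk].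
  have zz : \int[mu]_v ((dil phi s v - dil phi s (v + y)) * k z) = 0.
    rewrite RintegralZr// RintegralB//.
    by rewrite (Rint_shift y md) subrr mul0r.
  rewrite -[LHS]subr0 -zz -RintegralB//.
  - by apply: eq_Rintegral => v _; ring.
  - by have := intgB (intg_dk z id) (intg_dk z idy); apply: eq_integrable => // v _.
  - by have := intgZ (k z) iB; apply: eq_integrable => // v _; rewrite /= mulrC.
set W := w (2 * s / d) * d ^- n.
have W0 : 0 <= W.
  rewrite mulr_ge0//; first by apply: w_ge0; rewrite divr_ge0 ?mulr_ge0 ?(ltW s0) ?(ltW d0).
  by rewrite invr_ge0 exprn_ge0// ltW.
have pw v : `|(dil phi s v - dil phi s (v + y)) * (ktr (z - v) - k z)| <=
    (tau / s * W) * chi Lam s v.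
  rewrite normrM [tau / s * W]mulrC -mulrA [W * _]mulrC.
  have h0 := dil_chi bphi s0 v tau0 ts yc.
  have [e0|ne0] := eqVneq (dil phi s v - dil phi s (v + y)) 0.
    rewrite e0 normr0 mul0r; apply: mulr_ge0 => //; apply: mulr_ge0.
      by rewrite divr_ge0// ltW.
    exact: (chi_ge0 bphi s0 v).
  apply: ler_pM => //.
  have vs : enorm v <= 5 / 4 * s.
    have [z1|/(dil_supp bphi s0) h] := eqVneq (dil phi s v) 0; last by lra.
    have [z2|/(dil_supp bphi s0) h] := eqVneq (dil phi s (v + y)) 0.
      by move: ne0; rewrite z1 z2 subrr eqxx.
    by have := enormD (v + y) (- y); rewrite addrK enormN; lra.
  have h1 : rho < enorm (z - v).
    by have := enormD (z - v) v; rewrite subrK; lra.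
  rewrite /ktr h1; apply: le_trans (kreg (enorm_gt0 z0) _) _.
    by have := enorm_ge0 v; lra.
  apply: ler_pM.
  - by apply: w_ge0; rewrite divr_ge0 ?enorm_ge0.
  - by rewrite invr_ge0 exprn_ge0// ltW.
  - apply: w_mono; first by rewrite divr_ge0 ?enorm_ge0.
    apply: ler_pM; rewrite ?enorm_ge0 ?invr_ge0 ?(ltW z0)//.
      by lra.
    by rewrite lef_pV2 ?posrE.
  - rewrite lef_pV2 ?posrE ?exprn_gt0//; apply: lerXn2r; rewrite ?nnegrE ?(ltW d0) ?(ltW z0)//.
have mchi := @meas_chi R n Lam s.
have ichi : intg mu (chi Lam s) by apply: intgP => //; rewrite (nl1_chi bphi s0) ltry.
have iW := intgZ (tau / s * W) ichi.
have iD : intg mu (fun v => (dil phi s v - dil phi s (v + y)) * (ktr (z - v) - k z)).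
  apply: (le_intg _ iW); first by meas.
  by move=> v; apply: le_trans (pw v) _; rewrite ler_norm.
apply: le_trans (le_normr_Rintegral measurableT iD) _.
apply: (@le_trans _ _ (\int[mu]_v (tau / s * W * chi Lam s v))).
  apply: le_Rintegral => //.
  have mm := intg_meas iD; apply: (le_intg _ iW); first by meas.
  by move=> v; rewrite normr_id; apply: le_trans (pw v) _; rewrite ler_norm.
rewrite RintegralZl// (_ : \int[mu]_v chi Lam s v = Lam * n%:R * 4 ^+ n).
  by rewrite le_eqVlt; apply/orP; left; apply/eqP; rewrite /W; ring.
rewrite /Rintegral (_ : integral _ _ _ = nl1 mu (chi Lam s)); first by rewrite (nl1_chi bphi s0).
by rewrite /nl1; apply: eq_integral => v _; rewrite ger0_norm// (chi_ge0 bphi s0).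
Qed.

(** The bump now covers the singularity, and regularity of the kernel gives nothing. Its
    cancellation allows the value at the origin to be subtracted from the difference of the bumps;
    the second-difference bound then contributes a factor [|x|], and [|x|^(1-n)] has integral of
    order [s] over [|x| < 8 s]. *)
Lemma kF_far p z y (tau : R) : l1 y <= tau -> tau <= rho * 2 ^+ p ->
  enorm z <= 4 * (rho * 2 ^+ p) ->
  `|kF (rho * 2 ^+ p) z - kF (rho * 2 ^+ p) (z + y)| <=
  16 * 4 ^+ n * (Lam * n%:R) * CK * (tau / (rho * 2 ^+ p)) * (rho * 2 ^+ p) ^- n.
Proof.
move=> yt ts zs; set s := rho * 2 ^+ p in ts zs *.
have s0 : 0 < s by rewrite mulr_gt0// exprn_gt0.
have md := meas_dil bphi s; have mk := meas_ktr.
have tau0 : 0 <= tau by exact: le_trans (l1_ge0 y) yt.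
have ye : enorm y <= tau by exact: le_trans (enorm_le_l1 y) yt.
have id := intg_dil bphi s0.
pose h x : R := dil phi s (z - x) - dil phi s (z + y - x).
have m1 := meas_refl z md; have m2 := meas_refl (z + y) md.
have mh : measurable_fun setT h by rewrite /h; meas.
pose D : set rV := [set x | rho < enorm x < 8 * s].
(* The bumps involved live within [8 * s] of the origin, so cutting there changes nothing and leaves
   an annulus on which [k] integrates to zero. *)
pose k2 x : R := if rho < enorm x < 8 * s then k x else 0.
have k2E x : k2 x = ktr x * (enorm x < 8 * s)%R%:R.
  by rewrite /k2 /ktr; case: ltP => //= _; [case: ifP; rewrite ?mulr1 ?mulr0|rewrite mul0r].
have mk2 : measurable_fun setT k2.
  rewrite (_ : k2 = fun x => ktr x * (1 - (8 * s <= enorm x)%R%:R)); last first.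
    by apply/funext => x; rewrite k2E leNgt; case: (_ < _); rewrite /= ?subr0 ?subrr.
  apply: measurable_funM => //; apply: measurable_funB => //; apply: meas_bool.
  rewrite (_ : [set _ | _] = (@enorm R n) @^-1` `[8 * s, +oo[%classic); last first.
    by apply/seteqP; split => x /=; rewrite in_itv/= andbT.
  by rewrite -[X in measurable X]setTI; apply: measurable_enorm.
(* With these weights [ann] dominates [|x|^(1-n)] on the [p + 3] dyadic annuli that fill
   [rho < |x| < 8 * s]. *)
pose th i : R := if (i < p + 3)%N then 2 ^+ i.+1 * rho else 0.
have th0 i : 0 <= th i.
  by rewrite /th; case: ifP => // _; rewrite mulr_ge0 ?exprn_ge0// ltW.
have thS N : \sum_(i < N) th i <= 16 * s.
  have thz i : (p + 2 < i)%N -> th i = 0 by rewrite /th => h1; rewrite ltnNge addnS h1.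
  apply: le_trans (sum_ord_zero_tail _ th0 thz) _.
  have hind m : \sum_(i < m) 2 ^+ i.+1 * rho <= 2 ^+ m.+1 * rho.
    elim: m => [|m IH]; first by rewrite big_ord0 mulr_ge0 ?exprn_ge0// ltW.
    rewrite big_ord_recr/=; apply: le_trans (lerD IH (lexx _)) _.
    by rewrite le_eqVlt; apply/orP; left; apply/eqP; rewrite !exprS; ring.
  rewrite (eq_bigr (fun i : 'I_(p + 2).+1 => 2 ^+ i.+1 * rho)); last first.
    by move=> i _; rewrite /th ifT// (_ : (p + 3 = (p + 2).+1)%N) ?ltn_ord// addnS.
  apply: le_trans (hind _) _; rewrite (_ : (p + 2).+2 = p + 4)%N; last by rewrite !addnS.
  by rewrite /s exprD le_eqVlt; apply/orP; left; apply/eqP; ring.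
pose gb : rV -> R := ann rho th.
have gb0 x : 0 <= gb x by exact: (ann_ge0 rho0 th0).
have mgb : measurable_fun setT gb by exact: (meas_ann rho0 th0).
have gbE x : rho < enorm x < 8 * s -> enorm x * enorm x ^- n <= gb x.
  move=> /andP[h1 h2]; have x0 : 0 < enorm x := lt_trans rho0 h1.
  have [|i _ xi] := @find_annulus R n rho x 0 rho0; first by rewrite expr0 mul1r ltW.
  have ri : 0 < 2 ^+ i * rho by rewrite mulr_gt0// exprn_gt0.
  rewrite /gb (annE rho0 th0 xi); case/andP: xi => [x1 x2].
  have -> : th i = 2 ^+ i.+1 * rho.
    rewrite /th ifT//; have := le_lt_trans x1 h2.
    rewrite (_ : 8 * s = 2 ^+ (p + 3) * rho); last by rewrite /s exprD; ring.
    by rewrite ltr_pM2r// ltr_eXn2l ?ltr1n.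
  apply: ler_pM; rewrite ?enorm_ge0 ?invr_ge0 ?exprn_ge0 ?(ltW x2)// ?(ltW x0)//.
  by rewrite lef_pV2 ?posrE ?exprn_gt0//; apply: lerXn2r; rewrite ?nnegrE ?(ltW x0) ?(ltW ri).
have igb_le := @int_ann R n rho th rho0 th0 _ thS.
have igb : intg mu gb.
  apply: intgP => //; apply: le_lt_trans (ltry (4 ^+ n * (16 * s))).
  apply: le_trans igb_le; rewrite le_eqVlt; apply/orP; left; apply/eqP.
  by rewrite /nl1; apply: eq_integral => v _; rewrite ger0_norm// gb0.
have ik2 : intg mu k2.
  apply: (@le_intg _ _ _ mu _ (fun x => CK * rho^-1 * gb x)) => //; first exact: intgZ.
  move=> x; apply: le_trans (ler_norm _).
  rewrite /k2; case: ifP => hx; last by rewrite normr0 !mulr_ge0// invr_ge0 ltW.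
  have /andP[h1 _] := hx; have x0 : 0 < enorm x := lt_trans rho0 h1.
  apply: le_trans (ksize (enorm_gt0 x0)) _; rewrite -mulrA ler_wpM2l//.
  rewrite ler_pdivlMl//; apply: le_trans (gbE x hx).
  by rewrite ler_wpM2r ?invr_ge0 ?exprn_ge0// ltW.
have k20 : \int[mu]_x k2 x = 0.
  have r8 : rho < 8 * s.
    rewrite /s mulrCA ltr_pMr//; apply: (@lt_le_trans _ _ 8); first by rewrite ltr1n.
    by rewrite ler_peMr// exprn_ege1// ler1n.
  rewrite -(kcanc rho0 r8) [RHS]Rintegral_mkcond; apply: eq_Rintegral => x _.
  rewrite /k2 patchE; have [hx|/negP hx] := boolP (rho < enorm x < 8 * s).
    by rewrite mem_set.
  by rewrite memNset.
have hk x : h x * ktr x = h x * k2 x.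
  rewrite k2E; case: ltP => xs; rewrite ?mulr1// mulr0.
  have -> : h x = 0.
    rewrite /h; have [->|/(dil_supp bphi s0) h1] := eqVneq (dil phi s (z - x)) 0.
      have [->|/(dil_supp bphi s0) h2] := eqVneq (dil phi s (z + y - x)) 0; first by rewrite subrr.
      have := enormD (- (z + y - x)) (z + y); rewrite opprB subrK.
      have := enormD z y; have := enormN (z + y - x); rewrite opprB => -> ha hb; exfalso; lra.
    have := enormD (- (z - x)) z; rewrite opprB subrK -opprB enormN => hb; exfalso; lra.
  by rewrite !mul0r.
have ir z' : intg mu (fun x => dil phi s (z' - x)).
  apply: intgP; first exact: meas_refl.
  rewrite /nl1 (nl_refl (f := fun x => `|dil phi s x|) z')//; last by meas.
  by have := nl1_dil bphi s0; rewrite /nl1 => ->; rewrite ltry.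
have irk z' : intg mu (fun x => dil phi s (z' - x) * ktr x).
  have mr := intg_meas (ir z').
  apply: (@le_intg _ _ _ mu _ (fun x => (CK * rho ^- n) * dil phi s (z' - x))); [by meas|exact: intgZ|move=> x].
  by rewrite mulrC !normrM ler_wpM2r// (le_trans (ktr_le _))// -normrM ler_norm.
(* The value of [h] at the origin. *)
pose h0 := dil phi s z - dil phi s (z + y).
have DE : kF s z - kF s (z + y) = \int[mu]_x ((h x - h0) * k2 x).
  have e1 : kF s z - kF s (z + y) = \int[mu]_x (h x * k2 x).
    rewrite /kF /conv -RintegralB//; [|exact: irk|exact: irk].
    by apply: eq_Rintegral => x _; rewrite -hk /h mulrBl.
  rewrite e1 -[LHS]subr0 -(mulr0 h0) -k20 -RintegralZl// -RintegralB//.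
  - by apply: eq_Rintegral => x _; rewrite [RHS]mulrBl.
  - have := intgB (irk z) (irk (z + y)); apply: eq_integrable => // x _ /=.
    by rewrite -hk /h mulrBl.
  - exact: intgZ.
pose c := Lam * s ^- n.+2 * tau * n%:R * CK.
have c0 : 0 <= c by rewrite !mulr_ge0// invr_ge0 exprn_ge0// ltW.
have pw x : `|(h x - h0) * k2 x| <= c * gb x.
  rewrite normrM /k2; case: ifP => hx; last by rewrite normr0 mulr0 mulr_ge0.
  have /andP[h1 _] := hx; have x0 : 0 < enorm x := lt_trans rho0 h1.
  have l1x : l1 x <= n%:R * enorm x by apply: l1_le => i; exact: coord_le_enorm.
  have b1 : `|h x - h0| <= Lam * s ^- n.+2 * (tau * (n%:R * enorm x)).
    rewrite -normrN opprB; apply: le_trans (dil_lip2 bphi s0 z y x) _.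
    rewrite ler_wpM2l//; first by rewrite mulr_ge0// invr_ge0 exprn_ge0// ltW.
    by apply: ler_pM => //; exact: l1_ge0.
  apply: le_trans (ler_pM (normr_ge0 _) (normr_ge0 _) b1 (ksize (enorm_gt0 x0))) _.
  rewrite (_ : Lam * s ^- n.+2 * (tau * (n%:R * enorm x)) * (CK / enorm x ^+ n) =
    c * (enorm x * enorm x ^- n)); last by rewrite /c; ring.
  by rewrite ler_wpM2l// gbE.
have iD : intg mu (fun x => (h x - h0) * k2 x).
  apply: (le_intg _ (intgZ c igb)); first by meas.
  by move=> x; apply: le_trans (pw x) _; rewrite ler_norm.
rewrite DE; apply: le_trans (le_normr_Rintegral measurableT iD) _.
apply: (@le_trans _ _ (\int[mu]_x (c * gb x))).
  apply: le_Rintegral => //; last exact: intgZ.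
  have mm := intg_meas iD; apply: (le_intg _ (intgZ c igb)); first by meas.
  by move=> x; rewrite normr_id; apply: le_trans (pw x) _; rewrite ler_norm.
rewrite RintegralZl//; apply: le_trans (ler_wpM2l c0 (_ : _ <= 4 ^+ n * (16 * s))) _.
  by rewrite -lee_fin (EFin_Rintegral igb).
rewrite /c le_eqVlt; apply/orP; left; apply/eqP; rewrite !exprS; field.
by rewrite expf_neq0// gt_eqF.
Qed.

(** [yy i] bounds the l^q norm, over the scales below the shift, of the errors made on replacing
    [phi_k * K] by [K]. It is kept abstract because two choices are made later: a sharp one, and one
    that depends on the number of scales but asks only for the Dini condition on [w]. *)
Variables (q : R) (M a : nat) (yy : nat -> R).
Hypothesis q1 : 1 <= q.
Hypothesis yy0 : forall i, 0 <= yy i.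
Hypothesis hyy : forall i b, \sum_(l < M.+1) (if (l < b)%N then w (2^-1 ^+ (b + i - l)) `^ q else 0)
  <= yy i `^ q.

Let F p := kF (rho * 2 ^+ p).
Let c1 := Lam * n%:R * 4 ^+ n.
Let c3 := 16 * 4 ^+ n * (Lam * n%:R).

(* For [z] at distance about [rho 2^(J+i)] and a translation by at most
   [rho 2^J], the terms account for the scales [p < J], [J <= p < J + i - 1] and
   [p >= J + i - 1]. *)
Definition kth i : R := 4 * (w (2^-1 ^+ i) + 4 * (2 ^+ n.+1 * yy i) +
  4 * (c1 * (\sum_(l < i.-1) 2^-1 ^+ l * w (2^-1 ^+ (i.-1 - l))) + 4 * 2 ^+ n * c3 * CK * 2^-1 ^+ i)).

Let c10 : 0 <= c1.
Proof. by rewrite /c1 !mulr_ge0// exprn_ge0. Qed.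

Let c30 : 0 <= c3.
Proof. by rewrite /c3; apply: mulr_ge0; [apply: mulr_ge0; [exact: ler0n|exact: exprn_ge0]|exact: mulr_ge0]. Qed.

Let h0 i : 0 <= (2^-1 : R) ^+ i.
Proof. by rewrite exprn_ge0// invr_ge0. Qed.

Lemma kth_ge0 i : 0 <= kth i.
Proof.
rewrite /kth; apply: mulr_ge0 => //; apply: addr_ge0; first apply: addr_ge0.
- exact: w_ge0.
- by apply: mulr_ge0 => //; apply: mulr_ge0 => //; exact: exprn_ge0.
apply: mulr_ge0 => //; apply: addr_ge0.
  by apply: mulr_ge0 => //; apply: sumr_ge0 => l _; apply: mulr_ge0 => //; exact: w_ge0.
by apply: mulr_ge0 => //; apply: mulr_ge0 => //; apply: mulr_ge0 => //; apply: mulr_ge0 => //; exact: exprn_ge0.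
Qed.

(** Below the shift the kernels are close to [k] at both points, which leaves the sequence [A] with
    its single jump and the errors [B1], measured in l^q. From the shift on ([B2]), the differences
    decay and an l^1 sum is enough. *)
Lemma kernel_hormander P i z y t K : (4 <= i)%N ->
  l1 y <= rho * 2 ^+ P ->
  2 ^+ i * (rho * 2 ^+ P) <= enorm z < 2 ^+ i.+1 * (rho * 2 ^+ P) -> ndecr t ->
  pvar q (fun j => upto M (fun j => F (a + j)) j z - upto M (fun j => F (a + j)) j (z + y)) t K <=
  (kth i * (2 ^+ i * (rho * 2 ^+ P)) ^- n) `^ q.
Proof.
move=> i4 yl /andP[zi zi1] tm.
have q0 : 0 < q by exact: lt_le_trans q1.
have tau0 : 0 < rho * 2 ^+ P by rewrite mulr_gt0// exprn_gt0.
set tau := rho * 2 ^+ P in yl zi zi1 tau0 *.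
set d := 2 ^+ i * tau in zi *.
have d0 : 0 < d by rewrite mulr_gt0// exprn_gt0.
have td : 16 * tau <= d.
  by rewrite ler_pM2r// (_ : 16 = 2 ^+ 4) ?ler_weXn2l ?ler1n// -natrX.
have rt : rho <= tau by rewrite ler_peMr ?(ltW rho0)// exprn_ege1// ler1n.
have ye : enorm y <= tau by exact: le_trans (enorm_le_l1 y) yl.
have z0 : 0 < enorm z := lt_le_trans d0 zi.
have zy : d / 2 <= enorm (z + y).
  by have := enormD (z + y) (- y); rewrite addrK enormN; lra.
have zy0 : 0 < enorm (z + y) by apply: lt_le_trans zy; rewrite divr_gt0.
have dn : 0 < d ^- n by rewrite invr_gt0 exprn_gt0.
have rp p : 0 < rho * 2 ^+ p by rewrite mulr_gt0// exprn_gt0.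
(* The indices [j <= M] whose scale [a + j] lies below [P]. *)
pose A j : R := if (j < minn M.+1 (P - a))%N then k z - k (z + y) else 0.
pose B1 j : R := if (j < minn M.+1 (P - a))%N then
  (F (a + j) z - k z) - (F (a + j) (z + y) - k (z + y)) else 0.
pose f p : R := if (P <= p)%N then F p z - F p (z + y) else 0.
pose B2 j : R := if (j <= M)%N then f (a + j)%N else 0.
have -> : (fun j => upto M (fun j => F (a + j)) j z - upto M (fun j => F (a + j)) j (z + y)) =
    (fun j => A j + (B1 j + B2 j)).
  apply/funext => j; rewrite /A /B1 /B2 /f /upto leq_min ltnS.
  case: (leqP j M) => jM /=; last by rewrite subrr !addr0.
  case: (ltnP j (P - a)) => jP.
    rewrite ltn_subRL in jP; rewrite leqNgt jP /=.
    by move: (F _ z) (F _ (z + y)) (k z) (k (z + y)) => u1 u2 u3 u4; ring.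
  by rewrite leq_subLR in jP; rewrite jP !add0r.
have hA : pvar q A t K <= (w (2^-1 ^+ i) * d ^- n) `^ q.
  apply: le_trans (@pvar_step R q (k z - k (z + y)) (minn M.+1 (P - a)) t K q0 tm) _.
  apply: ge0_ler_powR; rewrite ?nnegrE ?(ltW q0)//.
    by rewrite mulr_ge0 ?(ltW dn)//; exact: w_ge0.
  have e0 := enorm_ge0 y.
  rewrite distrC -[y]opprK; apply: le_trans (kreg (enorm_gt0 z0) _) _; rewrite enormN.
    by lra.
  apply: ler_pM.
  - by apply: w_ge0; rewrite divr_ge0// ltW.
  - by rewrite invr_ge0 exprn_ge0// ltW.
  - apply: w_mono; first by rewrite divr_ge0// ltW.
    rewrite ler_pdivrMr//; apply: le_trans ye _.
    rewrite -ler_pdivrMl ?exprn_gt0 ?invr_gt0// exprVn invrK.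
    by [].
  - by rewrite lef_pV2 ?posrE ?exprn_gt0//; apply: lerXn2r; rewrite ?nnegrE ?(ltW d0) ?(ltW z0).
have near p v : (p < P)%N -> d / 2 <= enorm v ->
    `|F p v - k v| <= w (2^-1 ^+ (P + i - p)) * (2 ^+ n * d ^- n).
  move=> pP dv; have v0 : 0 < enorm v by apply: lt_le_trans dv; rewrite divr_gt0.
  have sp : rho * 2 ^+ p <= tau by rewrite /tau ler_pM2l// ler_weXn2l ?ler1n// ltnW.
  have sv : rho * 2 ^+ p <= enorm v by lra.
  apply: le_trans (kF_near (rp p) sv _) _; first by lra.
  apply: ler_pM.
  - by apply: w_ge0; rewrite divr_ge0 ?mulr_ge0 ?exprn_ge0// ltW.
  - by rewrite invr_ge0 exprn_ge0// ltW.
  - apply: w_mono; first by rewrite divr_ge0 ?mulr_ge0 ?exprn_ge0// ltW.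
    rewrite ler_pdivrMr ?mulr_gt0//; apply: (@le_trans _ _ (2^-1 ^+ (P + i - p) * d)).
      have e : 2 ^+ i * 2 ^+ P = 2 ^+ (P + i - p) * 2 ^+ p :> R.
        by rewrite -!exprD; congr (_ ^+ _); move: pP; clear; lia.
      rewrite le_eqVlt; apply/orP; left; apply/eqP; rewrite exprVn.
      rewrite (_ : d = rho * (2 ^+ i * 2 ^+ P)); last by rewrite /d /tau; ring.
      by rewrite e; field; rewrite expf_neq0.
    by rewrite ler_wpM2l//; lra.
  - rewrite (_ : 2 ^+ n * d ^- n = (d / 2) ^- n); last first.
      by rewrite expr_div_n invf_div.
    rewrite lef_pV2 ?posrE ?exprn_gt0 ?divr_gt0//; apply: lerXn2r; rewrite ?nnegrE ?(ltW v0)//.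
    by rewrite divr_ge0// ltW.
have h4 : (4 : R) `^ q = 2 `^ q * 2 `^ q by rewrite -powRM// -natrM.
have h24 : 2 * 2 `^ q <= (4 : R) `^ q.
  by rewrite h4 ler_wpM2r ?powR_ge0// le1r_powR// ler1n.
have hB1 : pvar q B1 t K <= (4 * (2 ^+ n.+1 * yy i * d ^- n)) `^ q.
  have Bz j : (M < j)%N -> B1 j = 0.
    move=> Mj; rewrite /B1 ifF//; apply/negbTE; rewrite -leqNgt.
    exact: leq_trans (geq_minl _ _) Mj.
  apply: le_trans (pvar_lq _ q0 tm Bz) _.
  have X0 : 0 <= 2 ^+ n.+1 * d ^- n :> R by rewrite mulr_ge0 ?exprn_ge0// ltW.
  have hs : \sum_(j < M.+1) `|B1 j| `^ q <= (2 ^+ n.+1 * d ^- n) `^ q * (yy i `^ q).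
    apply: le_trans (ler_wpM2l (powR_ge0 _ _) (hyy i (P - a))).
    rewrite mulr_sumr; apply: ler_sum => j _; rewrite /B1 leq_min ltn_ord/=.
    case: ltnP => jP; last by rewrite normr0 powR0 ?gt_eqF// mulr0.
    have wj0 : 0 <= w (2^-1 ^+ (P - a + i - j)) by exact: w_ge0.
    rewrite -powRM//; apply: ge0_ler_powR; rewrite ?nnegrE ?(ltW q0)//.
      exact: mulr_ge0.
    have jP' : (a + j < P)%N by rewrite -ltn_subRL.
    have e : (P - a + i - j = P + i - (a + j))%N by move: jP'; clear; lia.
    apply: le_trans (ler_normB _ _) _.
    have dz2 : d / 2 <= enorm z by lra.
    apply: le_trans (lerD (near _ _ jP' dz2) (near _ _ jP' zy)) _.
    by rewrite e le_eqVlt; apply/orP; left; apply/eqP; rewrite exprS; ring.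
  apply: le_trans (ler_wpM2l _ hs) _; first by rewrite mulr_ge0// powR_ge0.
  rewrite -(powRM _ X0 (yy0 i)).
  rewrite (_ : 2 ^+ n.+1 * d ^- n * yy i = 2 ^+ n.+1 * yy i * d ^- n); last by ring.
  rewrite [leRHS]powRM ?ler_wpM2r ?powR_ge0//.
  by rewrite mulr_ge0 ?(ltW dn)// mulr_ge0// exprn_ge0.
pose G l : R := c1 * d ^- n * (2^-1 ^+ l * w (2^-1 ^+ (i.-1 - l))).
have G0 l : 0 <= G l.
  by rewrite !mulr_ge0 ?(ltW dn)//; exact: w_ge0.
(* From this index on, the scale is at least [d / 2], hence at least [|z| / 4], as [kF_far]
   requires; one index earlier it is at most [d / 4], as [kF_mid] requires. *)
pose far p : R := if (i.-1 + P <= p)%N then f p else 0.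
have fsplit p : `|f p| <= (if (P <= p < P + i.-1)%N then G (p - P)%N else 0) + `|far p|.
  rewrite /far [(i.-1 + P)%N]addnC; case: (leqP (P + i.-1) p) => ip.
    by rewrite andbF add0r.
  rewrite normr0 addr0 andbT /f; case: (leqP P p) => Pp; last by rewrite normr0.
  have ts : tau <= rho * 2 ^+ p by rewrite /tau ler_pM2l// ler_weXn2l ?ler1n.
  have e : 2 ^+ i * 2 ^+ P = 2 * 2 ^+ (i.-1 - (p - P)) * 2 ^+ p :> R.
    by rewrite -exprS -!exprD; congr (_ ^+ _); move: Pp ip i4; clear; lia.
  have de : d = 2 * 2 ^+ (i.-1 - (p - P)) * (rho * 2 ^+ p).
    rewrite (_ : d = rho * (2 ^+ i * 2 ^+ P)); first by rewrite e; ring.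
    by rewrite /d /tau; ring.
  apply: le_trans (kF_mid (rp p) yl ts zi _ _) _.
  - rewrite de ler_pM2r// (_ : 4 = 2 * 2 ^+ 1); last by ring.
    by rewrite ler_pM2l// ler_weXn2l ?ler1n//; move: Pp ip i4; clear; lia.
  - by apply: le_trans td; rewrite ler_pM2l.
  rewrite -/c1 /G.
  have -> : 2 * (rho * 2 ^+ p) / d = 2^-1 ^+ (i.-1 - (p - P)).
    by rewrite de exprVn; field; rewrite !expf_neq0// gt_eqF.
  have -> : tau / (rho * 2 ^+ p) = 2^-1 ^+ (p - P).
    have e3 : 2 ^+ p = 2 ^+ (p - P) * 2 ^+ P :> R by rewrite -exprD subnK.
    rewrite e3 /tau exprVn; field.
    by rewrite !expf_neq0// gt_eqF.
  by rewrite le_eqVlt; apply/orP; left; apply/eqP; ring.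
pose c5 := c3 * CK * (2 ^+ n * d ^- n).
have c50 : 0 <= c5 by rewrite /c5 mulr_ge0 ?mulr_ge0 ?exprn_ge0// ltW.
have hfar : \sum_(p < a + M.+1) `|far p| <= 2 * c5 * 2^-1 ^+ i.-1.
  apply: (geo_tail bphi (P := P)) => //.
    by move=> p _ h1; rewrite /far leqNgt h1.
  move=> p _ h1; rewrite /far h1 /f (leq_trans (leq_addl i.-1 P) h1).
  have Pp : (P <= p)%N := leq_trans (leq_addl i.-1 P) h1.
  have ts : tau <= rho * 2 ^+ p by rewrite /tau ler_pM2l// ler_weXn2l ?ler1n.
  have de : d / 2 = rho * 2 ^+ (i.-1 + P).
    rewrite /d /tau exprD -{1}(prednK (_ : 0 < i)%N) ?exprS; last by rewrite (leq_trans _ i4).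
    by field.
  have dp : d / 2 <= rho * 2 ^+ p by rewrite de ler_pM2l// ler_weXn2l ?ler1n.
  apply: le_trans (kF_far yl ts _) _.
    have : 2 ^+ i.+1 * tau = 2 * d by rewrite /d exprS; ring.
    by lra.
  rewrite -/c3 /c5.
  have -> : tau / (rho * 2 ^+ p) = 2^-1 ^+ (p - P).
    have e3 : 2 ^+ p = 2 ^+ (p - P) * 2 ^+ P :> R by rewrite -exprD subnK.
    rewrite e3 /tau exprVn; field.
    by rewrite !expf_neq0// gt_eqF.
  rewrite -[_ * (2 ^+ n * d ^- n) * _]mulrA [2 ^+ n * d ^- n * _]mulrC -[leLHS]mulrA.
  rewrite ler_wpM2l ?mulr_ge0// ler_wpM2l//.
  rewrite (_ : 2 ^+ n * d ^- n = (d / 2) ^- n); last by rewrite expr_div_n invf_div.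
  rewrite lef_pV2 ?posrE ?exprn_gt0 ?divr_gt0//; apply: lerXn2r; rewrite ?nnegrE ?(ltW (rp p))//.
  by rewrite divr_ge0// ltW.
pose S := \sum_(l < i.-1) 2^-1 ^+ l * w (2^-1 ^+ (i.-1 - l)).
have hB2 : pvar q B2 t K <= (4 * (c1 * S + 4 * 2 ^+ n * c3 * CK * 2^-1 ^+ i) * d ^- n) `^ q.
  have Bz j : (M < j)%N -> B2 j = 0 by move=> Mj; rewrite /B2 leqNgt Mj.
  apply: le_trans (pvar_l1 K q1 tm Bz) _.
  have s0 : 0 <= \sum_(j < M.+1) `|B2 j| by apply: sumr_ge0.
  have le : \sum_(j < M.+1) `|B2 j| <= (c1 * S + 4 * 2 ^+ n * c3 * CK * 2^-1 ^+ i) * d ^- n.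
    rewrite (eq_bigr (fun j : 'I_M.+1 => `|f (a + j)%N|)); last first.
      by move=> j _; rewrite /B2 -ltnS ltn_ord.
    apply: le_trans (@sum_ord_shift _ (fun p => `|f p|) a M.+1 (fun=> normr_ge0 _)) _.
    apply: le_trans (ler_sum _ (fun (p : 'I_(a + M.+1)) _ => fsplit p)) _.
    rewrite big_split/=; apply: le_trans (lerD (sum_window _ _ _ G0) hfar) _.
    rewrite -mulr_sumr -/S /c5 le_eqVlt; apply/orP; left; apply/eqP.
    have -> : (2^-1 : R) ^+ i.-1 = 2 * 2^-1 ^+ i.
      by rewrite -{2}(prednK (_ : 0 < i)%N) ?exprS ?mulVKf// (leq_trans _ i4).
    by ring.
  apply: ge0_ler_powR; rewrite ?nnegrE ?(ltW q0)//.
  - exact: mulr_ge0.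
  - by rewrite -mulrA mulr_ge0//; apply: le_trans le.
  - by rewrite -mulrA ler_wpM2l.
apply: le_trans (pvarD _ _ _ _ (ltW q0)) _.
apply: le_trans (ler_wpM2l (powR_ge0 _ _) (lerD hA (pvarD _ _ _ _ (ltW q0)))) _.
apply: le_trans (ler_wpM2l (powR_ge0 _ _) (lerD (lexx _) (ler_wpM2l (powR_ge0 _ _) (lerD hB1 hB2)))) _.
set a1 := w _ * _; set a2 := 4 * (2 ^+ n.+1 * _ * _); set a3 := 4 * (c1 * S + _) * _.
have a10 : 0 <= a1 by rewrite mulr_ge0 ?(ltW dn)//; exact: w_ge0.
have a20 : 0 <= a2.
  by rewrite /a2 mulr_ge0// mulr_ge0 ?(ltW dn)// mulr_ge0// exprn_ge0.
have S0 : 0 <= S by apply: sumr_ge0 => l _; rewrite mulr_ge0//; exact: w_ge0.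
have a30 : 0 <= a3.
  rewrite /a3 mulr_ge0 ?(ltW dn)// mulr_ge0// addr_ge0//; first exact: mulr_ge0.
  by rewrite !mulr_ge0// exprn_ge0.
have -> : kth i * d ^- n = 4 * (a1 + a2 + a3).
  by rewrite /kth -/S /a1 /a2 /a3; ring.
rewrite powRM ?addr_ge0// h4 -mulrA ler_wpM2l ?powR_ge0//.
apply: (@le_trans _ _ (2 `^ q * (a1 `^ q + (a2 `^ q + a3 `^ q)))).
  rewrite [leRHS]mulrDr lerD2r ler_peMl ?powR_ge0//.
  by have := @le1r_powR _ 2 q (ler1n _ 2) q1; apply: le_trans; rewrite ler1n.
rewrite ler_wpM2l ?powR_ge0// -addrA.
apply: le_trans (lerD (lexx _) (powR_superadd q1 a20 a30)) _.
by apply: powR_superadd => //; exact: addr_ge0.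
Qed.

End kernel.

(** * Weak (1,1) bound for truncated kernels *)

Section kernel_weak11.
Context {R : realType} {n : nat}.
Local Notation mu := (@lebesgue_rV R n).
Local Notation rV := 'rV[R]_n.
Implicit Types (x y z v : rV).

Record real_kernel (k : rV -> R) (w : R -> R) (CK : R) : Prop := {
  rk_ge0 : forall t, 0 <= t -> 0 <= w t;
  rk_mono : forall s t, 0 <= s -> s <= t -> w s <= w t;
  rk_cvg : forall e : R, 0 < e -> exists i : nat, w (2^-1 ^+ i) < e;
  rk_CK0 : 0 <= CK;
  rk_size : forall x, x != 0 -> `|k x| <= CK * enorm x ^- n;
  rk_reg : forall x y, x != 0 -> 2 * enorm y <= enorm x ->
    `|k (x - y) - k x| <= w (enorm y / enorm x) * enorm x ^- n;
  rk_canc : forall e r : R, 0 < e -> e < r ->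
    \int[mu]_(x in [set x | e < enorm x < r]) k x = 0 }.

Lemma geo2_sum N : \sum_(i < N) (2^-1 : R) ^+ i <= 2.
Proof.
have := @geo_sum_le R 2^-1 N; rewrite (_ : 1 - 2^-1 = 2^-1); last by field.
by rewrite invrK => h; apply: h; [rewrite invr_ge0|rewrite invf_lt1// ltr1n].
Qed.

(** The entry at 0 would involve [w 1], which is not among the terms of the dyadic sums [W]; the
    annuli under consideration have [i >= 4]. *)
Definition tail1 (th : nat -> R) (i : nat) : R := if i is i'.+1 then th i'.+1 else 0.

(** The only double sum is a convolution of a geometric sequence with the values of [w]; exchanging
    the sums bounds it by [2 * W]. *)
Lemma kth_sum (w : R -> R) (CK Lam : R) (yy : nat -> R) (W Y : R) N :
  (forall t, 0 <= t -> 0 <= w t) -> 0 <= CK -> 0 <= Lam -> (forall i, 0 <= yy i) ->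
  (forall N, \sum_(i < N) w (2^-1 ^+ i.+1) <= W) -> (forall N, \sum_(i < N) yy i <= Y) ->
  \sum_(i < N) tail1 (@kth R n w CK Lam yy) i <=
  (16 * 2 ^+ n.+1 + 36 * (Lam * n%:R * 4 ^+ n) + 128 * (2 ^+ n * (16 * 4 ^+ n * (Lam * n%:R))) + 4) * (W + Y + CK).
Proof.
move=> w0 CK0 L0 y0 hW hY.
have p0 i : 0 <= (2^-1 : R) ^+ i by rewrite exprn_ge0// invr_ge0.
have W0 : 0 <= W by have := hW 0%N; rewrite big_ord0.
have Y0 : 0 <= Y by have := hY 0%N; rewrite big_ord0.
set c1 := Lam * n%:R * 4 ^+ n; set c3 := 16 * 4 ^+ n * (Lam * n%:R).
have c10 : 0 <= c1 by rewrite !mulr_ge0// exprn_ge0.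
have c30 : 0 <= c3.
  by apply: mulr_ge0; [apply: mulr_ge0; [exact: ler0n|exact: exprn_ge0]|exact: mulr_ge0].
have n20 : 0 <= (2 : R) ^+ n by exact: exprn_ge0.
have n30 : 0 <= (2 : R) ^+ n.+1 by exact: exprn_ge0.
pose f1 := tail1 (fun i => w (2^-1 ^+ i)).
pose S i : R := \sum_(l < i.-1) 2^-1 ^+ l * w (2^-1 ^+ (i.-1 - l)).
have f10 i : 0 <= f1 i by case: i => //= i; exact: w0.
have S1 i : 0 <= S i by apply: sumr_ge0 => l _; rewrite mulr_ge0//; exact: w0.
have hf1 : \sum_(i < N) f1 i <= W.
  by case: N => [|N]; [rewrite big_ord0|rewrite big_ord_recl/= add0r; exact: hW].
have hS : \sum_(i < N) S i <= 2 * W.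
  apply: (@le_trans _ _ (\sum_(i < N) \sum_(l < N) 2^-1 ^+ l *
      (if (l + 2 <= i < l + 2 + N)%N then w (2^-1 ^+ (i - (l + 2)).+1) else 0))).
    apply: ler_sum => -[i iN] _ /=; rewrite /S.
    pose g l : R := 2^-1 ^+ l * (if (l + 2 <= i < l + 2 + N)%N then w (2^-1 ^+ (i - (l + 2)).+1) else 0).
    have g0 l : 0 <= g l by rewrite mulr_ge0//; case: ifP => // _; exact: w0.
    rewrite -/(\sum_(l < N) g l).
    have i1N : (i.-1 <= N)%N by move: iN; clear; lia.
    have -> : \sum_(l < N) g l = \sum_(l < i.-1 + (N - i.-1)) g l by rewrite subnKC.
    rewrite big_split_ord/=; apply: (@le_trans _ _ (\sum_(l < i.-1) g l)).
      apply: ler_sum => l _; rewrite /g ler_wpM2l// ifT.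
        by rewrite (_ : (i.-1 - l = (i - (l + 2)).+1)%N)//; have := ltn_ord l; clear; lia.
      by have := ltn_ord l; move: iN; clear; lia.
    by rewrite lerDl; apply: sumr_ge0 => l _; exact: g0.
  rewrite exchange_big/=.
  apply: (@le_trans _ _ (\sum_(l < N) 2^-1 ^+ l * W)).
    apply: ler_sum => l _; rewrite -mulr_sumr ler_wpM2l//.
    apply: le_trans (@sum_window R (fun j => w (2^-1 ^+ j.+1)) (l + 2) N N _) (hW N).
    by move=> j; exact: w0.
  by rewrite -mulr_suml ler_wpM2r// geo2_sum.
apply: (@le_trans _ _ (\sum_(i < N) (4 * f1 i + 16 * 2 ^+ n.+1 * yy i + 16 * c1 * S i +
    64 * (2 ^+ n * c3 * CK) * 2^-1 ^+ i))).
  apply: ler_sum => -[[|i] /= _] _; last first.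
    by rewrite /kth -/c1 -/c3 le_eqVlt; apply/orP; left; apply/eqP; rewrite /S /=; ring.
  by rewrite !addr_ge0// !mulr_ge0.
rewrite !big_split/= -!mulr_sumr.
have hY' := hY N; have hg := geo2_sum N.
set X1 := \sum_(i < N) f1 i in hf1 *; set X2 := \sum_(i < N) yy i in hY' *.
set X3 := \sum_(i < N) S i in hS *; set X4 := \sum_(i < N) _ in hg *.
have b2 : 2 ^+ n.+1 * X2 <= 2 ^+ n.+1 * Y by rewrite ler_wpM2l.
have b3 : c1 * X3 <= c1 * (2 * W) by rewrite ler_wpM2l.
have b4 : 2 ^+ n * c3 * CK * X4 <= 2 ^+ n * c3 * CK * 2 by rewrite ler_wpM2l// mulr_ge0// mulr_ge0.
have e1 := mulr_ge0 n30 W0; have e2 := mulr_ge0 n30 CK0; have e3 := mulr_ge0 c10 Y0.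
have e4 := mulr_ge0 c10 CK0; have e5 := mulr_ge0 (mulr_ge0 n20 c30) W0.
have e6 := mulr_ge0 (mulr_ge0 n20 c30) Y0; have e7 := mulr_ge0 c10 W0.
have e8 := mulr_ge0 n30 Y0; have e9 := mulr_ge0 (mulr_ge0 n20 c30) CK0.
move: b2 b3 b4 e1 e2 e3 e4 e5 e6 e7 e8 e9 hf1.
by move: (2 ^+ n.+1) (2 ^+ n * c3) => z1 z2; lra.
Qed.

(** The Calderon-Zygmund theorem for the kernels [phi_k * K^rho]. Their weak (2,2) bound is that of
    the bumps applied to [K^rho * h], by associativity, combined with the L^2 bound [A1]. The offset
    [a] separates the side of the cells from the first scale of the bumps. *)
Lemma kernel_weak11 (phi : rV -> R) (Lam q : R) : bump phi Lam -> 2 < q -> (0 < n)%N -> 0 < Lam ->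
  exists2 C : R, 0 <= C & forall k w CK rho M a yy W Y A1,
    real_kernel k w CK -> 0 < rho -> 0 < A1 -> (forall i, 0 <= yy i) ->
    (forall i b, \sum_(l < M.+1) (if (l < b)%N then w (2^-1 ^+ (b + i - l)) `^ q else 0) <= yy i `^ q) ->
    (forall N, \sum_(i < N) w (2^-1 ^+ i.+1) <= W) -> (forall N, \sum_(i < N) yy i <= Y) ->
    (forall h, cellconst rho h -> (nl1 mu h < +oo)%E ->
      (nl2 mu (conv (ktr k rho) h) <= (A1 ^+ 2)%:E * nl2 mu h)%E) ->
    forall u al, cellconst rho u -> (nl1 mu u < +oo)%E -> 0 < al ->
    omeas mu (Vset q (upto M (fun i => conv (dil phi (rho * 2 ^+ (a + i))) (conv (ktr k rho) u))) al)
      ((C * (A1 + W + Y + CK) / al)%:E * nl1 mu u).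
Proof.
move=> bphi q2 n0 L0; have q1 : 1 < q by rewrite (lt_trans _ q2)// ltr1n.
have [C22 C220 w22] := bump_weak22 q2 n0 L0.
pose c := (2 ^ (n + 4))%N.
pose KH : R := 16 * 2 ^+ n.+1 + 36 * (Lam * n%:R * 4 ^+ n) + 128 * (2 ^+ n * (16 * 4 ^+ n * (Lam * n%:R))) + 4.
have KH0 : 0 <= KH.
  have h1 : 0 <= (4 : R) ^+ n by exact: exprn_ge0.
  have h2 : 0 <= (2 : R) ^+ n by exact: exprn_ge0.
  have h3 : 0 <= Lam * n%:R by rewrite mulr_ge0// ltW.
  have h4 := mulr_ge0 h3 h1; have h5 := mulr_ge0 h2 (mulr_ge0 h1 h3).
  have h6 : 0 <= (2 : R) ^+ n.+1 by exact: exprn_ge0.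
  move: h4 h5 h6; rewrite /KH; move: (2 ^+ n.+1) => z1; lra.
pose K0 : R := 48 * 2 ^+ n + (c.*2.+1 ^ n)%:R + 8.
have K00 : 0 <= K0.
  by rewrite !addr_ge0.
have s22 : 0 <= Num.sqrt (C22 + 1) by exact: sqrtr_ge0.
exists (K0 * (Num.sqrt (C22 + 1) + 4 ^+ n * KH)).
  by rewrite mulr_ge0// addr_ge0// mulr_ge0// exprn_ge0.
move=> k w CK rho M a yy W Y A1 hk rho0 A10 yy0 hyy hW hY hT u al cu u1 al0.
case: hk => w_ge0 w_mono w_cvg CK0 ksize kreg kcanc.
have W0 : 0 <= W by have := hW 0%N; rewrite big_ord0.
have Y0 : 0 <= Y by have := hY 0%N; rewrite big_ord0.
(* A weak (2,2) constant enters as a square in [cz_weak11]; adding 1 keeps it positive. *)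
pose A := Num.sqrt (C22 + 1) * A1.
have A0 : 0 < A by rewrite mulr_gt0// sqrtr_gt0 ltr_wpDl.
have AE : A ^+ 2 = (C22 + 1) * A1 ^+ 2 by rewrite exprMn sqr_sqrtr// addr_ge0.
have mk : measurable_fun setT (ktr k rho) by exact: (meas_ktr w_mono w_cvg kreg rho0).
have kle := ktr_le CK0 ksize rho0.
pose F i := kF k rho phi (rho * 2 ^+ (a + i)).
pose L := upto M F.
have rp p : 0 < rho * 2 ^+ p by rewrite mulr_gt0// exprn_gt0.
have mF i : measurable_fun setT (F i) by apply: meas_conv => //; exact: (meas_dil bphi).
have mL i : measurable_fun setT (L i) by exact: meas_upto.
have Fb i x : `|F i x| <= CK * rho ^- n.
  have c0 : 0 <= CK * rho ^- n by rewrite mulr_ge0// invr_ge0 exprn_ge0// ltW.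
  have md := meas_dil bphi (rho * 2 ^+ (a + i)).
  have id := intg_dil bphi (rp (a + i)%N).
  rewrite /F /kF conv_swap//.
  have iD : intg mu (fun v => dil phi (rho * 2 ^+ (a + i)) v * ktr k rho (x - v)).
    have mr := meas_refl x mk.
    apply: (@le_intg _ _ _ mu _ (fun v => CK * rho ^- n * dil phi (rho * 2 ^+ (a + i)) v)); [by meas|exact: intgZ|].
    by move=> v; rewrite mulrC !normrM ler_wpM2r// (le_trans (kle _))// -normrM ler_norm.
  apply: le_trans (le_normr_Rintegral measurableT iD) _.
  have e : \int[mu]_v (CK * rho ^- n * dil phi (rho * 2 ^+ (a + i)) v) = CK * rho ^- n.
    by rewrite RintegralZl// /Rintegral (int_dil bphi (rp _)) mulr1.
  rewrite -e; apply: le_Rintegral => //; last 2 first.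
  - exact: intgZ.
  - move=> v _; rewrite normrM mulrC (ger0_norm (dil_ge0 bphi (rp _) v)).
    by rewrite ler_wpM2r// (dil_ge0 bphi (rp _)).
  have mm := intg_meas iD; apply: (le_intg _ iD); first by meas.
  by move=> v; rewrite normr_id.
have Lb i : exists b : R, forall x, `|L i x| <= b.
  exists (CK * rho ^- n) => x; rewrite /L /upto; case: ifP => _; first exact: Fb.
  by rewrite normr0 mulr_ge0// invr_ge0 exprn_ge0// ltW.
have convF h i : cellconst rho h -> (nl1 mu h < +oo)%E ->
    conv (F i) h = conv (dil phi (rho * 2 ^+ (a + i))) (conv (ktr k rho) h).
  move=> hc h1; apply/funext => x; rewrite /F /kF conv_assoc//.
  - exact: (meas_dil bphi).
  - exact: (meas_cellconst rho0 hc).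
  - by exists (CK * rho ^- n).
  - by rewrite (nl1_dil bphi)// ltry.
have convL h : cellconst rho h -> (nl1 mu h < +oo)%E -> (fun i => conv (L i) h) =
    upto M (fun i => conv (dil phi (rho * 2 ^+ (a + i))) (conv (ktr k rho) h)).
  move=> hc h1; apply/funext => i; rewrite /L conv_upto.
  by apply/funext => x; rewrite /upto convF.
pose th := tail1 (@kth R n w CK Lam yy).
have th0 i : 0 <= th i.
  case: i => [|i] //=; exact: (kth_ge0 w_ge0 CK0 bphi yy0).
have thS N : \sum_(i < N) th i <= KH * (W + Y + CK).
  by apply: kth_sum => //; exact: ltW.
have [|Th [mTh Th0 ThB hoer]] := @hormander_ann R n q rho L th _ rho0 th0 thS.
  move=> P i z y i4 yl zi t N tm.
  have := kernel_hormander w_ge0 w_mono w_cvg CK0 ksize kreg kcanc rho0 bphi a (ltW q1) yy0 hyy N i4 yl zi tm.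
  by rewrite /th; case: i i4 zi.
have w22' h al' : cellconst rho h -> (nl1 mu h < +oo)%E -> 0 < al' ->
    omeas mu (Vset q (fun i => conv (L i) h) al') ((A ^+ 2 / al' ^+ 2)%:E * nl2 mu h).
  move=> hc h1 al'0; rewrite convL//.
  have mh := meas_cellconst rho0 hc.
  have h2 := cellconst_nl2 rho0 hc h1.
  have g2 : (nl2 mu (conv (ktr k rho) h) < +oo)%E.
    apply: le_lt_trans (hT h hc h1) _; rewrite lte_mul_pinfty ?lee_fin ?sqr_ge0//.
  have := w22 phi (rho * 2 ^+ a) (conv (ktr k rho) h) M al' bphi (rp a) (meas_conv mk mh) g2 al'0.
  rewrite (_ : (fun i => conv (dil phi (rho * 2 ^+ a * 2 ^+ i)) (conv (ktr k rho) h)) =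
     (fun i => conv (dil phi (rho * 2 ^+ (a + i))) (conv (ktr k rho) h))); last first.
    by apply/funext => i; rewrite exprD mulrA.
  apply: omeas_le; apply: le_trans (lee_wpmul2l _ (hT h hc h1)) _.
    by rewrite lee_fin divr_ge0 ?sqr_ge0.
  rewrite muleA -EFinM lee_wpmul2r ?nl2_ge0// lee_fin AE mulrAC.
  by rewrite ler_wpM2r ?invr_ge0 ?sqr_ge0// ler_wpM2r ?sqr_ge0// lerDl.
have := cz_weak11 n0 q1 rho0 A0 mL Lb mTh Th0 ThB hoer w22' cu u1 al0.
rewrite convL//; apply: omeas_le; rewrite lee_wpmul2r ?nl1_ge0// lee_fin.
rewrite ler_wpM2r ?invr_ge0 ?(ltW al0)// -/K0 -mulrA ler_wpM2l// /A.
have n40 : 0 <= (4 : R) ^+ n by exact: exprn_ge0.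
have e1 := mulr_ge0 s22 W0; have e2 := mulr_ge0 s22 Y0; have e3 := mulr_ge0 s22 CK0.
have e4 := mulr_ge0 (mulr_ge0 n40 KH0) (ltW A10).
by move: e1 e2 e3 e4; move: (Num.sqrt _) (4 ^+ n) (KH) => z1 z2 z3; lra.
Qed.

End kernel_weak11.

(** * Functions constant on cells *)

Section real_operator.
Context {R : realType} {n : nat}.
Local Notation mu := (@lebesgue_rV R n).
Local Notation rV := 'rV[R]_n.
Implicit Types (x y z : rV).

Definition cbox (rho : R) (v : 'rV[int]_n) x : R := (cell rho x == v)%:R.

(** Off these cells, the distance to the cell [v] is at least [2 * rho], so the truncation is not
    felt. *)
Definition nearb (rho : R) (v : 'rV[int]_n) x : bool :=
  [forall i, `|cell rho x ord0 i - v ord0 i| <= 2].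

(** The real or imaginary part of [T] on real functions. The kernel representation is asked only on
    indicators of cells, which is all that the comparison with the truncated kernel uses. *)
Record real_op (S : (rV -> R) -> rV -> R) (k : rV -> R) (A : R) : Prop := {
  ro_meas : forall u, measurable_fun setT u -> (nl2 mu u < +oo)%E -> measurable_fun setT (S u);
  ro_bound : forall u, measurable_fun setT u -> (nl2 mu u < +oo)%E ->
    (nl2 mu (S u) <= (A ^+ 2)%:E * nl2 mu u)%E;
  ro_lin : forall (a : R) u v, measurable_fun setT u -> (nl2 mu u < +oo)%E ->
    measurable_fun setT v -> (nl2 mu v < +oo)%E ->
    {ae mu, forall x, S (fun y => a * u y + v y) x = a * S u x + S v x};
  ro_repr : forall (rho : R) v, 0 < rho ->
    {ae mu, forall x, ~~ nearb rho v x ->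
      S (cbox rho v) x = \int[mu]_y (k (x - y) * cbox rho v y)} }.

Variables (S : (rV -> R) -> rV -> R) (k : rV -> R) (w : R -> R) (CK A rho : R).
Hypothesis hS : real_op S k A.
Hypothesis hk : real_kernel k w CK.
Hypothesis rho0 : 0 < rho.
Hypothesis A0 : 0 < A.

Let CK0 : 0 <= CK := rk_CK0 hk.
Let lam := A + CK.
Let lam0 : 0 < lam.
Proof. by rewrite ltr_pwDl. Qed.

Let rn0 : 0 < rho ^+ n.
Proof. exact: exprn_gt0. Qed.

Let mk : measurable_fun setT (ktr k rho).
Proof. exact: (meas_ktr (rk_mono hk) (rk_cvg hk) (rk_reg hk) rho0). Qed.

Let kle x : `|ktr k rho x| <= CK * rho ^- n.
Proof. exact: (ktr_le CK0 (rk_size hk) rho0). Qed.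

Lemma cbox_cellconst v : cellconst rho (cbox rho v).
Proof. by move=> x y xy; rewrite /cbox xy. Qed.

Lemma meas_cbox v : measurable_fun setT (cbox rho v).
Proof. exact: (meas_cellconst rho0 (cbox_cellconst v)). Qed.

Lemma cbox_ge0 v x : 0 <= cbox rho v x.
Proof. exact: ler0n. Qed.

Lemma int_cbox v : (\int[mu]_x (cbox rho v x)%:E = (rho ^+ n)%:E)%E.
Proof.
rewrite -(measure_box v rho0) -(setIT (box rho v)) -integral_indic//; last exact: measurable_box.
apply: eq_integral => x _; rewrite /cbox indicE.
have [h|h] := eqVneq (cell rho x) v; first by rewrite mem_set//; exact/(cellP _ _ rho0).
by rewrite memNset// => /(cellP _ _ rho0) e; rewrite e eqxx in h.
Qed.

Lemma nl1_cbox v : nl1 mu (cbox rho v) = (rho ^+ n)%:E.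
Proof. by rewrite -(int_cbox v); apply: eq_integral => x _; rewrite ger0_norm ?cbox_ge0. Qed.

Lemma nl2_cbox v : nl2 mu (cbox rho v) = (rho ^+ n)%:E.
Proof.
rewrite -(int_cbox v); apply: eq_integral => x _; rewrite /cbox.
by case: (_ == _); rewrite ?expr1n ?expr0n.
Qed.

Lemma meas_nearb v : measurable_fun setT (fun x => (nearb rho v x)%:R : R).
Proof.
apply: meas_bool.
exact: (@measurable_cell_comp _ _ _ _ rho id
  [set c | [forall i, `|c ord0 i - v ord0 i| <= 2]] rho0 (@measurable_id _ _ setT)).
Qed.

Lemma int_nearb v : (\int[mu]_x ((nearb rho v x)%:R)%:E <= (6 ^+ n * rho ^+ n)%:E)%E.
Proof.
pose c : rV := \row_i (rho * (v ord0 i)%:~R).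
pose Q : set rV := [set z : rV | [forall i, `|z ord0 i| <= 3 * rho]].
have mQ : measurable_fun setT (fun z => [forall i, `|z ord0 i| <= 3 * rho]%R%:R : R).
  by apply: meas_bool; exact: cube_measurable.
apply: (@le_trans _ _ (\int[mu]_x ([forall i, `|(x - c) ord0 i| <= 3 * rho]%R%:R)%:E)%E).
  apply: le_nl; [exact: meas_nearb|exact: (meas_shift c mQ)|move=> x].
  rewrite ler0n/= ler_nat; case: (boolP (nearb rho v x)) => //= /forallP h.
  rewrite lt0b; apply/forallP => i.
  have := h i; rewrite !mxE ler_norml => /andP[h1 h2].
  have /andP[f1 f2] := floor_itv (x ord0 i / rho).
  rewrite ler_pdivlMr// in f1; rewrite ltr_pdivrMr// intrD in f2.
  set fl := Num.floor _ in h1 h2 f1 f2.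
  have g1 : (v ord0 i)%:~R - 2 <= fl%:~R :> R.
    by rewrite -(intrD _ _ (- 2)) ler_int; move: h1; lia.
  have g2 : fl%:~R <= (v ord0 i)%:~R + 2 :> R.
    by rewrite -(intrD _ _ 2) ler_int; move: h2; lia.
  by rewrite ler_norml; apply/andP; split; nra.
rewrite (nl_shift (f := fun z => [forall i, `|z ord0 i| <= 3 * rho]%R%:R) (- c) mQ)//.
rewrite [X in (X <= _)%E](_ : _ = mu Q); last first.
  rewrite -(setIT Q) -integral_indic//; last exact: cube_measurable.
  apply: eq_integral => x _; rewrite indicE.
  by have [h|/negP h] := boolP [forall i, `|x ord0 i| <= 3 * rho]; [rewrite mem_set|rewrite memNset].
rewrite cube_measure ?mulr_ge0 ?(ltW rho0)// lee_fin -exprMn.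
by rewrite le_eqVlt; apply/orP; left; apply/eqP; congr (_ ^+ _); ring.
Qed.

Let ev v x : R := S (cbox rho v) x - conv (ktr k rho) (cbox rho v) x.

Let c2oo v : (nl2 mu (cbox rho v) < +oo)%E.
Proof. by rewrite nl2_cbox ltry. Qed.

Let mSv v : measurable_fun setT (S (cbox rho v)).
Proof. exact: (ro_meas hS (meas_cbox v) (c2oo v)). Qed.

Let mcv v : measurable_fun setT (conv (ktr k rho) (cbox rho v)).
Proof. exact: meas_conv mk (meas_cbox v). Qed.

Let mev v : measurable_fun setT (ev v).
Proof. by have h1 := mSv v; have h2 := mcv v; rewrite /ev; meas. Qed.

Let ktr_cbox_le v x : `|conv (ktr k rho) (cbox rho v) x| <= CK.
Proof.
have mr := meas_refl x mk; have mc := meas_cbox v.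
rewrite -lee_fin; apply: le_trans (abs_Rintegral_le _ _) _; first by meas.
apply: (@le_trans _ _ (\int[mu]_y ((CK * rho ^- n) * cbox rho v y)%:E)%E).
  apply: le_nl; [by meas|by meas|move=> y].
  by rewrite normr_ge0/= normrM (ger0_norm (cbox_ge0 _ _)) ler_wpM2r ?cbox_ge0.
rewrite ge0_nlZ//; last by rewrite mulr_ge0// invr_ge0 ltW.
by rewrite int_cbox -EFinM lee_fin mulfVK// gt_eqF.
Qed.

(** Away from the neighbouring cells both operators integrate the same kernel over the cell. *)
Let ev_far v : {ae mu, forall x, ev v x = (nearb rho v x)%:R * ev v x}.
Proof.
have := ro_repr hS v rho0; apply: filterS => x h.
case: (boolP (nearb rho v x)) => [_|nx]; first by rewrite mul1r.
rewrite mul0r /ev (h nx) /conv; apply/eqP; rewrite subr_eq0; apply/eqP.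
apply: eq_Rintegral => y _; rewrite /cbox.
have [yv|_] := eqVneq (cell rho y) v; last by rewrite !mulr0.
rewrite !mulr1 /ktr ifT//.
have [i hi] : exists i, 2 < `|cell rho x ord0 i - v ord0 i|.
  by move: nx; rewrite /nearb negb_forall => /existsP[i hi]; exists i; rewrite ltNge.
have := @cell_far _ _ rho x y 2 i rho0; rewrite yv => /(_ hi) h2.
apply: lt_le_trans (coord_le_enorm _ i); rewrite !mxE.
by apply: lt_le_trans h2; rewrite ltr_pMr// ltr1n.
Qed.

Let nl2_ev v : (\int[mu]_x ((nearb rho v x)%:R * ev v x ^+ 2)%:E <=
  (2 * 6 ^+ n * lam ^+ 2 * rho ^+ n)%:E)%E.
Proof.
have mn := meas_nearb v; have m1 := mSv v; have m2 := mcv v; have m3 := mev v.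
have n0 x : 0 <= ((nearb rho v x)%:R : R) by exact: ler0n.
have n1 x : ((nearb rho v x)%:R : R) <= 1 by case: nearb.
apply: (@le_trans _ _ (\int[mu]_x (2 * (S (cbox rho v) x ^+ 2 + CK ^+ 2 * (nearb rho v x)%:R))%:E)%E).
  apply: le_nl; [by meas|by meas|move=> x].
  have b0 := n0 x; have b1 := n1 x; rewrite mulr_ge0 ?sqr_ge0//=.
  have h : conv (ktr k rho) (cbox rho v) x ^+ 2 <= CK ^+ 2.
    by rewrite -(real_normK (num_real _)); apply: lerXn2r; rewrite ?nnegrE.
  rewrite /ev; move: h b0 b1.
  move: (S _ x) (conv _ _ x) ((nearb rho v x)%:R) => a b c h c0 c1.
  have h3 : 0 <= a ^+ 2 by exact: sqr_ge0.
  have h4 : (a - b) ^+ 2 <= 2 * (a ^+ 2 + CK ^+ 2) by have := sqr_ge0 (a + b); lra.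
  have h5 : c * (a - b) ^+ 2 <= c * (2 * (a ^+ 2 + CK ^+ 2)) by rewrite ler_wpM2l.
  have h6 : c * a ^+ 2 <= a ^+ 2 by rewrite ler_piMl.
  by apply: le_trans h5 _; lra.
rewrite ge0_nlZ//; last 2 first.
- by meas.
- by move=> x; rewrite addr_ge0 ?sqr_ge0// mulr_ge0 ?sqr_ge0.
rewrite ge0_nlD//; last 4 first.
- by meas.
- by meas.
- by move=> x; exact: sqr_ge0.
- by move=> x; rewrite mulr_ge0 ?sqr_ge0.
rewrite ge0_nlZ ?sqr_ge0//.
have h1 := ro_bound hS (meas_cbox v) (c2oo v); rewrite nl2_cbox -EFinM in h1.
have h2 := lee_wpmul2l (_ : (0 <= (CK ^+ 2)%:E)%E) (int_nearb v).
apply: le_trans (lee_wpmul2l _ (leeD h1 (h2 _))) _; rewrite ?lee_fin ?sqr_ge0//.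
rewrite /lam.
have n6 : 1 <= (6 : R) ^+ n by rewrite exprn_ege1// ler1n.
rewrite (_ : 2 * (A ^+ 2 * rho ^+ n + CK ^+ 2 * (6 ^+ n * rho ^+ n)) =
  (2 * (A ^+ 2 + 6 ^+ n * CK ^+ 2)) * rho ^+ n); last by ring.
rewrite ler_pM2r//.
have e1 : A ^+ 2 <= 6 ^+ n * A ^+ 2 by rewrite ler_peMl ?sqr_ge0.
have e2 : 0 <= 6 ^+ n * (A * CK) by rewrite mulr_ge0 ?mulr_ge0 ?(ltW A0)// (le_trans _ n6).
by move: e1 e2; move: (6 ^+ n) => z; lra.
Qed.

(** From L^2 to L^1 on a set of measure of order [rho^n], by the arithmetic-geometric inequality
    with weight [lam]. *)
Let nl1_ev v : (\int[mu]_x ((nearb rho v x)%:R * `|ev v x|)%:E <=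
  (2 * 6 ^+ n * lam * rho ^+ n)%:E)%E.
Proof.
have mn := meas_nearb v; have m3 := mev v.
apply: (@le_trans _ _ (\int[mu]_x (2^-1 * (lam * (nearb rho v x)%:R +
    lam^-1 * ((nearb rho v x)%:R * ev v x ^+ 2)))%:E)%E).
  apply: le_nl; [by meas|by meas|move=> x].
  rewrite mulr_ge0//= (_ : 2^-1 * _ = (nearb rho v x)%:R * (2^-1 * (lam + lam^-1 * ev v x ^+ 2))); last by ring.
  rewrite ler_wpM2l//.
  rewrite -(real_normK (num_real (ev v x))); move: (`|ev v x|) => a.
  have := sqr_ge0 (a - lam); rewrite -subr_ge0 => h.
  rewrite (_ : _ - a = lam^-1 * (2^-1 * (a - lam) ^+ 2)); last by field; rewrite gt_eqF.
  apply: mulr_ge0; first by rewrite invr_ge0 ltW.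
  by apply: mulr_ge0; [rewrite invr_ge0|exact: sqr_ge0].
have l0 := ltW lam0; have li0 : 0 <= lam^-1 by rewrite invr_ge0.
have p1 x : 0 <= (nearb rho v x)%:R * ev v x ^+ 2.
  by apply: mulr_ge0; [exact: ler0n|exact: sqr_ge0].
have p2 x : 0 <= lam * (nearb rho v x)%:R by apply: mulr_ge0; [|exact: ler0n].
have p3 x : 0 <= lam^-1 * ((nearb rho v x)%:R * ev v x ^+ 2) by apply: mulr_ge0.
have m4 : measurable_fun setT (fun x => (nearb rho v x)%:R * ev v x ^+ 2) by meas.
have m5 : measurable_fun setT (fun x => lam * (nearb rho v x)%:R) by meas.
have m6 : measurable_fun setT (fun x => lam^-1 * ((nearb rho v x)%:R * ev v x ^+ 2)) by meas.
have i20 : 0 <= (2^-1 : R) by rewrite invr_ge0.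
rewrite (ge0_nlZ _ (measurable_funD m5 m6) i20 (fun x => addr_ge0 (p2 x) (p3 x))).
rewrite (ge0_nlD _ m5 m6 p2 p3) (ge0_nlZ _ mn l0 (fun x => ler0n _ _)) (ge0_nlZ _ m4 li0 p1).
have h1 := lee_wpmul2l (_ : (0 <= lam%:E)%E) (int_nearb v).
have h2 := lee_wpmul2l (_ : (0 <= (lam^-1)%:E)%E) (nl2_ev v).
apply: le_trans (lee_wpmul2l _ (leeD (h1 _) (h2 _))) _; rewrite ?lee_fin ?invr_ge0//.
have -> : lam^-1 * (2 * 6 ^+ n * lam ^+ 2 * rho ^+ n) = 2 * 6 ^+ n * lam * rho ^+ n.
  by field; rewrite gt_eqF.
have : 0 <= 6 ^+ n * lam * rho ^+ n by rewrite !mulr_ge0 ?exprn_ge0// ltW.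
have -> : lam * (6 ^+ n * rho ^+ n) = 6 ^+ n * lam * rho ^+ n by ring.
have -> : 2 * 6 ^+ n * lam * rho ^+ n = 2 * (6 ^+ n * lam * rho ^+ n) by ring.
by move: (6 ^+ n * lam * rho ^+ n) => z; lra.
Qed.

Variables (I : finType) (vv : I -> 'rV[int]_n) (be : I -> R).
Hypothesis vv_inj : injective vv.

Let us (s : seq I) x : R := \sum_(i <- s) be i * cbox rho (vv i) x.
Let u x : R := \sum_i be i * cbox rho (vv i) x.

Let mus s : measurable_fun setT (us s).
Proof. by apply: measurable_sum => i; have := meas_cbox (vv i) => h; meas. Qed.

Let us2 s : (nl2 mu (us s) < +oo)%E.
Proof.
elim: s => [|i s IH].
  rewrite (_ : nl2 _ _ = 0%E) ?ltry//; apply: integral0_eq => x _.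
  by rewrite /us big_nil expr0n.
rewrite (_ : us (i :: s) = fun x => be i * cbox rho (vv i) x + us s x); last first.
  by apply/funext => x; rewrite /us big_cons.
have mc := meas_cbox (vv i); have ms := mus s.
apply: le_lt_trans (nl2D _ _ _) _; [by meas|by []|].
rewrite lte_mul_pinfty// lte_add_pinfty// nl2Z// lte_mul_pinfty ?lee_fin ?sqr_ge0//.
Qed.

Let intg_kc v x : intg mu (fun y => ktr k rho (x - y) * cbox rho v y).
Proof.
have mr := meas_refl x mk; have mc := meas_cbox v.
have ic : intg mu (cbox rho v) by apply: intgP => //; rewrite nl1_cbox ltry.
apply: (@le_intg _ _ _ mu _ (fun y => CK * rho ^- n * cbox rho v y)); [by meas|exact: intgZ|move=> y].
by rewrite !normrM ler_wpM2r// (le_trans (kle _))// -normrM ler_norm.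
Qed.

Let ae_us s : {ae mu, forall x, S (us s) x - conv (ktr k rho) (us s) x =
  \sum_(i <- s) be i * ((nearb rho (vv i) x)%:R * ev (vv i) x)}.
Proof.
have conv_us t x : intg mu (fun y => ktr k rho (x - y) * us t y) /\
    conv (ktr k rho) (us t) x = \sum_(i <- t) be i * conv (ktr k rho) (cbox rho (vv i)) x.
  elim: t => [|i t [IH1 IH2]].
    split.
      have := @integrable0 _ _ _ mu setT; apply: eq_integrable => // y _.
      by rewrite /= /us big_nil mulr0.
    rewrite big_nil /conv; under eq_Rintegral do rewrite /us big_nil mulr0.
    by rewrite Rintegral_cst// mul0r.
  have i1 := intgZ (be i) (intg_kc (vv i) x).
  split.
    have := intgD i1 IH1; apply: eq_integrable => // y _ /=.
    by rewrite /us big_cons mulrDr mulrCA.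
  rewrite big_cons -IH2 /conv -RintegralZl//; last exact: intg_kc.
  rewrite -RintegralD//; apply: eq_Rintegral => y _.
  by rewrite /us big_cons mulrDr mulrCA.
have S_us t : {ae mu, forall x, S (us t) x = \sum_(i <- t) be i * S (cbox rho (vv i)) x}.
  elim: t => [|i t IH].
    have := ro_lin hS 1 (mus [::]) (us2 [::]) (mus [::]) (us2 [::]).
    rewrite (_ : (fun y => 1 * us [::] y + us [::] y) = us [::]); last first.
      by apply/funext => y; rewrite /us big_nil mul1r addr0.
    apply: filterS => x; rewrite big_nil mul1r => h.
    by rewrite -[LHS](addrK (S (us [::]) x)) -h subrr.
  rewrite (_ : us (i :: t) = fun x => be i * cbox rho (vv i) x + us t x); last first.
    by apply/funext => x; rewrite /us big_cons.
  have h := ro_lin hS (be i) (meas_cbox (vv i)) (c2oo (vv i)) (mus t) (us2 t).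
  apply: filterS2 h IH => x h1 h2; rewrite h1 h2 big_cons//.
have E_s : {ae mu, forall x, \sum_(i <- s) be i * ev (vv i) x =
    \sum_(i <- s) be i * ((nearb rho (vv i) x)%:R * ev (vv i) x)}.
  elim: s => [|i t IH]; first by apply: aeW => x; rewrite !big_nil.
  by apply: filterS2 (ev_far (vv i)) IH => x h1 h2; rewrite !big_cons h2 -h1.
apply: filterS2 (S_us s) E_s => x h1 <-.
rewrite h1 (conv_us s x).2 -sumrB; apply: eq_bigr => i _.
by rewrite -mulrBr.
Qed.

(** Bounded overlap: the offsets from the cell of [x] inject the near cells into words of length [n]
    over six letters. *)
Let near_count x : \sum_i (nearb rho (vv i) x)%:R <= 6 ^+ n :> R.
Proof.
pose f (i : I) : {ffun 'I_n -> 'I_6} :=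
  [ffun j => inord (absz (vv i ord0 j - cell rho x ord0 j + 2%:Z)%R)].
have hf (i : I) : nearb rho (vv i) x -> forall j, ((f i j)%:Z = vv i ord0 j - cell rho x ord0 j + 2)%R.
  move=> /forallP h j; rewrite ffunE; have := h j.
  move: (cell rho x ord0 j) (vv i ord0 j) => c d hcd.
  have lt6 : (absz (d - c + 2%:Z)%R < 6)%N by lia.
  by rewrite inordK//; lia.
pose P : pred I := fun i => nearb rho (vv i) x.
rewrite (_ : \sum_i _ = #|P|%:R); last first.
  rewrite -sum1_card [RHS]natr_sum [RHS]big_mkcond/=; apply: eq_bigr => i _.
  by rewrite unfold_in /P; case: nearb.
rewrite -natrX ler_nat; have <- : #|{ffun 'I_n -> 'I_6}| = (6 ^ n)%N by rewrite card_ffun !card_ord.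
apply: (@leq_card_in _ _ f) => i j; rewrite !unfold_in => Pi Pj fij.
apply: vv_inj; apply/rowP => l.
by have := hf i Pi l; rewrite fij (hf j Pj l) => /addIr/addIr.
Qed.

Let uE x : `|u x| = \sum_i `|be i| * cbox rho (vv i) x /\
  u x ^+ 2 = \sum_i be i ^+ 2 * cbox rho (vv i) x.
Proof.
rewrite /u /cbox; have [/existsP[i /eqP hi]|h] := boolP [exists i, cell rho x == vv i].
  have z j : j != i -> (cell rho x == vv j)%:R = 0 :> R.
    move=> ji; rewrite (_ : (_ == _) = false)//; apply/negbTE; rewrite hi.
    by apply: contra ji => /eqP/vv_inj ->.
  have e (g : I -> R) : \sum_j g j * (cell rho x == vv j)%:R = g i.
    rewrite (bigD1 i)//= hi eqxx mulr1 big1 ?addr0// => j ji.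
    by rewrite -hi (z j ji) mulr0.
  by rewrite !e.
have z j : (cell rho x == vv j)%:R = 0 :> R.
  by move: h; rewrite negb_exists => /forallP/(_ j)/negbTE ->.
by split; rewrite !big1 ?normr0 ?expr0n// => j _; rewrite z mulr0.
Qed.

Lemma nl1_step : nl1 mu u = ((\sum_i `|be i|) * rho ^+ n)%:E.
Proof.
transitivity (\int[mu]_x (\sum_i `|be i| * cbox rho (vv i) x)%:E)%E.
  by apply: eq_integral => x _; rewrite (uE x).1.
rewrite ge0_nl_sum; last 2 first.
- by move=> i; have := meas_cbox (vv i) => h; meas.
- by move=> i x; rewrite mulr_ge0 ?cbox_ge0.
rewrite mulr_suml -sumEFin; apply: eq_bigr => i _.
by rewrite (ge0_nlZ _ (meas_cbox (vv i)) (normr_ge0 (be i)) (cbox_ge0 (vv i))) int_cbox EFinM.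
Qed.

Lemma nl2_step : nl2 mu u = ((\sum_i be i ^+ 2) * rho ^+ n)%:E.
Proof.
transitivity (\int[mu]_x (\sum_i be i ^+ 2 * cbox rho (vv i) x)%:E)%E.
  by apply: eq_integral => x _; rewrite (uE x).2.
rewrite ge0_nl_sum; last 2 first.
- by move=> i; have := meas_cbox (vv i) => h; meas.
- by move=> i x; rewrite mulr_ge0 ?sqr_ge0 ?cbox_ge0.
rewrite mulr_suml -sumEFin; apply: eq_bigr => i _.
by rewrite (ge0_nlZ _ (meas_cbox (vv i)) (sqr_ge0 (be i)) (cbox_ge0 (vv i))) int_cbox EFinM.
Qed.

Let err x := S u x - conv (ktr k rho) u x.

Let merr : measurable_fun setT err.
Proof.
have h1 := ro_meas hS (mus (index_enum I)) (us2 (index_enum I)).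
have h2 := meas_conv mk (mus (index_enum I)).
by rewrite /err; apply: measurable_funB.
Qed.

Let errE : {ae mu, forall x, err x = \sum_i be i * ((nearb rho (vv i) x)%:R * ev (vv i) x)}.
Proof. exact: ae_us. Qed.

(** The triangle inequality suffices: each cell contributes its coefficient times a local error of
    L^1 norm of order [lam * rho^n]. *)
Lemma err_nl1 : (nl1 mu err <= (2 * 6 ^+ n * lam)%:E * nl1 mu u)%E.
Proof.
have mn i := meas_nearb (vv i); have m3 i := mev (vv i).
apply: (@le_trans _ _ (\int[mu]_x (\sum_i `|be i| * ((nearb rho (vv i) x)%:R * `|ev (vv i) x|))%:E)%E).
  apply: ae_ge0_le_integral => //.
  - by apply/measurable_EFinP; meas.
  - by move=> x _; rewrite lee_fin; apply: sumr_ge0 => i _; rewrite !mulr_ge0.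
  - apply/measurable_EFinP; apply: measurable_sum => i; have h1 := mn i; have h2 := m3 i; meas.
  apply: filterS errE => x -> _; rewrite lee_fin.
  apply: le_trans (ler_norm_sum _ _ _) _; apply: ler_sum => i _.
  by rewrite !normrM [`|(_ : bool)%:R|]ger0_norm.
rewrite ge0_nl_sum; last 2 first.
- by move=> i; have h1 := mn i; have h2 := m3 i; meas.
- by move=> i x; rewrite !mulr_ge0.
rewrite nl1_step -EFinM.
apply: (@le_trans _ _ (\sum_i (`|be i| * (2 * 6 ^+ n * lam * rho ^+ n))%:E)%E); last first.
  rewrite sumEFin -mulr_suml lee_fin le_eqVlt; apply/orP; left; apply/eqP; ring.
apply: lee_sum => i _.
have m1 : measurable_fun setT (fun x => (nearb rho (vv i) x)%:R * `|ev (vv i) x|).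
  by have h1 := mn i; have h2 := m3 i; meas.
rewrite (ge0_nlZ _ m1 (normr_ge0 (be i)) (fun x => mulr_ge0 (ler0n _ _) (normr_ge0 _))).
by rewrite [in leRHS]EFinM lee_wpmul2l// lee_fin.
Qed.

(** At each point at most [6^n] cells contribute, so Cauchy-Schwarz over them costs [6^n]; the other
    factor [6^n] comes from the local errors. *)
Lemma err_nl2 : (nl2 mu err <= (2 * 36 ^+ n * lam ^+ 2)%:E * nl2 mu u)%E.
Proof.
have mn i := meas_nearb (vv i); have m3 i := mev (vv i).
have n6 : 0 <= (6 : R) ^+ n by exact: exprn_ge0.
have pos i x : 0 <= be i ^+ 2 * ((nearb rho (vv i) x)%:R * ev (vv i) x ^+ 2).
  by apply: mulr_ge0; [exact: sqr_ge0|apply: mulr_ge0; [exact: ler0n|exact: sqr_ge0]].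
apply: (@le_trans _ _ (\int[mu]_x (6 ^+ n * \sum_i be i ^+ 2 * ((nearb rho (vv i) x)%:R * ev (vv i) x ^+ 2))%:E)%E).
  apply: ae_ge0_le_integral => //.
  - by move=> x _; rewrite lee_fin sqr_ge0.
  - by apply/measurable_EFinP; meas.
  - move=> x _; rewrite lee_fin mulr_ge0//; by apply: sumr_ge0 => i _.
  - apply/measurable_EFinP; apply: measurable_funM => //.
    apply: measurable_sum => i; have h1 := mn i; have h2 := m3 i; meas.
  apply: filterS errE => x -> _; rewrite lee_fin.
  pose P i := nearb rho (vv i) x; pose d i := be i * ev (vv i) x.
  rewrite (eq_bigr (fun i => (P i)%:R * d i)); last by move=> i _; rewrite /d mulrCA.
  rewrite [in leRHS](eq_bigr (fun i => (P i)%:R * d i ^+ 2)); last first.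
    by move=> i _; rewrite /d exprMn mulrCA.
  have := near_count x; rewrite -/P => hc.
  apply: (@le_trans _ _ ((\sum_i (P i)%:R) * \sum_i (P i)%:R * d i ^+ 2)); last first.
    by rewrite ler_wpM2r//; apply: sumr_ge0 => i _; rewrite mulr_ge0 ?sqr_ge0.
  have P01 i : ((P i)%:R : R) * (P i)%:R = (P i)%:R by case: (P i); rewrite ?mulr1 ?mulr0.
  set N := \sum_i (P i)%:R; set m := \sum_i (P i)%:R * d i; set Q := \sum_i (P i)%:R * d i ^+ 2.
  have N0 : 0 <= N by apply: sumr_ge0.
  move: N0; rewrite le_eqVlt => /predU1P[N0|N0].
    have m0 : m = 0.
      rewrite /m big1// => i _.
      have -> : (P i)%:R = 0 :> R by apply: (@psumr_eq0P _ _ xpredT (fun i => (P i)%:R)).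
      by rewrite mul0r.
    by rewrite m0 expr0n -N0 mul0r.
  rewrite -subr_ge0 -(pmulr_rge0 _ N0).
  have -> : N * (N * Q - m ^+ 2) = \sum_i (P i)%:R * (N * d i - m) ^+ 2.
    have -> : \sum_i (P i)%:R * (N * d i - m) ^+ 2 = N ^+ 2 * Q - 2 * N * m * m + m ^+ 2 * N.
      rewrite (eq_bigr (fun i => N ^+ 2 * ((P i)%:R * d i ^+ 2) - 2 * N * m * ((P i)%:R * d i) +
        m ^+ 2 * (P i)%:R)); last by move=> i _; ring.
      by rewrite big_split/= sumrB -!mulr_sumr.
    by ring.
  by apply: sumr_ge0 => i _; rewrite mulr_ge0 ?sqr_ge0.
rewrite ge0_nlZ//; last 2 first.
- by apply: measurable_sum => i; have h1 := mn i; have h2 := m3 i; meas.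
- by move=> x; apply: sumr_ge0 => i _.
rewrite ge0_nl_sum; last 2 first.
- by move=> i; have h1 := mn i; have h2 := m3 i; meas.
- by [].
rewrite nl2_step -EFinM.
apply: (@le_trans _ _ ((6 ^+ n)%:E * \sum_i (be i ^+ 2 * (2 * 6 ^+ n * lam ^+ 2 * rho ^+ n))%:E)%E); last first.
  rewrite sumEFin -mulr_suml -EFinM lee_fin le_eqVlt; apply/orP; left; apply/eqP.
  by rewrite (_ : 36 = 6 * 6 :> R) ?exprMn; ring.
rewrite lee_wpmul2l ?lee_fin//.
apply: lee_sum => i _.
have m1 : measurable_fun setT (fun x => (nearb rho (vv i) x)%:R * ev (vv i) x ^+ 2).
  by have h1 := mn i; have h2 := m3 i; meas.
rewrite (ge0_nlZ _ m1 (sqr_ge0 (be i)) (fun x => mulr_ge0 (ler0n _ _) (sqr_ge0 _))).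
by rewrite [in leRHS]EFinM; apply: lee_wpmul2l; [rewrite lee_fin sqr_ge0|exact: nl2_ev].
Qed.

(** The truncated convolution is [S] minus the error, so on step functions it inherits an L^2 bound
    uniform in [rho]. *)
Lemma ktr_step_nl2 : (nl2 mu (conv (ktr k rho) u) <= ((3 * 6 ^+ n * lam) ^+ 2)%:E * nl2 mu u)%E.
Proof.
have m1 : measurable_fun setT (S u) := ro_meas hS (mus (index_enum I)) (us2 (index_enum I)).
have m2 : measurable_fun setT (conv (ktr k rho) u) := meas_conv mk (mus (index_enum I)).
have n6 : 1 <= (6 : R) ^+ n by rewrite exprn_ege1// ler1n.
rewrite (_ : conv (ktr k rho) u = fun x => S u x + -1 * err x); last first.
  by apply/funext => x; rewrite /err; ring.
apply: le_trans (nl2D _ m1 _) _; first by meas.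
rewrite nl2Z// sqrrN expr1n mul1e.
have h1 : (nl2 mu (S u) <= (A ^+ 2)%:E * nl2 mu u)%E := ro_bound hS (mus (index_enum I)) (us2 (index_enum I)).
apply: le_trans (lee_wpmul2l _ (leeD h1 err_nl2)) _; first by rewrite lee_fin.
pose b := (\sum_i be i ^+ 2) * rho ^+ n.
have -> : nl2 mu u = b%:E by exact: nl2_step.
have -> : (2 * ((A ^+ 2)%:E * b%:E + (2 * 36 ^+ n * lam ^+ 2)%:E * b%:E) =
    (2 * (A ^+ 2 * b + 2 * 36 ^+ n * lam ^+ 2 * b))%:E)%E by rewrite -!EFinM.
rewrite -EFinM lee_fin.
rewrite (_ : (36 : R) = 6 * 6); last by ring.
rewrite exprMn.
have b0 : 0 <= b by rewrite mulr_ge0 ?exprn_ge0 ?(ltW rho0)// sumr_ge0// => i _; exact: sqr_ge0.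
have l2 : A ^+ 2 <= lam ^+ 2 by rewrite /lam; apply: lerXn2r; rewrite ?nnegrE ?lerDl ?(ltW A0) ?addr_ge0 ?(ltW A0).
have h3 : 1 <= (6 : R) ^+ n * 6 ^+ n by rewrite mulr_ege1.
have h4 : A ^+ 2 <= (6 : R) ^+ n * 6 ^+ n * lam ^+ 2.
  by apply: le_trans l2 _; rewrite ler_peMl ?sqr_ge0.
have -> : 2 * (A ^+ 2 * b + 2 * (6 ^+ n * 6 ^+ n) * lam ^+ 2 * b) =
   (2 * A ^+ 2 + 4 * (6 ^+ n * 6 ^+ n * lam ^+ 2)) * b by ring.
rewrite ler_wpM2r//.
have -> : (3 * 6 ^+ n * lam) ^+ 2 = 9 * (6 ^+ n * 6 ^+ n * lam ^+ 2) by ring.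
have : 0 <= (6 : R) ^+ n * 6 ^+ n * lam ^+ 2 by rewrite mulr_ge0 ?sqr_ge0// (le_trans _ h3).
by move: h4; move: (6 ^+ n * 6 ^+ n * lam ^+ 2) => z; lra.
Qed.

End real_operator.

Section step_weak11.
Context {R : realType} {n : nat}.
Local Notation mu := (@lebesgue_rV R n).
Local Notation rV := 'rV[R]_n.
Implicit Types (x y z : rV).

Lemma fatou_le d (T : measurableType d) (m : {measure set T -> \bar R}) (f : nat -> T -> R)
    (g : T -> R) (C : \bar R) :
  (forall i, measurable_fun setT (f i)) -> (forall i t, 0 <= f i t) ->
  (forall t, f ^~ t @ \oo --> g t) ->
  (forall i, (\int[m]_t (f i t)%:E <= C)%E) -> (\int[m]_t (g t)%:E <= C)%E.
Proof.
move=> mf f0 fg fC.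
have mE i : measurable_fun setT (fun t => (f i t)%:E) by apply/measurable_EFinP.
have f0' i t : (setT : set T) t -> (0 <= (f i t)%:E)%E by rewrite lee_fin.
have := @fatou _ _ _ m setT measurableT (fun i t => (f i t)%:E) mE f0'.
rewrite [X in (X <= _)%E -> _](_ : _ = (\int[m]_t (g t)%:E)%E); last first.
  apply: eq_integral => t _.
  have : (fun i => (f i t)%:E) @ \oo --> (g t)%:E by apply/cvg_EFin; [exact: nearW|exact: fg].
  by move=> /cvg_limn_einf_sup[].
move=> h; apply: le_trans h _; rewrite limn_einf_lim.
apply: lime_le; first exact: is_cvg_einfs.
apply: nearW => i; apply: le_trans (fC i); apply: ereal_inf_lbound.
by exists i => //=.
Qed.

Lemma Rint_dominated d (T : measurableType d) (m : {measure set T -> \bar R})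
    (f : nat -> T -> R) (g h : T -> R) :
  (forall i, measurable_fun setT (f i)) -> intg m g -> intg m h ->
  (forall t, f ^~ t @ \oo --> g t) -> (forall i t, `|f i t| <= h t) ->
  (fun i => \int[m]_t f i t) @ \oo --> \int[m]_t g t.
Proof.
move=> mf ig ih fg fh.
have mE i : measurable_fun setT (fun t => (f i t)%:E) by apply/measurable_EFinP.
have fgE t : (setT : set T) t -> (fun i => (f i t)%:E) @ \oo --> (g t)%:E.
  by move=> _; apply/cvg_EFin; [exact: nearW|exact: fg].
have fin t : (setT : set T) t -> (h t)%:E \is a fin_num by [].
have ab i t : (setT : set T) t -> (`|(f i t)%:E| <= (h t)%:E)%E.
  by move=> _; rewrite abse_EFin lee_fin.
have := dominated_cvg measurableT mE fgE fin ih ab.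
by rewrite -(EFin_Rintegral ig) => /fine_cvgP[_].
Qed.

(** Restriction to finitely many cells, after which a function constant on cells is a finite
    combination of indicators. *)
Definition itrunc (rho : R) (N : nat) (u : rV -> R) x : R :=
  if [forall i, `|cell rho x ord0 i| <= N%:Z] then u x else 0.

Definition ivec N (f : {ffun 'I_n -> 'I_N.*2.+1}) : 'rV[int]_n :=
  \row_i ((f i)%:Z - N%:Z).

Lemma ivec_inj N : injective (@ivec N).
Proof.
move=> f g /rowP h; apply/ffunP => i; apply: val_inj => /=.
by have := h i; rewrite !mxE => /addIr[].
Qed.

Lemma itrunc_step (rho : R) N u x : 0 < rho -> cellconst rho u ->
  itrunc rho N u x =
  \sum_f u (\row_i (rho * (ivec f ord0 i)%:~R)) * cbox rho (@ivec N f) x.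
Proof.
move=> rho0 cu; have uc v : cell rho x = v -> u (\row_i (rho * (v ord0 i)%:~R)) = u x.
  by move=> <-; rewrite -/(corner rho x); apply: cu; rewrite cell_corner.
rewrite /itrunc; case: (boolP [forall i, _]) => [/forallP h|h].
  have lt i : (absz (cell rho x ord0 i + N%:Z)%R < N.*2.+1)%N.
    by have := h i; move: (cell rho x ord0 i) => c; clear; lia.
  pose f := [ffun i => Ordinal (lt i)].
  have fE : cell rho x = ivec f.
    apply/rowP => i; rewrite [RHS]mxE ffunE /=.
    by have := h i; move: (cell rho x ord0 i) => c; clear; lia.
  rewrite (bigD1 f)//= big1 ?addr0; last first.
    move=> g gf; rewrite /cbox fE; have [/ivec_inj e|_] := eqVneq; last by rewrite mulr0.
    by rewrite e eqxx in gf.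
  by rewrite (uc _ fE) /cbox fE eqxx mulr1.
rewrite big1// => f _; rewrite /cbox; have [e|_] := eqVneq; last by rewrite mulr0.
exfalso; move/negP: h; apply; apply/forallP => i; rewrite e mxE.
by have := ltn_ord (f i); move: (nat_of_ord (f i)) => c; clear; lia.
Qed.

Lemma itrunc_cell (rho : R) N u : cellconst rho u -> cellconst rho (itrunc rho N u).
Proof. by move=> cu x y xy; rewrite /itrunc xy (cu _ _ xy). Qed.

Lemma itrunc_le (rho : R) N u x : `|itrunc rho N u x| <= `|u x|.
Proof. by rewrite /itrunc; case: ifP => // _; rewrite normr0. Qed.

Lemma itrunc_near (rho : R) u x : \forall N \near \oo, itrunc rho N u x = u x.
Proof.
pose K := \sum_i absz (cell rho x ord0 i).
exists K => //= N /= KN; rewrite /itrunc ifT//; apply/forallP => i.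
have : (absz (cell rho x ord0 i) <= K)%N by rewrite /K (bigD1 i)//= leq_addr.
by move: KN; rewrite /=; move: (cell rho x ord0 i) K => c K; clear; lia.
Qed.

Lemma conv_itrunc_cvg (rho b : R) (L u : rV -> R) x : 0 < rho -> measurable_fun setT L ->
  (forall z, `|L z| <= b) -> cellconst rho u -> (nl1 mu u < +oo)%E ->
  (fun N => conv L (itrunc rho N u) x) @ \oo --> conv L u x.
Proof.
move=> rho0 mL Lb cu u1; have m_u := meas_cellconst rho0 cu; have mr := meas_refl x mL.
have mt N : measurable_fun setT (itrunc rho N u) := meas_cellconst rho0 (itrunc_cell N cu).
have b0 : 0 <= b := le_trans (normr_ge0 _) (Lb 0).
have iu := intgP m_u u1.
have ig : intg mu (fun y => b * `|u y|).
  apply: intgZ; apply: (le_intg _ iu) => [|y]; [by meas|by rewrite normr_id].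
have ibd (v : rV -> R) : measurable_fun setT v -> (forall y, `|v y| <= `|u y|) ->
    intg mu (fun y => L (x - y) * v y).
  move=> mv vu; apply: (le_intg _ ig); first by meas.
  move=> y; rewrite !normrM normr_id (ger0_norm b0); apply: ler_pM => //; exact: Lb.
have iN N : intg mu (fun y => L (x - y) * itrunc rho N u y).
  by apply: ibd => // y; exact: itrunc_le.
have iL : intg mu (fun y => L (x - y) * u y) by exact: ibd.
apply: (Rint_dominated _ iL ig).
- by move=> N; exact: intg_meas (iN N).
- move=> y; apply: cvg_near_cst; apply: filterS (itrunc_near rho u y) => N e.
  by rewrite /= e.
move=> N y; rewrite normrM; apply: ler_pM => //; exact: itrunc_le.
Qed.

(** Restriction to growing boxes converges pointwise under the bounded kernel, and Fatou's lemma
    carries over the L^2 bound. *)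
Lemma ktr_nl2 S k w CK A rho : real_op S k A -> real_kernel k w CK -> 0 < rho -> 0 < A ->
  forall h, cellconst rho h -> (nl1 mu h < +oo)%E ->
  (nl2 mu (conv (ktr k rho) h) <= ((3 * 6 ^+ n * (A + CK)) ^+ 2)%:E * nl2 mu h)%E.
Proof.
move=> hS hk rho0 A0 h hc h1; have mh := meas_cellconst rho0 hc.
have mk : measurable_fun setT (ktr k rho).
  exact: (meas_ktr (rk_mono hk) (rk_cvg hk) (rk_reg hk) rho0).
have kle := ktr_le (rk_CK0 hk) (rk_size hk) rho0.
have mt N : measurable_fun setT (itrunc rho N h) := meas_cellconst rho0 (itrunc_cell N hc).
have mc N := meas_conv mk (mt N).
apply: (@fatou_le _ _ mu (fun N x => conv (ktr k rho) (itrunc rho N h) x ^+ 2)).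
- by move=> N; have := mc N => m; meas.
- by move=> N x; exact: sqr_ge0.
- move=> x; have c := @conv_itrunc_cvg rho _ (ktr k rho) h x rho0 mk kle hc h1.
  by rewrite expr2; apply: cvgM.
move=> N; have e : itrunc rho N h = fun x => \sum_f h (\row_i (rho * (ivec f ord0 i)%:~R)) * cbox rho (@ivec N f) x.
  by apply/funext => x; exact: itrunc_step.
have := ktr_step_nl2 hS hk rho0 A0 (fun f => h (\row_i (rho * (ivec f ord0 i)%:~R))) (@ivec_inj N).
rewrite -e => /le_trans; apply; rewrite lee_wpmul2l ?lee_fin ?sqr_ge0//.
apply: le_nl; [by have := mt N => m; meas|by meas|move=> x].
rewrite sqr_ge0/= -(real_normK (num_real _)) -[leRHS](real_normK (num_real _)).
by apply: lerXn2r; rewrite ?nnegrE//; exact: itrunc_le.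
Qed.

(** [S u] is the truncated convolution, covered by [kernel_weak11], plus an L^1 error, covered by
    [bump_weak11]. *)
Lemma real_step_weak11 (phi : rV -> R) (Lam q : R) : bump phi Lam -> 2 < q -> (0 < n)%N -> 0 < Lam ->
  exists2 C : R, 0 <= C & forall S k w CK A rho M a yy W Y (I : finType)
      (vv : I -> 'rV[int]_n) (be : I -> R) al,
    real_op S k A -> real_kernel k w CK -> 0 < rho -> 0 < A -> (forall i, 0 <= yy i) ->
    (forall i b, \sum_(l < M.+1) (if (l < b)%N then w (2^-1 ^+ (b + i - l)) `^ q else 0) <= yy i `^ q) ->
    (forall N, \sum_(i < N) w (2^-1 ^+ i.+1) <= W) -> (forall N, \sum_(i < N) yy i <= Y) ->
    injective vv -> 0 < al ->
    omeas mu (Vset q (upto M (fun i => conv (dil phi (rho * 2 ^+ (a + i)))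
        (S (fun x => \sum_i be i * cbox rho (vv i) x)))) al)
      ((C * (A + W + Y + CK) / al)%:E * nl1 mu (fun x => (\sum_i be i * cbox rho (vv i) x)%R)).
Proof.
move=> bphi q2 n0 L0; have q1 : 1 < q by rewrite (lt_trans _ q2)// ltr1n.
have [C1 C10 w1] := kernel_weak11 bphi q2 n0 L0.
have [C2 C20 w2] := bump_weak11 bphi q2 n0 L0.
have n6 : 0 <= (6 : R) ^+ n by exact: exprn_ge0.
exists (4 * (C1 * (1 + 3 * 6 ^+ n) + C2 * (2 * 6 ^+ n))).
  have h1 : (0 : R) <= 1 + 3 * 6 ^+ n by rewrite addr_ge0 ?mulr_ge0.
  have h2 : (0 : R) <= 2 * 6 ^+ n by rewrite mulr_ge0.
  by rewrite mulr_ge0 ?addr_ge0 ?mulr_ge0.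
move=> S k w CK A rho M a yy W Y I vv be al hS hk rho0 A0 yy0 hyy hW hY vi al0.
have CK0 := rk_CK0 hk; set u := fun x => _.
have W0 : 0 <= W by have := hW 0%N; rewrite big_ord0.
have Y0 : 0 <= Y by have := hY 0%N; rewrite big_ord0.
have cu : cellconst rho u.
  by move=> x y xy; apply: eq_bigr => i _; rewrite /cbox xy.
have m_u := meas_cellconst rho0 cu.
have u1 : (nl1 mu u < +oo)%E by rewrite (nl1_step rho0 be vi) ltry.
have u2 : (nl2 mu u < +oo)%E := cellconst_nl2 rho0 cu u1.
pose lam := A + CK; have lam0 : 0 < lam by rewrite ltr_pwDl.
pose A1 := 3 * 6 ^+ n * lam.
have A10 : 0 < A1 by rewrite !mulr_gt0// exprn_gt0.
have al4 : 0 < al / 4 by rewrite divr_gt0.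
have h1 := w1 k w CK rho M a yy W Y A1 hk rho0 A10 yy0 hyy hW hY (ktr_nl2 hS hk rho0 A0) u _ cu u1 al4.
have mk : measurable_fun setT (ktr k rho).
  exact: (meas_ktr (rk_mono hk) (rk_cvg hk) (rk_reg hk) rho0).
pose err x := S u x - conv (ktr k rho) u x.
have mS : measurable_fun setT (S u) := ro_meas hS m_u u2.
have mc : measurable_fun setT (conv (ktr k rho) u) := meas_conv mk m_u.
have merr : measurable_fun setT err by exact: measurable_funB.
have e1 : (nl1 mu err <= (2 * 6 ^+ n * lam)%:E * nl1 mu u)%E := err_nl1 hS hk rho0 A0 be vi.
have eoo : (nl1 mu err < +oo)%E.
  by apply: le_lt_trans e1 _; rewrite lte_mul_pinfty// lee_fin mulr_ge0 ?mulr_ge0// ltW.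
have ra : 0 < rho * 2 ^+ a by rewrite mulr_gt0// exprn_gt0.
have rk i : 0 < rho * 2 ^+ (a + i) by rewrite mulr_gt0// exprn_gt0.
have h2 := w2 (rho * 2 ^+ a) err M _ ra merr eoo al4.
have dE : (fun i => conv (dil phi (rho * 2 ^+ a * 2 ^+ i)) err) =
    (fun i => conv (dil phi (rho * 2 ^+ (a + i))) err).
  by apply/funext => i; rewrite exprD mulrA.
rewrite dE in h2.
have {}h2 : omeas mu (Vset q (upto M (fun i => conv (dil phi (rho * 2 ^+ (a + i))) err)) (al / 4))
    ((C2 / (al / 4) * (2 * 6 ^+ n * lam))%:E * nl1 mu u).
  apply: omeas_le h2; apply: le_trans (lee_wpmul2l _ e1) _.
    by rewrite lee_fin divr_ge0// ltW.
  by rewrite muleA -EFinM.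
have := omeasU h1 h2.
have s0 : 0 <= A1 + W + Y + CK by rewrite !addr_ge0// ltW.
rewrite -ge0_muleDl ?lee_fin; last 2 first.
- by rewrite divr_ge0 ?(ltW al4)// mulr_ge0.
- by apply: mulr_ge0; [rewrite divr_ge0// ltW|apply: mulr_ge0; [exact: mulr_ge0|exact: ltW]].
rewrite -EFinD => h; apply: omeas_sub (omeas_le _ h); last first.
  rewrite lee_wpmul2r ?nl1_ge0// lee_fin !invf_div.
  rewrite (_ : C1 * (A1 + W + Y + CK) * (4 / al) + C2 * (4 / al) * (2 * 6 ^+ n * lam) =
    (4 * (C1 * (A1 + W + Y + CK) + C2 * (2 * 6 ^+ n) * lam)) / al); last by ring.
  apply: ler_wpM2r; first by rewrite invr_ge0 ltW.
  rewrite -[leRHS]mulrA; apply: ler_wpM2l => //; rewrite [leRHS]mulrDl.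
  have l1 : lam <= A + W + Y + CK by rewrite /lam; move: W0 Y0; clear; lra.
  apply: lerD; last by apply: ler_wpM2l => //; apply: mulr_ge0 => //; exact: mulr_ge0.
  rewrite -[leRHS]mulrA; apply: ler_wpM2l => //; rewrite [leRHS]mulrDl mul1r.
  have h3 : A1 <= 3 * 6 ^+ n * (A + W + Y + CK) by rewrite /A1 ler_wpM2l// mulr_ge0.
  rewrite addrC; move: (ltW A0); move: h3; move: (3 * 6 ^+ n * (A + W + Y + CK)) => z; lra.
have -> : upto M (fun i => conv (dil phi (rho * 2 ^+ (a + i))) (S u)) =
    (fun i x => upto M (fun i => conv (dil phi (rho * 2 ^+ (a + i))) (conv (ktr k rho) u)) i x +
      upto M (fun i => conv (dil phi (rho * 2 ^+ (a + i))) err) i x).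
  apply/funext => i; apply/funext => x; rewrite /upto; case: ifP => _; last by rewrite addr0.
  rewrite (conv_dilB bphi x (rk i) mS mc); first by rewrite addrC subrK.
    right; apply: le_lt_trans (ro_bound hS m_u u2) _.
    by rewrite lte_mul_pinfty// lee_fin sqr_ge0.
  right; apply: le_lt_trans (ktr_nl2 hS hk rho0 A0 cu u1) _.
  by rewrite lte_mul_pinfty// lee_fin sqr_ge0.
exact: VsetD (ltW q1) al0.
Qed.

End step_weak11.

(** * Density of functions constant on cells *)

Section density.
Context {R : realType} {n : nat}.
Local Notation mu := (@lebesgue_rV R n).
Local Notation rV := 'rV[R]_n.
Implicit Types (x y z : rV) (A B : set rV).
Local Notation r m := ((2^-1 : R) ^+ m).

Lemma pow_half_gt0 m : 0 < r m.
Proof. by rewrite exprn_gt0 ?invr_gt0. Qed.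

Lemma pow_half_lt (e : R) : 0 < e -> exists m, r m < e.
Proof.
move=> e0; have [N _ h] := near_infty_natSinv_expn_lt (PosNum e0).
by exists N; have := h N (leqnn N); rewrite /= div1r -exprVn.
Qed.

Lemma cellconst_half (S : Type) (h : rV -> S) m m' : (m <= m')%N ->
  cellconst (r m) h -> cellconst (r m') h.
Proof.
move=> mm hc; have := @cellconst_scale R n (r m') S h 0 (m' - m) (pow_half_gt0 m') (leq0n _).
rewrite expr0 mulr1; apply; rewrite -{1}(subnKC mm) exprD -mulrA -exprMn mulVf//.
by rewrite expr1n mulr1.
Qed.

Definition qcube (J : nat) x : bool := [forall i, `|cell 1 x ord0 i| <= J%:Z].

Lemma qcube_cell m J : cellconst (r m) (qcube J).
Proof.
apply: (@cellconst_half _ _ 0%N) => //; rewrite expr0 => x y xy.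
by rewrite /qcube xy.
Qed.

Lemma measurable_qcube J : measurable [set x | qcube J x].
Proof.
exact: (measurable_cell_comp (fun v => [forall i, `|v ord0 i| <= J%:Z]) ltr01
  (@measurable_id _ _ setT)).
Qed.

Lemma meas_qcube J : measurable_fun setT (fun x => (qcube J x)%:R : R).
Proof. by apply: meas_bool; exact: measurable_qcube. Qed.

Lemma nl1_qcube J : (nl1 mu (fun x => (qcube J x)%:R) < +oo)%E.
Proof.
have c1 : cellconst (1 : R) (fun _ : rV => 1 : R) by [].
rewrite (_ : (fun x => _) = fun x => \sum_f 1 * cbox 1 (@ivec n J f) x); last first.
  by apply/funext => x; rewrite -(itrunc_step J x ltr01 c1) /itrunc -/(qcube J x); case: ifP.
by rewrite (nl1_step ltr01 (fun=> 1) (@ivec_inj n J)) ltry.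
Qed.

Lemma intg_qcube J : intg mu (fun x => (qcube J x)%:R).
Proof. by apply: intgP; [exact: meas_qcube|exact: nl1_qcube]. Qed.

Lemma meas_cap_qcube A J : measurable A ->
  measurable_fun setT (fun x => ((x \in A) && qcube J x)%:R : R).
Proof.
move=> mA; apply: meas_bool.
rewrite (_ : [set _ | _] = A `&` [set x | qcube J x]).
  by apply: measurableI => //; exact: measurable_qcube.
by apply/seteqP; split=> x /=; [move=> /andP[/set_mem]|move=> [/mem_set -> ->]].
Qed.

Lemma meas_cellb m (h : rV -> bool) : cellconst (r m) h ->
  measurable_fun setT (fun x => (h x)%:R : R).
Proof.
by move=> hc; apply: (meas_cellconst (pow_half_gt0 m)) => x y xy; rewrite (hc _ _ xy).
Qed.

(** Sets that can be approximated in measure, within each bounded cube, by unions of dyadic cells.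
    The cube makes the property stable under complement for sets of infinite measure. *)
Definition dyapp A := measurable A /\ forall J (e : R), 0 < e ->
  exists m (h : rV -> bool), cellconst (r m) h /\
    (nl1 mu (fun x => (((x \in A) && qcube J x)%:R - (h x)%:R)%R) <= e%:E)%E.

Lemma dyapp_cell A m : cellconst (r m) (fun x => x \in A) -> dyapp A.
Proof.
move=> hA; have mA : measurable A.
  have := meas_cellb hA => /(_ measurableT [set 1] (measurable_set1 _)).
  rewrite setTI (_ : _ @^-1` _ = A)//; apply/seteqP; split=> x /=.
    by case: (boolP (x \in A)) => [/set_mem//|_] /eqP; rewrite eq_sym oner_eq0.
  by move=> /mem_set ->.
split=> // J e e0; exists m, (fun x => (x \in A) && qcube J x); split.
  by move=> x y xy; rewrite (hA _ _ xy) (qcube_cell J xy).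
rewrite /nl1 (eq_integral (fun=> 0%E)) ?integral0 ?lee_fin ?ltW// => x _.
by rewrite subrr normr0.
Qed.

Lemma dyapp0 : dyapp set0.
Proof. by apply: (@dyapp_cell _ 0%N) => x y _; rewrite !in_set0. Qed.

Lemma dyappC A : dyapp A -> dyapp (~` A).
Proof.
move=> [mA hA]; split=> [|J e e0]; first exact: measurableC.
have [m [h [hc he]]] := hA J e e0; exists m, (fun x => qcube J x && ~~ h x); split.
  by move=> x y xy; rewrite (hc _ _ xy) (qcube_cell J xy).
apply: le_trans he; apply: le_nl1.
- apply: measurable_funB; first by apply: meas_cap_qcube; exact: measurableC.
  apply: (@meas_cellb m (fun x => qcube J x && ~~ h x)) => x y xy.
  by rewrite (hc _ _ xy) (qcube_cell J xy).
- by have := meas_cap_qcube J mA; have := meas_cellb hc => h1 h2; meas.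
move=> x; rewrite in_setC; case: (x \in A); case: (qcube J x); case: (h x) => /=;
  by rewrite ?subrr ?subr0 ?sub0r ?normrN ?normr0 ?normr1.
Qed.

Lemma dyappU A B : dyapp A -> dyapp B -> dyapp (A `|` B).
Proof.
move=> [mA hA] [mB hB]; split=> [|J e e0]; first exact: measurableU.
have e2 : 0 < e / 2 by rewrite divr_gt0.
have [m [h [hc he]]] := hA J _ e2; have [m' [h' [hc' he']]] := hB J _ e2.
have {}hc := cellconst_half (leq_maxl m m') hc.
have {}hc' := cellconst_half (leq_maxr m m') hc'.
have hh : cellconst (r (maxn m m')) (fun x => h x || h' x).
  by move=> x y xy; rewrite (hc _ _ xy) (hc' _ _ xy).
exists (maxn m m'), (fun x => h x || h' x); split => //.
rewrite (splitr e) EFinD; apply: le_trans (leeD he he').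
have h1 := meas_cap_qcube J mA; have h2 := meas_cap_qcube J mB.
have h3 := meas_cellb hc; have h4 := meas_cellb hc'; have h5 := meas_cellb hh.
have h6 := meas_cap_qcube J (measurableU _ _ mA mB).
rewrite /nl1 -ge0_nlD; [|by meas|by meas|by move=> x|by move=> x].
apply: le_nl1; [by meas|by meas|move=> x].
by rewrite in_setU; case: (x \in A); case: (x \in B); case: (qcube J x); case: (h x);
  case: (h' x) => /=; rewrite ?subrr ?subr0 ?sub0r ?normrN ?normr0 ?normr1 ?addr0 ?add0r// lerDl.
Qed.

Lemma dyapp_bigsetU (F : nat -> set rV) N : (forall i, dyapp (F i)) ->
  dyapp (\big[setU/set0]_(i < N) F i).
Proof.
move=> hF; elim: N => [|N IH]; first by rewrite big_ord0; exact: dyapp0.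
by rewrite big_ord_recr; exact: dyappU.
Qed.

(** Dominated convergence in the cube reduces to a finite union. *)
Lemma dyapp_bigcup (F : nat -> set rV) : (forall i, dyapp (F i)) -> dyapp (\bigcup_i F i).
Proof.
move=> hF; have mF : measurable (\bigcup_i F i) by apply: bigcupT_measurable => i; exact: (hF i).1.
split=> // J e e0; have e2 : 0 < e / 2 by rewrite divr_gt0.
pose G N := \big[setU/set0]_(i < N) F i.
have hG N : dyapp (G N) by exact: dyapp_bigsetU.
pose d N x : R := `|((x \in \bigcup_i F i) && qcube J x)%:R - ((x \in G N) && qcube J x)%:R|.
have md N : measurable_fun setT (d N).
  have h1 := meas_cap_qcube J mF; have h2 := meas_cap_qcube J (hG N).1.
  by rewrite /d; meas.
have GF N x : x \in G N -> x \in \bigcup_i F i.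
  rewrite !in_setE /G -bigcup_mkord => -[i _ h]; by exists i.
have dle N x : d N x <= (qcube J x)%:R.
  rewrite /d; have := @GF N x; case: (x \in G N); case: (x \in \bigcup_i F i) => /= h;
    case: (qcube J x) => /=; rewrite ?subrr ?subr0 ?normr0 ?normr1 ?ler01//;
    by have := h isT.
have i0 : intg mu (fun _ : rV => 0 : R).
  by apply: intgP => //; rewrite /nl1 (eq_integral (fun=> 0%E)) ?integral0// => x _; rewrite normr0.
have cv : (fun N => \int[mu]_x d N x) @ \oo --> (0 : R).
  have := @Rint_dominated _ _ _ mu d (fun=> 0) (fun x => (qcube J x)%:R) md i0 (intg_qcube J).
  rewrite Rintegral_cst// mul0r; apply.
  - move=> x; apply: cvg_near_cst; rewrite /d.
    case: (boolP (x \in \bigcup_i F i)) => [|nx].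
      rewrite in_setE => -[i _ Fi]; exists i.+1 => //= N /= iN.
      rewrite (_ : x \in G N) ?subrr ?normr0//; rewrite in_setE /G -bigcup_mkord.
      by exists i.
    apply: nearW => N; rewrite (_ : x \in G N = false) ?subrr ?normr0//.
    by apply/negbTE; apply: contra nx; exact: GF.
  - by move=> N x; rewrite ger0_norm ?normr_ge0//; exact: dle.
have [N hN] : exists N, \int[mu]_x d N x < e / 2.
  by have [N _ h] := @cvgr_lt _ _ _ _ _ _ cv _ e2; exists N; exact: (h N (leqnn N)).
have iN : intg mu (d N).
  apply: le_intg (intg_qcube J) _ => // x.
  by rewrite ger0_norm ?normr_ge0// ger0_norm ?ler0n.
have [m [h [hc he]]] := (hG N).2 J _ e2.
exists m, h; split => //; rewrite (splitr e) EFinD.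
apply: le_trans (leeD (lexx _) he).
apply: (@le_trans _ _ (\int[mu]_x (d N x)%:E + nl1 mu (fun x => (((x \in G N) && qcube J x)%:R - (h x)%:R)%R))%E); last first.
  by apply: leeD => //; rewrite -EFin_Rintegral// lee_fin ltW.
have h1 := meas_cap_qcube J mF; have h2 := meas_cap_qcube J (hG N).1; have h3 := meas_cellb hc.
rewrite /nl1 -ge0_nlD; [|exact: md|by meas|by move=> x; exact: normr_ge0|by move=> x].
apply: le_nl1; [by meas|have := md N => h4; by meas|move=> x].
by rewrite /d; apply: le_trans (ler_normD _ _); rewrite addrA subrK.
Qed.

(* The half-space is the increasing union of the sets where the lower corner of
   the cell of [x] satisfies the strict inequality. *)
Lemma dyapp_ray i (a : R) : dyapp [set x : rV | a < x ord0 i].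
Proof.
rewrite (_ : [set _ | _] = \bigcup_m [set x : rV | a < corner (r m) x ord0 i]).
  apply: dyapp_bigcup => m; apply: (@dyapp_cell _ m) => x y xy.
  by apply/idP/idP; rewrite !in_setE /= /corner xy.
have cl m x : corner (r m) x ord0 i <= x ord0 i < corner (r m) x ord0 i + r m.
  have /(cellP _ _ (pow_half_gt0 m))/(_ i) := erefl (cell (r m) x).
  rewrite /= in_itv/= intrD mulrDr mulr1 => h.
  by rewrite (_ : corner (r m) x ord0 i = r m * (cell (r m) x ord0 i)%:~R)// mxE.
apply/seteqP; split=> x /=.
  move=> ax; have [m hm] := @pow_half_lt (x ord0 i - a) ltac:(by rewrite subr_gt0).
  by exists m => //=; have /andP[_] := cl m x; lra.
by move=> [m _ /= h]; have /andP[+ _] := cl m x; exact: lt_le_trans.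
Qed.

(** The approximable sets form a sigma-algebra containing the half-spaces, which generate the Borel
    sets. *)
Lemma dyapp_measurable A : measurable A -> dyapp A.
Proof.
have sd : sigma_algebra setT dyapp.
  split; [exact: dyapp0|by move=> B hB; rewrite setTD; exact: dyappC|].
  by move=> F hF; exact: dyapp_bigcup.
suff : g_sigma_preimage (fun i (x : rV) => x ord0 i) `<=` dyapp by apply.
apply: smallest_sub => //.
rewrite -bigcup_seq; apply: bigcup_sub => i _ B [C + <-].
rewrite setTI [X in X C -> _](_ : _ = <<s @RGenOInfty.G R >>); last exact: RGenOInfty.measurableE.
move=> sC; pose P (C : set R) := dyapp ((fun x : rV => x ord0 i) @^-1` C).
apply: (@smallest_sub _ (sigma_algebra setT) (@RGenOInfty.G R) P) sC.
  split; rewrite /P.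
  - by rewrite preimage_set0; exact: dyapp0.
  - by move=> D hD; rewrite setTD preimage_setC; exact: dyappC.
  - by move=> F hF; rewrite preimage_bigcup; exact: dyapp_bigcup.
move=> _ [a ->]; rewrite /P (_ : _ @^-1` _ = [set x : rV | a < x ord0 i]); first exact: dyapp_ray.
by apply/seteqP; split=> x /=; rewrite in_itv/= andbT.
Qed.

Definition d2app (u : rV -> R) := measurable_fun setT u /\ forall e : R, 0 < e ->
  exists m (h : rV -> R), cellconst (r m) h /\ (nl2 mu (fun x => (u x - h x)%R) <= e%:E)%E.

Lemma d2app_lim (u : rV -> R) : measurable_fun setT u ->
  (forall e : R, 0 < e -> exists v, d2app v /\ (nl2 mu (fun x => (u x - v x)%R) <= e%:E)%E) ->
  d2app u.
Proof.
move=> m_u hu; split=> // e e0; have e4 : 0 < e / 4 by rewrite divr_gt0.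
have [v [[mv hv] uv]] := hu _ e4; have [m [h [hc vh]]] := hv _ e4.
have mh := meas_cellconst (pow_half_gt0 m) hc.
exists m, h; split => //.
rewrite (_ : (fun x => _) = fun x => (u x - v x) + (v x - h x)); last first.
  by apply/funext => x; rewrite addrA subrK.
apply: le_trans (nl2D _ _ _) _; [by meas|by meas|].
apply: (@le_trans _ _ (2%:E * ((e / 4)%:E + (e / 4)%:E))%E).
  by rewrite lee_wpmul2l ?lee_fin//; apply: leeD.
by rewrite -EFinD -EFinM lee_fin; lra.
Qed.

Lemma d2appD (u v : rV -> R) : d2app u -> d2app v -> d2app (fun x => u x + v x).
Proof.
move=> [m_u hu] [mv hv]; split=> [|e e0]; first by meas.
have e4 : 0 < e / 4 by rewrite divr_gt0.
have [m [h [hc uh]]] := hu _ e4; have [m' [h' [hc' vh]]] := hv _ e4.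
have {}hc := cellconst_half (leq_maxl m m') hc.
have {}hc' := cellconst_half (leq_maxr m m') hc'.
have mh := meas_cellconst (pow_half_gt0 _) hc; have mh' := meas_cellconst (pow_half_gt0 _) hc'.
exists (maxn m m'), (fun x => h x + h' x); split.
  by move=> x y xy; rewrite (hc _ _ xy) (hc' _ _ xy).
rewrite (_ : (fun x => _) = fun x => (u x - h x) + (v x - h' x)); last first.
  by apply/funext => x; rewrite opprD addrACA.
apply: le_trans (nl2D _ _ _) _; [by meas|by meas|].
apply: (@le_trans _ _ (2%:E * ((e / 4)%:E + (e / 4)%:E))%E).
  by rewrite lee_wpmul2l ?lee_fin//; apply: leeD.
by rewrite -EFinD -EFinM lee_fin; lra.
Qed.

Lemma d2appZ (c : R) (u : rV -> R) : d2app u -> d2app (fun x => c * u x).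
Proof.
move=> [m_u hu]; split=> [|e e0]; first by meas.
have c0 : 0 < c ^+ 2 + 1 by rewrite ltr_wpDl// sqr_ge0.
have [m [h [hc uh]]] := hu _ (divr_gt0 e0 c0).
have mh := meas_cellconst (pow_half_gt0 _) hc.
exists m, (fun x => c * h x); split.
  by move=> x y xy; rewrite (hc _ _ xy).
rewrite (_ : (fun x => _) = fun x => c * (u x - h x)); last first.
  by apply/funext => x; rewrite mulrBr.
rewrite nl2Z; last by meas.
apply: le_trans (lee_wpmul2l _ uh) _; first by rewrite lee_fin sqr_ge0.
rewrite -EFinM lee_fin mulrA ler_pdivrMr// mulrC ler_wpM2l ?(ltW e0)//.
by rewrite lerDl.
Qed.

Lemma d2app_cap_qcube A J : measurable A -> d2app (fun x => ((x \in A) && qcube J x)%:R).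
Proof.
move=> mA; split=> [|e e0]; first exact: meas_cap_qcube.
have [m [h [hc he]]] := (dyapp_measurable mA).2 J _ e0.
exists m, (fun x => (h x)%:R); split; first by move=> x y xy; rewrite (hc _ _ xy).
apply: le_trans he; have h1 := meas_cap_qcube J mA; have h2 := meas_cellb hc.
apply: le_nl; [by meas|by meas|move=> x]; rewrite sqr_ge0/=.
by case: (_ && _); case: (h x) => /=;
  rewrite ?subrr ?subr0 ?sub0r ?sqrrN ?normrN ?normr0 ?normr1 ?expr0n ?expr1n.
Qed.

Lemma d2app_sum (I : Type) (s : seq I) (f : I -> rV -> R) : (forall i, d2app (f i)) ->
  d2app (fun x => \sum_(i <- s) f i x).
Proof.
move=> hf; elim: s => [|i s IH].
  rewrite (_ : (fun x => _) = fun x => 0 * ((x \in set0 : bool) && qcube 0 x)%:R).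
    by apply: d2appZ; exact: d2app_cap_qcube.
  by apply/funext => x; rewrite big_nil mul0r.
rewrite (_ : (fun x => _) = fun x => f i x + \sum_(i <- s) f i x); first exact: d2appD.
by apply/funext => x; rewrite big_cons.
Qed.

(** Rounding down to multiples of [1 / M] gives a finite combination of indicators of level sets. *)
Lemma d2app_bounded (u : rV -> R) (N : nat) : measurable_fun setT u ->
  d2app (fun x => u x * ((`|u x| <= N%:R) && qcube N x)%:R).
Proof.
move=> m_u; have mset : measurable [set x | `|u x| <= N%:R].
  rewrite (_ : [set _ | _] = (fun x => `|u x|) @^-1` `]-oo, N%:R]%classic).
    have m1 : measurable_fun setT (fun x => `|u x|) by meas.
    by rewrite -[X in measurable X]setTI; apply: m1 => //; exact: measurable_itv.
  by apply/seteqP; split=> x /=; rewrite in_itv.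
have mv : measurable_fun setT (fun x => u x * ((`|u x| <= N%:R) && qcube N x)%:R).
  apply: measurable_funM => //; apply: meas_bool.
  rewrite (_ : [set _ | _] = [set x | `|u x| <= N%:R] `&` [set x | qcube N x]).
    by apply: measurableI => //; exact: measurable_qcube.
  by apply/seteqP; split=> x /= => [/andP[]|[-> ->]].
apply: d2app_lim => // e e0.
set Q := fine (nl1 mu (fun x => (qcube N x)%:R)).
have QE : nl1 mu (fun x => (qcube N x)%:R) = Q%:E.
  by rewrite fineK// ge0_fin_numE ?nl1_ge0// nl1_qcube.
have Q0 : 0 <= Q by rewrite fine_ge0// nl1_ge0.
(* The squared error is at most [1 / M^2 <= 1 / M] on a cube of measure [Q]. *)
pose M := (Num.truncn (Q / e)).+1.
have M1 : (1 : R) <= M%:R by rewrite ler1n.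
have M0 : (0 : R) < M%:R by rewrite ltr0n.
have QM : Q / e <= M%:R.
  by rewrite ltW//; have /andP[] := truncn_itv (divr_ge0 Q0 (ltW e0)).
pose A (j : nat) := [set x | `|u x| <= N%:R] `&`
  (fun x => (u x + N%:R) * M%:R) @^-1` `[j%:R, j.+1%:R[%classic.
have mA j : measurable (A j).
  apply: measurableI => //; rewrite -[X in measurable X]setTI.
  have m1 : measurable_fun setT (fun x => (u x + N%:R) * M%:R) by meas.
  by apply: m1 => //; exact: measurable_itv.
pose v x : R := \sum_(j < (2 * N * M).+1) (j%:R / M%:R - N%:R) * ((x \in A j) && qcube N x)%:R.
have hv : d2app v by apply: d2app_sum => j; apply: d2appZ; apply: d2app_cap_qcube.
exists v; split => //.
have dv x : `|u x * ((`|u x| <= N%:R) && qcube N x)%:R - v x| <= M%:R^-1 * (qcube N x)%:R.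
  rewrite /v; case: (boolP (qcube N x)) => qx; last first.
    by rewrite andbF mulr0 big1 ?subr0 ?normr0 ?mulr0// => j _; rewrite andbF mulr0.
  rewrite andbT mulr1; case: (boolP (`|u x| <= N%:R)) => ux; last first.
    rewrite mulr0 big1 ?subr0 ?normr0 ?invr_ge0 ?ltW// => j _.
    rewrite (_ : x \in A j = false) ?mulr0//.
    by apply/negbTE; apply/negP => /set_mem[/= h]; rewrite h in ux.
  rewrite mulr1; have /andP[ul ur] : - N%:R <= u x <= N%:R by rewrite -ler_norml.
  have z0 : 0 <= (u x + N%:R) * M%:R by rewrite mulr_ge0 ?ler0n// -lerBlDr sub0r.
  have /andP[jl jr] := truncn_itv z0; set j := Num.truncn _ in jl jr.
  have jlt : (j < (2 * N * M).+1)%N.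
    rewrite ltnS -(ler_nat R); apply: le_trans jl _.
    by rewrite !natrM ler_wpM2r ?ler0n// mulr_natl mulr2n lerD2r.
  rewrite (bigD1 (Ordinal jlt))//= big1 ?addr0; last first.
    move=> k kj; rewrite (_ : x \in A k = false) ?mulr0//.
    apply/negbTE; apply/negP => /set_mem[_]; rewrite /= in_itv/= => /andP[h1 h2].
    move/eqP: kj; apply; apply: val_inj => /=.
    have a1 : (k < j.+1)%N by rewrite -(ltr_nat R); exact: le_lt_trans jr.
    have a2 : (j < k.+1)%N by rewrite -(ltr_nat R); exact: le_lt_trans h2.
    by apply/eqP; rewrite eqn_leq; apply/andP; split.
  rewrite (_ : x \in A j) ?mulr1; last by rewrite in_setE; split => //=; rewrite in_itv/= jl jr.
  rewrite -[leRHS]mul1r ler_pdivlMr// -[X in _ * X](gtr0_norm M0) -normrM.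
  rewrite mulrBl mulrBl divfK ?gt_eqF// ger0_norm; last by rewrite mulrDl in jl; lra.
  by rewrite mulrDl -natr1 in jr; lra.
have mvv := hv.1; have mq := meas_qcube N.
apply: (@le_trans _ _ (\int[mu]_x (M%:R^-1 * (qcube N x)%:R)%:E)%E).
  apply: le_nl; [by meas|by meas|move=> x]; rewrite sqr_ge0/=.
  rewrite -real_normK ?num_real//.
  apply: le_trans (lerXn2r 2 _ _ (dv x)) _; rewrite ?nnegrE ?mulr_ge0 ?invr_ge0 ?ler0n//.
  rewrite exprMn expr2 -[in leRHS](mulr1 M%:R^-1) -!mulrA; apply: ler_wpM2l; first by rewrite invr_ge0.
  case: (qcube N x) => /=; rewrite ?expr0n ?mulr0// expr1n !mulr1.
  by rewrite invf_le1.
have Mi0 : (0 : R) <= M%:R^-1 by rewrite invr_ge0 ltW.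
rewrite (ge0_nlZ _ mq Mi0 (fun x => ler0n _ (qcube N x))).
rewrite (_ : (\int[mu]_x (qcube N x)%:R%:E = Q%:E)%E); last first.
  by rewrite -QE; apply: eq_integral => x _; rewrite normr_nat.
by rewrite -EFinM lee_fin mulrC ler_pdivrMr// mulrC -ler_pdivrMr.
Qed.

Lemma d2app_all (u : rV -> R) : measurable_fun setT u -> (nl2 mu u < +oo)%E -> d2app u.
Proof.
move=> m_u u2; apply: d2app_lim => // e e0.
pose v N x := u x * ((`|u x| <= N%:R) && qcube N x)%:R.
have mv N : measurable_fun setT (v N) := (d2app_bounded N m_u).1.
have iu : intg mu (fun x => u x ^+ 2) by apply: (intgM m_u m_u).
have i0 : intg mu (fun _ : rV => 0 : R).
  by apply: intgP => //; rewrite /nl1 (eq_integral (fun=> 0%E)) ?integral0// => x _; rewrite normr0.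
have dle N x : 0 <= (u x - v N x) ^+ 2 <= u x ^+ 2.
  by rewrite sqr_ge0/= /v; case: (_ && _); rewrite ?mulr1 ?subrr ?mulr0 ?subr0 ?expr0n ?sqr_ge0.
have md N : measurable_fun setT (fun x => (u x - v N x) ^+ 2) by have := mv N => h; meas.
have cv : (fun N => \int[mu]_x (u x - v N x) ^+ 2) @ \oo --> (0 : R).
  have := @Rint_dominated _ _ _ mu (fun N x => (u x - v N x) ^+ 2) (fun=> 0) _ md i0 iu.
  rewrite Rintegral_cst// mul0r; apply.
  - move=> x; apply: cvg_near_cst; rewrite /v.
    have h1 : \forall N \near \oo, `|u x| <= N%:R by exact: nbhs_infty_ger.
    have h2 : \forall N \near \oo, qcube N x.
      pose K := \sum_i absz (cell 1 x ord0 i).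
      exists K => //= N /= KN; apply/forallP => i.
      have : (absz (cell 1 x ord0 i) <= K)%N by rewrite /K (bigD1 i)//= leq_addr.
      by move: KN; move: (cell 1 x ord0 i) K => c K; clear; lia.
    near=> N; have -> : `|u x| <= N%:R by near: N.
    have -> : qcube N x by near: N.
    by rewrite mulr1 subrr expr0n.
  - by move=> N x; have /andP[a b] := dle N x; rewrite ger0_norm.
have [N hN] : exists N, \int[mu]_x (u x - v N x) ^+ 2 < e.
  by have [N _ h] := @cvgr_lt _ _ _ _ _ _ cv _ e0; exists N; exact: (h N (leqnn N)).
exists (v N); split; first exact: d2app_bounded.
rewrite /nl2 -EFin_Rintegral ?lee_fin ?ltW//.
apply: le_intg iu _ => // x.
by have /andP[a b] := dle N x; rewrite !ger0_norm ?sqr_ge0.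
Unshelve. all: by end_near. Qed.

(* Conditional expectations approximate in L^2 as well as functions constant on
   cells do, up to a factor, and they do not increase the L^1 norm. *)
Lemma E_approx (u : rV -> R) (e : R) : measurable_fun setT u -> (nl2 mu u < +oo)%E -> 0 < e ->
  exists m0, forall m, (m0 <= m)%N -> (nl2 mu (fun x => (u x - E (r m) u x)%R) <= e%:E)%E.
Proof.
move=> m_u u2 e0; have e4 : 0 < e / 4 by rewrite divr_gt0.
have [m0 [h [hc uh]]] := (d2app_all m_u u2).2 _ e4.
exists m0 => m mm; have rm := pow_half_gt0 m.
have {}hc := cellconst_half mm hc; have mh := meas_cellconst rm hc.
have md : measurable_fun setT (fun x => u x - h x) by meas.
have d2 : (nl2 mu (fun x => (u x - h x)%R) < +oo)%E by apply: le_lt_trans uh _; rewrite ltry.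
have lu := locint2 rm m_u u2; have ld := locint2 rm md d2.
rewrite (_ : (fun x => _) = fun x => (u x - h x) + -1 * E (r m) (fun y => u y - h y) x); last first.
  apply/funext => x; have -> : E (r m) u x = E (r m) (fun y => (u y - h y) + 1 * h y) x.
    by congr E; apply/funext => y; rewrite mul1r subrK.
  have lh : locint (r m) (fun y => 1 * h y).
    by apply: locintM => // z; under eq_fun do rewrite mulr1; exact: intg_ce.
  rewrite (E_D x ld lh) (_ : E (r m) (fun y => 1 * h y) x = h x); first by ring.
  by rewrite -(E_id rm x hc); congr E; apply/funext => y; rewrite mul1r.
have mE := meas_E rm (fun y => u y - h y).
apply: le_trans (nl2D _ _ _) _; [by meas|by meas|].
rewrite nl2Z// sqrrN expr1n mul1e.
apply: (@le_trans _ _ (2%:E * ((e / 4)%:E + (e / 4)%:E))%E).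
  by rewrite lee_wpmul2l ?lee_fin//; apply: leeD => //; apply: le_trans (nl2_E rm md) _.
by rewrite -EFinD -EFinM lee_fin; lra.
Qed.

Lemma step_approx (u : rV -> R) (e : R) : measurable_fun setT u -> (nl2 mu u < +oo)%E -> 0 < e ->
  exists m0, forall m, (m0 <= m)%N -> exists N,
    (nl2 mu (fun x => (u x - itrunc (r m) N (E (r m) u) x)%R) <= e%:E)%E.
Proof.
move=> m_u u2 e0; have e4 : 0 < e / 4 by rewrite divr_gt0.
have [m0 h0] := E_approx m_u u2 e4; exists m0 => m mm; have {}h0 := h0 m mm.
have rm := pow_half_gt0 m; pose g := E (r m) u.
have mg : measurable_fun setT g := meas_E rm u.
have gc : cellconst (r m) g := E_cellconst u.
have g2 : (nl2 mu g < +oo)%E := le_lt_trans (nl2_E rm m_u) u2.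
have mt N : measurable_fun setT (itrunc (r m) N g) := meas_cellconst rm (itrunc_cell N gc).
have ig : intg mu (fun x => g x ^+ 2) by apply: (intgM mg mg).
have i0 : intg mu (fun _ : rV => 0 : R).
  by apply: intgP => //; rewrite /nl1 (eq_integral (fun=> 0%E)) ?integral0// => x _; rewrite normr0.
have dle N x : 0 <= (g x - itrunc (r m) N g x) ^+ 2 <= g x ^+ 2.
  by rewrite sqr_ge0/= /itrunc; case: ifP; rewrite ?subrr ?subr0 ?expr0n ?sqr_ge0.
have md N : measurable_fun setT (fun x => (g x - itrunc (r m) N g x) ^+ 2).
  by have := mt N => h; meas.
have cv : (fun N => \int[mu]_x (g x - itrunc (r m) N g x) ^+ 2) @ \oo --> (0 : R).
  have := @Rint_dominated _ _ _ mu (fun N x => (g x - itrunc (r m) N g x) ^+ 2) (fun=> 0) _ md i0 ig.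
  rewrite Rintegral_cst// mul0r; apply.
  - move=> x; apply: cvg_near_cst; apply: filterS (itrunc_near (r m) g x) => N ->.
    by rewrite subrr expr0n.
  - by move=> N x; have /andP[a b] := dle N x; rewrite ger0_norm.
have [N hN] : exists N, \int[mu]_x (g x - itrunc (r m) N g x) ^+ 2 < e / 4.
  by have [N _ h] := @cvgr_lt _ _ _ _ _ _ cv _ e4; exists N; exact: (h N (leqnn N)).
exists N; rewrite (_ : (fun x => _) = fun x => (u x - g x) + (g x - itrunc (r m) N g x)); last first.
  by apply/funext => x; rewrite addrA subrK.
have h := mt N; apply: le_trans (nl2D _ _ _) _; [by meas|by meas|].
apply: (@le_trans _ _ (2%:E * ((e / 4)%:E + (e / 4)%:E))%E).
  rewrite lee_wpmul2l ?lee_fin//; apply: leeD => //.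
  rewrite /nl2 -EFin_Rintegral ?lee_fin ?ltW//.
  by apply: le_intg ig _ => // x; have /andP[a b] := dle N x; rewrite !ger0_norm ?sqr_ge0.
by rewrite -EFinD -EFinM lee_fin; lra.
Qed.

End density.

(** * Smooth functions as bumps *)

Section smooth_bump.
Context {R : realType} {n : nat}.
Local Notation mu := (@lebesgue_rV R n).
Local Notation rV := 'rV[R]_n.
Local Notation ei i := (delta_mx ord0 i : rV).
Implicit Types (x y z v : rV) (f : rV -> R).

Lemma corner_cvg x : (fun m => corner ((2^-1 : R) ^+ m) x) @ \oo --> x.
Proof.
apply/cvg_ballP => e e0; have [m0 hm] := pow_half_lt e0.
exists m0 => // m /= mm; split => // i j; rewrite (ord1 i) /ball/=.
have r0 := @pow_half_gt0 R m.
have := cell_near j r0 (cell_corner x r0); rewrite distrC => h.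
apply: lt_trans h _; apply: le_lt_trans hm.
by rewrite ler_wiXn2l ?invr_ge0// invf_le1// ler1n.
Qed.

(** The sigma-algebra is generated by coordinates and not by the topology; evaluating at corners of
    shrinking cells gives measurable approximations. *)
Lemma continuous_meas f : continuous f -> measurable_fun setT f.
Proof.
move=> cf; apply: (@measurable_fun_cvg _ _ _ _ (fun m x => f (corner ((2^-1 : R) ^+ m) x))).
  move=> m; apply: (meas_cellconst (@pow_half_gt0 R m)) => x y xy.
  by rewrite /corner xy.
by move=> x _; apply: continuous_cvg; [exact: cf|exact: corner_cvg].
Qed.

Lemma derive_line f x v (t : R) : derivable f (x + t *: v) v ->
  is_derive t 1 (fun s => f (x + s *: v)) ('D_v f (x + t *: v)).
Proof.
move=> df; have e : (fun h : R => h^-1 *: (((fun s => f (x + s *: v)) \o shift t) (h *: (1 : R)) - f (x + t *: v))) =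
    (fun h : R => h^-1 *: ((f \o shift (x + t *: v)) (h *: v) - f (x + t *: v))).
  apply/funext => h /=; congr (_ *: (f _ - _)).
  by rewrite scalerDl /GRing.scale/= mulr1 addrCA.
by split; rewrite /derivable /derive e.
Qed.

Lemma derivable_shift f x y v : derivable f (x + y) v -> derivable (fun z => f (z + y)) x v.
Proof.
have e : (fun h : R => h^-1 *: (((fun z => f (z + y)) \o shift x) (h *: v) - f (x + y))) =
    (fun h : R => h^-1 *: ((f \o shift (x + y)) (h *: v) - f (x + y))).
  by apply/funext => h /=; rewrite addrA.
by rewrite /derivable e.
Qed.

Lemma derive_shift f x y v : 'D_v (fun z => f (z + y)) x = 'D_v f (x + y).
Proof.
have e : (fun h : R => h^-1 *: (((fun z => f (z + y)) \o shift x) (h *: v) - f (x + y))) =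
    (fun h : R => h^-1 *: ((f \o shift (x + y)) (h *: v) - f (x + y))).
  by apply/funext => h /=; rewrite addrA.
by rewrite /derive e.
Qed.

Lemma coord_lip f i (B : R) x (t : R) : (forall z, derivable f z (ei i)) ->
  (forall z, `|'D_(ei i) f z| <= B) -> `|f (x + t *: ei i) - f x| <= B * `|t|.
Proof.
move=> df fB; have key (a b : R) : a <= b -> `|f (x + b *: ei i) - f (x + a *: ei i)| <= B * (b - a).
  move=> ab; have dg (s : R) : is_derive s 1 (fun s => f (x + s *: ei i)) ('D_(ei i) f (x + s *: ei i)).
    exact: derive_line.
  have [|c _ ->] := MVT_segment ab (fun s _ => dg s).
    by apply: derivable_within_continuous => s _; case: (dg s).
  have ba : 0 <= b - a by rewrite subr_ge0.
  by rewrite normrM (ger0_norm ba); exact: ler_wpM2r.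
have [t0|t0] := leP 0 t.
  by have := key _ _ t0; rewrite scale0r addr0 subr0 (ger0_norm t0).
have := key _ _ (ltW t0); rewrite scale0r addr0 sub0r distrC => h.
by rewrite (ltr0_norm t0).
Qed.

(** A path from [y] to [x] that moves one coordinate at a time. *)
Lemma l1_lip f (B : R) x y : (forall i z, derivable f z (ei i)) ->
  (forall i z, `|'D_(ei i) f z| <= B) -> `|f x - f y| <= B * l1 (x - y).
Proof.
move=> df fB.
have key (s : seq 'I_n) (d : 'I_n -> R) z :
    `|f (z + \sum_(i <- s) d i *: ei i) - f z| <= B * \sum_(i <- s) `|d i|.
  elim: s z => [|i s IH] z; first by rewrite !big_nil addr0 subrr normr0 mulr0.
  rewrite !big_cons addrA.
  rewrite (_ : f _ - f z = (f (z + d i *: ei i + \sum_(j <- s) d j *: ei j) - f (z + d i *: ei i)) +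
    (f (z + d i *: ei i) - f z)); last by rewrite addrA subrK.
  apply: le_trans (ler_normD _ _) _; rewrite mulrDr addrC.
  by apply: lerD; [exact: coord_lip|exact: IH].
have := key (index_enum _) (fun i => (x - y) ord0 i) y.
rewrite (_ : \sum_(i < n) (x - y) ord0 i *: ei i = x - y); last exact/esym/row_sum_delta.
by rewrite [y + (x - y)]addrC subrK.
Qed.

(** [l1_lip] for the difference [f u - f (u + y)], whose partial derivatives are bounded by [l1_lip]
    again. *)
Lemma l1_lip2 f (B : R) x y z : (forall i z, derivable f z (ei i)) ->
  (forall i j z, derivable ('D_(ei i) f) z (ei j)) ->
  (forall i j z, `|'D_(ei j) ('D_(ei i) f) z| <= B) ->
  `|f x - f (x + y) - (f (x - z) - f (x + y - z))| <= B * (l1 y * l1 z).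
Proof.
move=> df ddf fB; pose g u := f u - f (u + y).
have dfy i u : derivable (fun u => f (u + y)) u (ei i) by exact: derivable_shift.
have h : `|g x - g (x - z)| <= B * l1 y * l1 (x - (x - z)).
  apply: l1_lip => [i u|i u].
    by apply: derivableB.
  rewrite /g (_ : (fun _ => _) = f - (fun u => f (u + y)))//.
  rewrite deriveB// derive_shift.
  have := @l1_lip ('D_(ei i) f) B u (u + y) (fun j => ddf i j) (fun j => fB i j).
  by rewrite opprD addrA subrr sub0r l1N.
rewrite (_ : x - (x - z) = z) in h; last by rewrite opprB addrC subrK.
by rewrite mulrA [x + y - z]addrAC.
Qed.

Lemma partial_zero f (a : R) (s : seq 'I_n) : (forall x i, a < `|x ord0 i| -> f x = 0) ->
  forall x i, a < `|x ord0 i| -> partial s f x = 0.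
Proof.
move=> f0; elim: s => [|j s IH] x i ax; first exact: f0 ax.
rewrite /= (@near_eq_derive _ _ _ _ (cst 0) x); first by rewrite derive_cst.
have op : nbhs x [set z : rV | a < `|z ord0 i|].
  have e0 : 0 < `|x ord0 i| - a by rewrite subr_gt0.
  apply/nbhs_ballP; exists (`|x ord0 i| - a) => //= z [_ /(_ ord0 i)]; rewrite /ball/= => h.
  have := ler_normD (z ord0 i) (x ord0 i - z ord0 i).
  by rewrite addrC subrK => h'; lra.
by apply: filterS op => z; exact: IH.
Qed.

(** A continuous function is bounded on a compact cube and this one vanishes off it; by
    [partial_zero] this covers all partial derivatives of [phi]. *)
Lemma zero_bounded f (a : R) : continuous f -> (forall x i, a < `|x ord0 i| -> f x = 0) ->
  exists B : R, forall x, `|f x| <= B.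
Proof.
move=> cf f0; pose Q : set rV := [set v | forall i, `[- a, a]%classic (v ord0 i)].
have cQ : compact Q by apply: (@rV_compact R n (fun=> `[- a, a]%classic)) => i; exact: segment_compact.
have := compact_bounded (continuous_compact (continuous_subspaceT cf) cQ).
move=> /pinfty_ex_gt0[M M0 hM]; exists (Num.max M 0) => x.
have [Qx|nQ] := pselect (Q x); first by rewrite le_max; apply/orP; left; apply: hM; exists x.
have [i hi] : exists i, a < `|x ord0 i|.
  apply: contrapT => h; apply: nQ => i /=; rewrite in_itv/= -ler_norml leNgt.
  by apply/negP => hi; apply: h; exists i.
by rewrite (f0 _ _ hi) normr0 le_max lexx orbT.
Qed.

Lemma smooth_is_bump f : smooth f -> (forall x, 0 <= f x) ->
  (forall x, f x != 0 -> enorm x <= 4^-1) -> \int[mu]_x f x = 1 ->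
  exists2 Lam, 0 < Lam & bump f Lam.
Proof.
move=> sf f0 fs f1.
have fz x i : 4^-1 < `|x ord0 i| -> f x = 0.
  move=> h; apply/eqP; apply: contraTT h => /fs h; rewrite -leNgt.
  exact: le_trans (coord_le_enorm _ _) h.
have hb s : exists B : R, forall x, `|partial s f x| <= B.
  by apply: (@zero_bounded _ 4^-1 (sf s).1); exact: partial_zero.
have [B hB] := choice hb.
have B0 s : 0 <= B s := le_trans (normr_ge0 _) (hB s 0).
pose L1 := \sum_i B [:: i]; pose L2 := \sum_i \sum_j B [:: j; i].
have L10 : 0 <= L1 by apply: sumr_ge0.
have L20 : 0 <= L2 by apply: sumr_ge0 => i _; apply: sumr_ge0.
exists (1 + B [::] + L1 + L2).
  by have := B0 [::]; move: L10 L20; clear; lra.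
have l1_ge0 v : 0 <= l1 v by apply: sumr_ge0.
split => //.
- exact: continuous_meas (sf [::]).1.
- move=> x; have := hB [::] x; rewrite /= ger0_norm// => h.
  by move: L10 L20 h; clear; lra.
- have mf := continuous_meas (sf [::]).1.
  move: f1; rewrite /Rintegral; have : (0 <= \int[mu]_x (f x)%:E)%E.
    by apply: integral_ge0 => x _; rewrite lee_fin.
  by case: (\int[mu]_x (f x)%:E)%E => //= [t _ ->//|_ /eqP]; rewrite eq_sym oner_eq0.
- move=> x y; apply: (@le_trans _ _ (L1 * l1 (x - y))).
    apply: l1_lip => [i z|i z]; first exact: (sf [::]).2.
    apply: le_trans (hB [:: i] z) _.
    by rewrite /L1 (bigD1 i)//= lerDl; apply: sumr_ge0.
  by rewrite ler_wpM2r//; have := B0 [::]; move: L20; clear; lra.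
- move=> x y z; apply: (@le_trans _ _ (L2 * (l1 y * l1 z))).
    apply: l1_lip2 => [i u|i j u|i j u]; first exact: (sf [::]).2.
    + exact: (sf [:: i]).2.
    + apply: le_trans (hB [:: j; i] u) _.
      rewrite /L2 (bigD1 i)//= (bigD1 j)//= -addrA lerDl addr_ge0//.
        by apply: sumr_ge0.
      by apply: sumr_ge0 => k _; apply: sumr_ge0.
  by rewrite ler_wpM2r ?mulr_ge0//; have := B0 [::]; move: L10; clear; lra.
Qed.

End smooth_bump.

(** * Weak (1,1) bound for functions in L^1 and L^2 *)

Section real_weak11.
Context {R : realType} {n : nat}.
Local Notation mu := (@lebesgue_rV R n).
Local Notation rV := 'rV[R]_n.
Implicit Types (x y z : rV) (u v h : rV -> R).

Lemma nl2_ae u v : measurable_fun setT u -> measurable_fun setT v ->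
  {ae mu, forall x, u x = v x} -> nl2 mu u = nl2 mu v.
Proof.
move=> m_u mv uv; apply: ge0_ae_eq_integral => //; [by meas|by meas|..].
- by move=> x _; rewrite lee_fin sqr_ge0.
- by move=> x _; rewrite lee_fin sqr_ge0.
by apply: filterS uv => x /= -> _.
Qed.

Lemma real_op_diff S k (A : R) u v : real_op S k A ->
  measurable_fun setT u -> (nl2 mu u < +oo)%E -> measurable_fun setT v -> (nl2 mu v < +oo)%E ->
  (nl2 mu (fun x => (S u x - S v x)%R) <= (A ^+ 2)%:E * nl2 mu (fun x => (u x - v x)%R))%E.
Proof.
move=> hS m_u u2 mv v2.
have mS := ro_meas hS m_u u2; have mS' := ro_meas hS mv v2.
have md : measurable_fun setT (fun x => u x - v x) by meas.
have d2 : (nl2 mu (fun x => (u x - v x)%R) < +oo)%E.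
  rewrite (_ : (fun x => _) = fun x => u x + -1 * v x); last by apply/funext => x; rewrite mulN1r.
  have m1 : measurable_fun setT (fun x => -1 * v x) by meas.
  apply: le_lt_trans (nl2D _ m_u m1) _.
  rewrite nl2Z// sqrrN expr1n mul1e lte_mul_pinfty// ?lee_fin//.
  by rewrite lte_add_pinfty.
have lin := ro_lin hS (-1) mv v2 m_u u2.
rewrite (@nl2_ae _ (S (fun x => u x - v x))); first exact: (ro_bound hS md d2).
- by meas.
- exact: (ro_meas hS md d2).
apply: filterS lin => x.
by rewrite (_ : (fun y => -1 * v y + u y) = fun y => u y - v y);
  [move=> ->; ring|apply/funext => y; ring].
Qed.

Variables (phi : rV -> R) (Lam : R).
Hypothesis bphi : bump phi Lam.

(** At a fixed scale, convergence in L^2 becomes uniform convergence after convolution with a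
    bump. *)
Lemma conv_dil_sup (s : R) u x : 0 < s -> measurable_fun setT u ->
  (((conv (dil phi s) u x) ^+ 2)%:E <= (Lam * s ^- n)%:E * nl2 mu u)%E.
Proof.
move=> s0 m_u; have md := meas_dil bphi s; have mr := meas_refl x md.
have Lam0 := bump_Lam bphi; have sn0 : 0 <= s ^- n by rewrite invr_ge0 exprn_ge0// ltW.
have e1 : (nl1 mu (fun y => dil phi s (x - y)) <= 1%:E)%E.
  rewrite -(nl1_dil bphi s0) /nl1 (nl_refl x (f := fun y => `|dil phi s y|))//.
  by meas.
apply: le_trans (weighted_CS ltr01 mr m_u e1) _; rewrite mul1e.
have c0 : 0 <= Lam * s ^- n by exact: mulr_ge0.
have m2 : measurable_fun setT (fun y => u y ^+ 2) by meas.
rewrite -(ge0_nlZ mu m2 c0 (fun y => sqr_ge0 (u y))).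
apply: le_nl; [by meas|by meas|move=> y].
rewrite mulr_ge0 ?sqr_ge0//= ler_wpM2r ?sqr_ge0//.
by rewrite ger0_norm; [exact: (dil_le bphi s0)|exact: (dil_ge0 bphi s0)].
Qed.

Variable q : R.
Hypothesis q2 : 2 < q.
Hypothesis n0 : (0 < n)%N.
Hypothesis Lam_gt0 : 0 < Lam.

(** The variation of [M + 1] small terms is at most four times their sum, by [pvar_l1]. *)
Lemma Vset_small M (F : nat -> rV -> R) (al : R) x : 0 < al ->
  (forall i, (i <= M)%N -> 4 * (M.+1)%:R * `|F i x| <= al) -> ~ Vset q (upto M F) al x.
Proof.
move=> al0 hF [t [L [tm]]]; apply/negP; rewrite -leNgt.
have q1 : 1 <= q by rewrite (le_trans _ (ltW q2))// ler1n.
apply: le_trans (@pvar_l1 _ q _ t L M q1 tm _) _.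
  by move=> p pM; rewrite /upto leqNgt pM.
apply: ge0_ler_powR; rewrite ?nnegrE ?(ltW al0)//.
- by rewrite (le_trans _ q1).
- by rewrite mulr_ge0// sumr_ge0.
have M0 : (0 : R) < M.+1%:R by rewrite ltr0n.
apply: (@le_trans _ _ (4 * \sum_(i < M.+1) (al / (4 * M.+1%:R)))).
  rewrite ler_wpM2l//; apply: ler_sum => i _; rewrite /upto -ltnS ltn_ord.
  rewrite ler_pdivlMr ?mulr_gt0// mulrC; apply: hF.
  by rewrite -ltnS.
rewrite sumr_const card_ord -mulr_natr le_eqVlt; apply/orP; left; apply/eqP.
by field; rewrite gt_eqF//.
Qed.

(** [u] is replaced by a step function close in L^2 and no larger in L^1. For finitely many scales
    the change in the convolutions is uniformly negligible; the precision depends on [M] and [N],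
    the constant does not. *)
Lemma real_weak11 : exists2 C : R, 0 <= C & forall S k w CK A M yy W Y (N : nat) u al,
    real_op S k A -> real_kernel k w CK -> 0 < A -> (forall i, 0 <= yy i) ->
    (forall i b, \sum_(l < M.+1) (if (l < b)%N then w (2^-1 ^+ (b + i - l)) `^ q else 0) <= yy i `^ q) ->
    (forall N, \sum_(i < N) w (2^-1 ^+ i.+1) <= W) -> (forall N, \sum_(i < N) yy i <= Y) ->
    measurable_fun setT u -> (nl1 mu u < +oo)%E -> (nl2 mu u < +oo)%E -> 0 < al ->
    omeas mu (Vset q (upto M (fun i => conv (dil phi (2^-1 ^+ N * 2 ^+ i)) (S u))) al)
      ((C * (A + W + Y + CK) / al)%:E * nl1 mu u).
Proof.
have [C C0 hC] := real_step_weak11 bphi q2 n0 Lam_gt0; exists (4 * C); first exact: mulr_ge0.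
move=> S k w CK A M yy W Y N u al hS hk A0 yy0 hyy hW hY m_u u1 u2 al0.
have CK0 := rk_CK0 hk.
have W0 : 0 <= W by have := hW 0%N; rewrite big_ord0.
have Y0 : 0 <= Y by have := hY 0%N; rewrite big_ord0.
pose s i : R := 2^-1 ^+ N * 2 ^+ i.
have s0 i : 0 < s i by rewrite mulr_gt0// exprn_gt0// invr_gt0.
pose D := 1 + \sum_(i < M.+1) Lam * s i ^- n.
have Dt0 i : 0 <= Lam * s i ^- n.
  by rewrite mulr_ge0 ?(ltW Lam_gt0)// invr_ge0 exprn_ge0// ltW.
have D0 : 0 < D by rewrite ltr_wpDr// sumr_ge0.
have M0 : (0 : R) < M.+1%:R by rewrite ltr0n.
(* Chosen so that every convolution with the error is at most [al / (16 (M + 1))], the threshold of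
   [Vset_small] at level [al / 4]. *)
pose e := (al / (16 * M.+1%:R)) ^+ 2 / (D * A ^+ 2).
have e0 : 0 < e by rewrite divr_gt0 ?mulr_gt0 ?exprn_gt0// divr_gt0// mulr_gt0.
have [m0 hm0] := step_approx m_u u2 e0.
(* The cells may be much smaller than the first bump; the offset [m - N] makes up for the
   difference. *)
pose m := maxn m0 N; have [K hK] := hm0 m (leq_maxl _ _).
have rm := @pow_half_gt0 R m.
pose g := E (2^-1 ^+ m) u; have gc : cellconst (2^-1 ^+ m) g := E_cellconst u.
pose v := itrunc (2^-1 ^+ m) K g.
have vc : cellconst (2^-1 ^+ m) v := itrunc_cell K gc.
have mv : measurable_fun setT v := meas_cellconst rm vc.
have mg : measurable_fun setT g := meas_E rm u.
have v1 : (nl1 mu v <= nl1 mu u)%E.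
  apply: le_trans (nl1_E rm m_u); apply: le_nl; [by meas|by meas|move=> x].
  by rewrite normr_ge0/=; exact: itrunc_le.
have v2 : (nl2 mu v < +oo)%E := cellconst_nl2 rm vc (le_lt_trans v1 u1).
have mS := ro_meas hS m_u u2; have mSv := ro_meas hS mv v2.
pose d x := S u x - S v x.
have md : measurable_fun setT d by rewrite /d; meas.
have d2 : (nl2 mu d <= (A ^+ 2 * e)%:E)%E.
  apply: le_trans (real_op_diff hS m_u u2 mv v2) _; rewrite [leRHS]EFinM.
  by apply: lee_wpmul2l => //; rewrite lee_fin sqr_ge0.
have dfin : L12 d by right; apply: le_lt_trans d2 _; rewrite ltry.
have Su2 : L12 (S u).
  by right; apply: le_lt_trans (ro_bound hS m_u u2) _; rewrite lte_mul_pinfty// lee_fin sqr_ge0.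
have Sv2 : L12 (S v).
  by right; apply: le_lt_trans (ro_bound hS mv v2) _; rewrite lte_mul_pinfty// lee_fin sqr_ge0.
have al4 : 0 < al / 4 by rewrite divr_gt0.
have dsmall i x : (i <= M)%N -> 4 * M.+1%:R * `|conv (dil phi (s i)) d x| <= al / 4.
  move=> iM; have h := conv_dil_sup x (s0 i) md.
  have {h} : (conv (dil phi (s i)) d x) ^+ 2 <= Lam * s i ^- n * (A ^+ 2 * e).
    rewrite -lee_fin; apply: le_trans h _; rewrite [leRHS]EFinM.
    by apply: lee_wpmul2l => //; rewrite lee_fin.
  have hD : Lam * s i ^- n <= D.
    rewrite /D (bigD1 (Ordinal (iM : (i < M.+1)%N)))//= addrCA lerDl addr_ge0//.
    exact: sumr_ge0.
  move=> h; have {h} : `|conv (dil phi (s i)) d x| ^+ 2 <= (al / (16 * M.+1%:R)) ^+ 2.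
    rewrite real_normK ?num_real//; apply: le_trans h _.
    apply: (@le_trans _ _ (D * (A ^+ 2 * e))).
      by apply: ler_wpM2r => //; rewrite mulr_ge0 ?sqr_ge0// ltW.
    by rewrite mulrA /e mulrC divfK// gt_eqF// mulr_gt0// exprn_gt0.
  rewrite ler_pXn2r ?nnegrE ?divr_ge0 ?mulr_ge0 ?(ltW al0) ?(ltW M0)//.
  rewrite ler_pdivlMr ?mulr_gt0// => h.
  rewrite ler_pdivlMr//; apply: le_trans h; rewrite le_eqVlt; apply/orP; left; apply/eqP.
  by ring.
have vstep : v = fun x => \sum_f g (\row_i (2^-1 ^+ m * (ivec f ord0 i)%:~R)) * cbox (2^-1 ^+ m) (@ivec n K f) x.
  by apply/funext => x; exact: itrunc_step.
have := hC S k w CK A (2^-1 ^+ m) M (m - N)%N yy W Y _ (@ivec n K)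
  (fun f => g (\row_i (2^-1 ^+ m * (ivec f ord0 i)%:~R))) (al / 4)
  hS hk rm A0 yy0 hyy hW hY (@ivec_inj n K) al4.
rewrite -vstep => hv.
have sE i : 2^-1 ^+ m * 2 ^+ (m - N + i) = s i.
  have mN : (N <= m)%N by exact: leq_maxr.
  by rewrite /s -{1}(subnKC mN) !exprD mulrA -[_ * 2 ^+ (m - N)]mulrA -exprMn mulVf// expr1n mulr1.
have FE : (fun i => conv (dil phi (2^-1 ^+ m * 2 ^+ (m - N + i))) (S v)) =
    (fun i => conv (dil phi (s i)) (S v)) by apply/funext => i; rewrite sE.
rewrite FE in hv.
apply: omeas_sub (omeas_le _ hv); last first.
  apply: (@le_trans _ _ ((C * (A + W + Y + CK) / (al / 4))%:E * nl1 mu u)%E).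
    apply: lee_wpmul2l => //; rewrite lee_fin.
    by apply: divr_ge0 (ltW al4); apply: mulr_ge0 => //; rewrite !addr_ge0// ltW.
  rewrite le_eqVlt; apply/orP; left; apply/eqP; congr (_%:E * _)%E.
  by field; rewrite gt_eqF.
have -> : upto M (fun i => conv (dil phi (2^-1 ^+ N * 2 ^+ i)) (S u)) =
    (fun i x => upto M (fun i => conv (dil phi (s i)) (S v)) i x +
      upto M (fun i => conv (dil phi (s i)) d) i x).
  apply/funext => i; apply/funext => x; rewrite /upto; case: ifP => _; last by rewrite addr0.
  by rewrite (conv_dilB bphi x (s0 i) mS mSv Su2 Sv2) addrC subrK.
have q1 : 1 <= q by rewrite (le_trans _ (ltW q2))// ler1n.
move=> x /(VsetD q1 al0)[//|].
by move=> hx; case: (Vset_small al4 (fun i => @dsmall i x) hx).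
Qed.

End real_weak11.

(** * Dini sums *)

Section dini_sums.
Context {R : realType}.
Local Open Scope ring_scope.

(** By monotonicity, the integral of [g t / t] over [(a, 2a]] is at least [g a / 2]. *)
Lemma dini_sum (g : R -> R) N : (forall t, 0 <= t -> 0 <= g t) ->
  (forall s t, 0 <= s -> s <= t -> g s <= g t) ->
  ((\sum_(i < N) g (2^-1 ^+ i.+1))%:E <= 2%:E * dini g)%E.
Proof.
(* Extended by [g 0] to the negative numbers, [g] is monotone on the whole line and hence
   measurable. *)
move=> g0 gm; pose G t : R := g (Num.max t 0).
have mG : measurable_fun setT G.
  apply: nondecreasing_measurable => // s t st.
  apply: gm; first by rewrite le_max lexx orbT.
  by rewrite ge_max !le_max st lexx !orbT.
have mI (D : set R) : measurable D -> D `<=` [set t | 0 < t] ->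
    measurable_fun D (fun t => (g t / t)%:E).
  move=> mD D0; apply/measurable_EFinP.
  apply: (eq_measurable_fun (fun t => G t * (t `^ (-1)))).
    move=> t /set_mem/D0 /= t0; rewrite /G max_l ?(ltW t0)//.
    by rewrite powR_inv1// ltW.
  apply: measurable_funM; first exact: measurable_funTS.
  by apply: measurable_funTS; exact: measurable_powR.
have key : ((\sum_(i < N) g (2^-1 ^+ i.+1))%:E <=
    2%:E * \int[lebesgue_measure]_(t in `](2^-1 ^+ N)%R, 1%R]) (g t / t)%:E)%E.
  elim: N => [|N IH].
    by rewrite big_ord0 expr0 set_itvoc0 integral_set0 mule0.
  set a := 2^-1 ^+ N.+1; have a0 : 0 < a by rewrite exprn_gt0// invr_gt0.
  have aE : 2^-1 ^+ N = 2 * a by rewrite /a exprS mulrA divff// mul1r.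
  have a1 : 2 * a <= 1 by rewrite -aE exprn_ile1// ?invr_ge0// invf_le1// ler1n.
  have U : `]a, 1%R]%classic = `]a, 2 * a]%classic `|` `]2 * a, 1%R]%classic.
    apply/seteqP; split=> t /=; rewrite !in_itv/=.
      by move=> /andP[at_ t1]; rewrite at_ t1 andbT; case: (leP t (2 * a)); [left|right].
    by move=> [|] /andP[h1 h2]; apply/andP; split => //; move: a1 h1 h2 a0; clear; lra.
  have p1 : `]a, (2 * a)]%classic `<=` [set t : R | 0 < t].
    by move=> t /=; rewrite in_itv/= => /andP[+ _]; exact: lt_trans.
  have p2 : `]2 * a, 1%R]%classic `<=` [set t : R | 0 < t].
    by move=> t /=; rewrite in_itv/= => /andP[+ _]; apply: lt_trans; rewrite mulr_gt0.
  have g0' t : 0 < t -> (0 <= (g t / t)%:E)%E.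
    by move=> t0; rewrite lee_fin divr_ge0 ?g0// ltW.
  rewrite U ge0_integral_setU//; last 3 first.
  - apply: mI; [exact: measurableU|by rewrite subUset].
  - by move=> t [/p1|/p2]; exact: g0'.
  - by apply/disj_setPS => t [/=]; rewrite !in_itv/= => /andP[_ h] /andP[h' _];
    have := lt_le_trans h' h; rewrite ltxx.
  rewrite ge0_muleDr; last 2 first.
  - by apply: integral_ge0 => t /p1; exact: g0'.
  - by apply: integral_ge0 => t /p2; exact: g0'.
  rewrite big_ord_recr/= EFinD addeC; apply: leeD; last by rewrite -aE.
  have h : (\int[lebesgue_measure]_(t in `]a, (2 * a)%R]) (g a / (2 * a))%:E <=
      \int[lebesgue_measure]_(t in `]a, (2 * a)%R]) (g t / t)%:E)%E.
    apply: ge0_le_integral => //.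
    - by move=> t _; rewrite lee_fin divr_ge0 ?g0 ?mulr_ge0// ltW.
    - exact: mI.
    move=> t /=; rewrite in_itv/= => /andP[t1 t2]; have t0 := lt_trans a0 t1.
    rewrite lee_fin; apply: ler_pM; rewrite ?g0 ?invr_ge0 ?mulr_ge0 ?(ltW a0)//.
      by apply: gm; rewrite ltW.
    by rewrite lef_pV2// posrE mulr_gt0.
  have -> : ((g a)%:E = 2%:E * \int[lebesgue_measure]_(t in `]a, (2 * a)%R]) (g a / (2 * a))%:E)%E.
    rewrite integral_cst//= lebesgue_measure_itv/= lte_fin.
    rewrite ltr_pMl// ltr1n/= -EFinD -!EFinM; congr EFin.
    by field; rewrite gt_eqF.
  by rewrite lee_wpmul2l// lee_fin.
apply: le_trans key _; rewrite lee_wpmul2l ?lee_fin//.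
apply: ge0_subset_integral => //.
- by apply: mI => // t /=; rewrite in_itv/= => /andP[].
- move=> t /=; rewrite in_itv/= => /andP[t0 _].
  by rewrite lee_fin divr_ge0 ?g0// ltW.
move=> t /=; rewrite !in_itv/= => /andP[h ->]; rewrite andbT.
by apply: lt_trans h; rewrite exprn_gt0// invr_gt0.
Qed.

Lemma window_sum (f : nat -> R) (W : R) : (forall i, 0 <= f i) ->
  (forall N, \sum_(i < N) f i.+1 <= W) ->
  forall i b M, \sum_(l < M) (if (l < b)%N then f (b + i - l)%N else 0) <= W.
Proof.
move=> f0 fW i b M; apply: le_trans (fW (b + i)%N).
elim: b M => [|b IH] [|M]; rewrite ?big_ord0; try by apply: sumr_ge0.
  by rewrite big1 ?sumr_ge0// => l _; rewrite ltn0.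
rewrite big_ord_recl/= subn0 addSn big_ord_recr/= addrC; apply: lerD => //.
apply: le_trans (IH M); apply: ler_sum => l _.
by rewrite (_ : fintype.bump 0 l = l.+1)// ltnS subSS.
Qed.

(** In a window [l < b] all indices [b + i - l] exceed [i], so [q - 1] of the [q] factors are at
    most [f (i + 1)] and the remaining ones sum to at most [W]. The exponent [(q - 1) / q] is
    [1 / q']. *)
Lemma window_powR (q : R) (f : nat -> R) (W : R) : 1 < q -> (forall i, 0 <= f i) ->
  (forall i j, (i <= j)%N -> f j <= f i) -> (forall N, \sum_(i < N) f i.+1 <= W) ->
  forall i b M, \sum_(l < M) (if (l < b)%N then f (b + i - l)%N `^ q else 0) <=
    (W `^ q^-1 * f i.+1 `^ ((q - 1) / q)) `^ q.
Proof.
move=> q1 f0 fm fW i b M; have q0 : 0 < q by rewrite (lt_trans _ q1).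
have W0 : 0 <= W by have := fW 0%N; rewrite big_ord0.
rewrite powRM ?powR_ge0// -!powRrM mulVf ?gt_eqF// divfK ?gt_eqF// powRr1// mulrC.
apply: (@le_trans _ _ (f i.+1 `^ (q - 1) *
    \sum_(l < M) (if (l < b)%N then f (b + i - l)%N else 0))); last first.
  by rewrite ler_wpM2l ?powR_ge0//; exact: window_sum.
rewrite mulr_sumr; apply: ler_sum => l _; case: ifP => [lb|]; last by rewrite mulr0.
rewrite (_ : f (b + i - l)%N `^ q = f (b + i - l)%N `^ (q - 1) * f (b + i - l)%N); last first.
  rewrite -[X in _ * X]powRr1// -powRD ?subrK//.
  by rewrite (gt_eqF q0).
rewrite ler_wpM2r// ge0_ler_powR ?nnegrE ?subr_ge0 ?(ltW q1)//.
by apply: fm; move: lb; clear; lia.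
Qed.

(* Depends on the number of scales, but is finite even when [w^(1/q')] has an
   infinite Dini norm. *)
Lemma window_crude (q : R) (f : nat -> R) : 1 < q -> (forall i, 0 <= f i) ->
  (forall i j, (i <= j)%N -> f j <= f i) ->
  forall i b M, \sum_(l < M) (if (l < b)%N then f (b + i - l)%N `^ q else 0) <=
    (M%:R * f i.+1) `^ q.
Proof.
move=> q1 f0 fm i b M; have q0 : 0 < q by rewrite (lt_trans _ q1).
rewrite powRM ?ler0n//; apply: (@le_trans _ _ (M%:R * f i.+1 `^ q)); last first.
  rewrite ler_wpM2r ?powR_ge0//; case: M => [|M]; first by rewrite powR_ge0.
  by rewrite -{1}[M.+1%:R]powRr1// ler_powR ?ler1n// ltW.
rewrite -[X in X%:R](card_ord M) mulr_natl -sumr_const; apply: ler_sum => l _.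
case: ifP => [lb|_]; last exact: powR_ge0.
rewrite ge0_ler_powR ?nnegrE ?(ltW q0)//.
by apply: fm; move: lb; clear; lia.
Qed.

Lemma sum_bounded_cvg0 (f : nat -> R) (W : R) : (forall N, \sum_(i < N) f i.+1 <= W) ->
  forall e : R, 0 < e -> exists i, f i < e.
Proof.
move=> fW e e0; apply: contrapT => h.
have fe i : e <= f i by rewrite leNgt; apply/negP => fi; apply: h; exists i.
pose N := (Num.truncn (`|W| / e)).+1.
have NW : `|W| / e < N%:R by have /andP[] := truncn_itv (divr_ge0 (normr_ge0 W) (ltW e0)).
have : N%:R * e <= W.
  apply: le_trans (fW N); rewrite -[X in X%:R](card_ord N) mulr_natl -sumr_const.
  by apply: ler_sum => i _; exact: fe.
apply/negP; rewrite -ltNge (le_lt_trans (ler_norm _))//.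
by rewrite -ltr_pdivrMr.
Qed.

Lemma modulus_mono (w : R -> R) s t : modulus_of_continuity w -> 0 <= s -> s <= t -> w s <= w t.
Proof.
move=> [_ w0 wa] s0 st; have t0 := le_trans s0 st.
by have := wa t 0 s t0 (lexx 0) s0; rewrite addr0 w0 addr0; apply.
Qed.

End dini_sums.

(** * Complex-valued functions and the operator *)

Section complex_functions.
Context {R : realType} {n : nat}.
Local Notation mu := (@lebesgue_rV R n).
Local Notation rV := 'rV[R]_n.
Implicit Types (x y z : rV) (f g : rV -> R[i]) (u v : rV -> R).

(** The boolean lets one statement serve for real and imaginary parts. *)
Definition part (b : bool) (z : R[i]) : R := if b then complex.Re z else complex.Im z.

Lemma partD b (z z' : R[i]) : part b (z + z') = part b z + part b z'.
Proof. by case: b z z' => -[a c] [a' c']. Qed.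

Lemma partN b (z : R[i]) : part b (- z) = - part b z.
Proof. by case: b z => -[a c]. Qed.

Lemma partB b (z z' : R[i]) : part b (z - z') = part b z - part b z'.
Proof. by rewrite partD partN. Qed.

Lemma partZ b (a : R) (z : R[i]) : part b (Complex a 0 * z) = a * part b z.
Proof. by case: b z => -[c d] /=; rewrite mul0r ?subr0 ?addr0. Qed.

Lemma partMr b (a : R) (z : R[i]) : part b (z * Complex a 0) = part b z * a.
Proof. by rewrite mulrC partZ mulrC. Qed.

Lemma part_cintegral b (D : set rV) f : part b (cintegral D f) = \int[mu]_(x in D) part b (f x).
Proof. by case: b. Qed.

Lemma cabsE (z : R[i]) : cabs z = Num.sqrt (part true z ^+ 2 + part false z ^+ 2).
Proof. by case: z. Qed.

Lemma cabs_ge0 (z : R[i]) : 0 <= cabs z.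
Proof. by rewrite cabsE sqrtr_ge0. Qed.

Lemma cabs_sqr (z : R[i]) : cabs z ^+ 2 = part true z ^+ 2 + part false z ^+ 2.
Proof. by rewrite cabsE sqr_sqrtr// addr_ge0 ?sqr_ge0. Qed.

Lemma part_le b (z : R[i]) : `|part b z| <= cabs z.
Proof.
by rewrite cabsE -sqrtr_sqr ler_wsqrtr//; case: b; rewrite ?lerDl ?lerDr sqr_ge0.
Qed.

Lemma cabs_le (z : R[i]) : cabs z <= `|part true z| + `|part false z|.
Proof.
rewrite -(@ler_pXn2r _ 2)// ?nnegrE ?cabs_ge0 ?addr_ge0// cabs_sqr.
rewrite -(real_normK (num_real (part true z))) -(real_normK (num_real (part false z))).
have := normr_ge0 (part true z); have := normr_ge0 (part false z).
move: (`|part true z|) (`|part false z|) => a c; clear; nra.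
Qed.

Lemma cmeasP f : cmeasurable f <-> forall b, measurable_fun setT (fun x => part b (f x)).
Proof. by split=> [[h1 h2] []//|h]; split; [exact: (h true)|exact: (h false)]. Qed.

Lemma meas_cabs f : cmeasurable f -> measurable_fun setT (fun x => cabs (f x)).
Proof.
move=> /cmeasP mf; rewrite (_ : (fun x => _) = @Num.sqrt R \o
    (fun x => part true (f x) ^+ 2 + part false (f x) ^+ 2)); last first.
  by apply/funext => x; rewrite cabsE.
apply: measurableT_comp; first by apply: continuous_measurable_fun; exact: sqrt_continuous.
by have h1 := mf true; have h2 := mf false; meas.
Qed.

Lemma cmeasB f g : cmeasurable f -> cmeasurable g -> cmeasurable (fun x => f x - g x).
Proof.
move=> /cmeasP mf /cmeasP mg; apply/cmeasP => b; have h1 := mf b; have h2 := mg b.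
under eq_fun do rewrite partB.
exact: measurable_funB.
Qed.

Lemma Lpnorm1E f : Lpnorm 1 f = (\int[mu]_x (cabs (f x))%:E)%E.
Proof.
rewrite /Lpnorm Lnorm1; apply: eq_integral => x _.
by rewrite /= ger0_norm// cabs_ge0.
Qed.

Lemma nl1_part b f : cmeasurable f -> (nl1 mu (fun x => part b (f x)) <= Lpnorm 1 f)%E.
Proof.
move=> mf; have /cmeasP h1 := mf; have h2 := h1 b; rewrite Lpnorm1E.
by apply: le_nl1; [exact: h2|exact: meas_cabs|move=> x; exact: part_le].
Qed.

Lemma Lpnorm2E f : cmeasurable f ->
  (Lpnorm 2 f `^ 2 = nl2 mu (fun x => part true (f x)) + nl2 mu (fun x => part false (f x)))%E.
Proof.
move=> /cmeasP mf; have h1 := mf true; have h2 := mf false.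
rewrite /Lpnorm powR_Lnorm// -ge0_nlD; [|by meas|by meas|by move=> x; exact: sqr_ge0|by move=> x; exact: sqr_ge0].
apply: eq_integral => x _; rewrite /= ger0_norm ?cabs_ge0//.
by rewrite powR_mulrn ?cabs_ge0// cabs_sqr.
Qed.

Lemma nl2_part b f : cmeasurable f -> (nl2 mu (fun x => part b (f x)) <= Lpnorm 2 f `^ 2)%E.
Proof. by move=> mf; rewrite Lpnorm2E//; case: b; rewrite ?leeDl ?leeDr ?nl2_ge0. Qed.

Lemma Lpnorm_ge0 p f : (0 <= Lpnorm p f)%E.
Proof. exact: Lnorm_ge0. Qed.

Lemma Lp2_nl2 b f : Lp 2 f -> (nl2 mu (fun x => part b (f x)) < +oo)%E.
Proof.
move=> [mf foo]; apply: le_lt_trans (nl2_part b mf) _.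
by apply: poweR_lty.
Qed.

Lemma Lp2P f : (forall b, measurable_fun setT (fun x => part b (f x))) ->
  (forall b, nl2 mu (fun x => part b (f x)) < +oo)%E -> Lp 2 f.
Proof.
move=> mf f2; have cf : cmeasurable f by apply/cmeasP.
split=> //; apply: (@lty_poweRy _ _ 2) => //; rewrite Lpnorm2E//.
by rewrite lte_add_pinfty.
Qed.

Definition cre u : rV -> R[i] := fun x => Complex (u x) 0.

Lemma Lp2_cre u : measurable_fun setT u -> (nl2 mu u < +oo)%E -> Lp 2 (cre u).
Proof.
move=> m_u u2; apply: Lp2P => -[]//; rewrite /nl2 /=.
by rewrite (eq_integral (fun=> 0%E)) ?integral0// => x _; rewrite expr0n.
Qed.

Lemma Lpnorm2_cre u : measurable_fun setT u -> (Lpnorm 2 (cre u) `^ 2 = nl2 mu u)%E.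
Proof.
move=> m_u; rewrite Lpnorm2E; last by apply/cmeasP => -[].
rewrite /nl2 /= [X in (_ + X)%E](eq_integral (fun=> 0%E)) ?integral0 ?adde0//.
by move=> x _; rewrite expr0n.
Qed.

End complex_functions.

(** * Real and imaginary parts of a Calderon-Zygmund operator *)

Section CZ_parts.
Context {R : realType} {n : nat}.
Local Notation mu := (@lebesgue_rV R n).
Local Notation rV := 'rV[R]_n.
Implicit Types (x y z : rV) (f g : rV -> R[i]) (u v : rV -> R).
Variable T : (rV -> R[i]) -> rV -> R[i].
Hypothesis hT : L2_bounded_linear T.

Let T0 : {ae mu, forall x, T (fun=> 0) x = 0}.
Proof.
have z2 : Lp 2 (fun _ : rV => 0 : R[i]).
  apply: Lp2P => -[] //; rewrite /nl2 /=;
  by rewrite (eq_integral (fun=> 0%E)) ?integral0// => x _; rewrite expr0n.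
apply: filterS (L2_linear hT 1 z2 z2) => x.
rewrite (_ : (fun y : rV => 1 * 0 + 0) = fun=> 0 : R[i]); last first.
  by apply/funext => y; rewrite mulr0 addr0.
rewrite mul1r => /eqP; rewrite -{1}[T _ x]addr0 => /eqP/addrI.
by move=> <-.
Qed.

Lemma T_scale (c : R) u : measurable_fun setT u -> (nl2 mu u < +oo)%E ->
  {ae mu, forall x, T (cre (fun y => c * u y)) x = Complex c 0 * T (cre u) x}.
Proof.
move=> m_u u2; have z2 : Lp 2 (fun _ : rV => 0 : R[i]).
  apply: Lp2P => -[] //; rewrite /nl2 /=;
  by rewrite (eq_integral (fun=> 0%E)) ?integral0// => x _; rewrite expr0n.
apply: filterS2 (L2_linear hT (Complex c 0) (Lp2_cre m_u u2) z2) T0 => x.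
rewrite (_ : (fun y => _) = cre (fun y => c * u y)); last first.
  apply/funext => y; rewrite addr0 /cre; apply/eqP; rewrite eq_complex/=.
  by rewrite mul0r subr0 mulr0 mul0r addr0 !eqxx.
by move=> -> ->; rewrite addr0.
Qed.

Variable A : R.
Hypothesis A0 : 0 <= A.
Hypothesis hA : (L2_opnorm T <= A%:E)%E.

(** The operator norm is a supremum over the unit ball, so [u] is rescaled into it, using
    homogeneity almost everywhere. *)
Lemma T_part_nl2 b u : measurable_fun setT u -> (nl2 mu u < +oo)%E ->
  (nl2 mu (fun x => part b (T (cre u) x)) <= (A ^+ 2)%:E * nl2 mu u)%E.
Proof.
move=> m_u u2; have [mT Too] := L2_stable hT (Lp2_cre m_u u2).
have /cmeasP/(_ b) mTb := mT.
set s := fine (nl2 mu u); have s0 : 0 <= s by rewrite fine_ge0// nl2_ge0.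
have sE : nl2 mu u = s%:E by rewrite fineK// ge0_fin_numE ?nl2_ge0.
rewrite sE -EFinM; apply/lee_addgt0Pr => e e0.
(* Slightly more than the squared norm of [u], so that the rescaling also makes sense for a null
   function. *)
pose d := s + e / (A ^+ 2 + 1); have A20 : 0 < A ^+ 2 + 1 by rewrite ltr_wpDl// sqr_ge0.
have d0 : 0 < d by rewrite ltr_wpDl// divr_gt0.
pose c := (Num.sqrt d)^-1; have c2 : c ^+ 2 = d^-1 by rewrite exprVn sqr_sqrtr// ltW.
pose v y := c * u y; have mv : measurable_fun setT v by rewrite /v; meas.
have v2E : nl2 mu v = (d^-1 * s)%:E by rewrite nl2Z// sE c2 -EFinM.
have v2 : (nl2 mu v < +oo)%E by rewrite v2E ltry.
have Lv := Lp2_cre mv v2; have [mTv Tvoo] := L2_stable hT Lv.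
have nv : (Lpnorm 2 (cre v) <= 1)%E.
  have : (Lpnorm 2 (cre v) `^ 2 <= 1 `^ 2)%E.
    rewrite Lpnorm2_cre// v2E poweR_EFin powR1 lee_fin mulrC ler_pdivrMr// mul1r.
    by rewrite lerDl divr_ge0 ?(ltW e0)// ltW.
  set L := Lpnorm 2 (cre v); rewrite poweR1r => h.
  have -> : (L <= 1)%E = ((L `^ 2) `^ 2^-1 <= 1 `^ 2^-1)%E.
    by rewrite poweR1r -poweRrM mulfV// poweRe1// Lpnorm_ge0.
  apply: gt0_ler_poweR => //.
    by rewrite in_itv/= poweR_ge0 leey.
  by rewrite in_itv/= lee_fin ler01 leey.
have Tv : (Lpnorm 2 (T (cre v)) <= A%:E)%E.
  by apply: le_trans hA; apply: ereal_sup_ubound; exists (cre v).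
have : (nl2 mu (fun x => part b (T (cre v) x)) <= (A ^+ 2)%:E)%E.
  apply: le_trans (nl2_part b mTv) _.
  rewrite -(powR_mulrn 2 A0) -poweR_EFin.
  by apply: gt0_ler_poweR => //; rewrite in_itv/= ?leey ?Lpnorm_ge0// lee_fin A0.
have /cmeasP/(_ b) mTvb := mTv.
rewrite (@nl2_ae _ _ _ (fun x => c * part b (T (cre u) x)))//; last 2 first.
- by meas.
- by apply: filterS (T_scale c m_u u2) => x ->; rewrite partZ.
rewrite nl2Z// c2 => h.
have {}h : (nl2 mu (fun x => part b (T (cre u) x)) <= (d * A ^+ 2)%:E)%E.
  rewrite -(@lee_pmul2l _ (d^-1)%:E) ?fin_numE// ?lte_fin ?invr_gt0//.
  by rewrite -EFinM mulKf ?gt_eqF.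
apply: le_trans h _; rewrite -EFinD lee_fin /d mulrDl [s * _]mulrC lerD2l.
rewrite mulrAC ler_pdivrMr// ler_pM2l// lerDl; exact: ler01.
Qed.

Variables (w : R -> R) (K : rV -> R[i]) (CK : R).
Hypothesis hCZ : dini_CZ_operator w K CK T.

Lemma CZ_real_op b : real_op (fun u x => part b (T (cre u) x)) (fun x => part b (K x)) A.
Proof.
split.
- by move=> u m_u u2; have [/cmeasP + _] := L2_stable hT (Lp2_cre m_u u2); apply.
- by move=> u m_u u2; exact: T_part_nl2.
- move=> a u v m_u u2 mv v2.
  apply: filterS (L2_linear hT (Complex a 0) (Lp2_cre m_u u2) (Lp2_cre mv v2)) => x.
  rewrite (_ : (fun y => _) = cre (fun y => a * u y + v y)); last first.
    apply/funext => y; rewrite /cre; apply/eqP; rewrite eq_complex/=.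
    by rewrite mul0r subr0 mulr0 mul0r !addr0 !eqxx.
  by move=> ->; rewrite partD partZ.
move=> rho v rho0.
have m1 : measurable_fun setT (cbox rho v) := meas_cbox rho0 v.
have m2 : (nl2 mu (cbox rho v) < +oo)%E.
  apply: (@cellconst_nl2 _ _ rho _ rho0); first exact: cbox_cellconst.
  by rewrite (nl1_cbox rho0 v) ltry.
apply: filterS (CZ_repr hCZ (Lp2_cre m1 m2)) => x h nx.
rewrite h ?part_cintegral; first by apply: eq_Rintegral => y _; rewrite partMr.
(* A point that is not near the cell has a ball of radius [rho] disjoint from it, so it lies off the
   essential support of the indicator. *)
move=> /(_ rho rho0); apply; apply: aeW => y yx.
rewrite /cre /cbox; have [e|//] := eqVneq (cell rho y) v.
exfalso; move/negP: nx; apply; apply/forallP => i.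
rewrite leNgt; apply/negP => hi.
have : rho * 2%:R <= `|x ord0 i - y ord0 i|.
  by apply: cell_far => //; rewrite e.
have := coord_le_enorm (y - x) i; rewrite !mxE distrC => h1 h2.
by have := le_lt_trans (le_trans h2 h1) yx; lra.
Qed.

Lemma CZ_real_kernel b (W : R) : (0 < n)%N -> modulus_of_continuity w ->
  kernel_cancellation K -> (forall N, \sum_(i < N) w (2^-1 ^+ i.+1) <= W) ->
  real_kernel (fun x => part b (K x)) w CK.
Proof.
move=> n0 hw hK hW; split.
- by case: hw.
- by move=> s t; exact: modulus_mono.
- exact: (sum_bounded_cvg0 (f := fun i => w (2^-1 ^+ i)) hW).
(* The size bound at one nonzero point gives [CK >= 0]; such a point exists because [n > 0]. *)
- pose x : rV := const_mx 1; have x0 : x != 0.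
    apply/eqP => /rowP/(_ (Ordinal n0)); rewrite !mxE => /eqP.
    by rewrite oner_eq0.
  have := le_trans (cabs_ge0 _) (CZ_size hCZ x0).
  have e0 : 0 < enorm x.
    by rewrite lt_neqAle enorm_ge0 andbT eq_sym; apply: contra x0 => /eqP/enorm_eq0 ->.
  by rewrite pmulr_lge0// invr_gt0 exprn_gt0.
- by move=> x x0; apply: le_trans (part_le _ _) (CZ_size hCZ x0).
- move=> x y x0 yx; rewrite -partB.
  exact: le_trans (part_le _ _) (CZ_regular hCZ x0 yx).
- by move=> e r e0 er; have := hK e r e0 er; rewrite -part_cintegral => ->; case: b.
Qed.

End CZ_parts.

Section complex_weak11.
Context {R : realType} {n : nat}.
Local Notation mu := (@lebesgue_rV R n).
Local Notation rV := 'rV[R]_n.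
Implicit Types (x y z : rV) (f g v : rV -> R[i]).

Lemma VsetN (q : R) (F : nat -> rV -> R) al :
  Vset q (fun i x => - F i x) al = Vset q F al.
Proof.
have e x t L : pvar q (fun i => - F i x) t L = pvar q (F ^~ x) t L.
  by apply: eq_bigr => i _; rewrite -opprD normrN.
by apply/seteqP; split=> x [t [L [tm h]]]; exists t, L; split => //; move: h; rewrite -e.
Qed.

(** The artificial jump to 0 after the scale [M] turns a bound on the variation into one on each
    single term. *)
Lemma jump_Vset (q : R) M i (F : nat -> rV -> R) al x : 0 < q -> 0 <= al -> (i <= M)%N ->
  al < `|F i x| -> Vset q (upto M F) al x.
Proof.
move=> q0 al0 iM h; exists (fun k => if k == 0%N then i else M.+1), 2%N; split.
  by move=> [|j] [|k]//= _; rewrite leqW.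
rewrite /pvar big_nat1/= /upto iM ltnn sub0r normrN.
by apply: gt0_ltr_powR; rewrite ?nnegrE.
Qed.

Lemma cabsD (z z' : R[i]) : cabs (z + z') <= cabs z + cabs z'.
Proof.
have := ler_normD z z'; rewrite lecE => /andP[_].
by rewrite -[X in _ <= X -> _]/(part true (`|z| + `|z'|)) partD.
Qed.

Lemma cabsN (z : R[i]) : cabs (- z) = cabs z.
Proof. by rewrite /cabs normrN. Qed.

Lemma Lpnorm1D f g : cmeasurable f -> cmeasurable g ->
  (Lpnorm 1 (fun x => f x - g x)%R <= Lpnorm 1 f + Lpnorm 1 g)%E.
Proof.
move=> mf mg; rewrite !Lpnorm1E; have h1 := meas_cabs mf; have h2 := meas_cabs mg.
have h3 := meas_cabs (cmeasB mf mg).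
rewrite -ge0_nlD//; try by move=> x; exact: cabs_ge0.
apply: le_nl; [exact: h3|by meas|move=> x].
by rewrite cabs_ge0 -(cabsN (g x)) cabsD.
Qed.

Variables (phi : rV -> R) (Lam : R).
Hypothesis bphi : bump phi Lam.
Variable q : R.
Hypothesis q2 : 2 < q.
Hypothesis n0 : (0 < n)%N.

Let q0 : 0 < q. Proof. by rewrite (lt_trans _ q2). Qed.
Let q1 : 1 <= q. Proof. by rewrite (le_trans _ (ltW q2))// ler1n. Qed.

Lemma dilateE (N i : nat) : dilate phi (i%:Z - N%:Z) = dil phi (2^-1 ^+ N * 2 ^+ i).
Proof.
have e (k : int) x : dilate phi k x = dil phi (2 ^ k) x.
  by rewrite /dilate /dil exprnP exprz_exp !invr_expz.
apply/funext => x; rewrite e; congr dil.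
by rewrite expfzDr// -invr_expz -!exprnP mulrC exprVn.
Qed.

Lemma part_convol b h f x : part b (convol h f x) = conv h (fun y => part b (f y)) x.
Proof. by rewrite part_cintegral; apply: eq_Rintegral => y _; rewrite partZ. Qed.

Variable T : (rV -> R[i]) -> rV -> R[i].
Variables (w : R -> R) (K : rV -> R[i]) (CK A W : R).
Hypothesis hw : modulus_of_continuity w.
Hypothesis hCZ : dini_CZ_operator w K CK T.
Hypothesis hK : kernel_cancellation K.
Hypothesis A0 : 0 < A.
Hypothesis hA : (L2_opnorm T <= A%:E)%E.
Hypothesis hW : forall N, \sum_(i < N) w (2^-1 ^+ i.+1) <= W.

Let hT := CZ_L2 hCZ.

Let cT f : Lp 2 f -> forall b, measurable_fun setT (fun x => part b (T f x)).
Proof. by move=> h; have [/cmeasP] := L2_stable hT h. Qed.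

Let nT f : Lp 2 f -> forall b, L12 (fun x => part b (T f x)).
Proof. by move=> h b; right; apply: Lp2_nl2; exact: L2_stable. Qed.

Lemma part_lin (a : R[i]) f g b : Lp 2 f -> Lp 2 g ->
  {ae mu, forall x, part b (T (fun y => a * f y + g y) x) = part b (a * T f x + T g x)}.
Proof. by move=> hf hg; apply: filterS (L2_linear hT a hf hg) => x ->. Qed.

Lemma conv_ae (s : R) (u u' : rV -> R) x : 0 < s -> measurable_fun setT u ->
  measurable_fun setT u' -> {ae mu, forall x, u x = u' x} ->
  conv (dil phi s) u x = conv (dil phi s) u' x.
Proof.
move=> s0 m_u m_u' uu; have mr := meas_refl x (meas_dil bphi s).
by apply: ae_eq_Rintegral; [by meas|by meas|apply: filterS uu => y ->].
Qed.

Lemma convTB (s : R) f g b x : 0 < s -> Lp 2 f -> Lp 2 g ->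
  Lp 2 (fun y => f y - g y) ->
  conv (dil phi s) (fun y => part b (T (fun y => f y - g y) y)) x =
  conv (dil phi s) (fun y => part b (T f y)) x - conv (dil phi s) (fun y => part b (T g y)) x.
Proof.
move=> s0 hf hg hfg; have h1 := cT hf b; have h2 := cT hg b.
rewrite -(conv_dilB bphi x s0 h1 h2 (nT hf b) (nT hg b)); apply: conv_ae => //.
- exact: cT.
- by meas.
apply: filterS (part_lin (-1) b hg hf) => y.
rewrite (_ : (fun y => _) = fun y => f y - g y); last first.
  by apply/funext => z; rewrite mulN1r addrC.
by move=> ->; rewrite mulN1r addrC partB.
Qed.

Let Sp b (u : rV -> R) x := part b (T (cre u) x).

(** From [T v = T (Re v) + i T (Im v)]: multiplication by [i] exchanges the parts and accounts for
    the sign. *)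
Lemma convT_parts (s : R) v b x : 0 < s -> Lp 2 v ->
  conv (dil phi s) (fun y => part b (T v y)) x =
  conv (dil phi s) (Sp b (fun y => part true (v y))) x +
  (if b then -1 else 1) * conv (dil phi s) (Sp (~~ b) (fun y => part false (v y))) x.
Proof.
move=> s0 hv; have /cmeasP mv := hv.1.
have ha : Lp 2 (cre (fun y => part true (v y))) by apply: Lp2_cre => //; exact: Lp2_nl2.
have hb : Lp 2 (cre (fun y => part false (v y))) by apply: Lp2_cre => //; exact: Lp2_nl2.
have h1 := cT ha b; have h2 := cT hb (~~ b).
pose c : R := if b then -1 else 1.
rewrite -/c (conv_ae _ s0 (cT hv b) (u' := fun y => Sp b (fun y => part true (v y)) y -
  (- c) * Sp (~~ b) (fun y => part false (v y)) y)); last 2 first.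
- by rewrite /Sp; meas.
- apply: filterS (part_lin (Complex 0 1) b hb ha) => y.
  rewrite (_ : (fun y => _) = v); last first.
    apply/funext => z; rewrite /cre /part; case: (v z) => p r.
    apply/eqP; rewrite eq_complex/=.
    by rewrite !mul0r !mulr0 subr0 !add0r addr0 mul1r !eqxx.
  move=> ->; rewrite partD addrC mulNr opprK; congr (_ + _).
  rewrite /c /Sp; case: (b) => /=; case: (T _ y) => p r /=;
  by rewrite ?mul0r ?mul1r ?mulN1r ?add0r ?sub0r.
have mc : measurable_fun setT (fun y => - c * Sp (~~ b) (fun y => part false (v y)) y).
  by rewrite /Sp; meas.
have c2 : L12 (fun y => - c * Sp (~~ b) (fun y => part false (v y)) y).
  right; rewrite nl2Z//; apply: lte_mul_pinfty; rewrite ?lee_fin ?sqr_ge0//.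
  by have [] := L2_stable hT hb => m _; apply: Lp2_nl2; exact: L2_stable.
rewrite (conv_dilB bphi x s0 h1 mc (nT ha b) c2); congr (_ + _).
rewrite /conv; under eq_Rintegral do rewrite mulrCA.
rewrite RintegralZl ?mulNr ?opprK//.
exact: (intg_dil_mul bphi x s0 h2 (nT hb (~~ b))).
Qed.

Let Phi (N i : nat) v x := convol (dilate phi (i%:Z - N%:Z)) (T v) x.

Let s0 (N i : nat) : 0 < (2^-1 ^+ N * 2 ^+ i : R).
Proof. by rewrite mulr_gt0// exprn_gt0// invr_gt0. Qed.

Let PhiE N i v b x : part b (Phi N i v x) =
  conv (dil phi (2^-1 ^+ N * 2 ^+ i)) (fun y => part b (T v y)) x.
Proof. by rewrite part_convol dilateE. Qed.

Let meas_Phi N i v b : Lp 2 v -> measurable_fun setT (fun x => part b (Phi N i v x)).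
Proof.
move=> hv; under eq_fun do rewrite PhiE.
by apply: meas_conv; [exact: (meas_dil bphi)|exact: cT].
Qed.

Variable C : R.
Hypothesis C0 : 0 <= C.
Hypothesis hC : forall S k w CK A M yy W Y (N : nat) u al,
    real_op S k A -> real_kernel k w CK -> 0 < A -> (forall i, 0 <= yy i) ->
    (forall i b, \sum_(l < M.+1) (if (l < b)%N then w (2^-1 ^+ (b + i - l)) `^ q else 0) <= yy i `^ q) ->
    (forall N, \sum_(i < N) w (2^-1 ^+ i.+1) <= W) -> (forall N, \sum_(i < N) yy i <= Y) ->
    measurable_fun setT u -> (nl1 mu u < +oo)%E -> (nl2 mu u < +oo)%E -> 0 < al ->
    omeas mu (Vset q (upto M (fun i => conv (dil phi (2^-1 ^+ N * 2 ^+ i)) (S u))) al)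
      ((C * (A + W + Y + CK) / al)%:E * nl1 mu u).

Let CK0 : 0 <= CK := rk_CK0 (CZ_real_kernel hCZ true n0 hw hK hW).
Let W0 : 0 <= W. Proof. by have := hW 0%N; rewrite big_ord0. Qed.

Lemma weak11_L12 M N (yy : nat -> R) (Y al : R) v b : (forall i, 0 <= yy i) ->
    (forall i b, \sum_(l < M.+1) (if (l < b)%N then w (2^-1 ^+ (b + i - l)) `^ q else 0) <= yy i `^ q) ->
    (forall N, \sum_(i < N) yy i <= Y) -> Lp 1 v -> Lp 2 v -> 0 < al ->
    omeas mu (Vset q (upto M (fun i x => part b (Phi N i v x))) al)
      ((8 * C * (A + W + Y + CK) / al)%:E * Lpnorm 1 v).
Proof.
move=> yy0 hyy hY [mv v1] v2 al0; have /cmeasP mvb := mv.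
have Y0 : 0 <= Y by have := hY 0%N; rewrite big_ord0.
have al4 : 0 < al / 4 by rewrite divr_gt0.
have h b1 b2 : omeas mu (Vset q (upto M (fun i => conv (dil phi (2^-1 ^+ N * 2 ^+ i))
    (Sp b1 (fun y => part b2 (v y))))) (al / 4)) ((4 * C * (A + W + Y + CK) / al)%:E * Lpnorm 1 v).
  have u1 := nl1_part b2 mv.
  have := hC N (CZ_real_op hT (ltW A0) hA hCZ b1) (CZ_real_kernel hCZ b1 n0 hw hK hW) A0 yy0 hyy hW hY
    (mvb b2) (le_lt_trans u1 v1) (Lp2_nl2 b2 v2) al4.
  apply: omeas_le.
  rewrite (_ : C * (A + W + Y + CK) / (al / 4) = 4 * C * (A + W + Y + CK) / al); last first.
    by field; rewrite gt_eqF.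
  by apply: lee_wpmul2l => //; rewrite lee_fin divr_ge0 ?(ltW al0)// mulr_ge0 ?mulr_ge0// !addr_ge0// ltW.
have := omeasU (h b true) (h (~~ b) false); rewrite -ge0_muleDl; last 2 first.
- by rewrite lee_fin divr_ge0 ?(ltW al0)// mulr_ge0 ?mulr_ge0// !addr_ge0// ltW.
- by rewrite lee_fin divr_ge0 ?(ltW al0)// mulr_ge0 ?mulr_ge0// !addr_ge0// ltW.
rewrite -EFinD (_ : _ + _ = 8 * C * (A + W + Y + CK) / al); last by field; rewrite gt_eqF.
apply: omeas_sub; pose c : R := if b then -1 else 1.
pose G i := conv (dil phi (2^-1 ^+ N * 2 ^+ i)) (Sp (~~ b) (fun y => part false (v y))).
have -> : upto M (fun i x => part b (Phi N i v x)) = (fun i x =>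
    upto M (fun i => conv (dil phi (2^-1 ^+ N * 2 ^+ i)) (Sp b (fun y => part true (v y)))) i x +
    (fun i x => c * upto M G i x) i x).
  apply/funext => i; apply/funext => x; rewrite /upto; case: ifP => _; last by rewrite mulr0 addr0.
  by rewrite PhiE convT_parts.
have -> : Vset q (upto M G) (al / 4) = Vset q (fun i x => c * upto M G i x) (al / 4).
  rewrite /c; case: (b); last by congr Vset; apply/funext => i; apply/funext => x; rewrite mul1r.
  by rewrite -VsetN; congr Vset; apply/funext => i; apply/funext => x; rewrite mulN1r.
exact: VsetD.
Qed.

Let wf i : 0 <= w (2^-1 ^+ i).
Proof. by case: hw => h _ _; apply: h; rewrite exprn_ge0// invr_ge0. Qed.

Let wm i j : (i <= j)%N -> w (2^-1 ^+ j) <= w (2^-1 ^+ i).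
Proof.
move=> ij; apply: modulus_mono => //.
by rewrite ler_wiXn2l ?invr_ge0// invf_le1// ler1n.
Qed.

Let D M := 8 * C * (A + W + M.+1%:R * W + CK).

Let D0 M : 0 <= D M.
Proof. by rewrite mulr_ge0 ?mulr_ge0// !addr_ge0 ?mulr_ge0 ?ler0n// ltW. Qed.

(** A bound at one scale that uses only the Dini condition on [w]. Its constant grows with [M], but
    it serves solely to show that errors tend to zero. *)
Lemma weak11_single M N i (al : R) v b : (i <= M)%N -> Lp 1 v -> Lp 2 v -> 0 < al ->
    omeas mu [set x | al < `|part b (Phi N i v x)|] ((D M / al)%:E * Lpnorm 1 v).
Proof.
move=> iM v1 v2 al0.
have yy0 j : 0 <= M.+1%:R * w (2^-1 ^+ j.+1) by rewrite mulr_ge0 ?ler0n.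
have hyy j c : \sum_(l < M.+1) (if (l < c)%N then w (2^-1 ^+ (c + j - l)) `^ q else 0) <=
    (M.+1%:R * w (2^-1 ^+ j.+1)) `^ q.
  have q11 : 1 < q by rewrite (lt_trans _ q2)// ltr1n.
  exact: (window_crude q11 wf wm).
have hY k : \sum_(j < k) M.+1%:R * w (2^-1 ^+ j.+1) <= M.+1%:R * W.
  by rewrite -mulr_sumr ler_wpM2l ?ler0n.
apply: omeas_sub (weak11_L12 N b yy0 hyy hY v1 v2 al0) => x /=.
exact: jump_Vset q0 (ltW al0) iM.
Qed.

(** Each [F k] has its own approximants [u k]. They are all compared with the single [v = u 0]:
    [u k - v] is small in L^1, so [weak11_single] bounds the deviation at each scale of the window,
    and the uniform bound is applied to [v] alone. *)
Lemma weak11_extension M N (F : int -> rV -> R[i]) f (yy : nat -> R) (Y al eta : R) b :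
    (forall i, 0 <= yy i) ->
    (forall i b, \sum_(l < M.+1) (if (l < b)%N then w (2^-1 ^+ (b + i - l)) `^ q else 0) <= yy i `^ q) ->
    (forall N, \sum_(i < N) yy i <= Y) -> Lp 1 f -> 0 < al -> 0 < eta ->
    (forall k, density_extension (fun g => convol (dilate phi k) (T g)) f (F k)) ->
    omeas mu (Vset q (upto M (fun i x => part b (F (i%:Z - N%:Z) x))) al)
      ((32 * C * (A + W + Y + CK) / al)%:E * Lpnorm 1 f + eta%:E).
Proof.
move=> yy0 hyy hY [mf f1] al0 eta0 hF.
have Y0 : 0 <= Y by have := hY 0%N; rewrite big_ord0.
have al4 : 0 < al / 4 by rewrite divr_gt0.
have M0 : (0 : R) < M.+1%:R by rewrite ltr0n.
pose Gam := 8 * C * (A + W + Y + CK).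
have Gam0 : 0 <= Gam by rewrite mulr_ge0 ?mulr_ge0// !addr_ge0// ltW.
(* A deviation is split into two pieces compared with [lam] each; [2 * lam] is the threshold of
   [Vset_small] at level [al / 4]. *)
pose lam := al / (32 * M.+1%:R); have lam0 : 0 < lam by rewrite divr_gt0// mulr_gt0.
pose Z := Gam / (al / 4) + M.+1%:R * (lam^-1 + D M / lam * 2).
have Z0 : 0 <= Z.
  apply: addr_ge0; first by rewrite divr_ge0// ltW.
  apply: mulr_ge0; first exact: ltW.
  apply: addr_ge0; first by rewrite invr_ge0 ltW.
  by apply: mulr_ge0 => //; rewrite divr_ge0// ltW.
(* [Z] gathers all the factors that multiply the approximation error, which therefore costs at most
   [eta] in total. *)
pose del := eta / (Z + 1); have del0 : 0 < del by rewrite divr_gt0// ltr_wpDl.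
have approx k : exists u, [/\ Lp 1 u, Lp 2 u, (Lpnorm 1 (fun x => (u x - f x)%R) <= del%:E)%E &
    (weak_L1norm (fun x => (cabs (convol (dilate phi k) (T u) x - F k x))%:E) <= del%:E)%E].
  have [_ [u [hu c1 c2]]] := hF k; have d0 : (0 < del%:E)%E by rewrite lte_fin.
  have e1 : \forall j \near \oo, (Lpnorm 1 (fun x => (u j x - f x)%R) < del%:E)%E.
    exact: (c1 _ (open_ereal_lt' d0)).
  have e2 : \forall j \near \oo,
      (weak_L1norm (fun x => (cabs (convol (dilate phi k) (T (u j)) x - F k x))%:E) < del%:E)%E.
    exact: (c2 _ (open_ereal_lt' d0)).
  have [j /= [h1 h2]] := filter_ex (filterI e1 e2).
  by exists (u j); have [] := hu j; split => //; exact: ltW.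
have [u hu] := choice approx.
have [v1 v2 vf _] := hu 0; pose v := u 0.
have mu_ k : cmeasurable (u k) by have [[]] := hu k.
have vfin : (Lpnorm 1 v <= Lpnorm 1 f + del%:E)%E.
  rewrite (_ : v = fun x => (v x - f x) - (- f x)); last first.
    by apply/funext => x; rewrite opprK subrK.
  have mNf : cmeasurable (fun x => - f x).
    by apply/cmeasP => c; under eq_fun do rewrite partN; have /cmeasP/(_ c) := mf => h; apply: measurable_funN.
  apply: le_trans (Lpnorm1D (cmeasB (mu_ 0) mf) mNf) _; rewrite addeC; apply: leeD => //.
  rewrite !Lpnorm1E le_eqVlt; apply/orP; left; apply/eqP; apply: eq_integral => x _.
  by rewrite cabsN.
pose k i := (i%:Z - N%:Z)%R.
pose d i x := part b (F (k i) x - Phi N i v x).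
have L2d i : Lp 2 (fun y => u (k i) y - v y).
  have [_ w2 _ _] := hu (k i).
  apply: Lp2P => c; have /cmeasP/(_ c) m1 := mu_ (k i); have /cmeasP/(_ c) m2 := mu_ 0.
    by under eq_fun do rewrite partB; exact: measurable_funB.
  under eq_fun do rewrite partB -[X in _ + X]mulN1r.
  have m3 : measurable_fun setT (fun x => -1 * part c (u 0 x)) by meas.
  apply: le_lt_trans (nl2D _ m1 m3) _; rewrite nl2Z// sqrrN expr1n mul1e.
  by rewrite lte_mul_pinfty// ?lee_fin// lte_add_pinfty ?Lp2_nl2.
have dsub i x : lam *+ 2 < `|d i x| -> lam < cabs (Phi N i (u (k i)) x - F (k i) x) \/
    lam < `|part b (Phi N i (fun y => u (k i) y - v y) x)|.
  move=> h; have [h1|h1] := ltP lam (cabs (Phi N i (u (k i)) x - F (k i) x)); [by left|right].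
  have [[_ _] w2 _ _] := hu (k i).
  have := part_le b (Phi N i (u (k i)) x - F (k i) x) => h2.
  rewrite PhiE (convTB _ _ (s0 N i) w2 v2 (L2d i)) -!PhiE -partB.
  have := ler_normD (part b (Phi N i (u (k i)) x - Phi N i v x)) (- part b (Phi N i (u (k i)) x - F (k i) x)).
  rewrite normrN -partN -partD (_ : _ - _ + - _ = F (k i) x - Phi N i v x) -/(d i x); last by ring.
  move=> h3; rewrite -(ltrD2r lam) -mulr2n; apply: lt_le_trans h _; apply: le_trans h3 _.
  by rewrite lerD2l; exact: le_trans h2 h1.
have one i : (i <= M)%N -> omeas mu [set x | lam *+ 2 < `|d i x|] ((lam^-1 + D M / lam * 2)%:E * del%:E).
  move=> iM; have [[mw w1] w2 wf' ww] := hu (k i).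
  have w3 : Lp 1 (fun y => u (k i) y - v y).
    split; first exact: (cmeasB mw (mu_ 0)).
    apply: le_lt_trans (Lpnorm1D mw (mu_ 0)) _; rewrite lte_add_pinfty//.
    by have [[_ ?]] := hu 0.
  have o2 := weak11_single N b iM w3 (L2d i) lam0.
  have uv : (Lpnorm 1 (fun y => (u (k i) y - v y)%R) <= (2 * del)%:E)%E.
    rewrite (_ : (fun y => _) = fun y => (u (k i) y - f y) - (v y - f y)); last first.
      by apply/funext => y; ring.
    apply: le_trans (Lpnorm1D (cmeasB mw mf) (cmeasB (mu_ 0) mf)) _.
    by rewrite mulr_natl mulr2n EFinD; apply: leeD.
  have mPF : cmeasurable (fun x => Phi N i (u (k i)) x - F (k i) x).
    apply: cmeasB; last by have [] := hF (k i).
    by apply/cmeasP => c; apply: meas_Phi.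
  have mset : measurable [set x | lam < cabs (Phi N i (u (k i)) x - F (k i) x)].
    rewrite (_ : [set _ | _] = (fun x => cabs (Phi N i (u (k i)) x - F (k i) x)) @^-1` `]lam, +oo[%classic).
      rewrite -[X in measurable X]setTI; apply: (meas_cabs mPF) => //.
    by apply/seteqP; split=> x /=; rewrite in_itv/= andbT.
  have o1 : omeas mu [set x | lam < cabs (Phi N i (u (k i)) x - F (k i) x)] ((lam^-1)%:E * del%:E).
    exists [set x | lam < cabs (Phi N i (u (k i)) x - F (k i) x)]; split => //.
    rewrite -(@lee_pmul2l _ lam%:E)// [leRHS]muleA -(EFinM lam lam^-1) mulfV ?gt_eqF// mul1e.
    apply: le_trans ww; apply: ereal_sup_ubound; exists lam => //.
    congr (_ * mu _)%E; apply/seteqP; split=> x /=; by rewrite lte_fin ger0_norm ?cabs_ge0.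
  apply: omeas_sub (omeas_le _ (omeasU o1 o2)); first by move=> x /dsub[]; [left|right].
  apply: (@le_trans _ _ ((lam^-1)%:E * del%:E + (D M / lam)%:E * (2 * del)%:E)%E).
    by apply: leeD => //; apply: lee_wpmul2l => //; rewrite lee_fin divr_ge0// ltW.
  rewrite -(EFinM lam^-1 del) -(EFinM (D M / lam) (2 * del)) -EFinD.
  rewrite -(EFinM (lam^-1 + D M / lam * 2) del) lee_fin le_eqVlt; apply/orP; left; apply/eqP.
  by rewrite [RHS]mulrDl; congr (_ + _); rewrite -!mulrA.
have od : omeas mu (Vset q (upto M d) (al / 4)) ((M.+1%:R * (lam^-1 + D M / lam * 2))%:E * del%:E).
  have := omeas_big (index_enum _) (fun i : 'I_M.+1 => one i (ltn_ord i)).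
  rewrite sumEFin sumr_const card_ord => h.
  apply: omeas_sub (omeas_le _ h).
    move=> x; apply: contraPP => nx; apply: Vset_small => // i iM.
    have iM' : (i < M.+1)%N by [].
    rewrite leNgt; apply/negP => hx; apply: nx; rewrite -bigcup_mkord_ord.
    exists i => //=; rewrite inordK//=.
    move: hx; rewrite -ltr_pdivrMl ?mulr_gt0// => hx; apply: le_lt_trans hx.
    rewrite le_eqVlt; apply/orP; left; apply/eqP; rewrite /lam -mulr_natr.
    by field; rewrite gt_eqF.
  by rewrite -(EFinM (M.+1%:R * _) del) lee_fin -[leLHS]mulr_natl mulrA.
have ov := weak11_L12 N b yy0 hyy hY v1 v2 al4.
apply: omeas_sub (omeas_le _ (omeasU ov od)).
  have -> : upto M (fun i x => part b (F (k i) x)) =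
      fun i x => upto M (fun i x => part b (Phi N i v x)) i x + upto M d i x.
    apply/funext => i; apply/funext => x; rewrite /upto; case: ifP => _; last by rewrite addr0.
    by rewrite /d partB addrC subrK.
  exact: VsetD.
apply: (@le_trans _ _ ((Gam / (al / 4))%:E * (Lpnorm 1 f + del%:E) +
  (M.+1%:R * (lam^-1 + D M / lam * 2))%:E * del%:E)%E).
  apply: leeD => //; apply: lee_wpmul2l => //.
  by rewrite lee_fin divr_ge0// ltW.
rewrite ge0_muleDr ?lee_fin ?(ltW del0) ?Lpnorm_ge0// -addeA -EFinM -EFinM -EFinD -mulrDl -/Z.
apply: leeD; last by rewrite lee_fin /del mulrA ler_pdivrMr ?ltr_wpDl// mulrC ler_pM2l// lerDl.
rewrite le_eqVlt; apply/orP; left; apply/eqP; congr (_%:E * _)%E.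
by rewrite /Gam; field; rewrite gt_eqF.
Qed.

End complex_weak11.

(** * Level sets of the variation *)

Section q_variation_levels.
Context {R : realType} {n : nat}.
Local Notation mu := (@lebesgue_rV R n).
Local Notation rV := 'rV[R]_n.
Implicit Types (x y z : rV).
Variables (q : R) (F : int -> rV -> R[i]).
Hypothesis q0 : 0 < q.
Hypothesis mF : forall k, cmeasurable (F k).

Definition seq_var (s : seq int) x : R :=
  \sum_(1 <= k < size s) cabs (F (nth 0 s k) x - F (nth 0 s k.-1) x) `^ q.

(* Finitely many indices at a time, so that the level sets of the variation are
   countable unions of measurable sets. *)
Definition window N (s : seq int) : bool := sorted <=%R s && all (fun k => `|k| <= N%:Z) s.

(** A countable union over finite sorted lists of indices in [[-N, N]]; it increases with [N] and
    exhausts the level set of the variation. *)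
Definition var_level (al : R) N : set rV :=
  \bigcup_(s in [set s | window N s]) [set x | al `^ q < seq_var s x].

Lemma meas_seq_var s : measurable_fun setT (seq_var s).
Proof.
apply: measurable_sum => k; apply: (measurableT_comp (measurable_powR q)).
by apply: meas_cabs; exact: cmeasB.
Qed.

Lemma measurable_var_level al N : measurable (var_level al N).
Proof.
rewrite /var_level bigcup_mkcond; apply: countable_bigcupT_measurable => [|s].
  exact: countableP.
case: ifP => // _; rewrite (_ : [set _ | _] = seq_var s @^-1` `]al `^ q, +oo[%classic).
  by rewrite -[X in measurable X]setTI; apply: meas_seq_var.
by apply/seteqP; split=> x /=; rewrite in_itv/= andbT.
Qed.

Lemma var_level_nd al : {homo var_level al : N M / (N <= M)%N >-> (N <= M)%O}.
Proof.
move=> N M NM; rewrite subsetEset => x [s /= /andP[ss sa] h]; exists s => //=.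
rewrite /window ss/=; apply: sub_all sa => k /le_trans; apply.
by rewrite lez_nat.
Qed.

(** Continuing a finite list by its last element gives a nondecreasing sequence and adds only zero
    terms to the variation. *)
Lemma sorted_nth_homo (s : seq int) : sorted <=%R s ->
  {homo (fun k => nth (last 0 s) s k) : j k / (j <= k)%N >-> j <= k}.
Proof.
move=> ss j k jk; have [ks|ks] := ltnP k (size s).
  apply: (sorted_leq_nth le_trans le_refl _ ss) => //.
  by rewrite inE (leq_ltn_trans jk).
rewrite [leRHS]nth_default//; have [js|js] := ltnP j (size s); last by rewrite nth_default.
case: s ss js {ks} => // a s ss js; rewrite (_ : last 0 (a :: s) = nth a (a :: s) (size s)); last first.
  by rewrite nth_last.
rewrite (set_nth_default a)//.
by apply: (sorted_leq_nth le_trans le_refl _ ss) => //; rewrite inE.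
Qed.

Lemma q_variation_level al : 0 < al ->
  [set x | (al%:E < `|q_variation q F x|)%E] = \bigcup_N var_level al N.
Proof.
move=> al0; have qi0 : 0 < q^-1 by rewrite invr_gt0.
have alq : al = (al `^ q) `^ q^-1 by rewrite -powRrM mulfV ?gt_eqF// powRr1// ltW.
have t0 (t : nat -> int) x k : (0 <= (cabs (F (t k) x - F (t k.-1) x) `^ q)%:E)%E.
  by rewrite lee_fin powR_ge0.
apply/seteqP; split=> x /=.
  have v0 : (0 <= q_variation q F x)%E.
    apply: le_trans (ereal_sup_ubound _); last by exists (fun=> 0).
    exact: poweR_ge0.
  rewrite gee0_abs// => /ereal_sup_gt[_ [t tm <-]] h.
  have [N hN] : exists N, al `^ q < \sum_(1 <= k < N) cabs (F (t k) x - F (t k.-1) x) `^ q.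
    apply: contrapT => nN; move: h; apply/negP; rewrite -leNgt alq -poweR_EFin.
    apply: gt0_ler_poweR; rewrite ?(ltW qi0)//.
    - by rewrite in_itv/= leey andbT; apply: nneseries_ge0.
    - by rewrite in_itv/= leey lee_fin powR_ge0.
    apply: lime_le; first by apply: is_cvg_nneseries => k _ _.
    apply: nearW => N; rewrite sumEFin lee_fin leNgt; apply/negP => hN.
    by apply: nN; exists N.
  pose s := mkseq t N; pose M := \sum_(k < N) absz (t k).
  exists M => //; exists s.
    rewrite /= /window; apply/andP; split.
      rewrite /s /mkseq sorted_map; apply: (@sub_sorted _ leq); last exact: iota_sorted.
      by move=> j k; exact: tm.
    apply/allP => _ /mapP[k + ->]; rewrite mem_iota/= add0n => kN.
    have : (absz (t k) <= M)%N by rewrite /M (bigD1 (Ordinal kN))//= leq_addr.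
    by move: (t k) M => c M; clear; lia.
  rewrite /= /seq_var size_mkseq (_ : \sum_(1 <= k < N) _ =
    \sum_(1 <= k < N) cabs (F (t k) x - F (t k.-1) x) `^ q)//.
  apply: eq_big_nat => k /andP[k1 kN].
  by rewrite !nth_mkseq// (leq_ltn_trans (leq_pred k)).
move=> [N _ [s /= /andP[ss sa] h]].
pose t k := nth (last 0 s) s k.
have hs : \sum_(1 <= k < size s) cabs (F (t k) x - F (t k.-1) x) `^ q = seq_var s x.
  apply: eq_big_nat => k /andP[k1 ks]; have kp := leq_ltn_trans (leq_pred k) ks.
  by rewrite /t !(set_nth_default 0 (last 0 s)).
apply: lt_le_trans (lee_abs _).
apply: (@lt_le_trans _ _ ((\sum_(1 <= k <oo) (cabs (F (t k) x - F (t k.-1) x) `^ q)%:E) `^ q^-1)%E); last first.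
  by apply: ereal_sup_ubound; exists t => //=; exact: sorted_nth_homo.
apply: (@lt_le_trans _ _ ((seq_var s x)%:E `^ q^-1)%E).
  rewrite alq poweR_EFin lte_fin; apply: gt0_ltr_powR => //; rewrite nnegrE ?powR_ge0//.
  by rewrite ltW// (le_lt_trans _ h)// powR_ge0.
apply: gt0_ler_poweR; rewrite ?(ltW qi0)//.
- by rewrite in_itv/= leey lee_fin ltW// (le_lt_trans _ h)// powR_ge0.
- by rewrite in_itv/= leey andbT; apply: nneseries_ge0.
by rewrite -hs -sumEFin; apply: nneseries_lim_ge.
Qed.

(** Shifting by [N] brings the indices into [[0, 2N]]; the modulus is at most the sum of the moduli
    of the two parts, whence [al / 4] as in [VsetD]. *)
Lemma var_level_Vset al N : 1 <= q -> 0 < al -> var_level al N `<=`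
  Vset q (upto N.*2 (fun i x => part true (F (i%:Z - N%:Z) x))) (al / 4) `|`
  Vset q (upto N.*2 (fun i x => part false (F (i%:Z - N%:Z) x))) (al / 4).
Proof.
move=> q1 al0 x [s /= /andP[ss sa] h].
pose t k := absz (nth (last 0 s) s k + N%:Z).
case: (posnP (size s)) => s0.
  move: h; rewrite /seq_var s0 big_geq// => h.
  by have := lt_le_trans h (powR_ge0 al q); rewrite ltxx.
have tb k : `|nth (last 0 s) s k| <= N%:Z.
  have [ks|ks] := ltnP k (size s); first by apply: (allP sa); exact: mem_nth.
  rewrite nth_default//; apply: (allP sa); case: (s) s0 => // a s' _.
  by rewrite (_ : last 0 (a :: s') = last a s')// mem_last.
have tm : ndecr t.
  move=> j k jk; have := sorted_nth_homo ss jk; have := tb j; have := tb k; rewrite /t.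
  by move: (nth _ _ _) (nth _ _ _) => c d; clear; lia.
have t2 k : (t k <= N.*2)%N.
  by have := tb k; rewrite /t; move: (nth _ _ _) => c; clear; lia.
have tE k : (t k)%:Z - N%:Z = nth (last 0 s) s k.
  by have := tb k; rewrite /t; move: (nth _ _ _) => c; clear; lia.
pose P b := pvar q (upto N.*2 (fun i x => part b (F (i%:Z - N%:Z) x)) ^~ x) t (size s).
have hP : seq_var s x <= 2 `^ q * (P true + P false).
  rewrite /P /pvar -big_split/= mulr_sumr /seq_var !big_nat; apply: ler_sum => k /andP[k1 ks].
  have kp := leq_ltn_trans (leq_pred k) ks.
  rewrite /upto !t2 !tE !(set_nth_default 0 (last 0 s))//.
  set z := F (nth 0 s k) x; set z' := F (nth 0 s k.-1) x.
  apply: (@le_trans _ _ (`|(`|part true (z - z')|) + (`|part false (z - z')|)| `^ q)).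
    apply: ge0_ler_powR; rewrite ?nnegrE ?cabs_ge0 ?(ltW q0)//.
    by rewrite [leRHS]ger0_norm ?addr_ge0//; exact: cabs_le.
  by apply: le_trans (powRD_le _ _ (ltW q0)) _; rewrite !normr_id !partB.
have [h1|h1] := ltP ((al / 4) `^ q) (P true); first by left; exists t, (size s).
have [h2|h2] := ltP ((al / 4) `^ q) (P false); first by right; exists t, (size s).
exfalso; move: h; apply/negP; rewrite -leNgt; apply: le_trans hP _.
apply: le_trans (ler_wpM2l (powR_ge0 _ _) (lerD h1 h2)) _.
have h4 : 4 `^ q * (al / 4) `^ q = al `^ q.
  by rewrite -powRM ?divr_ge0 ?(ltW al0)// mulrC divfK.
have h22 : (4 : R) `^ q = 2 `^ q * 2 `^ q by rewrite -powRM// -natrM.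
have h2q : (2 : R) <= 2 `^ q by rewrite -{1}(powRr1 (ler0n R 2)) ler_powR// ler1n.
rewrite -h4 h22 -[leRHS]mulrA; apply: ler_wpM2l; first exact: powR_ge0.
by rewrite -mulr2n -[leLHS]mulr_natl; apply: ler_wpM2r => //; exact: powR_ge0.
Qed.

End q_variation_levels.

Section final_estimate.
Context {R : realType}.

Lemma dini_ge0 (g : R -> R) : (forall t, 0 <= t -> 0 <= g t) -> (0 <= dini g)%E.
Proof.
move=> g0; apply: integral_ge0 => t /=; rewrite in_itv/= => /andP[t0 _].
by rewrite lee_fin divr_ge0 ?g0// ltW.
Qed.

Lemma two_eps (m Z G X : R) : 0 <= Z -> 0 <= X ->
  (forall d e : R, 0 < d -> 0 < e -> m <= Z * (G + d) * X + e) -> m <= Z * G * X.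
Proof.
move=> Z0 X0 h; apply/ler_addgt0Pr => e e0.
have z0 : 0 < Z * X + 1 by rewrite ltr_wpDl// mulr_ge0.
have d0 : 0 < e / (Z * X + 1) by rewrite divr_gt0.
have e2 : 0 < e / (Z * X + 1) by [].
apply: le_trans (h _ _ d0 e2) _; rewrite mulrDr mulrDl -addrA lerD2l.
rewrite (_ : Z * _ * X + _ = e); first by [].
by field; rewrite gt_eqF.
Qed.

End final_estimate.

Theorem corollary1p7 (R : realType) (n : nat) (n_gt0 : (0 < n)%N)
    (q : R) (q_gt2 : 2 < q)
    (phi : 'rV[R]_n -> R)
    (phi_smooth : smooth phi)
    (phi_ge0 : forall x, 0 <= phi x)
    (phi_radial : radial phi)
    (phi_supp : forall x, phi x != 0 -> enorm x <= 4^-1)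
    (phi_int : \int[lebesgue_rV n]_x phi x = 1) :
  exists2 c : R, 0 < c &
    forall (w : R -> R) (K : 'rV[R]_n -> R[i]) (CK : R)
      (T : ('rV[R]_n -> R[i]) -> 'rV[R]_n -> R[i]),
    modulus_of_continuity w -> (dini w < +oo)%E ->
    dini_CZ_operator w K CK T -> kernel_cancellation K ->
    forall f : 'rV[R]_n -> R[i], Lp 1 f ->
    forall F : int -> 'rV[R]_n -> R[i],
    (forall k,
      density_extension (fun g => convol (dilate phi k) (T g)) f (F k)) ->
    let q' := q / (q - 1) in
    (weak_L1norm (q_variation q F) <=
      c%:E * (dini w
              + dini w `^ q^-1 * dini (fun t => (w t `^ q'^-1)%R)
              + dini w `^ q'^-1 * dini (fun t => (w t `^ 2^-1)%R) `^ (2 / q)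
              + CK%:E + L2_opnorm T) * Lpnorm 1 f)%E.
Proof.
have [Lam Lam0 bphi] := smooth_is_bump phi_smooth phi_ge0 phi_supp phi_int.
have [C C0 hC] := real_weak11 bphi q_gt2 n_gt0 Lam0.
have q1 : 1 < q by rewrite (lt_trans _ q_gt2)// ltr1n.
have q0 : 0 < q by rewrite (lt_trans _ q1).
(* [weak11_extension] at level [al / 4], once for each of the two parts, gives [2 * 4 * 32]. *)
have [Z Z0 ZE] : exists2 Z : R, 0 <= Z & Z = 8 * 32 by exists (8 * 32); rewrite ?mulr_ge0.
have ZC : 0 <= 4 * Z * C by rewrite !mulr_ge0.
exists (4 * Z * C + 1); first by rewrite ltr_wpDl.
move=> w K CK T hw wfin hCZ hK f hf F hF; cbv zeta; set q' := q / (q - 1).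
have [w_ge0 _ _] := hw; have wm s t := @modulus_mono R w s t hw.
set c := 4 * Z * C + 1.
pose Dw := fine (dini w); have Dw0 : 0 <= Dw by rewrite fine_ge0// dini_ge0.
have DwE : dini w = Dw%:E by rewrite fineK// ge0_fin_numE// dini_ge0.
have hW N : \sum_(i < N) w (2^-1 ^+ i.+1) <= 2 * Dw.
  by rewrite -lee_fin EFinM -DwE; exact: dini_sum.
have CK0 : 0 <= CK := rk_CK0 (CZ_real_kernel hCZ true n_gt0 hw hK hW).
have op0 : (0 <= L2_opnorm T)%E.
  have z2 : Lp 2 (cre (fun _ : 'rV[R]_n => 0 : R)).
    apply: Lp2_cre => //.
    by rewrite /nl2 (eq_integral (fun=> 0%E)) ?integral0// => x _; rewrite expr0n.
  apply: le_trans (Lpnorm_ge0 2 (T (cre (fun=> 0)))) _; apply: ereal_sup_ubound.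
  exists (cre (fun=> 0)) => //; split => //.
  rewrite /Lpnorm (_ : _ \o _ = cst 0); first by rewrite Lnorm0.
  by apply/funext => x; rewrite /= /cabs normr0.
pose A0 := fine (L2_opnorm T); have A00 : 0 <= A0 by rewrite fine_ge0.
have AE : L2_opnorm T = A0%:E by rewrite fineK// ge0_fin_numE// (L2_bounded (CZ_L2 hCZ)).
pose X := fine (Lpnorm 1 f); have X0 : 0 <= X by rewrite fine_ge0// Lpnorm_ge0.
have XE : Lpnorm 1 f = X%:E by rewrite fineK// ge0_fin_numE ?Lpnorm_ge0// hf.2.
have mF k : cmeasurable (F k) by have [] := hF k.
set P := dini (fun t => (w t `^ q'^-1)%R).
have P0 : (0 <= P)%E by apply: dini_ge0 => t _; exact: powR_ge0.
set Q := (dini w `^ q'^-1 * dini (fun t => (w t `^ 2^-1)%R) `^ (2 / q))%E.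
have Q0 : (0 <= Q)%E by rewrite mule_ge0// poweR_ge0.
have PD0 : (0 <= dini w `^ q^-1 * P)%E by rewrite mule_ge0// poweR_ge0.
pose wf i := w (2^-1 ^+ i).
have wf0 i : 0 <= wf i by apply: w_ge0; rewrite exprn_ge0// invr_ge0.
have wfm i j : (i <= j)%N -> wf j <= wf i.
  move=> ij; apply: wm => //.
  by rewrite ler_wiXn2l ?invr_ge0// invf_le1// ler1n.
(* The operator norm may be zero, whereas the bounds above ask for a positive [A]; [A0 + d] is used
   and [d] tends to 0 in [union]. *)
have level (yy : nat -> R) Y N al d e : 0 < al -> 0 < d -> 0 < e -> (forall i, 0 <= yy i) ->
    (forall i b, \sum_(l < N.*2.+1) (if (l < b)%N then wf (b + i - l)%N `^ q else 0) <= yy i `^ q) ->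
    (forall k, \sum_(i < k) yy i <= Y) ->
    (lebesgue_rV n (var_level q F al N) <=
      (Z * C / al * (A0 + 2 * Dw + Y + CK + d) * X + e)%:E)%E.
  move=> al0 d0 e0 yy0 hyy hY.
  have al4 : 0 < al / 4 by rewrite divr_gt0.
  have e2 : 0 < e / 2 by rewrite divr_gt0.
  have Ad : 0 < A0 + d by rewrite ltr_wpDl.
  have hA : (L2_opnorm T <= (A0 + d)%:E)%E by rewrite AE lee_fin lerDl ltW.
  have h b := weak11_extension bphi q_gt2 n_gt0 hw hCZ hK Ad hA hW C0 hC N b yy0 hyy hY hf al4 e2 hF.
  apply: omeas_measurable; first exact: measurable_var_level.
  apply: omeas_sub (omeas_le _ (omeasU (h true) (h false))).
    by apply: var_level_Vset => //; exact: ltW.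
  rewrite XE -!EFinM -!EFinD lee_fin le_eqVlt; apply/orP; left; apply/eqP; rewrite ZE.
  by field; rewrite gt_eqF.
have union (Y : R) al : 0 < al ->
    (forall N d e, 0 < d -> 0 < e -> (lebesgue_rV n (var_level q F al N) <=
      (Z * C / al * (A0 + 2 * Dw + Y + CK + d) * X + e)%:E)%E) ->
    (al%:E * lebesgue_rV n [set x | (al%:E < `|q_variation q F x|)%E] <=
      (Z * C * (A0 + 2 * Dw + Y + CK) * X)%:E)%E.
  move=> al0 h; rewrite q_variation_level//.
  have Z1 : 0 <= Z * C / al by rewrite divr_ge0 ?mulr_ge0// ltW.
  have mU : measurable (\bigcup_N var_level q F al N).
    by apply: bigcupT_measurable => N; exact: measurable_var_level.
  have hU d e : 0 < d -> 0 < e -> (lebesgue_rV n (\bigcup_N var_level q F al N) <=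
      (Z * C / al * (A0 + 2 * Dw + Y + CK + d) * X + e)%:E)%E.
    move=> d0 e0.
    have cv := nondecreasing_cvg_mu (mu := lebesgue_rV n)
      (fun N => measurable_var_level q mF al N) mU (@var_level_nd _ _ q F al).
    rewrite -(cvg_lim _ cv)//; apply: lime_le; first by apply/cvg_ex; eexists; exact: cv.
    by apply: nearW => N; exact: h.
  set m := lebesgue_rV n _ in hU *.
  have m0 : (0 <= m)%E by exact: measure_ge0.
  have mfin : m \is a fin_num.
    by rewrite ge0_fin_numE// (le_lt_trans (hU 1 1 ltr01 ltr01))// ltry.
  rewrite -(fineK mfin) -EFinM lee_fin.
  have : fine m <= Z * C / al * (A0 + 2 * Dw + Y + CK) * X.
    apply: two_eps => // d e d0 e0; rewrite -lee_fin fineK//; exact: hU.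
  move=> h'; apply: le_trans (ler_wpM2l (ltW al0) h') _; rewrite le_eqVlt; apply/orP; left; apply/eqP.
  by field; rewrite gt_eqF.
(* For [f = 0] almost everywhere the right-hand side is 0 even when a Dini norm is infinite, so the
   level sets must be shown to be null; the window bound that depends on the number of scales is
   enough here. *)
have crude al : 0 < al -> X = 0 -> (al%:E * lebesgue_rV n [set x | (al%:E < `|q_variation q F x|)%E] <= 0)%E.
  move=> al0 X00.
  have := @union 0 al al0; rewrite X00 mulr0; apply => N d e d0 e0.
  have yy0 i : 0 <= N.*2.+1%:R * wf i.+1 by rewrite mulr_ge0 ?ler0n.
  have hY k : \sum_(j < k) N.*2.+1%:R * wf j.+1 <= N.*2.+1%:R * (2 * Dw).
    by rewrite -mulr_sumr; apply: ler_wpM2l; [exact: ler0n|exact: hW].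
  have := level _ _ N al d e al0 d0 e0 yy0 (fun i b => window_crude q1 wf0 wfm i b _) hY.
  by rewrite X00 !mulr0.
(* The first, second, fourth and fifth terms carry the bound; the third one is nonnegative and is
   added at the end. *)
have main al (Y : R) : 0 < al -> 0 <= Y -> (Y%:E <= 4%:E * (dini w `^ q^-1 * P))%E ->
    (forall k, \sum_(i < k) (2 * Dw) `^ q^-1 * wf i.+1 `^ ((q - 1) / q) <= Y) ->
    (al%:E * lebesgue_rV n [set x | (al%:E < `|q_variation q F x|)%E] <=
      c%:E * (dini w + dini w `^ q^-1 * P + Q + CK%:E + L2_opnorm T) * Lpnorm 1 f)%E.
  move=> al0 Y0 YP hY.
  have yy0 i : 0 <= (2 * Dw) `^ q^-1 * wf i.+1 `^ ((q - 1) / q) by rewrite mulr_ge0 ?powR_ge0.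
  apply: le_trans (union Y al al0 _) _.
    move=> N d e d0 e0.
    exact: (level _ _ N al d e al0 d0 e0 yy0 (fun i b => window_powR q1 wf0 wfm hW i b _) hY).
  have Yh : ((Y / 4)%:E <= dini w `^ q^-1 * P)%E.
    by rewrite -(@lee_pmul2l _ 4%:E) ?lte_fin// -EFinM mulrC divfK.
  apply: (@le_trans _ _ (c%:E * (Dw%:E + (Y / 4)%:E + 0 + CK%:E + A0%:E) * X%:E)%E).
    rewrite adde0 -!EFinD -!EFinM lee_fin; apply: ler_wpM2r => //.
    apply: (@le_trans _ _ (4 * Z * C * (Dw + Y / 4 + CK + A0))); last first.
      by apply: ler_wpM2r; rewrite ?addr_ge0 ?divr_ge0// /c lerDl.
    rewrite (_ : 4 * Z * C * _ = Z * C * (4 * (Dw + Y / 4 + CK + A0))); last by ring.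
    by apply: ler_wpM2l; [exact: mulr_ge0|lra].
  have c0 : (0 <= c%:E)%E by rewrite lee_fin addr_ge0.
  rewrite XE; apply: lee_wpmul2r; first by rewrite lee_fin.
  by apply: lee_wpmul2l => //; rewrite DwE AE; do 2?[apply: leeD => //]; apply: leeD => //; rewrite DwE in Yh *; apply: leeD.
apply: ge_ereal_sup => _ [al /= al0 <-].
(* If the Dini norm of [w] is zero, the second term is 0 even when [P] is infinite. The dyadic
   values of [w] have sum zero as well, and [Y = 0] is admissible. *)
have [Dz|Dn] := eqVneq Dw 0.
  apply: (main al 0 al0) => // [|k]; first by rewrite mule_ge0.
  by rewrite big1// => i _; rewrite Dz mulr0 powR0 ?mul0r// invr_neq0// gt_eqF.
have Dp : 0 < Dw by rewrite lt_neqAle eq_sym Dn.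
(* With a positive Dini norm of [w] and [P] infinite, the right-hand side is infinite unless [f]
   vanishes. *)
have [Poo|Pfin] := eqVneq P +oo%E.
  have [Xz|Xn] := eqVneq X 0.
    by apply: le_trans (crude al al0 Xz) _; rewrite XE Xz mule0.
  have E1 : (dini w `^ q^-1 * P = +oo)%E.
    by rewrite Poo gt0_muley// DwE poweR_EFin lte_fin powR_gt0.
  rewrite E1 DwE AE addey// addye//; last by rewrite gt_eqF// (lt_le_trans _ Q0)// ltNy0.
  by rewrite !addye// gt0_muley ?lte_fin ?ltr_wpDl ?mulr_ge0// gt0_mulye ?leey// XE lte_fin lt_neqAle eq_sym Xn.
have PfinE : P = (fine P)%:E by rewrite fineK// ge0_fin_numE// ltey.
have fP0 : 0 <= fine P by rewrite fine_ge0.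
have qi : q'^-1 = (q - 1) / q by rewrite /q' invf_div.
have wP k : \sum_(i < k) wf i.+1 `^ ((q - 1) / q) <= 2 * fine P.
  rewrite -lee_fin EFinM -PfinE -qi.
  apply: (@dini_sum R (fun t => w t `^ q'^-1)) => [t _|s t s0 st]; first exact: powR_ge0.
  apply: ge0_ler_powR; rewrite ?nnegrE.
  - by rewrite qi divr_ge0 ?subr_ge0 ?(ltW q1)// ltW.
  - exact: w_ge0.
  - by apply: w_ge0; exact: le_trans st.
  - exact: wm.
(* Both factors 2 come from [dini_sum]; as [2^(1/q) <= 2], the product is at most four times the
   second term. *)
apply: (main al ((2 * Dw) `^ q^-1 * (2 * fine P)) al0).
- by rewrite mulr_ge0 ?powR_ge0// mulr_ge0.
- rewrite PfinE DwE poweR_EFin -!EFinM lee_fin powRM//.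
  have h2 : (2 : R) `^ q^-1 <= 2.
    by rewrite -{2}(powRr1 (ler0n R 2)) ler_powR ?ler1n// invf_le1// ltW.
  rewrite (_ : 4 * (_ * _) = 2 * (Dw `^ q^-1 * (2 * fine P))); last by ring.
  by rewrite -mulrA; apply: ler_wpM2r => //; rewrite mulr_ge0 ?powR_ge0// mulr_ge0.
by move=> k; rewrite -mulr_sumr; apply: ler_wpM2l; [exact: powR_ge0|exact: wP].
Qed.
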